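(* Let $X$ be a complex manifold of dimension $n\ge 2$. The following conditions are equivalent. (a) $X$ admits a $C^\infty$ connection in $T_X$ satisfying Wronskian curvature positivity. (b) $X$ admits a torsion-free $C^\infty$ connection in $T_X$ satisfying Wronskian curvature positivity. (c) $X$ admits a holomorphic projective connection.
   Context: Write $T_X := T^{1,0}X$ for the holomorphic tangent bundle and $K_X^* := \bigwedge^n T_X$. A $C^\infty$ connection in $T_X$ is a map $(U,V)\mapsto \nabla_U V$, for smooth sections $U,V\in\Gamma^\infty(T_X)$, with values in $\Gamma^\infty(T_X)$, complex linear in both variables, $C^\infty$-linear in $U$, and satisfying $\nabla_U(aV)=U(a)V+a\nabla_U V$ for every smooth complex-valued function $a$ (only $(1,0)$ directions $U$ are involved). In local holomorphic coordinates write $\nabla_{\partial_i}\partial_j=\Gamma^k_{ij}\partial_k$ (Einstein summation), with smooth $\Gamma^k_{ij}$. Torsion: $T^\nabla(U,V):=\nabla_UV-\nabla_VU-[U,V]$; $\nabla$ is torsion-free if $T^\nabla=0$. Wronskian: for a holomorphic curve $f$ from an open subset of $\mathbb C$ (coordinate $t$) to $X$, set $F_1:=f'$, $F_{r+1}:=\nabla_{f'}F_r$ ($r\ge1$), smooth sections of $f^*T_X$, where in coordinates $(\nabla_{f'}G)^k=\partial_t G^k+\Gamma^k_{ij}(f)\,(f^i)'G^j$ for a smooth section $G$ of $f^*T_X$, with $\partial_t$ the Wirtinger derivative. Put $W(\nabla,f):=F_1\wedge\cdots\wedge F_n$, a smooth section of $f^*K_X^*$. Wronskian curvature positivity of $\nabla$: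 for every holomorphic disk $f:\Delta\to X$, every sufficiently small subdisk $\Delta_0\subset\Delta$ whose image lies in an open set trivializing $K_X^*$ holomorphically, and every holomorphic frame $\varepsilon$ of $K_X^*$ there, write $W(\nabla,f)|_{\Delta_0}=w_f\,\varepsilon$; the condition is that whenever $W(\nabla,f)\not\equiv0$, the function $\log|w_f|$ (value $-\infty$ allowed at zeros of $w_f$) is subharmonic on $\Delta_0$. (This is independent of the frame $\varepsilon$.) Projective equivalence: torsion-free connections $D,\widehat D$ are projectively equivalent if locally there is a smooth $1$-form $\alpha$ (section of $T_X^*$) with $\widehat D_UV=D_UV+\alpha(U)V+\alpha(V)U$. A projective class is an equivalence class. The projective Christoffel symbols of a torsion-free connection with coefficients $S^k_{ij}$ are $\Pi^k_{ij}:=S^k_{ij}-\frac1{n+1}(\delta^k_iS^a_{aj}+\delta^k_jS^a_{ai})$; they depend only on the projective class. The projective class is holomorphic if $\bar\partial\,\Pi^k_{ij}=0$ in every holomorphic coordinate chart. A holomorphic projective connection on $X$ is a holomorphic projective class; equivalently, it is given locally by torsion-free holomorphic connections (i.e. with holomorphic coefficients in holomorphic coordinates) whose differences on overlaps have the form $(U,V)\mapsto\eta(U)V+\eta(V)U$ for a $1$-form $\eta$. *)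

(* Defs.v *)
From HB Require Import structures.
From mathcomp Require Import all_boot all_order all_algebra.
From mathcomp Require Import complex.
From mathcomp Require Import all_classical all_reals all_analysis.

Set Implicit Arguments.
Unset Strict Implicit.
Unset Printing Implicit Defensive.

Import Order.TTheory GRing.Theory Num.Theory.
Import numFieldNormedType.Exports.

Local Open Scope ring_scope.
Local Open Scope complex_scope.
Local Open Scope classical_set_scope.

(* R[i] with the topology of its norm, as a normed space over itself, so that
   [differentiable] and [derivable] on R[i] and 'rV[R[i]]_n are complex
   differentiability. *)
HB.instance Definition _ (R : realType) := NormedModule.copy R[i] R[i]^o.

Section Calculus.
Variable R : realType.
Local Notation C := R[i].

Definition rderivable (V : lmodType C) (g : V -> C) (z v : V) : Prop :=
  derivable (fun h : R => complex.Re (g (z + h%:C *: v))) 0 1 /\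
  derivable (fun h : R => complex.Im (g (z + h%:C *: v))) 0 1.

(* derivative of g along the real line through z in direction v *)
Definition rderive (V : lmodType C) (v : V) (g : V -> C) (z : V) : C :=
  derive1 (fun h : R => complex.Re (g (z + h%:C *: v))) 0 +i*
  derive1 (fun h : R => complex.Im (g (z + h%:C *: v))) 0.

(* Wirtinger derivatives: for v = delta_mx 0 j these are d/dz_j and d/dzbar_j,
   for V = C and v = 1 they are d/dt and d/dtbar *)
Definition wirtinger (V : lmodType C) (v : V) (g : V -> C) (z : V) : C :=
  (rderive v g z - Complex 0 1 * rderive (Complex 0 1 *: v) g z) / 2%:R.

Definition wirtinger_bar (V : lmodType C) (v : V) (g : V -> C) (z : V) : C :=
  (rderive v g z + Complex 0 1 * rderive (Complex 0 1 *: v) g z) / 2%:R.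

(* real differentiability class C^k of a complex-valued function on an open
   subset A of C^n *)
Fixpoint Ck n (k : nat) (A : set 'rV[C]_n) (g : 'rV[C]_n -> C) : Prop :=
  (forall z, A z -> {for z, continuous g}) /\
  match k with
  | 0%N => True
  | k'.+1 => forall v : 'rV[C]_n,
      (forall z, A z -> rderivable g z v) /\ Ck k' A (rderive v g)
  end.

Definition smooth_on n (A : set 'rV[C]_n) (g : 'rV[C]_n -> C) : Prop :=
  forall k, Ck k A g.

Definition holomorphic_on n (W : normedModType C)
    (A : set 'rV[C]_n) (g : 'rV[C]_n -> W) : Prop :=
  forall z, A z -> differentiable g z.

Definition disk (a : C) (r : R) : set C := [set z | `|z - a| < r%:C].

(* Subharmonic functions with values in [-oo, +oo[ on an open set A; the
   function constantly equal to -oo is allowed. *)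
Definition subharmonic_on (A : set C) (u : C -> \bar R) : Prop :=
  [/\ forall z, A z -> (u z < +oo)%E,
      forall z (a : R), A z -> (u z < a%:E)%E ->
        \forall y \near z, (u y < a%:E)%E
    & forall z (r : R), 0 < r -> [set y | `|y - z| <= r%:C] `<=` A ->
        (u z <= ((2 * pi)^-1)%:E *
          \int[lebesgue_measure]_(th in `[0%R, (2 * pi)%R])
             u (z + r%:C * (cos th +i* sin th))%R)%E].

End Calculus.

Section Manifold.
Variable R : realType.
Local Notation C := R[i].

(* The total functions [coords] and [param] are only meaningful on [dom] and on
   [coords @` dom]. *)
Record chart (T : topologicalType) (n : nat) := Chart {
  dom : set T ;
  coords : T -> 'rV[C]_n ;
  param : 'rV[C]_n -> T ;
  dom_open : open dom ;
  img_open : open (coords @` dom) ;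
  coordsK : forall x, dom x -> param (coords x) = x ;
  coords_continuous : forall x, dom x -> {for x, continuous coords} ;
  param_continuous : forall x, dom x -> {for coords x, continuous param} }.

Definition transition (T : topologicalType) n (c c' : chart T n) :
    'rV[C]_n -> 'rV[C]_n :=
  coords c' \o param c.

Definition holo_compatible (T : topologicalType) n (c c' : chart T n) : Prop :=
  holomorphic_on (coords c @` (dom c `&` dom c')) (transition c c') /\
  holomorphic_on (coords c' @` (dom c `&` dom c')) (transition c' c).

Record complexManifold (n : nat) := ComplexManifold {
  carrier :> topologicalType ;
  carrier_hausdorff : hausdorff_space carrier ;
  carrier_second_countable : @second_countable carrier ;
  atlas : set (chart carrier n) ;
  atlas_cover : forall x : carrier, exists2 c, atlas c & dom c x ;
  atlas_compatible : forall c c', atlas c -> atlas c' -> holo_compatible c c' ;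
  atlas_maximal : forall c, (forall c', atlas c' -> holo_compatible c c') ->
    atlas c }.

Record holo_chart n (X : complexManifold n) := HoloChart {
  chart_of :> chart X n ;
  chart_of_atlas : atlas chart_of }.

End Manifold.

Section TangentBundle.
Variables (R : realType) (n : nat) (X : complexManifold R n).
Local Notation C := R[i].
Local Notation hchart := (holo_chart X).
Local Notation "''e_' i" := (delta_mx 0 i : 'rV[C]_n) (at level 8, i at level 2).

Definition img (c : hchart) : set 'rV[C]_n := coords c @` dom c.

(* (jac c c' x) i j is the derivative of the j-th coordinate of c' with respect
   to the i-th coordinate of c: tangent components are row vectors and
   transform by right multiplication. *)
Definition jac (c c' : hchart) (x : X) : 'M[C]_n :=
  'J (transition c c') (coords c x).

Definition smooth_fun (a : X -> C) : Prop :=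
  forall c : hchart, smooth_on (img c) (a \o param c).

(* A section V of T_X is given by its components V c x in every holomorphic
   chart c; they are set to 0 outside the domain of c, so that equality of
   sections is equality of functions. *)
Definition vfield := hchart -> X -> 'rV[C]_n.

Definition smooth_vfield (V : vfield) : Prop :=
  [/\ forall (c : hchart) x, ~ dom c x -> V c x = 0,
      forall (c c' : hchart) x, dom c x -> dom c' x -> V c' x = V c x *m jac c c' x
    & forall (c : hchart) j,
        smooth_on (img c) (fun z => V c (param c z) 0 j)].

Definition vadd (U V : vfield) : vfield := fun c x => U c x + V c x.
Definition vscale (a : X -> C) (V : vfield) : vfield :=
  fun c x => a x *: V c x.

(* U(a), computed in the chart c *)
Definition vderive (U : vfield) (a : X -> C) (c : hchart) (x : X) : C :=
  \sum_i U c x 0 i * wirtinger 'e_i (a \o param c) (coords c x).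

Definition vbracket (U V : vfield) : vfield := fun c x =>
  \row_j (vderive U (fun y => V c y 0 j) c x
          - vderive V (fun y => U c y 0 j) c x).

(* D U V is the covariant derivative of V along U; only its values on smooth
   sections matter. *)
Record is_connection (D : vfield -> vfield -> vfield) : Prop := IsConnection {
  conn_smooth : forall U V, smooth_vfield U -> smooth_vfield V ->
    smooth_vfield (D U V) ;
  conn_addl : forall U U' V,
    smooth_vfield U -> smooth_vfield U' -> smooth_vfield V ->
    D (vadd U U') V = vadd (D U V) (D U' V) ;
  conn_scalel : forall a U V,
    smooth_fun a -> smooth_vfield U -> smooth_vfield V ->
    D (vscale a U) V = vscale a (D U V) ;
  conn_addr : forall U V V',
    smooth_vfield U -> smooth_vfield V -> smooth_vfield V' ->
    D U (vadd V V') = vadd (D U V) (D U V') ;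
  conn_scaler : forall (k : C) U V, smooth_vfield U -> smooth_vfield V ->
    D U (vscale (cst k) V) = vscale (cst k) (D U V) ;
  conn_leibniz : forall a U V,
    smooth_fun a -> smooth_vfield U -> smooth_vfield V ->
    forall (c : hchart) x, dom c x ->
      D U (vscale a V) c x = vderive U a c x *: V c x + a x *: D U V c x }.

Definition torsion (D : vfield -> vfield -> vfield) (U V : vfield) : vfield :=
  fun c x => D U V c x - D V U c x - vbracket U V c x.

Definition torsion_free (D : vfield -> vfield -> vfield) : Prop :=
  forall U V, smooth_vfield U -> smooth_vfield V ->
  forall (c : hchart) x, dom c x -> torsion D U V c x = 0.

(* Gamma^k_ij at x in the chart c: the k-th component of D d_i d_j at x. The
   coordinate fields d_i, d_j of c are only defined on dom c, so D is applied
   to smooth global fields U, V coinciding with them near x; by locality of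
   connections the result does not depend on the choice of U and V. *)
Definition christoffel (D : vfield -> vfield -> vfield) (c : hchart)
    (i j k : 'I_n) (x : X) : C :=
  xget 0 [set z | exists U V, [/\ smooth_vfield U, smooth_vfield V,
    \forall y \near x, U c y = 'e_i, \forall y \near x, V c y = 'e_j
    & z = D U V c x 0 k]].

Definition holomorphic_curve (A : set C) (f : C -> X) : Prop :=
  forall t, A t -> {for t, continuous f} /\
    forall c : hchart, dom c (f t) -> derivable (coords c \o f) t 1.

(* components in the chart c of F_(r.+1), where F_1 = f' and
   F_(r.+1) = D_(f') F_r *)
Fixpoint curve_jet (D : vfield -> vfield -> vfield) (f : C -> X) (c : hchart)
    (r : nat) (t : C) : 'rV[C]_n :=
  match r with
  | 0%N => derive1 (coords c \o f) t
  | r'.+1 => \row_k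
      (wirtinger (1 : C) (fun s : C => curve_jet D f c r' s 0 k) t
       + \sum_i \sum_j christoffel D c i j k (f t)
           * (derive1 (coords c \o f) t : 'rV[C]_n) 0 i
           * curve_jet D f c r' t 0 j)
  end.

(* coefficient of F_1 /\ ... /\ F_n on d_1 /\ ... /\ d_n in the chart c *)
Definition wronskian (D : vfield -> vfield -> vfield) (f : C -> X)
    (c : hchart) (t : C) : C :=
  \det (\matrix_(r < n, k < n) curve_jet D f c r t 0 k).

(* A holomorphic frame of K_X^* over O, e c x being its coefficient on
   d_1 /\ ... /\ d_n in the chart c. *)
Definition holo_frame (O : set X) (e : hchart -> X -> C) : Prop :=
  [/\ open O,
      forall (c c' : hchart) x, O x -> dom c x -> dom c' x ->
        e c' x = e c x * \det (jac c c' x),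
      forall c : hchart,
        holomorphic_on (coords c @` (O `&` dom c)) (e c \o param c)
    & forall (c : hchart) x, O x -> dom c x -> e c x != 0].

Definition wronskian_curvature_positive (D : vfield -> vfield -> vfield) :
    Prop :=
  forall (f : C -> X) (t0 : C) (r0 : R), 0 < r0 ->
  holomorphic_curve (disk t0 r0) f ->
  forall (t1 : C) (r1 : R), 0 < r1 -> disk t1 r1 `<=` disk t0 r0 ->
  forall (O : set X) (e : hchart -> X -> C), holo_frame O e ->
  f @` disk t1 r1 `<=` O ->
  forall w : C -> C,
  (forall t (c : hchart), disk t1 r1 t -> dom c (f t) ->
     wronskian D f c t = w t * e c (f t)) ->
  (exists t (c : hchart),
     [/\ disk t0 r0 t, dom c (f t) & wronskian D f c t != 0]) ->
  subharmonic_on (disk t1 r1) (fun t => lne (complex.Re `|w t|)%:E).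

(* A smooth section of T_X^* over O; the components are column vectors. *)
Definition smooth_form_on (O : set X) (al : hchart -> X -> 'cV[C]_n) : Prop :=
  (forall (c c' : hchart) x, O x -> dom c x -> dom c' x ->
     al c x = jac c c' x *m al c' x) /\
  (forall (c : hchart) j,
     smooth_on (coords c @` (O `&` dom c)) (fun z => al c (param c z) j 0)).

Definition form_apply (al : hchart -> X -> 'cV[C]_n) (U : vfield)
    (c : hchart) (x : X) : C :=
  (U c x *m al c x) 0 0.

Definition projectively_equivalent (D D' : vfield -> vfield -> vfield) : Prop :=
  forall p : X, exists (O : set X) (al : hchart -> X -> 'cV[C]_n),
    [/\ open O, O p, smooth_form_on O al
      & forall U V, smooth_vfield U -> smooth_vfield V ->
        forall (c : hchart) x, O x -> dom c x ->
          D' U V c x = D U V c x + form_apply al U c x *: V c x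
                                 + form_apply al V c x *: U c x].

Definition projective_class (P : set (vfield -> vfield -> vfield)) : Prop :=
  exists D, [/\ is_connection D, torsion_free D
    & P = [set D' | [/\ is_connection D', torsion_free D'
                      & projectively_equivalent D D']]].

Definition proj_christoffel (D : vfield -> vfield -> vfield) (c : hchart)
    (i j k : 'I_n) (x : X) : C :=
  christoffel D c i j k x
  - (n.+1%:R)^-1 * ((k == i)%:R * \sum_a christoffel D c a j a x
                    + (k == j)%:R * \sum_a christoffel D c a i a x).

Definition holomorphic_class (P : set (vfield -> vfield -> vfield)) : Prop :=
  forall D, P D -> forall (c : hchart) i j k l z, img c z ->
    wirtinger_bar 'e_l (proj_christoffel D c i j k \o param c) z = 0.

Definition holomorphic_projective_connection
    (P : set (vfield -> vfield -> vfield)) : Prop :=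
  projective_class P /\ holomorphic_class P.

End TangentBundle.

(* Main.v *)
Require Import Defs.
From HB Require Import structures.
From mathcomp Require Import all_boot all_order all_algebra.
From mathcomp Require Import perm complex ring lra.
From mathcomp Require Import all_classical all_reals all_analysis.
From mathcomp Require Import measurable_realfun.

(** Replacing the Christoffel symbols by the projective ones changes each jet F_r by a combination
    of the previous ones, so W(D, f) is also the Wronskian built from Pi. If Pi is holomorphic,
    W(D, f) is therefore a holomorphic section, and the logarithm of the modulus of a holomorphic
    function is subharmonic.

    Conversely, adding xi t^(n+1) / (n+1)! to a curve f in a chart changes its Wronskian w to
    w + t m, with m linear in xi, up to terms that do not affect w, dw, dbar w and dbar d w at 0.
    Positivity of the Laplacian of log |w| at 0 is then an
    inequality Re (k0 + k1(xi)) >= 0 with k1 complex linear, whence k1 = 0, that is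
    w dbar m = m dbar w. It follows that the determinant of F_1, ..., F_(n-1), dbar F_2 vanishes at 0.
    As F_1, ..., F_n can be prescribed at a point, v and sum_l conj(v_l) dbar_l Gamma(v, v) are
    parallel for all v. The factors conj(v_l) separate, and the resulting polynomial identities in v
    say that dbar_l of the symmetric part of Gamma is pure trace: the torsion-free symmetrization
    D - T/2 has a holomorphic projective class. *)

Set Implicit Arguments.
Unset Strict Implicit.
Unset Printing Implicit Defensive.

Import Order.TTheory GRing.Theory Num.Theory.
Import numFieldNormedType.Exports.

Local Open Scope ring_scope.
Local Open Scope complex_scope.
Local Open Scope classical_set_scope.

(** * Norms and directional derivatives *)

(** The exponent n + 1 comes from counting orders: a term xi t^(n+1) / (n+1)! first reaches F_r in
    its derivative of order n + 1 - r, so at first order in t only F_n feels it, and w changes by t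
    m with m = det (F_1, ..., F_(n-1), xi). Hence w and dbar w keep their values at 0, while dw and
    dbar d w move by m and dbar m. The vanishing determinant is the case xi = F_2(0): with F_2(t) in
    the last row the determinant is identically w if n = 2 and 0 if n > 2, and applying dbar to this
    identity leaves only the term where dbar falls on F_2.

    Connections act on arbitrary global fields, so locality, Christoffel symbols and changes of
    chart rest on cutoff functions. Holomorphy is complex differentiability, without continuity of
    the derivatives: Goursat's lemma gives mean values, these give the maximum principle, which
    bounds difference quotients and so yields all derivatives. The maximum principle serves again
    for products of values of w on a circle, where it gives Jensen's inequality without dividing out
    zeros. *)

Section RealNorm.
Variable R : realType.
Local Notation C := R[i].

(** The norm of a normed module over [R[i]] takes its values in [R[i]]; the real part brings
    estimates into the ordered field [R], within reach of linear arithmetic. *)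
Definition nrm (V : normedModType C) (x : V) : R := complex.Re `|x|.

Section Generic.
Variable V : normedModType C.
Implicit Types x y : V.

Lemma nrmE x : `|x| = (nrm x)%:C.
Proof.
have := normr_ge0 x; rewrite /nrm; case: `|x| => a b.
by rewrite lecE /= => /andP[/eqP -> _].
Qed.

Lemma nrm_ge0 x : 0 <= nrm x.
Proof. by rewrite -(ler0c) -nrmE. Qed.

Lemma nrmD x y : nrm (x + y) <= nrm x + nrm y.
Proof. by rewrite -lecR rmorphD /= -!nrmE ler_normD. Qed.

Lemma nrmN x : nrm (- x) = nrm x.
Proof. by rewrite /nrm normrN. Qed.

Lemma nrmB x y : nrm (x - y) <= nrm x + nrm y.
Proof. by rewrite -(nrmN y) nrmD. Qed.

Lemma nrm_distC x y : nrm (x - y) = nrm (y - x).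
Proof. by rewrite -nrmN opprB. Qed.

Lemma nrm0 : nrm (0 : V) = 0.
Proof. by rewrite /nrm normr0. Qed.

Lemma nrm_eq0 x : (nrm x == 0) = (x == 0).
Proof. by rewrite -(inj_eq (@complexI R)) -nrmE /= normr_eq0. Qed.

Lemma nrm_gt0 x : (0 < nrm x) = (x != 0).
Proof. by rewrite lt0r nrm_eq0 nrm_ge0 andbT. Qed.

Lemma nrm_trans z x y : nrm (x - y) <= nrm (x - z) + nrm (z - y).
Proof. by rewrite -[in leLHS](subrK z x) -addrA nrmD. Qed.

Lemma nrm_sub x y : nrm x - nrm y <= nrm (x - y).
Proof. by have := nrmD (x - y) y; rewrite subrK; lra. Qed.

End Generic.

Lemma nrmZ (V : normedModType C) (a : C) (x : V) :
  nrm (a *: x) = nrm a * nrm x.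
Proof. by apply: (@complexI R); rewrite rmorphM /= -!nrmE normrZ. Qed.

Lemma nrmM (a b : C) : nrm (a * b) = nrm a * nrm b.
Proof. by apply: (@complexI R); rewrite rmorphM /= -!nrmE normrM. Qed.

Lemma nrmV (a : C) : nrm a^-1 = (nrm a)^-1.
Proof. by apply: (@complexI R); rewrite fmorphV /= -!nrmE normfV. Qed.

Lemma nrm1 : nrm (1 : C) = 1.
Proof. by rewrite /nrm normr1. Qed.

Lemma nrmX (a : C) k : nrm (a ^+ k) = nrm a ^+ k.
Proof. by elim: k => [|k IH]; rewrite ?expr0 ?nrm1 // !exprS nrmM IH. Qed.

Lemma nrmR (a : R) : nrm (a%:C : C) = `|a|.
Proof.
by rewrite /nrm normc_def /= expr0n /= addr0 sqrtr_sqr.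
Qed.

Lemma nrmJ (a : C) : nrm ((conjc a) : C) = nrm a.
Proof. by rewrite /nrm normcJ. Qed.

Lemma nrm_sqr (a : C) : nrm a ^+ 2 = complex.Re a ^+ 2 + complex.Im a ^+ 2.
Proof.
by rewrite /nrm normc_def /= sqr_sqrtr // addr_ge0 // sqr_ge0.
Qed.

Lemma Re_le_nrm (a : C) : `|complex.Re a| <= nrm a.
Proof.
rewrite -(@ler_pXn2r _ 2) ?nnegrE ?nrm_ge0 // nrm_sqr real_normK ?num_real //.
by rewrite lerDl sqr_ge0.
Qed.

Lemma Im_le_nrm (a : C) : `|complex.Im a| <= nrm a.
Proof.
rewrite -(@ler_pXn2r _ 2) ?nnegrE ?nrm_ge0 // nrm_sqr real_normK ?num_real //.
by rewrite lerDr sqr_ge0.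
Qed.

Lemma nrm_le_ReIm (a : C) : nrm a <= `|complex.Re a| + `|complex.Im a|.
Proof.
rewrite -(@ler_pXn2r _ 2) ?nnegrE ?nrm_ge0 ?addr_ge0 // nrm_sqr sqrrD.
rewrite !real_normK ?num_real //.
by rewrite lerD2r lerDl mulrn_wge0 // mulr_ge0.
Qed.

Lemma nrm_i : nrm ('i%C : C) = 1.
Proof. by rewrite /nrm normc_def /= expr0n /= expr1n add0r sqrtr1. Qed.

Lemma ReD (a b : C) : complex.Re (a + b) = complex.Re a + complex.Re b.
Proof. by case: a b => [? ?] [? ?]. Qed.
Lemma ImD (a b : C) : complex.Im (a + b) = complex.Im a + complex.Im b.
Proof. by case: a b => [? ?] [? ?]. Qed.
Lemma ReN (a : C) : complex.Re (- a) = - complex.Re a.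
Proof. by case: a. Qed.
Lemma ImN (a : C) : complex.Im (- a) = - complex.Im a.
Proof. by case: a. Qed.
Lemma ReM (a b : C) : complex.Re (a * b) =
  complex.Re a * complex.Re b - complex.Im a * complex.Im b.
Proof. by case: a b => [? ?] [? ?]. Qed.
Lemma ImM (a b : C) : complex.Im (a * b) =
  complex.Re a * complex.Im b + complex.Im a * complex.Re b.
Proof. by case: a b => [? ?] [? ?]. Qed.
Lemma ReR (a : R) : complex.Re (a%:C : C) = a. Proof. by []. Qed.
Lemma ImR (a : R) : complex.Im (a%:C : C) = 0. Proof. by []. Qed.
Definition ReImE := (ReD, ImD, ReN, ImN, ReM, ImM, ReR, ImR).

Lemma complexP (a b : C) : complex.Re a = complex.Re b ->
  complex.Im a = complex.Im b -> a = b.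
Proof. by case: a b => [? ?] [? ?] /= -> ->. Qed.

Lemma nbhs_nrm (V : normedModType C) (x : V) (P : V -> Prop) :
  (\forall y \near x, P y) <->
  exists2 e : R, 0 < e & forall y, nrm (y - x) < e -> P y.
Proof.
split.
  move/nbhs_normP => [e /= e0 H].
  have er : e = (complex.Re e)%:C.
    by move: e0; case: (e) => a b; rewrite ltcE /= => /andP[/eqP -> _].
  exists (complex.Re e); first by rewrite -ltcR -er.
  move=> y yx; apply: H; rewrite /ball_ /=.
  by rewrite -opprB normrN nrmE er ltcR.
case=> e e0 H; apply/nbhs_normP; exists e%:C => /=; first by rewrite ltcR.
move=> y /=; rewrite -opprB normrN nrmE ltcR; exact: H.
Qed.

Lemma open_nrm (V : normedModType C) (A : set V) :
  open A <-> forall x, A x -> exists2 e : R, 0 < e &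
    forall y, nrm (y - x) < e -> A y.
Proof.
rewrite openE; split=> H x Ax; first by apply/nbhs_nrm; exact: H.
by apply/nbhs_nrm; exact: H.
Qed.

Definition ctn (V W : normedModType C) (f : V -> W) (x : V) : Prop :=
  forall e : R, 0 < e -> exists2 d : R, 0 < d &
    forall y, nrm (y - x) < d -> nrm (f y - f x) < e.

Lemma ctnP (V W : normedModType C) (f : V -> W) (x : V) :
  {for x, continuous f} <-> ctn f x.
Proof.
split.
  move=> cf e e0; have /nbhs_nrm // : \forall y \near x, nrm (f y - f x) < e.
  by apply: (cf [set y | nrm (y - f x) < e]); apply/(nbhs_nrm (f x)); exists e.
move=> H A /nbhs_nrm[e e0 HA]; have [d d0 Hd] := H e e0.
by apply/(nbhs_nrm x); exists d => // y /Hd /HA.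
Qed.

Lemma continuous_nrmR (V : normedModType C) (f : V -> R) (x : V) :
  (forall e : R, 0 < e -> exists2 d : R, 0 < d &
    forall y, nrm (y - x) < d -> `|f y - f x| < e) ->
  {for x, continuous f}.
Proof.
move=> H A /nbhs_normP[e /= e0 HA]; have [d d0 Hd] := H e e0.
by apply/(nbhs_nrm x); exists d => // y /Hd fy; apply: HA; rewrite /ball_ /= distrC.
Qed.

Definition ctnR (f : R -> C) : Prop := forall x,
  forall e : R, 0 < e -> exists2 d : R, 0 < d &
    forall y, `|y - x| < d -> nrm (f y - f x) < e.

Lemma continuousRR (f : R -> R) (x : R) :
  {for x, continuous f} <->
  forall e : R, 0 < e -> exists2 d : R, 0 < d &
    forall y, `|y - x| < d -> `|f y - f x| < e.
Proof.
split.
  move=> cf e e0.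
  have : \forall y \near x, `|f y - f x| < e.
    by apply: (cf [set y | `|y - f x| < e]); apply/nbhs_normP; exists e => //= y;
      rewrite /= distrC.
  move=> /nbhs_normP[d /= d0 H]; exists d => // y yx.
  by apply: H; rewrite /ball_ /= distrC.
move=> H A /nbhs_normP[e /= e0 HA]; have [d d0 Hd] := H e e0.
apply/nbhs_normP; exists d => //= y; rewrite /ball_ /= distrC.
by move=> /Hd fy; apply: HA; rewrite /ball_ /= distrC.
Qed.

End RealNorm.

Lemma addr6ACA (V : zmodType) (a b c d e f : V) :
  a + b - (c + d) - (e + f) = (a - c - e) + (b - d - f).
Proof. by rewrite !opprD (addrACA a b) (addrACA (a - c)). Qed.

(** * Derivatives along a direction, with real or complex increments *)

Section Directional.
Variable R : realType.
Local Notation C := R[i].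
Local Notation nrm := (@nrm R _).

(* [S] is the set of admissible increments: all of C for complex derivatives,
   the real axis for real ones. *)
Definition hder (S : set C) (V W : normedModType C) (f : V -> W) (z v : V)
    (d : W) : Prop :=
  forall e : R, 0 < e -> exists2 r : R, 0 < r &
    forall h : C, S h -> nrm h < r ->
      nrm (f (z + h *: v) - f z - h *: d) <= e * nrm h.

Definition Sreal : set C := [set h | complex.Im h = 0].

Section Rules.
Variables (S : set C) (V : normedModType C).
Implicit Types (z v : V).

Lemma hder_sub (S' : set C) (W : normedModType C) (f : V -> W) z v d :
  S' `<=` S -> hder S f z v d -> hder S' f z v d.
Proof.
move=> sS H e e0; have [r r0 Hr] := H e e0.
by exists r => // h /sS; exact: Hr.
Qed.

Lemma small_step z v (e : R) : 0 < e -> exists2 r : R, 0 < r &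
  forall h : C, nrm h < r -> nrm ((z + h *: v) - z) < e.
Proof.
move=> e0; have v0 : 0 < 1 + nrm v by rewrite ltr_pwDl ?nrm_ge0.
exists (e / (1 + nrm v)); first exact: divr_gt0.
move=> h hr; rewrite addrAC subrr add0r nrmZ.
move: hr; rewrite ltr_pdivlMr // => hr; apply: le_lt_trans hr.
by rewrite ler_wpM2l ?nrm_ge0 // lerDr.
Qed.

Lemma hder_ext (W : normedModType C) (f g : V -> W) z v d :
  (\forall y \near z, f y = g y) -> hder S f z v d -> hder S g z v d.
Proof.
move=> /nbhs_nrm[r0 r00 fg] H e e0; have [r r1 Hr] := H e e0.
have [r2 r20 Hr2] := small_step z v r00.
exists (Num.min r r2); first by rewrite lt_min r1.
move=> h Sh; rewrite lt_min => /andP[hr hr2].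
by rewrite -!fg; [exact: Hr|rewrite subrr nrm0|exact: Hr2].
Qed.

Lemma hder_cst (W : normedModType C) (k : W) z v : hder S (fun=> k) z v 0.
Proof.
move=> e e0; exists 1 => // h _ _.
by rewrite subrr scaler0 subr0 nrm0 mulr_ge0 ?nrm_ge0 // ltW.
Qed.

Lemma hder_add (W : normedModType C) (f g : V -> W) z v d d' :
  hder S f z v d -> hder S g z v d' -> hder S (fun y => f y + g y) z v (d + d').
Proof.
move=> Hf Hg e e0.
have [|r r0 Hr] := Hf (e / 2); first by rewrite divr_gt0.
have [|r' r'0 Hr'] := Hg (e / 2); first by rewrite divr_gt0.
exists (Num.min r r'); first by rewrite lt_min r0.
move=> h Sh; rewrite lt_min => /andP[/(Hr _ Sh) h1 /(Hr' _ Sh) h2].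
have -> : f (z + h *: v) + g (z + h *: v) - (f z + g z) - h *: (d + d') =
  (f (z + h *: v) - f z - h *: d) + (g (z + h *: v) - g z - h *: d').
  by rewrite scalerDr addr6ACA.
by apply: (le_trans (nrmD _ _)); lra.
Qed.

Lemma hder_scale (W : normedModType C) (f : V -> W) (a : C) z v d :
  hder S f z v d -> hder S (fun y => a *: f y) z v (a *: d).
Proof.
move=> Hf e e0; have a0 : 0 < 1 + nrm a by rewrite ltr_pwDl ?nrm_ge0.
have [|r r0 Hr] := Hf (e / (1 + nrm a)); first by rewrite divr_gt0.
exists r => // h Sh /(Hr _ Sh) h1.
rewrite scalerA mulrC -scalerA -!scalerBr nrmZ.
apply: (@le_trans _ _ ((1 + nrm a) * (e / (1 + nrm a) * nrm h))).
  by apply: ler_pM; rewrite ?nrm_ge0 // lerDr.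
by rewrite mulrA mulrCA mulfV ?gt_eqF // mulr1.
Qed.

Lemma hder_opp (W : normedModType C) (f : V -> W) z v d :
  hder S f z v d -> hder S (fun y => - f y) z v (- d).
Proof.
move=> Hf; rewrite -scaleN1r.
by apply: hder_ext (hder_scale (-1) Hf); near=> y; rewrite scaleN1r.
Unshelve. all: by end_near. Qed.

Lemma hder_lip (W : normedModType C) (f : V -> W) z v d :
  hder S f z v d -> exists2 r : R, 0 < r &
    forall h : C, S h -> nrm h < r ->
      nrm (f (z + h *: v) - f z) <= (1 + nrm d) * nrm h.
Proof.
move=> Hf; have [r r0 Hr] := Hf 1 ltr01; exists r => // h Sh /(Hr _ Sh) h1.
have -> : f (z + h *: v) - f z = (f (z + h *: v) - f z - h *: d) + h *: d.
  by rewrite subrK.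
apply: (le_trans (nrmD _ _)); rewrite nrmZ mulrDl [nrm d * _]mulrC.
by rewrite lerD2r.
Qed.

Lemma hder_mul (f g : V -> C) z v d d' :
  hder S f z v d -> hder S g z v d' ->
  hder S (fun y => f y * g y) z v (d * g z + f z * d').
Proof.
move=> Hf Hg e e0.
have [p p0 Hp] := hder_lip Hf; have [p' p'0 Hp'] := hder_lip Hg.
(* [A] exceeds the product of the Lipschitz constants of the two increments and controls the
   quadratic remainder; [K] absorbs the factors [f z] and [g z] of the two linear remainders. *)
set A := (1 + nrm d) * (1 + nrm d') + 1.
have A0 : 0 < A by rewrite ltr_wpDl // mulr_ge0 // addr_ge0 ?nrm_ge0.
set K := 3 * (1 + nrm (g z) + nrm (f z)).
have K0 : 0 < K.
  by rewrite mulr_gt0 // -addrA ltr_pwDl // addr_ge0 // nrm_ge0.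
have eK0 : 0 < e / K by rewrite divr_gt0.
have [r r0 Hr] := Hf _ eK0; have [r' r'0 Hr'] := Hg _ eK0.
have eA0 : 0 < e / (3 * A) by rewrite divr_gt0 // mulr_gt0.
exists (Num.min (Num.min r r') (Num.min (Num.min p p') (e / (3 * A)))).
  by rewrite !lt_min r0 r'0 p0 p'0.
move=> h Sh; rewrite !lt_min => /andP[/andP[/(Hr _ Sh) h1 /(Hr' _ Sh) h2]].
move=> /andP[/andP[/(Hp _ Sh) h3 /(Hp' _ Sh) h4] h5].
set F := f (z + h *: v) in h1 h3 *; set G := g (z + h *: v) in h2 h4 *.
have -> : F * G - f z * g z - h *: (d * g z + f z * d') =
  (F - f z - h *: d) * g z + f z * (G - g z - h *: d') + (F - f z) * (G - g z).
  rewrite /GRing.scale /=; ring.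
apply: le_trans (nrmD _ _) _.
have -> : e * nrm h = e / 3 * nrm h + e / 3 * nrm h + e / 3 * nrm h by lra.
have h0 := nrm_ge0 h; have f0 := nrm_ge0 (f z); have g0 := nrm_ge0 (g z).
have key : e / K * (nrm (g z) + nrm (f z)) <= e / 3.
  rewrite -(ler_pM2r K0) mulrAC divfK ?gt_eqF // /K.
  have -> : e / 3 * (3 * (1 + nrm (g z) + nrm (f z))) =
     e + e * (nrm (g z) + nrm (f z)) by field.
  by rewrite lerDr ltW.
apply: lerD.
  apply: le_trans (nrmD _ _) _; rewrite !nrmM.
  apply: (@le_trans _ _ (e / K * nrm h * nrm (g z) + nrm (f z) * (e / K * nrm h))).
    by apply: lerD; [apply: ler_wpM2r|apply: ler_wpM2l].
  have -> : e / K * nrm h * nrm (g z) + nrm (f z) * (e / K * nrm h) =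
   e / K * (nrm (g z) + nrm (f z)) * nrm h by ring.
  apply: le_trans (ler_wpM2r h0 key) _.
  by rewrite lerDl mulr_ge0 // divr_ge0 // ltW.
rewrite nrmM; apply: le_trans (ler_pM (nrm_ge0 _) (nrm_ge0 _) h3 h4) _.
have -> : (1 + nrm d) * nrm h * ((1 + nrm d') * nrm h) =
  (A - 1) * nrm h * nrm h by rewrite /A; ring.
apply: ler_wpM2r => //.
apply: (@le_trans _ _ (A * nrm h)).
  by rewrite ler_wpM2r // lerBlDr lerDl.
rewrite -ler_pdivlMl //; apply: (le_trans (ltW h5)).
by rewrite [3 * A]mulrC invfM mulrCA mulrA.
Qed.

Lemma hder_id z v : hder S (fun y => y) z v v.
Proof.
move=> e e0; exists 1 => // h _ _.
by rewrite [z + _]addrC addrK subrr nrm0 mulr_ge0 ?nrm_ge0 // ltW.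
Qed.

Lemma hder_sum (W : normedModType C) (I : Type) (r : seq I) (P : pred I)
   (F : I -> V -> W) z v (D : I -> W) :
  (forall i, P i -> hder S (F i) z v (D i)) ->
  hder S (fun y => \sum_(i <- r | P i) F i y) z v (\sum_(i <- r | P i) D i).
Proof.
move=> H; elim: r => [|i r IH].
  rewrite big_nil; apply: hder_ext (hder_cst 0 z v).
  by near=> y; rewrite big_nil.
rewrite big_cons; case: ifPn => Pi; last first.
  by apply: hder_ext IH; near=> y; rewrite big_cons (negbTE Pi).
apply: hder_ext (hder_add (H i Pi) IH).
by near=> y; rewrite big_cons Pi.
Unshelve. all: by end_near. Qed.

(** A complex derivative of [g] allows every increment of [f]. A function [g] differentiable only
    along the real axis can still be composed, provided that [f] moves by real amounts. *)
Lemma hder_comp_gen (S' : set C) (W : normedModType C) (f : V -> C) (g : C -> W)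
    z v d d' : (forall h, S h -> S' (f (z + h *: v) - f z)) ->
  hder S' g (f z) 1 d' -> hder S f z v d ->
  hder S (fun y => g (f y)) z v (d *: d').
Proof.
move=> SS Hg Hf e e0; have [p p0 Hp] := hder_lip Hf.
have n1 : 0 < 1 + nrm d by rewrite ltr_pwDl ?nrm_ge0.
have n2 : 0 < 1 + nrm d' by rewrite ltr_pwDl ?nrm_ge0.
have [|q q0 Hq] := Hg (e / (2 * (1 + nrm d))).
  by rewrite divr_gt0 // mulr_gt0.
have [|r r0 Hr] := Hf (e / (2 * (1 + nrm d'))).
  by rewrite divr_gt0 // mulr_gt0.
exists (Num.min (Num.min r p) (q / (1 + nrm d))).
  by rewrite !lt_min r0 p0 divr_gt0.
move=> h Sh; rewrite !lt_min => /andP[/andP[/(Hr _ Sh) h1 /(Hp _ Sh) h2] h3].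
set F := f (z + h *: v) in h1 h2 *.
have h4 : nrm (F - f z) < q.
  by apply: le_lt_trans h2 _; move: h3; rewrite ltr_pdivlMr // mulrC.
have := Hq _ (SS _ Sh) h4; have -> : f z + (F - f z) *: 1 = F by rewrite /GRing.scale /= mulr1 addrC subrK.
move=> h5.
have -> : g F - g (f z) - h *: (d *: d') =
  (g F - g (f z) - (F - f z) *: d') + (F - f z - h *: d) *: d'.
  rewrite [(F - f z - _) *: _]scalerBl (addrA (_ - _)) subrK.
  by rewrite scalerA.
apply: le_trans (nrmD _ _) _; rewrite nrmZ.
have -> : e * nrm h = e / 2 * nrm h + e / 2 * nrm h by lra.
apply: lerD.
  apply: le_trans h5 _; apply: le_trans (ler_wpM2l _ h2) _.
    by rewrite ltW // divr_gt0 // mulr_gt0.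
  rewrite mulrA ler_wpM2r ?nrm_ge0 // invfM mulrA mulfVK ?gt_eqF //.
apply: le_trans (ler_wpM2r (nrm_ge0 _) h1) _.
rewrite mulrAC ler_wpM2r ?nrm_ge0 //.
rewrite invfM mulrA mulrAC ler_pdivrMr // ler_wpM2l ?divr_ge0 // ?ltW //.
by rewrite ltrDr.
Qed.

Lemma hder_comp (W : normedModType C) (f : V -> C) (g : C -> W) z v d d' :
  hder setT g (f z) 1 d' -> hder S f z v d ->
  hder S (fun y => g (f y)) z v (d *: d').
Proof. exact: hder_comp_gen. Qed.

End Rules.

Lemma cder_inv (x : C) : x != 0 -> hder setT (fun y : C => y^-1) x 1 (- x^-2).
Proof.
move=> x0 e e0; have n0 : 0 < nrm x by rewrite nrm_gt0.
exists (Num.min (nrm x / 2) (e * nrm x ^+ 3 / 2)).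
  by rewrite lt_min !divr_gt0 // mulr_gt0 // exprn_gt0.
move=> h _; rewrite lt_min => /andP[h1 h2]; rewrite ![_ *: _]/GRing.scale /= mulr1.
have n1 : nrm x / 2 < nrm (x + h) by have := nrm_sub x (- h); rewrite nrmN opprK; lra.
have xh0 : x + h != 0 by rewrite -nrm_gt0; lra.
have -> : (x + h)^-1 - x^-1 - h * - x^-2 = h * (h / ((x + h) * x ^+ 2)).
  by field; rewrite x0 xh0.
rewrite nrmM mulrC ler_wpM2r ?nrm_ge0 // nrmM nrmV nrmM nrmX.
rewrite ler_pdivrMr ?mulr_gt0 ?exprn_gt0 //; last by lra.
apply: (le_trans (ltW h2)); rewrite -mulrA ler_wpM2l ?ltW //.
by rewrite exprS mulrAC ltr_pM2r // exprn_gt0.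
Qed.

Lemma hder_inv S (V : normedModType C) (f : V -> C) (z v : V) d :
  f z != 0 -> hder S f z v d ->
  hder S (fun y => (f y)^-1) z v (- (d / (f z) ^+ 2)).
Proof.
move=> fz0 Hf; have := hder_comp (cder_inv fz0) Hf.
by rewrite /GRing.scale /= mulrN.
Qed.

Lemma rder_conj (V : normedModType C) (f : V -> C) (z v : V) d :
  hder Sreal f z v d -> hder Sreal (fun y => (conjc (f y))) z v ((conjc d)).
Proof.
move=> Hf e e0; have [r r0 Hr] := Hf e e0; exists r => // h Sh /(Hr _ Sh).
have hh : h = (conjc h).
  by move: Sh; rewrite /Sreal /=; case: (h) => a b /= ->; rewrite oppr0.
rewrite -nrmJ !rmorphB /= [in X in X -> _]/GRing.scale /= rmorphM /= -hh.
by [].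
Qed.

Lemma SrealR (r : R) : Sreal (r%:C).
Proof. by []. Qed.

Lemma Sreal_E h : Sreal h -> h = (complex.Re h)%:C.
Proof. by case: h => a b; rewrite /Sreal /= => ->. Qed.

(** Bridge from limits of difference quotients to the form without division, where h = 0 is no
    exception; [cderP] and [rderP] do the same for the other derivatives. *)
Lemma real_derP (F : R -> R) (x d : R) :
  (derivable F x 1 /\ derive1 F x = d) <->
  (forall e : R, 0 < e -> exists2 r : R, 0 < r &
    forall h, `|h| < r -> `|F (x + h) - F x - h * d| <= e * `|h|).
Proof.
have E (h : R) : h != 0 -> forall l, `|l - h^-1 *: ((F \o shift x) (h *: 1) - F x)|
    = `|F (x + h) - F x - h * l| / `|h|.
  move=> h0 l; rewrite -normfV -normrM -normrN /= [h *: 1]mulr1 [h + x]addrC.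
  by congr `|_|; rewrite /GRing.scale /=; field.
split.
  move=> [dF <-] e e0; rewrite derive1E; move/cvgrPdist_le: dF => /(_ e e0).
  rewrite near_withinE => /nbhs_normP[r /= r0 Hr]; exists r => // h hr.
  have [->|h0] := eqVneq h 0.
    by rewrite addr0 subrr mul0r subr0 normr0 mulr0.
  have := Hr h; rewrite /ball_ /= sub0r normrN => /(_ hr h0).
  by rewrite E // ler_pdivrMr ?normr_gt0.
move=> H.
have C : (fun h => h^-1 *: ((F \o shift x) (h *: 1) - F x)) @ 0^' --> d.
  apply/cvgrPdist_le => e e0; have [r r0 Hr] := H e e0.
  rewrite near_withinE; apply/nbhs_normP; exists r => //= h.
  rewrite /ball_ /= sub0r normrN => hr h0.
  by rewrite E // ler_pdivrMr ?normr_gt0 // Hr.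
split; first by apply/cvg_ex; exists d.
by rewrite derive1E; apply/cvg_lim.
Qed.

Lemma cderP (V W : normedModType C) (f : V -> W) (z v : V) (d : W) :
  (derivable f z v /\ 'D_v f z = d) <-> hder setT f z v d.
Proof.
have E (h : C) : h != 0 -> forall l, nrm (l - h^-1 *: ((f \o shift z) (h *: v) - f z))
    = nrm (f (z + h *: v) - f z - h *: l) / nrm h.
  move=> h0 l; rewrite -nrmV mulrC -nrmZ nrm_distC /= [h *: v + z]addrC.
  by congr nrm; rewrite [RHS]scalerBr scalerA mulVf // scale1r.
split.
  move=> [dF <-] e e0; move/cvgrPdist_le: dF => /(_ e%:C).
  rewrite ltcR => /(_ e0).
  rewrite near_withinE => /nbhs_nrm[r r0 Hr]; exists r => // h _ hr.
  have [->|h0] := eqVneq h 0.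
    by rewrite scale0r addr0 subrr scale0r subr0 !nrm0 mulr0.
  have := Hr h; rewrite subr0 => /(_ hr h0).
  by rewrite nrmE lecR E // ler_pdivrMr ?nrm_gt0.
move=> H.
have CC : (fun h => h^-1 *: ((f \o shift z) (h *: v) - f z)) @ 0^' --> d.
  apply/cvgrPdist_le => e e0.
  have er : e = (complex.Re e)%:C.
    by move: e0; case: (e) => a b; rewrite ltcE /= => /andP[/eqP -> _].
  have [|r r0 Hr] := H (complex.Re e); first by rewrite -ltcR -er.
  rewrite near_withinE; apply/(nbhs_nrm (0 : C)); exists r => //= h.
  rewrite subr0 => hr h0.
  by rewrite nrmE er lecR E // ler_pdivrMr ?nrm_gt0 // Hr.
split; first by apply/cvg_ex; exists d.
exact/cvg_lim.
Qed.

Lemma rderP (V : normedModType C) (g : V -> C) (z v : V) (d : C) :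
  (rderivable g z v /\ rderive v g z = d) <-> hder Sreal g z v d.
Proof.
split.
  move=> [[d1 d2] <-] e e0; have e2 : 0 < e / 2 by rewrite divr_gt0.
  have [r r0 Hr] := (real_derP _ _ _).1 (conj d1 erefl) _ e2.
  have [r' r'0 Hr'] := (real_derP _ _ _).1 (conj d2 erefl) _ e2.
  exists (Num.min r r'); first by rewrite lt_min r0.
  move=> h /Sreal_E ->; move: (complex.Re h) => {}h.
  rewrite nrmR lt_min => /andP[/Hr h1 /Hr' h2].
  rewrite add0r scale0r addr0 in h1; rewrite add0r scale0r addr0 in h2.
  apply: le_trans (nrm_le_ReIm _) _; rewrite /rderive.
  move: h1 h2; rewrite !ReImE /= !mul0r subr0 addr0 => h1 h2; lra.
move=> H.
have h1 : derivable (fun h : R => complex.Re (g (z + h%:C *: v))) 0 1 /\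
  derive1 (fun h : R => complex.Re (g (z + h%:C *: v))) 0 = complex.Re d.
  apply/real_derP => e e0; have [r r0 Hr] := H e e0; exists r => // h hr.
  have := Hr h%:C (SrealR _); rewrite nrmR => /(_ hr).
  apply: le_trans; rewrite add0r scale0r addr0.
  by apply: le_trans (Re_le_nrm _); rewrite !ReImE mul0r subr0.
have h2 : derivable (fun h : R => complex.Im (g (z + h%:C *: v))) 0 1 /\
  derive1 (fun h : R => complex.Im (g (z + h%:C *: v))) 0 = complex.Im d.
  apply/real_derP => e e0; have [r r0 Hr] := H e e0; exists r => // h hr.
  have := Hr h%:C (SrealR _); rewrite nrmR => /(_ hr).
  apply: le_trans; rewrite add0r scale0r addr0.
  by apply: le_trans (Im_le_nrm _); rewrite !ReImE mul0r addr0.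
case: h1 h2 => [d1 e1] [d2 e2]; split; first by [].
by rewrite /rderive e1 e2; case: (d).
Qed.

Lemma cder_rder (V W : normedModType C) (f : V -> W) (z v : V) d :
  hder setT f z v d -> hder Sreal f z v d.
Proof. exact: hder_sub. Qed.

Lemma cder_dir (V W : normedModType C) (f : V -> W) (z v : V) d (a : C) :
  hder setT f z v d -> hder setT f z (a *: v) (a *: d).
Proof.
move=> H e e0; have n1 : 0 < 1 + nrm a by rewrite ltr_pwDl ?nrm_ge0.
have [|r r0 Hr] := H (e / (1 + nrm a)); first by rewrite divr_gt0.
exists (r / (1 + nrm a)); first by rewrite divr_gt0.
move=> h _; rewrite ltr_pdivlMr // => hr.
have hh : nrm (h * a) < r.
  apply: le_lt_trans hr; rewrite nrmM ler_wpM2l ?nrm_ge0 // lerDr //.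
rewrite !scalerA; apply: le_trans (Hr _ I hh) _.
rewrite nrmM [nrm h * _]mulrC mulrA ler_wpM2r ?nrm_ge0 //.
by rewrite mulrAC ler_pdivrMr // ler_wpM2l ?ltW // ltrDr.
Qed.

End Directional.

(** * Rules for continuity at a point *)

Section Continuity.
Variable R : realType.
Local Notation C := R[i].
Local Notation nrm := (@nrm R _).

Section Source.
Variable V : normedModType C.

Lemma ctn_ext (W : normedModType C) (f g : V -> W) z :
  (\forall y \near z, f y = g y) ->
  ctn f z -> ctn g z.
Proof.
move=> /nbhs_nrm[r r0 fg] cf => e /cf[d d0 Hd].
exists (Num.min r d); first by rewrite lt_min r0.
move=> y; rewrite lt_min => /andP[yr yd].
by rewrite -!fg; [exact: Hd|rewrite subrr nrm0|].
Qed.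

Lemma ctn_cst (W : normedModType C) (k : W) (z : V) :
  ctn (fun=> k) z.
Proof. by move=> e e0; exists e => // y _; rewrite subrr nrm0. Qed.

Lemma ctn_id (z : V) : ctn (fun y : V => y) z.
Proof. by move=> e e0; exists e. Qed.

Lemma ctn_add (W : normedModType C) (f g : V -> W) z :
  ctn f z -> ctn g z ->
  ctn (fun y => f y + g y) z.
Proof.
move=> cf cg => e e0.
have [|d d0 Hd] := cf (e / 2); first by rewrite divr_gt0.
have [|r r0 Hr] := cg (e / 2); first by rewrite divr_gt0.
exists (Num.min d r); first by rewrite lt_min d0.
move=> y; rewrite lt_min => /andP[/Hd h1 /Hr h2].
rewrite opprD addrACA; apply: le_lt_trans (nrmD _ _) _; lra.
Qed.

Lemma ctn_scale (W : normedModType C) (a : C) (f : V -> W) z :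
  ctn f z -> ctn (fun y => a *: f y) z.
Proof.
move=> cf => e e0.
have a0 : 0 < 1 + nrm a by rewrite ltr_pwDl ?nrm_ge0.
have [|d d0 Hd] := cf (e / (1 + nrm a)); first by rewrite divr_gt0.
exists d => // y /Hd; rewrite -scalerBr nrmZ ltr_pdivlMr // mulrC.
by apply: le_lt_trans; rewrite ler_wpM2r ?nrm_ge0 // lerDr.
Qed.

Lemma ctn_opp (W : normedModType C) (f : V -> W) z :
  ctn f z -> ctn (fun y => - f y) z.
Proof.
move=> cf; apply: ctn_ext _ (@ctn_scale W (-1) f z cf).
by near=> y; rewrite scaleN1r.
Unshelve. all: by end_near. Qed.

Lemma ctn_mul (f g : V -> C) z :
  ctn f z -> ctn g z ->
  ctn (fun y => f y * g y) z.
Proof.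
move=> cf cg => e e0.
set A := 1 + nrm (f z) + nrm (g z).
have A1 : 1 <= A by rewrite /A -addrA lerDl addr_ge0 // nrm_ge0.
have A0 : 0 < A by apply: lt_le_trans A1.
have [|d d0 Hd] := cf (Num.min 1 (e / (2 * A))).
  by rewrite lt_min ltr01 divr_gt0 // mulr_gt0.
have [|r r0 Hr] := cg (Num.min 1 (e / (2 * A))).
  by rewrite lt_min ltr01 divr_gt0 // mulr_gt0.
exists (Num.min d r); first by rewrite lt_min d0.
move=> y; rewrite lt_min => /andP[/Hd + /Hr].
rewrite !lt_min => /andP[h1 h2] /andP[h3 h4].
have -> : f y * g y - f z * g z = (f y - f z) * g y + f z * (g y - g z) by ring.
apply: le_lt_trans (nrmD _ _) _; rewrite !nrmM.
have g1 : nrm (g y) <= A.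
  have := nrmD (g y - g z) (g z); rewrite subrK.
  have := nrm_ge0 (f z); rewrite /A; lra.
have f1 : nrm (f z) <= A by have := nrm_ge0 (g z); rewrite /A; lra.
have -> : e = e / (2 * A) * A + A * (e / (2 * A)) by field; rewrite gt_eqF.
apply: ler_ltD.
  by apply: ler_pM; rewrite ?nrm_ge0 // ltW.
apply: le_lt_trans (_ : A * nrm (g y - g z) < _).
  by apply: ler_wpM2r; rewrite ?nrm_ge0.
by rewrite ltr_pM2l.
Qed.

Lemma ctn_conj (f : V -> C) z :
  ctn f z -> ctn (fun y => (conjc (f y))) z.
Proof.
move=> cf => e /cf[d d0 Hd].
by exists d => // y /Hd; rewrite -nrmJ rmorphB.
Qed.

Lemma ctn_sum (W : normedModType C) (I : Type) (r : seq I) (P : pred I)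
    (F : I -> V -> W) z : (forall i, P i -> ctn (F i) z) ->
  ctn (fun y => \sum_(i <- r | P i) F i y) z.
Proof.
move=> H; elim: r => [|i r IH].
  by apply: ctn_ext _ (@ctn_cst W 0 z); near=> y; rewrite big_nil.
case Pi : (P i); last by apply: ctn_ext _ IH; near=> y; rewrite big_cons Pi.
by apply: ctn_ext _ (ctn_add (H _ Pi) IH); near=> y; rewrite big_cons Pi.
Unshelve. all: by end_near. Qed.

Lemma ctn_prod (I : Type) (r : seq I) (P : pred I)
    (F : I -> V -> C) z : (forall i, P i -> ctn (F i) z) ->
  ctn (fun y => \prod_(i <- r | P i) F i y) z.
Proof.
move=> H; elim: r => [|i r IH].
  by apply: ctn_ext _ (@ctn_cst C 1 z); near=> y; rewrite big_nil.
case Pi : (P i); last by apply: ctn_ext _ IH; near=> y; rewrite big_cons Pi.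
by apply: ctn_ext _ (ctn_mul (H _ Pi) IH); near=> y; rewrite big_cons Pi.
Unshelve. all: by end_near. Qed.

Lemma ctn_comp (W U : normedModType C) (f : V -> W) (g : W -> U) z :
  ctn f z -> ctn g (f z) ->
  ctn (fun y => g (f y)) z.
Proof.
move=> cf cg => e e0.
have [d d0 Hd] := cg _ e0; have [r r0 Hr] := cf _ d0.
by exists r => // y /Hr /Hd.
Qed.

Lemma ctn_neq0 (f : V -> C) z : ctn f z -> f z != 0 ->
  \forall y \near z, f y != 0.
Proof.
move=> cf fz; have n0 : 0 < nrm (f z) by rewrite nrm_gt0.
have [d d0 Hd] := cf _ n0; apply/nbhs_nrm; exists d => // y /Hd.
apply: contraTneq => ->; by rewrite sub0r nrmN ltxx.
Qed.

End Source.

Lemma cder_ctn (W : normedModType C) (f : C -> W) (z : C) d :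
  hder setT f z 1 d -> ctn f z.
Proof.
move=> /hder_lip[r r0 Hr] => e e0.
have n1 : 0 < 1 + nrm d by rewrite ltr_pwDl ?nrm_ge0.
exists (Num.min r (e / (1 + nrm d))); first by rewrite lt_min r0 divr_gt0.
move=> y; rewrite lt_min => /andP[h1]; rewrite ltr_pdivlMr // => h2.
have := Hr (y - z) I h1.
have -> : z + (y - z) *: 1 = y by rewrite /GRing.scale /= mulr1 addrC subrK.
by move=> h3; apply: le_lt_trans h3 _; rewrite mulrC.
Qed.

Lemma ctn_inv (V : normedModType C) (f : V -> C) z :
  f z != 0 -> ctn f z -> ctn (fun y => (f y)^-1) z.
Proof.
move=> fz cf; apply: (ctn_comp (g := fun x : C => x^-1) cf).
exact: cder_ctn (cder_inv fz).
Qed.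

End Continuity.

(** * Goursat's lemma, mean values and the maximum principle *)

Section IntervalIntegral.
Variable R : realType.
Local Notation C := R[i].
Local Notation nrm := (@nrm R _).
Local Notation mu := (@lebesgue_measure R).

Lemma continuous_integrable_seg (h : R -> R) (a b : R) : continuous h ->
  mu.-integrable `[a, b] (EFin \o h).
Proof.
move=> ch; apply: continuous_compact_integrable; first exact: segment_compact.
exact: continuous_subspaceT.
Qed.

(** On ]-M, M[ the signed integral from 0 differs by a constant from the integral from -M, to which
    the fundamental theorem applies; M = |x| + 1 keeps a neighbourhood of x inside. *)
Lemma primitive_exists (h : R -> R) : continuous h ->
  exists H : R -> R, forall x, is_derive x (1 : R) H (h x).
Proof.
move=> ch.
pose H x : R := if 0 <= x then (\int[mu]_(t in `]0%R, x]) h t)%R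
            else - (\int[mu]_(t in `]x, 0%R]) h t)%R.
pose F M x : R := (\int[mu]_(t in `[- M, x]) h t)%R.
have HF (M x : R) : `|x| < M -> H x = F M x - F M 0.
  move=> xM; have M0 : 0 < M by apply: le_lt_trans xM.
  have [xM1 xM2] : - M <= x /\ x <= M.
    by move: xM; rewrite ltr_norml => /andP[/ltW ? /ltW ?].
  rewrite /H /F; case: ifPn => x0.
    rewrite Rintegral_itvB ?bnd_simp //; first exact: continuous_integrable_seg.
    by rewrite oppr_le0 ltW.
  rewrite -ltNge in x0.
  rewrite -[RHS]opprB; congr (- _).
  rewrite Rintegral_itvB ?bnd_simp //; first exact: continuous_integrable_seg.
  exact: ltW.
exists H => x; pose M := `|x| + 1.
have xM : `|x| < M by rewrite ltrDl.
have [dF F'] : derivable (F M) x 1 /\ derive1 (F M) x = h x.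
  apply: (@continuous_FTC1_closed R h (- M) x M) => //.
  - by apply: le_lt_trans (ler_norm _) xM.
  - exact: continuous_integrable_seg.
  - by move: xM; rewrite ltr_norml => /andP[].
  - exact: ch.
have D1 : is_derive x (1 : R) (F M) (h x) by rewrite -F' derive1E; exact: derivableP.
have := is_deriveB D1 (is_derive_cst (F M 0) x (1 : R)); rewrite subr0.
apply: near_eq_is_derive.
apply/nbhs_normP; exists 1 => //= y; rewrite /ball_ /= => yx.
rewrite (HF M) //; apply: le_lt_trans (_ : _ <= `|x| + `|x - y|) _.
  by rewrite -[in leLHS](subKr x y) ler_normB.
by rewrite ltrD2l.
Qed.

(* Difference of the values of a primitive of [h]; 0 if [h] has none. *)
Definition Int (h : R -> R) (a b : R) : R :=
  let H := xget (cst 0) [set H : R -> R | forall x, is_derive x (1 : R) H (h x)] in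
  H b - H a.

Arguments Int : simpl never.

Lemma IntE (h K : R -> R) a b : (forall x, is_derive x (1 : R) K (h x)) ->
  Int h a b = K b - K a.
Proof.
move=> HK; rewrite /Int; case: xgetP => [H _ HH|/(_ K)]; last by [].
have E x y : (H \- K) x = (H \- K) y.
  apply: is_derive_0_is_cst => z; rewrite -(subrr (h z)).
  by apply: is_deriveB.
have := E b a => /=; lra.
Qed.

Lemma Int_ex (h : R -> R) : continuous h -> exists K : R -> R,
  (forall x, is_derive x (1 : R) K (h x)) /\ forall a b, Int h a b = K b - K a.
Proof.
move=> /primitive_exists[K HK]; exists K; split=> // a b; exact: IntE.
Qed.

Lemma Int_cat (h : R -> R) a b c : Int h a b + Int h b c = Int h a c.
Proof. rewrite /Int; lra. Qed.

Lemma IntD (h g : R -> R) a b : continuous h -> continuous g ->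
  Int (fun x => h x + g x) a b = Int h a b + Int g a b.
Proof.
move=> /Int_ex[H [dH ->]] /Int_ex[G [dG ->]].
rewrite (@IntE _ (fun x => H x + G x)); lra.
Qed.

Lemma IntZ (h : R -> R) k a b : continuous h ->
  Int (fun x => k * h x) a b = k * Int h a b.
Proof.
move=> /Int_ex[H [dH ->]].
rewrite (@IntE _ (fun x => k * H x)); lra.
Qed.

Lemma Int_ge0 (h : R -> R) a b : a <= b -> continuous h ->
  (forall x, a <= x <= b -> 0 <= h x) -> 0 <= Int h a b.
Proof.
move=> ab /Int_ex[H [dH ->]] h0.
have [|c] := @MVT_segment R H h a b ab (fun x _ => dH x).
  apply: continuous_subspaceT => x; apply: differentiable_continuous.
  by apply/derivable1_diffP; case: (dH x).
rewrite in_itv /= => /h0 c0 ->; by rewrite mulr_ge0 // subr_ge0.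
Qed.

Lemma Int_le (h g : R -> R) a b : a <= b -> continuous h -> continuous g ->
  (forall x, a <= x <= b -> h x <= g x) -> Int h a b <= Int g a b.
Proof.
move=> ab ch cg hg; rewrite -subr_ge0.
have -> : Int g a b - Int h a b = Int (fun x => g x + -1 * h x) a b.
  rewrite IntD //; first by rewrite IntZ //; lra.
  by move=> x; apply: cvgMr; exact: ch.
apply: Int_ge0 => //.
  by move=> x; apply: cvgD; [exact: cg|apply: cvgMr; exact: ch].
by move=> x /hg; lra.
Qed.

Lemma Int_cst k a b : Int (fun=> k) a b = k * (b - a).
Proof.
have D x : is_derive x (1 : R) (fun x => k * x) k.
  have := @is_deriveZ _ _ _ id k x 1 1 (is_derive_id _ _).
  by rewrite [k *: 1]mulr1.
rewrite (IntE _ _ D); lra.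
Qed.

Lemma Int_Leb (h : R -> R) a b : a < b -> continuous h ->
  (\int[mu]_(x in `[a, b]) (h x)%:E = (Int h a b)%:E)%E.
Proof.
move=> ab ch; have [H [dH ->]] := Int_ex ch.
have cH : continuous H.
  move=> x; apply: differentiable_continuous.
  by apply/derivable1_diffP; case: (dH x).
rewrite (@continuous_FTC2 _ h H) //.
- exact: continuous_subspaceT.
- split; [by move=> x _; case: (dH x)|exact/cvg_at_right_filter/cH|].
  exact/cvg_at_left_filter/cH.
- by move=> x _; rewrite derive1E; apply: derive_val.
Qed.

Definition CInt (h : R -> C) (a b : R) : C :=
  Int (fun x => complex.Re (h x)) a b +i* Int (fun x => complex.Im (h x)) a b.

Lemma ctsRe (h : R -> C) : ctnR h -> continuous (fun x => complex.Re (h x)).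
Proof.
move=> ch x; apply/continuousRR => e e0.
have [d d0 Hd] := ch x _ e0.
exists d => // y /Hd; apply: le_lt_trans.
by apply: le_trans (Re_le_nrm _); rewrite !ReImE.
Qed.

Lemma ctsIm (h : R -> C) : ctnR h -> continuous (fun x => complex.Im (h x)).
Proof.
move=> ch x; apply/continuousRR => e e0.
have [d d0 Hd] := ch x _ e0.
exists d => // y /Hd; apply: le_lt_trans.
by apply: le_trans (Im_le_nrm _); rewrite !ReImE.
Qed.

Lemma CInt_cat (h : R -> C) a b c : CInt h a b + CInt h b c = CInt h a c.
Proof. by rewrite /CInt -(Int_cat _ a b c) -[in RHS](Int_cat _ a b c). Qed.

Lemma CIntD (h g : R -> C) a b : ctnR h -> ctnR g ->
  CInt (fun x => h x + g x) a b = CInt h a b + CInt g a b.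
Proof.
move=> ch cg; apply: complexP; rewrite !ReImE /= -IntD;
  try exact: ctsRe; try exact: ctsIm.
- by congr Int; apply/funext => x; rewrite ReImE.
- by congr Int; apply/funext => x; rewrite ReImE.
Qed.

Lemma CIntZ (h : R -> C) (k : C) a b : ctnR h ->
  CInt (fun x => k * h x) a b = k * CInt h a b.
Proof.
move=> ch.
have cr (m : R) : continuous (fun x => m * complex.Re (h x)).
  by move=> x; apply: cvgMr; exact: ctsRe.
have ci (m : R) : continuous (fun x => m * complex.Im (h x)).
  by move=> x; apply: cvgMr; exact: ctsIm.
apply: complexP; rewrite !ReImE /=.
- rewrite -mulNr -(IntZ _ _ _ (ctsRe ch)) -(IntZ _ _ _ (ctsIm ch)) -IntD //.
  by congr Int; apply/funext => x; rewrite ReImE mulNr.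
- rewrite -(IntZ _ _ _ (ctsRe ch)) -(IntZ _ _ _ (ctsIm ch)) -IntD //.
  by congr Int; apply/funext => x; rewrite ReImE.
Qed.

Lemma CInt_cst (k : C) a b : CInt (fun=> k) a b = k * (b - a)%:C.
Proof.
by apply: complexP; rewrite [LHS]/= Int_cst !ReImE ?mulr0 ?subr0 ?add0r.
Qed.

Lemma CInt_eq (h g : R -> C) a b : h =1 g -> CInt h a b = CInt g a b.
Proof. by move=> /funext ->. Qed.

Lemma continuousCM (h : R -> C) (k : C) : ctnR h ->
  ctnR (fun x => k * h x).
Proof.
move=> ch x e e0.
have n1 : 0 < 1 + nrm k by rewrite ltr_pwDl ?nrm_ge0.
have [|d d0 Hd] := ch x (e / (1 + nrm k)).
  by rewrite divr_gt0.
exists d => // y /Hd; rewrite -mulrBr nrmM ltr_pdivlMr //.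
by apply: le_lt_trans; rewrite mulrC ler_wpM2l ?nrm_ge0 // lerDr.
Qed.

Lemma continuousCD (h g : R -> C) : ctnR h -> ctnR g ->
  ctnR (fun x => h x + g x).
Proof.
move=> ch cg x e e0.
have [|d d0 Hd] := ch x (e / 2); first by rewrite divr_gt0.
have [|r r0 Hr] := cg x (e / 2); first by rewrite divr_gt0.
exists (Num.min d r); first by rewrite lt_min d0.
move=> y; rewrite lt_min => /andP[/Hd h1 /Hr h2].
rewrite opprD addrACA; apply: le_lt_trans (nrmD _ _) _; lra.
Qed.

Lemma CInt_nrm (h : R -> C) (M a b : R) : a <= b -> ctnR h ->
  (forall x, a <= x <= b -> nrm (h x) <= M) -> nrm (CInt h a b) <= M * (b - a).
Proof.
move=> ab ch hM; set c := CInt h a b.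
have M0 : 0 <= M by apply: le_trans (hM a _); rewrite ?nrm_ge0 // lexx.
have [c0|c0] := eqVneq c 0; first by rewrite c0 nrm0 mulr_ge0 // subr_ge0.
(* rotate the integral onto the positive real axis *)
pose u : C := (nrm c)%:C / c.
have nu : nrm u = 1.
  by rewrite nrmM nrmV nrmR ger0_norm ?nrm_ge0 // divff // nrm_eq0.
have -> : nrm c = complex.Re (CInt (fun x => u * h x) a b).
  by rewrite CIntZ // -/c divfK.
rewrite /= -Int_cst; apply: Int_le => //.
- apply: (@ctsRe (fun x => u * h x)); exact: continuousCM.
- by move=> x; exact: cvg_cst.
- move=> x /hM hx; apply: le_trans (ler_norm _) _.
  by apply: le_trans (Re_le_nrm _) _; rewrite nrmM nu mul1r.
Qed.

Lemma CInt_id a b : CInt (fun x => x%:C) a b = ((b ^+ 2 - a ^+ 2) / 2)%:C.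
Proof.
apply: complexP => /=; last by rewrite Int_cst mul0r.
have D x : is_derive x (1 : R) (fun x => 2^-1 * x ^+ 2) x.
  have := @is_deriveX _ _ id 2 x 1 1 (is_derive_id _ _).
  move=> /(@is_deriveZ _ _ _ _ 2^-1 x 1 _).
  rewrite (_ : _ *: _ = x) // /GRing.scale /= expr1 mulr1.
  by field.
rewrite (IntE _ _ D); lra.
Qed.

End IntervalIntegral.

(** * Goursat's lemma on rectangles *)

Section Goursat.
Variable R : realType.
Local Notation C := R[i].
Local Notation nrm := (@nrm R _).
Variable g : C -> C.
Hypothesis cg : forall z, ctn g z.

Lemma cont_hor (f : C -> C) (y : R) : (forall z, ctn f z) ->
  ctnR (fun x : R => f (x +i* y)).
Proof.
move=> cf x; move=> e e0.
have [d d0 Hd] := cf (x +i* y) _ e0.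
exists d => // x' xx; apply: Hd; apply: le_lt_trans (nrm_le_ReIm _) _.
by rewrite !ReImE /= subrr normr0 addr0.
Qed.

Lemma cont_ver (f : C -> C) (x : R) : (forall z, ctn f z) ->
  ctnR (fun y : R => f (x +i* y)).
Proof.
move=> cf y; move=> e e0.
have [d d0 Hd] := cf (x +i* y) _ e0.
exists d => // x' xx; apply: Hd; apply: le_lt_trans (nrm_le_ReIm _) _.
by rewrite !ReImE /= subrr normr0 add0r.
Qed.

(** The integral of f dz over the boundary of [a, b] x [c, d], counterclockwise. *)
Definition bdry (f : C -> C) (a b c d : R) : C :=
  CInt (fun x => f (x +i* c)) a b + 'i%C * CInt (fun y => f (b +i* y)) c d
  - CInt (fun x => f (x +i* d)) a b - 'i%C * CInt (fun y => f (a +i* y)) c d.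

Lemma bdryD (f h : C -> C) a b c d : (forall z, ctn f z) -> (forall z, ctn h z) ->
  bdry (fun z => f z + h z) a b c d = bdry f a b c d + bdry h a b c d.
Proof.
move=> cf ch; rewrite /bdry !CIntD; try (by apply: cont_hor); try (by apply: cont_ver).
ring.
Qed.

Lemma bdryZ (f : C -> C) k a b c d : (forall z, ctn f z) ->
  bdry (fun z => k * f z) a b c d = k * bdry f a b c d.
Proof.
move=> cf; rewrite /bdry !CIntZ; try (by apply: cont_hor); try (by apply: cont_ver).
ring.
Qed.

Lemma bdry_cst (k : C) a b c d : bdry (fun=> k) a b c d = 0.
Proof. rewrite /bdry !CInt_cst; ring. Qed.

Lemma continuous_idC : forall z : C, ctn (fun z : C => z) z.
Proof. by move=> z; exact: ctn_id. Qed.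

Lemma complexXY (x y : R) : x +i* y = x%:C + 'i%C * y%:C :> C.
Proof. by apply: complexP; rewrite !ReImE /= ?mul0r ?mul1r ?subr0 ?addr0 ?add0r. Qed.

Lemma continuous_RC : ctnR (fun x : R => x%:C : C).
Proof.
move=> x e e0; exists e => // y.
by rewrite -rmorphB nrmR.
Qed.

Lemma continuous_cstRC (k : C) : ctnR (fun x : R => k).
Proof. by move=> x e e0; exists 1 => // y _; rewrite subrr nrm0. Qed.

Lemma bdry_id a b c d : bdry (fun z => z) a b c d = 0.
Proof.
rewrite /bdry.
have H (k l : C) u v : CInt (fun x => k + l * x%:C) u v =
  k * (v - u)%:C + l * ((v ^+ 2 - u ^+ 2) / 2)%:C.
  rewrite CIntD; [|exact: continuous_cstRC|exact: continuousCM continuous_RC].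
  by rewrite CInt_cst CIntZ ?CInt_id //; exact: continuous_RC.
have Hh (y u v : R) : CInt (fun x => x +i* y : C) u v =
   ('i%C * y%:C) * (v - u)%:C + 1 * ((v ^+ 2 - u ^+ 2) / 2)%:C.
  by rewrite -H; apply: CInt_eq => x; rewrite complexXY mul1r addrC.
have Hv (x u v : R) : CInt (fun y => x +i* y : C) u v =
   x%:C * (v - u)%:C + 'i%C * ((v ^+ 2 - u ^+ 2) / 2)%:C.
  by rewrite -H; apply: CInt_eq => y; rewrite complexXY.
rewrite !Hh !Hv; apply: complexP; rewrite !ReImE /=; lra.
Qed.

Lemma continuous_affine (k l : C) (f : C -> C) : (forall z, ctn f z) ->
  forall z, ctn (fun z : C => f z + (k + l * z)) z.
Proof.
move=> cf z; apply: ctn_add; first exact: cf.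
by apply: ctn_add; [exact: ctn_cst|apply: ctn_mul; [exact: ctn_cst|exact: ctn_id]].
Qed.

(** Affine functions have zero boundary integral, so the first order expansion of [f] at a point may
    be subtracted. *)
Lemma bdry_lin (k l : C) (f : C -> C) a b c d : (forall z, ctn f z) ->
  bdry f a b c d = bdry (fun z => f z + (k + l * z)) a b c d.
Proof.
have cl : forall z, ctn (fun z : C => l * z) z.
  by move=> z; apply: ctn_mul; [exact: ctn_cst|exact: ctn_id].
have ckl : forall z, ctn (fun z : C => k + l * z) z.
  by move=> z; apply: ctn_add; [exact: ctn_cst|exact: cl].
have ck : forall z, ctn (fun _ : C => k) z by move=> z; exact: ctn_cst.
move=> cf; rewrite (@bdryD f (fun z => k + l * z) _ _ _ _ cf ckl).
rewrite (@bdryD (fun=> k) (fun z => l * z) _ _ _ _ ck cl).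
by rewrite bdry_cst (@bdryZ id _ _ _ _ _ continuous_idC) bdry_id mulr0 !addr0.
Qed.

Lemma bdry_nrm (f : C -> C) (M a b c d : R) : a <= b -> c <= d ->
  (forall z, ctn f z) ->
  (forall x y, a <= x <= b -> c <= y <= d -> nrm (f (x +i* y)) <= M) ->
  nrm (bdry f a b c d) <= M * (2 * (b - a) + 2 * (d - c)).
Proof.
move=> ab cd cf H.
have h1 : nrm (CInt (fun x => f (x +i* c)) a b) <= M * (b - a).
  apply: CInt_nrm => //; first exact: cont_hor.
  by move=> x xab; apply: H; rewrite // lexx.
have h2 : nrm (CInt (fun x => f (x +i* d)) a b) <= M * (b - a).
  apply: CInt_nrm => //; first exact: cont_hor.
  by move=> x xab; apply: H; rewrite // lexx cd.
have h3 : nrm (CInt (fun y => f (b +i* y)) c d) <= M * (d - c).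
  apply: CInt_nrm => //; first exact: cont_ver.
  by move=> x xab; apply: H; rewrite // lexx ab.
have h4 : nrm (CInt (fun y => f (a +i* y)) c d) <= M * (d - c).
  apply: CInt_nrm => //; first exact: cont_ver.
  by move=> x xab; apply: H; rewrite // lexx ab.
rewrite /bdry; apply: le_trans (nrmB _ _) _; rewrite nrmM nrm_i mul1r.
apply: le_trans (lerD (nrmB _ _) (lexx _)) _.
apply: le_trans (lerD (lerD (nrmD _ _) (lexx _)) (lexx _)) _.
rewrite nrmM nrm_i mul1r; lra.
Qed.

Lemma bdry_quarter (f : C -> C) a b c d x y :
  bdry f a b c d = bdry f a x c y + bdry f x b c y + bdry f a x y d
    + bdry f x b y d.
Proof.
rewrite /bdry -(CInt_cat (fun x => f (x +i* c)) a x b)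
  -(CInt_cat (fun x => f (x +i* d)) a x b)
  -(CInt_cat (fun y => f (a +i* y)) c y d)
  -(CInt_cat (fun y => f (b +i* y)) c y d).
ring.
Qed.

Section Bisection.
Variables (a0 c0 w h : R).
Hypotheses (w0 : 0 < w) (h0 : 0 < h).

Let Q (p : R * R) (s : R) := bdry g p.1 (p.1 + w * s) p.2 (p.2 + h * s).
Let s (k : nat) : R := 2^-1 ^+ k.

Let s_gt0 k : 0 < s k.
Proof. by rewrite exprn_gt0 // invr_gt0. Qed.

Let sS k : s k.+1 = s k / 2.
Proof. by rewrite /s exprSr. Qed.

Let child (k : nat) (p p' : R * R) : Prop :=
  (p'.1 = p.1 \/ p'.1 = p.1 + w * s k.+1) /\
  (p'.2 = p.2 \/ p'.2 = p.2 + h * s k.+1).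

Let bad (e : R) k p := e * s k ^+ 2 < nrm (Q p (s k)).

(** The boundary integral is the sum over the four quarters and s(k)^2 = 4 s(k+1)^2, so at least one
    quarter inherits the excess. *)
Let bad_child e k p : bad e k p -> exists p', child k p p' /\ bad e k.+1 p'.
Proof.
move=> bp; apply: contrapT => Hn.
have nb p' : child k p p' -> nrm (Q p' (s k.+1)) <= e * s k.+1 ^+ 2.
  by move=> cp; rewrite leNgt; apply/negP => b; apply: Hn; exists p'.
have e1 : p.1 + w * s k.+1 + w * s k.+1 = p.1 + w * s k by rewrite sS; lra.
have e2 : p.2 + h * s k.+1 + h * s k.+1 = p.2 + h * s k by rewrite sS; lra.
have := nb (p.1, p.2); have := nb (p.1 + w * s k.+1, p.2).
have := nb (p.1, p.2 + h * s k.+1); have := nb (p.1 + w * s k.+1, p.2 + h * s k.+1).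
rewrite /Q /child /= e1 e2.
move=> /(_ (conj (or_intror erefl) (or_intror erefl))) q4.
move=> /(_ (conj (or_introl erefl) (or_intror erefl))) q3.
move=> /(_ (conj (or_intror erefl) (or_introl erefl))) q2.
move=> /(_ (conj (or_introl erefl) (or_introl erefl))) q1.
move: bp; rewrite /bad ltNge => /negP; apply.
rewrite /Q (bdry_quarter _ _ _ _ _ (p.1 + w * s k.+1) (p.2 + h * s k.+1)).
apply: le_trans (nrmD _ _) _.
apply: le_trans (lerD (nrmD _ _) (lexx _)) _.
apply: le_trans (lerD (lerD (nrmD _ _) (lexx _)) (lexx _)) _.
have -> : e * s k ^+ 2 = 4 * (e * s k.+1 ^+ 2) by rewrite sS; field.
lra.
Qed.

Let nested (u : nat -> R) (l : R) : (forall k, u k.+1 = u k \/ u k.+1 = u k + l * s k.+1) ->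
  0 < l -> exists A, forall k, u k <= A <= u k + l * s k.
Proof.
move=> H l0.
have i1 k : u k <= u k.+1.
  by case: (H k) => ->; rewrite // lerDl mulr_ge0 // ltW.
have i2 k : u k.+1 + l * s k.+1 <= u k + l * s k.
  have := mulr_gt0 l0 (s_gt0 k).
  by rewrite sS; case: (H k) => ->; rewrite ?sS; lra.
have j1 k m : (k <= m)%N -> u k <= u m.
  move=> /subnK <-; elim: (m - k)%N => [//|j IH]; rewrite addSn.
  exact: le_trans IH (i1 _).
have j2 k m : (k <= m)%N -> u m + l * s m <= u k + l * s k.
  move=> /subnK <-; elim: (m - k)%N => [//|j IH]; rewrite addSn.
  exact: le_trans (i2 _) IH.
have ub k m : u m <= u k + l * s k.
  have p m' : 0 <= l * s m' by rewrite mulr_ge0 // ltW.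
  case: (leqP k m) => [km|/ltnW mk].
    by apply: le_trans (j2 _ _ km); rewrite lerDl.
  by apply: le_trans (j1 _ _ mk) _; rewrite lerDl.
exists (sup (range u)) => k; apply/andP; split.
  apply: ub_le_sup; last by exists k.
  by exists (u 0%N + l * s 0%N) => _ [m _ <-].
by apply: ge_sup; [exists (u 0%N); exists 0%N|move=> _ [m _ <-]].
Qed.

(** Differentiability is asked relative to the closed rectangle only: the function of [mean_value],
    built with [clampRe], is not complex differentiable across the right side. *)
Lemma goursat_rect :
  (forall x y, a0 <= x <= a0 + w -> c0 <= y <= c0 + h ->
     exists m : C, forall e : R, 0 < e -> exists2 r : R, 0 < r &
       forall x' y', a0 <= x' <= a0 + w -> c0 <= y' <= c0 + h ->
         nrm ((x' +i* y') - (x +i* y)) < r ->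
         nrm (g (x' +i* y') - g (x +i* y) - m * ((x' +i* y') - (x +i* y)))
           <= e * nrm ((x' +i* y') - (x +i* y))) ->
  bdry g a0 (a0 + w) c0 (c0 + h) = 0.
Proof.
move=> Hd; apply/eqP; rewrite -nrm_eq0; apply/negPn/negP => n0.
have npos : 0 < nrm (bdry g a0 (a0 + w) c0 (c0 + h)) by rewrite lt_def n0 nrm_ge0.
pose e := nrm (bdry g a0 (a0 + w) c0 (c0 + h)) / 2.
have e0 : 0 < e by rewrite divr_gt0.
have bad0 : bad e 0 (a0, c0) by rewrite /bad /Q /s expr0 !mulr1 expr1n mulr1 /e; lra.
(* Along the sequence a bad child always exists by [bad_child], so the default of [xget] is never
   taken. *)
pose nxt k p := xget p [set p' | child k p p' /\ bad e k.+1 p'].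
pose p := fix p k := if k is k'.+1 then nxt k' (p k') else (a0, c0).
have pbad k : bad e k (p k).
  elim: k => [//|k IH] /=; rewrite /nxt; have [p' Hp'] := bad_child IH.
  by case: xgetP => [q _ [] //|/(_ p')]; case.
have pch k : child k (p k) (p k.+1).
  rewrite /= /nxt; have [p' Hp'] := bad_child (pbad k).
  by case: xgetP => [q _ [] //|/(_ p')]; case.
have [A HA] := @nested (fun k => (p k).1) w (fun k => (pch k).1) w0.
have [B HB] := @nested (fun k => (p k).2) h (fun k => (pch k).2) h0.
have sub1 k x : (p k).1 <= x <= (p k).1 + w * s k -> a0 <= x <= a0 + w.
  elim: k x => [|k IH] x; first by rewrite /= /s expr0 mulr1.
  move=> Hx; apply: IH; move: Hx; have := mulr_gt0 w0 (s_gt0 k).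
  by case: (pch k) => [[]] -> _; rewrite sS; lra.
have sub2 k x : (p k).2 <= x <= (p k).2 + h * s k -> c0 <= x <= c0 + h.
  elim: k x => [|k IH] x; first by rewrite /= /s expr0 mulr1.
  move=> Hx; apply: IH; move: Hx; have := mulr_gt0 h0 (s_gt0 k).
  by case: (pch k) => [_ []] ->; rewrite sS; lra.
have [m Hm] := Hd _ _ (sub1 _ _ (HA 0%N)) (sub2 _ _ (HB 0%N)).
have wh : 0 < w + h by rewrite addr_gt0.
(* At scale s the remainder is at most this constant times (w + h) s, and the perimeter is 2 (w + h)
   s; the product is e s^2, which contradicts badness. *)
have [|r r0 Hr] := Hm (e / (2 * (w + h) ^+ 2)).
  by rewrite divr_gt0 // mulr_gt0 // exprn_gt0.
have [k Hk] : exists k, (w + h) * s k < r.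
  have : s @ \oo --> (0 : R) by apply: cvg_expr; rewrite ger0_norm ?invr_ge0 //
    invf_lt1 // ltr1n.
  move=> /cvgrPdist_lt/(_ (r / (w + h))); rewrite divr_gt0 // => /(_ isT).
  move=> [k _ /(_ k (leqnn k))]; rewrite sub0r normrN ger0_norm ?ltW //.
  by rewrite ltr_pdivlMr // mulrC => ?; exists k.
have := pbad k; rewrite /bad ltNge => /negP; apply.
set z := A +i* B; rewrite /Q (@bdry_lin (m * z - g z) (- m)) //.
have key x y : (p k).1 <= x <= (p k).1 + w * s k ->
   (p k).2 <= y <= (p k).2 + h * s k -> nrm ((x +i* y) - z) <= (w + h) * s k.
  move=> Hx Hy; apply: le_trans (nrm_le_ReIm _) _; rewrite !ReImE /=.
  have := HA k; have := HB k => HBk HAk.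
  rewrite mulrDl; apply: lerD; rewrite ler_norml; lra.
have cl : forall x, ctn (fun z' : C => g z' + (m * z - g z + - m * z')) x.
  exact: continuous_affine.
have wsk : 0 < w * s k by rewrite mulr_gt0.
have hsk : 0 < h * s k by rewrite mulr_gt0.
apply: le_trans (@bdry_nrm _ (e / (2 * (w + h) ^+ 2) * ((w + h) * s k)) _ _ _ _ _ _ cl _) _.
- by rewrite lerDl ltW.
- by rewrite lerDl ltW.
- move=> x y Hx Hy.
  have -> : g (x +i* y) + (m * z - g z + - m * (x +i* y)) =
    g (x +i* y) - g z - m * ((x +i* y) - z) by ring.
  have kxy := key _ _ Hx Hy.
  apply: le_trans (Hr _ _ (sub1 _ _ Hx) (sub2 _ _ Hy) (le_lt_trans kxy Hk)) _.
  by rewrite ler_wpM2l // ltW // divr_gt0 // mulr_gt0 // exprn_gt0.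
- rewrite (_ : _ * _ = e * s k ^+ 2) //; field.
  by rewrite gt_eqF.
Qed.

End Bisection.
End Goursat.

(** * The exponential function and the mean value property *)

Section MeanValue.
Variable R : realType.
Local Notation C := R[i].
Local Notation nrm := (@nrm R _).

Definition cis (t : R) : C := cos t +i* sin t.

Lemma nrm_cis t : nrm (cis t) = 1.
Proof.
apply/eqP; rewrite -(@eqrXn2 _ 2) ?nrm_ge0 // nrm_sqr /= cos2Dsin2 expr1n.
by [].
Qed.

Lemma cisD s t : cis (s + t) = cis s * cis t.
Proof. by apply: complexP; rewrite !ReImE /= ?cosD ?sinD //; ring. Qed.

Lemma cis0 : cis 0 = 1.
Proof. by rewrite /cis cos0 sin0. Qed.

Lemma cis2pi : cis (2 * pi) = 1.
Proof. by rewrite /cis mulr_natl cos2pi sin2pi. Qed.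

Definition Ex (z : C) : C := (expR (complex.Re z))%:C * cis (complex.Im z).

Lemma ExD z w : Ex (z + w) = Ex z * Ex w.
Proof. by rewrite /Ex !ReImE expRD cisD rmorphM /=; ring. Qed.

Lemma nrm_Ex z : nrm (Ex z) = expR (complex.Re z).
Proof. by rewrite /Ex nrmM nrmR nrm_cis mulr1 ger0_norm // expR_ge0. Qed.

Lemma cder_Ex z : hder setT Ex z 1 (Ex z).
Proof.
suff H0 e : 0 < e -> exists2 r : R, 0 < r &
    forall h : C, nrm h < r -> nrm (Ex h - 1 - h) <= e * nrm h.
  move=> e e0; have n1 : 0 < 1 + nrm (Ex z) by rewrite ltr_pwDl ?nrm_ge0.
  have [|r r0 Hr] := H0 (e / (1 + nrm (Ex z))); first by rewrite divr_gt0.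
  exists r => // h _ /Hr; rewrite ![_ *: _]/GRing.scale /= mulr1 ExD => {}Hr.
  have -> : Ex z * Ex h - Ex z - h * Ex z = Ex z * (Ex h - 1 - h) by ring.
  rewrite nrmM; apply: le_trans (ler_wpM2l (nrm_ge0 _) Hr) _.
  rewrite mulrA ler_wpM2r ?nrm_ge0 // mulrCA ler_piMr ?ltW //.
  by rewrite ltr_pdivrMr // mul1r ltrDr.
move=> e0.
(* The errors below add up to 9 eta |h|; eta <= 1 also gives exp a <= 3. *)
have [eta [eta0 eta1 eta2]] : exists eta : R, [/\ 0 < eta, eta <= 1 & 12 * eta <= e].
  exists (Num.min 1 (e / 12)); split; first by rewrite lt_min ltr01 divr_gt0.
    by rewrite ge_min lexx.
  by rewrite mulrC -ler_pdivlMr // ge_min lexx orbT.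
have isd (F : R -> R) d : is_derive (0 : R) (1 : R) F d ->
   derivable F 0 1 /\ derive1 F 0 = d.
  by move=> H; split; [case: H|rewrite derive1E; apply: derive_val].
have /real_derP/(_ _ eta0)[r1 r10 H1] := isd _ _ (is_derive_expR 0).
have /real_derP/(_ _ eta0)[r2 r20 H2] := isd _ _ (is_derive_cos 0).
have /real_derP/(_ _ eta0)[r3 r30 H3] := isd _ _ (is_derive_sin 0).
exists (Num.min (Num.min r1 r2) (Num.min r3 eta)).
  by rewrite !lt_min r10 r20 r30 eta0.
move=> h; rewrite !lt_min => /andP[/andP[hr1 hr2] /andP[hr3 hr4]].
have := Re_le_nrm h; have := Im_le_nrm h.
set a := complex.Re h; set b := complex.Im h; set n := nrm h in hr1 hr2 hr3 hr4 *.
move=> bn an.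
have := H1 a (le_lt_trans an hr1); have := H2 b (le_lt_trans bn hr2).
have := H3 b (le_lt_trans bn hr3).
rewrite !add0r expR0 cos0 sin0 oppr0 mulr0 !subr0 !mulr1 => {}H3 {}H2 {}H1.
apply: le_trans (nrm_le_ReIm _) _.
have -> : complex.Re (Ex h - 1 - h) = expR a * cos b - 1 - a.
  by rewrite /Ex !ReImE /= mul0r subr0.
have -> : complex.Im (Ex h - 1 - h) = expR a * sin b - b.
  by rewrite /Ex !ReImE /= mul0r addr0 oppr0 addr0.
rewrite addr0 in H3.
set A := expR a in H1 *; set c := cos b in H2 *; set s := sin b in H3 *.
have n0 : 0 <= n by apply: nrm_ge0.
have en : eta * `|a| <= eta * n by rewrite ler_wpM2l // ltW.
have em : eta * `|b| <= eta * n by rewrite ler_wpM2l // ltW.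
have A1 : `|A| <= 3.
  have -> : A = (A - 1 - a) + 1 + a by ring.
  apply: le_trans (ler_normD _ _) _; apply: le_trans (lerD (ler_normD _ _) (lexx _)) _.
  have : eta * n <= 1 by rewrite -[1]mulr1; apply: ler_pM => //; [exact: ltW|lra].
  rewrite normr1; lra.
have A2 : `|A - 1| <= 2 * n.
  have -> : A - 1 = (A - 1 - a) + a by ring.
  apply: le_trans (ler_normD _ _) _.
  have : eta * n <= 1 * n by rewrite ler_wpM2r.
  lra.
have -> : A * c - 1 - a = A * (c - 1) + (A - 1 - a) by ring.
have -> : A * s - b = A * (s - b) + (A - 1) * b by ring.
have k1 : `|A * (c - 1)| <= 3 * (eta * n).
  by rewrite normrM; apply: ler_pM => //; lra.
have k2 : `|A * (s - b)| <= 3 * (eta * n).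
  by rewrite normrM; apply: ler_pM => //; lra.
have k3 : `|(A - 1) * b| <= 2 * (eta * n).
  rewrite normrM; apply: (@le_trans _ _ ((2 * n) * n)); first exact: ler_pM.
  by rewrite mulrA ler_wpM2r // ler_wpM2l // ltW.
apply: le_trans (lerD (ler_normD _ _) (ler_normD _ _)) _.
have : 12 * eta * n <= e * n by rewrite ler_wpM2r.
have : 0 <= eta * n by rewrite mulr_ge0 // ltW.
lra.
Qed.

Lemma ctn_Ex z : ctn Ex z.
Proof. exact: cder_ctn (cder_Ex z). Qed.

Definition clampRe (X : R) (z : C) : C := (Num.min (complex.Re z) X) +i* complex.Im z.

Lemma min_lip (p q X : R) : `|Num.min p X - Num.min q X| <= `|p - q|.
Proof.
rewrite /Num.min; case: (ltP p X); case: (ltP q X) => qX pX;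
  case: (ger0P (p - q)) => pq; rewrite ?ler_norml; lra.
Qed.

Lemma ctn_clampRe X z : ctn (clampRe X) z.
Proof.
move=> e e0; exists (e / 2); first by rewrite divr_gt0.
move=> y yz; apply: le_lt_trans (nrm_le_ReIm _) _; rewrite !ReImE /=.
have h1 := le_lt_trans (Re_le_nrm (y - z)) yz.
have h2 := le_lt_trans (Im_le_nrm (y - z)) yz.
rewrite !ReImE in h1 h2.
have : `|Num.min (complex.Re y) X - Num.min (complex.Re z) X| <=
   `|complex.Re y - complex.Re z|.
  exact: min_lip.
lra.
Qed.

(* The substitution z = z0 + exp(x + i y) turns the circle means into integrals
   over vertical segments, which Goursat's lemma shows to be independent of x;
   then x tends to -oo. [clampRe] makes the integrand continuous on all of C. *)
Lemma mean_value (f : C -> C) (z0 : C) (r0 r : R) : 0 < r -> r < r0 ->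
  (forall z, nrm (z - z0) < r0 -> ctn f z) ->
  (forall z, z != z0 -> nrm (z - z0) < r0 -> exists d, hder setT f z 1 d) ->
  CInt (fun t => f (z0 + r%:C * cis t)) 0 (2 * pi) = (2 * pi)%:C * f z0.
Proof.
move=> r_gt0 rr0 cf df; pose X := ln r.
have eX : expR X = r by rewrite lnK // posrE.
pose G z := f (z0 + Ex (clampRe X z)).
have nG z : nrm (Ex (clampRe X z)) < r0.
  rewrite nrm_Ex /=; apply: le_lt_trans rr0; rewrite -eX ler_expR.
  by rewrite ge_min lexx orbT.
have cG z : ctn G z.
  apply: (@ctn_comp _ _ _ _ (fun z => z0 + Ex (clampRe X z)) f).
    apply: ctn_add; first exact: ctn_cst.
    by apply: (@ctn_comp _ _ _ _ (clampRe X) Ex); [exact: ctn_clampRe|exact: ctn_Ex].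
  by apply: cf; rewrite addrAC subrr add0r.
have pi2 : 0 < 2 * pi :> R by rewrite mulr_gt0 // pi_gt0.
pose M x := CInt (fun y => G (x +i* y)) 0 (2 * pi).
have MX x1 : x1 < X -> M x1 = M X.
  move=> x1X; have w0 : 0 < X - x1 by rewrite subr_gt0.
  have := @goursat_rect R G cG x1 0 (X - x1) (2 * pi) w0 pi2.
  rewrite add0r [x1 + _]addrC subrK => H.
  suff : bdry G x1 X 0 (2 * pi) = 0.
    rewrite /bdry.
    (* The two horizontal sides cancel because [Ex] has period 2 pi i. *)
    have -> : CInt (fun x => G (x +i* (2 * pi))) x1 X = CInt (fun x => G (x +i* 0)) x1 X.
      by apply: CInt_eq => x; rewrite /G /Ex /= cis2pi cis0.
    rewrite -/(M X) -/(M x1) => HH.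
    have : 'i%C * (M X - M x1) = 0 by rewrite -HH; ring.
    move=> /eqP; rewrite mulf_eq0 subr_eq0 => /orP[/eqP i0|/eqP -> //].
    by have := nrm_i R; rewrite i0 nrm0 => /eqP; rewrite eq_sym oner_eq0.
  apply: H => x y /andP[_ xX] _.
  have e0 : z0 + Ex (x +i* y) != z0.
    rewrite -subr_eq0 addrAC subrr add0r -nrm_gt0 nrm_Ex expR_gt0 //.
  have [|d Hd] := df _ e0.
    by rewrite addrAC subrr add0r; have := nG (x +i* y); rewrite /clampRe /= min_l.
  have H1 := @hder_comp _ setT C C (fun z => z0 + Ex z) f (x +i* y) 1 _ _ Hd
    (hder_add (hder_cst setT z0 (x +i* y : C) 1) (cder_Ex (x +i* y))).
  exists ((0 + Ex (x +i* y)) *: d) => e /H1[p p0 Hp]; exists p => // x' y' /andP[_ x'X] _ Hn.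
  have := Hp (x' +i* y' - x +i* y) I Hn.
  rewrite /G /clampRe /= !min_l //.
  have -> : (x +i* y : C) + (x' +i* y' - x +i* y) *: 1 = x' +i* y'.
    by rewrite [_ *: 1]/GRing.scale /= mulr1 addrC subrK.
  by rewrite [_ *: (_ *: _)]/GRing.scale /= [_ * (_ *: _)]mulrC.
have -> : CInt (fun t => f (z0 + r%:C * cis t)) 0 (2 * pi) = M X.
  by apply: CInt_eq => t; rewrite /G /clampRe /Ex /= minxx eX.
apply/eqP; rewrite -subr_eq0 -nrm_eq0; apply/negPn/negP => n0.
have npos : 0 < nrm (M X - (2 * pi)%:C * f z0) by rewrite lt_def n0 nrm_ge0.
set N := nrm _ in npos.
(* Over a segment of length 2 pi this oscillation bound yields N / 2, short of the assumed N. *)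
have N4 : 0 < N / (4 * pi) by rewrite divr_gt0 // mulr_gt0 // pi_gt0.
have z0r : nrm (z0 - z0) < r0 by rewrite subrr nrm0 (lt_trans r_gt0).
have [d d0 Hd] := cf z0 z0r _ N4.
pose x1 := Num.min (X - 1) (ln (d / 2)).
have d20 : 0 < d / 2 by rewrite divr_gt0.
have x1X : x1 < X by rewrite gt_min; apply/orP; left; lra.
have ex1 : expR x1 < d.
  apply: le_lt_trans (_ : d / 2 < _); last by lra.
  by rewrite -[leRHS]lnK ?posrE // ler_expR ge_min lexx orbT.
have cM : ctnR (fun y => G (x1 +i* y)) by apply: cont_ver.
have : N <= N / (4 * pi) * (2 * pi - 0).
  rewrite {1}/N -(MX _ x1X).
  have -> : M x1 - (2 * pi)%:C * f z0 =
     CInt (fun y => G (x1 +i* y) + - f z0) 0 (2 * pi).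
    rewrite CIntD //; last exact: continuous_cstRC.
    by rewrite CInt_cst subr0 mulrC mulNr.
  apply: CInt_nrm; [exact: ltW| |].
    by apply: continuousCD => //; exact: continuous_cstRC.
  move=> y _; apply/ltW/Hd.
  by rewrite addrAC subrr add0r nrm_Ex /= min_l // ltW.
rewrite subr0 (_ : _ * (2 * pi) = N / 2); first by lra.
by move: (pi_gt0 R); move: (@pi R) => P P0; field; rewrite gt_eqF.
Qed.

End MeanValue.

(** * The maximum principle *)

Section MaximumModulus.
Variable R : realType.
Local Notation C := R[i].
Local Notation nrm := (@nrm R _).

Lemma ctn_nrm (V W : normedModType C) (f : V -> W) z : ctn f z ->
  ctn (fun y => (nrm (f y))%:C : C) z.
Proof.
move=> cf e /cf[d d0 Hd]; exists d => // y /Hd; apply: le_lt_trans.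
rewrite -rmorphB nrmR ler_norml nrm_sub andbT.
by have := nrm_sub (f z) (f y); rewrite [nrm (f z - _)]nrm_distC; lra.
Qed.

Lemma ctnR_circle (f : C -> C) (c : C) (r : R) :
  (forall t, ctn f (c + r%:C * cis t)) -> ctnR (fun t => f (c + r%:C * cis t)).
Proof.
move=> cf t e e0; have [d d0 Hd] := cf t e e0.
have n1 : 0 < 1 + `|r| by rewrite ltr_pwDl.
have d2 : 0 < d / 2 / (1 + `|r|) by rewrite !divr_gt0.
have cc : {for t, continuous (@cos R)} by exact: continuous_cos.
have cs : {for t, continuous (@sin R)} by exact: continuous_sin.
have [p p0 Hp] := (continuousRR _ _).1 cc _ d2.
have [q q0 Hq] := (continuousRR _ _).1 cs _ d2.
exists (Num.min p q); first by rewrite lt_min p0.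
move=> y; rewrite lt_min => /andP[/Hp h1 /Hq h2]; apply: Hd.
rewrite opprD addrACA subrr add0r -mulrBr nrmM nrmR.
have h3 : nrm (cis y - cis t) < d / (1 + `|r|).
  apply: le_lt_trans (nrm_le_ReIm _) _; rewrite !ReImE /=; lra.
move: h3; rewrite ltr_pdivlMr // mulrC; apply: le_lt_trans.
by rewrite ler_wpM2r ?nrm_ge0 // lerDr.
Qed.

Lemma re_mean_le (f : C -> C) (c : C) (r0 r K : R) : 0 < r -> r < r0 ->
  (forall z, nrm (z - c) < r0 -> ctn f z) ->
  (forall z, z != c -> nrm (z - c) < r0 -> exists d, hder setT f z 1 d) ->
  (forall t, complex.Re (f (c + r%:C * cis t)) <= K) -> complex.Re (f c) <= K.
Proof.
move=> r0_ rr cf df fK; have := mean_value r0_ rr cf df.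
move=> /(congr1 (@complex.Re R)); rewrite ReM /= mul0r subr0 => H.
have pi2 : 0 < 2 * pi :> R by rewrite mulr_gt0 // pi_gt0.
have cF : ctnR (fun t => f (c + r%:C * cis t)).
  apply: ctnR_circle => t; apply: cf.
  by rewrite addrAC subrr add0r nrmM nrm_cis mulr1 nrmR gtr0_norm.
rewrite -(ler_pM2l pi2) -H [leRHS]mulrC -[X in _ <= _ * X]subr0 -Int_cst.
apply: Int_le => //; first exact: ltW.
- exact: ctsRe cF.
- by move=> x; exact: cvg_cst.
Qed.

Lemma disc_compact (c : C) (r : R) : compact [set z : C | nrm (z - c) <= r].
Proof.
pose box : set 'rV[R]_2 := [set v | forall i, `[- r, r]%classic (v ord0 i)].
have cb : compact box by apply: (@rV_compact _ _ (fun=> `[- r, r]%classic)) => i; exact: segment_compact.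
pose F (v : 'rV[R]_2) : C := c + (v ord0 ord0 +i* v ord0 ord_max).
have cF : continuous F.
  move=> v A /nbhs_nrm[e e0 HA].
  have e2 : 0 < e / 2 by rewrite divr_gt0.
  have c1 : nbhs v [set w : 'rV[R]_2 | `|w ord0 ord0 - v ord0 ord0| < e / 2].
    apply: (@coord_continuous R^o 1 2 ord0 ord0 v [set y | `|y - v ord0 ord0| < e / 2]).
    by apply/nbhs_normP; exists (e / 2) => //= y; rewrite /ball_ /= distrC.
  have c2 : nbhs v [set w : 'rV[R]_2 | `|w ord0 ord_max - v ord0 ord_max| < e / 2].
    apply: (@coord_continuous R^o 1 2 ord0 ord_max v [set y | `|y - v ord0 ord_max| < e / 2]).
    by apply/nbhs_normP; exists (e / 2) => //= y; rewrite /ball_ /= distrC.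
  have FF : Filter (nbhs v) by exact: (@nbhs_filter ('rV[R]_2) v).
  apply: (@filterS _ _ FF _ _ _ (@filterI _ _ FF _ _ c1 c2)) => w [/= h1 h2].
  apply: HA; rewrite /F opprD addrACA subrr add0r.
  by apply: le_lt_trans (nrm_le_ReIm _) _; rewrite !ReImE /=; lra.
have cI : compact (F @` box).
  by apply: continuous_compact => //; exact: continuous_subspaceT.
apply: subclosed_compact cI _.
  rewrite -openC; apply/open_nrm => z /= /negP; rewrite -ltNge => zr.
  exists (nrm (z - c) - r); first by rewrite subr_gt0.
  move=> y yz; apply/negP; rewrite -ltNge.
  have := nrm_trans y z c; rewrite [nrm (z - y)]nrm_distC; lra.
move=> z /= zr; exists (\row_i (if i == ord0 then complex.Re (z - c) else complex.Im (z - c))).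
  move=> i /=; rewrite mxE in_itv /= -ler_norml.
  by case: ifP => _; apply: le_trans zr; [exact: Re_le_nrm|exact: Im_le_nrm].
rewrite /F !mxE /=; apply: complexP; rewrite !ReImE /=; lra.
Qed.

(** Adding dl |z - z0|^2 makes the mean value inequality strict, so that the maximum cannot lie at
    an interior point c; dl makes the addition at most e on the disc. Interior points have only
    punctured discs of differentiability, as difference quotients do. *)
Lemma max_mod (f : C -> C) (z0 : C) (r0 M : R) : 0 < r0 ->
  (forall z, nrm (z - z0) <= r0 -> ctn f z) ->
  (forall z, nrm (z - z0) < r0 -> exists2 p : R, 0 < p &
     forall z', z' != z -> nrm (z' - z) < p -> exists d, hder setT f z' 1 d) ->
  (forall z, nrm (z - z0) = r0 -> nrm (f z) <= M) ->
  forall z, nrm (z - z0) <= r0 -> nrm (f z) <= M.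
Proof.
move=> r00 cf df fM z zr; apply/ler_addgt0Pr => e e0.
pose dl := e / r0 ^+ 2.
have dl0 : 0 < dl by rewrite divr_gt0 // exprn_gt0.
pose v x := nrm (f x) + dl * nrm (x - z0) ^+ 2.
pose A := [set z : C | nrm (z - z0) <= r0].
have cv : {within A, continuous v}.
  apply: continuous_in_subspaceT => x; rewrite inE => Ax.
  have c1 := ctn_nrm (cf x Ax).
  have c2 : ctn (fun y => y - z0) x by apply: ctn_add; [exact: ctn_id|exact: ctn_cst].
  have c3 := ctn_add c1 (ctn_mul (ctn_cst (dl%:C : C) x)
    (ctn_mul (ctn_nrm c2) (ctn_nrm c2))).
  apply: continuous_nrmR => q /c3[d d0 Hd]; exists d => // y /Hd.
  by apply: le_lt_trans; apply: le_trans (Re_le_nrm _); rewrite !ReImE /= !mul0r !subr0 /v !expr2.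
have [||c cA cmax] := @compact_EVT_max _ R v A _ _ cv.
- by exists z.
- exact: disc_compact.
rewrite inE in cA.
have vb : v c <= M + e.
  have [cr|] := eqVneq (nrm (c - z0)) r0.
    rewrite /v cr /dl divfK ?gt_eqF ?exprn_gt0 // lerD2r; exact: fM.
  move=> cr; exfalso.
  have {cr} cr : nrm (c - z0) < r0 by rewrite lt_neqAle cr.
  have [p p0 Hp] := df _ cr.
  pose q := Num.min p (r0 - nrm (c - z0)).
  have q0 : 0 < q by rewrite lt_min p0 subr_gt0.
  have qD x : nrm (x - c) < q -> nrm (x - z0) < r0.
    rewrite lt_min => /andP[_ h]; have := nrm_trans c x z0; lra.
  (* A phase with u f(c) = |f(c)|; it is 0 when f(c) = 0. *)
  pose u : C := (nrm (f c))%:C / f c.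
  have u1 : nrm u <= 1.
    have [f0|f0] := eqVneq (f c) 0; first by rewrite /u f0 nrm0 mul0r nrm0.
    by rewrite nrmM nrmV nrmR ger0_norm ?nrm_ge0 // divff // nrm_eq0.
  have uf : u * f c = (nrm (f c))%:C.
    have [f0|f0] := eqVneq (f c) 0; first by rewrite /u f0 nrm0 mulr0.
    by rewrite divfK.
  (* Re (k w) is the cross term of dl |c + w - z0|^2. With k (x - c) added to u f, maximality of [v]
     at c becomes a bound on a real part, to which the mean value property applies. *)
  pose k : C := 2 * dl%:C * (conjc (c - z0)).
  pose g x := u * f x + k * (x - c).
  pose s := q / 2.
  have s0 : 0 < s by rewrite divr_gt0.
  have sq : s < q by rewrite /s; lra.
  suff : complex.Re (g c) <= nrm (f c) - dl * s ^+ 2.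
    rewrite /g subrr mulr0 addr0 uf /=.
    have : 0 < dl * s ^+ 2 by rewrite mulr_gt0 // exprn_gt0.
    lra.
  apply: (re_mean_le s0 sq).
  - move=> x xq; apply: ctn_add.
      by apply: ctn_mul; [exact: ctn_cst|apply: cf; apply: ltW; exact: qD].
    apply: ctn_mul; first exact: ctn_cst.
    by apply: ctn_add; [exact: ctn_id|exact: ctn_cst].
  - move=> x xc xq; have [|d Hd] := Hp x xc.
      by move: xq; rewrite lt_min => /andP[].
    exists ((0 * f x + u * d) + (0 * (x - c) + k * (1 + 0))).
    apply: hder_add; first by apply: hder_mul => //; exact: hder_cst.
    apply: hder_mul; first exact: hder_cst.
    by apply: hder_add; [exact: hder_id|exact: hder_cst].
  - move=> t; set w := s%:C * cis t.
    have nw : nrm w = s by rewrite nrmM nrm_cis mulr1 nrmR gtr0_norm.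
    have Aw : A (c + w).
      by apply/ltW/qD; rewrite addrAC subrr add0r nw.
    have := cmax (c + w); rewrite inE => /(_ Aw); rewrite /v => h1.
    have h2 : complex.Re (u * f (c + w)) <= nrm (f (c + w)).
      apply: le_trans (ler_norm _) _; apply: le_trans (Re_le_nrm _) _.
      by rewrite nrmM ler_piMl ?nrm_ge0.
    have h3 : dl * nrm (c + w - z0) ^+ 2 =
       dl * nrm (c - z0) ^+ 2 + complex.Re (k * w) + dl * s ^+ 2.
      rewrite -nw !nrm_sqr /k.
      have -> : (2 : C) = (2 : R)%:C by rewrite rmorph_nat.
      rewrite !ReImE; have -> : complex.Re (conjc (c - z0)) = complex.Re (c - z0) by case: (c - z0).
      have -> : complex.Im (conjc (c - z0)) = - complex.Im (c - z0) by case: (c - z0).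
      rewrite !ReImE; ring.
    rewrite /g ReD [c + w - c]addrAC subrr add0r; lra.
apply: le_trans vb; have := cmax z; rewrite inE => /(_ zr); apply: le_trans.
by rewrite /v lerDl mulr_ge0 ?exprn_ge0 ?nrm_ge0 // ltW.
Qed.

End MaximumModulus.

(** * Bounds for difference quotients *)

Section DifferenceQuotient.
Variable R : realType.
Local Notation C := R[i].
Local Notation nrm := (@nrm R _).
Variables (f f' : C -> C) (a : C) (r0 M : R).
Hypothesis df : forall z, nrm (z - a) < r0 -> hder setT f z 1 (f' z).
Hypothesis fM : forall z, nrm (z - a) < r0 -> nrm (f z) <= M.

Definition dquo (g g' : C -> C) (b z : C) : C :=
  if z == b then g' b else (g z - g b) / (z - b).

Lemma ctn_dquo_at (g g' : C -> C) b : hder setT g b 1 (g' b) ->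
  ctn (dquo g g' b) b.
Proof.
move=> H e e0; have [|r r0' Hr] := H (e / 2); first by rewrite divr_gt0.
exists r => // y yb; rewrite /dquo eqxx; case: eqVneq => [_|nyb].
  by rewrite subrr nrm0.
have yb0 : y - b != 0 by rewrite subr_eq0.
have := Hr (y - b) I yb.
have -> : b + (y - b) *: 1 = y by rewrite /GRing.scale /= mulr1 addrC subrK.
have -> : g y - g b - (y - b) *: g' b =
   (y - b) * ((g y - g b) / (y - b) - g' b) by rewrite /GRing.scale /=; field.
rewrite nrmM [e / 2 * _]mulrC ler_pM2l ?nrm_gt0 //; lra.
Qed.

Lemma cder_dquo (g g' : C -> C) b z d : z != b -> hder setT g z 1 d ->
  exists d', hder setT (dquo g g' b) z 1 d'.
Proof.
move=> zb H; have zb0 : z - b != 0 by rewrite subr_eq0.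
have H1 := hder_add H (hder_opp (hder_cst setT (g b) z 1)).
have H2 := hder_add (hder_id setT z (1 : C)) (hder_opp (hder_cst setT b z 1)).
have H3 := hder_mul H1 (@hder_inv _ _ _ (fun y => y - b) z 1 _ zb0 H2).
eexists; apply: hder_ext H3; apply/nbhs_nrm; exists (nrm (z - b)).
  by rewrite nrm_gt0.
move=> y yz; rewrite /dquo; case: eqVneq => // yb.
by move: yz; rewrite yb [nrm (b - z)]nrm_distC ltxx.
Qed.

Local Notation q := (dquo f f' a).

(** The bound is immediate on the circle |z - a| = p; the maximum principle carries it inside,
    across the point a where only continuity is known. *)
Lemma dquo_bound (p : R) z : 0 < p -> p < r0 -> nrm (z - a) <= p ->
  nrm (q z) <= 2 * M / p.
Proof.
move=> p0 pr za; move: z za; apply: max_mod => //.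
- move=> z zp; have zr := le_lt_trans zp pr.
  have [->|zb] := eqVneq z a.
    by apply: ctn_dquo_at; apply: df; rewrite subrr nrm0 (lt_trans p0).
  by have [d' /cder_ctn] := cder_dquo f' zb (df zr).
- move=> z zp.
  have [->|za] := eqVneq z a.
    exists p => // z' za' z'p; exact: cder_dquo za' (df (lt_trans z'p pr)).
  exists (Num.min (nrm (z - a)) (p - nrm (z - a))).
    by rewrite lt_min nrm_gt0 subr_eq0 za subr_gt0.
  move=> z' _; rewrite lt_min => /andP[h1 h2].
  have z'a : z' != a.
    by apply: contraTneq h1 => ->; rewrite nrm_distC ltxx.
  apply: (cder_dquo _ z'a (df _)).
  have := nrm_trans z z' a; lra.
- move=> z zp; have zr : nrm (z - a) < r0 by rewrite zp.
  have za : z != a by rewrite -subr_eq0 -nrm_gt0 zp.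
  rewrite /dquo (negbTE za) nrmM nrmV zp ler_pM2r ?invr_gt0 //.
  apply: le_trans (nrmB _ _) _; have := fM zr.
  by have := fM (z := a); rewrite subrr nrm0 (lt_trans p0 pr) => /(_ isT); lra.
Qed.

(** The maximum principle again, for the difference quotient of q at z: on |x - a| = p one has |x -
    z| >= p / 2 and |q(x) - q(z)| <= 4 M / p. This bound takes the place of Cauchy's formula, as it
    makes difference quotients converge uniformly. *)
Lemma dquo_lip (p : R) y z : 0 < p -> p < r0 ->
  nrm (y - a) <= p / 2 -> nrm (z - a) <= p / 2 ->
  nrm (q y - q z) <= 8 * M / p ^+ 2 * nrm (y - z).
Proof.
move=> p0 pr.
have main : forall y z, nrm (y - a) <= p / 2 -> nrm (z - a) <= p / 2 -> z != a ->
  nrm (q y - q z) <= 8 * M / p ^+ 2 * nrm (y - z).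
  move=> {}y {}z yp zp za.
  have [->|yz] := eqVneq y z; first by rewrite !subrr nrm0 mulr0.
  have [d Hd] : exists d, hder setT q z 1 d.
    apply: (cder_dquo _ za (df _)); lra.
  pose g := dquo q (fun=> d) z.
  suff : nrm (g y) <= 8 * M / p ^+ 2.
    rewrite /g /dquo (negbTE yz) -/(q y) -/(q z) nrmM nrmV ler_pdivrMr //.
    by rewrite nrm_gt0 subr_eq0.
  have cq x : nrm (x - a) <= p -> ctn q x.
    move=> xp; have xr := le_lt_trans xp pr.
    have [->|xa] := eqVneq x a.
      by apply: ctn_dquo_at; apply: df; rewrite subrr nrm0 (lt_trans p0).
    by have [d' /cder_ctn] := cder_dquo f' xa (df xr).
  have dq x : nrm (x - a) < p -> x != a -> exists d', hder setT q x 1 d'.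
    move=> xp xa; exact: cder_dquo xa (df (lt_trans xp pr)).
  have : nrm (y - a) <= p by lra.
  move: (y); apply: max_mod => //.
  - move=> x xp; have [->|xz] := eqVneq x z; first exact: ctn_dquo_at.
    have cx := cq _ xp.
    have : ctn (fun t => (q t - q z) / (t - z)) x.
      apply: ctn_mul; first by apply: ctn_add => //; exact: ctn_cst.
      apply: ctn_inv; first by rewrite subr_eq0.
      by apply: ctn_add; [exact: ctn_id|exact: ctn_cst].
    apply: ctn_ext; apply/nbhs_nrm; exists (nrm (x - z)).
      by rewrite nrm_gt0 subr_eq0.
    move=> t tx; rewrite /g [RHS]/dquo; case: eqVneq => // tz.
    by move: tx; rewrite tz [nrm (z - x)]nrm_distC ltxx.
  - move=> x xp.
    pose m1 := if x == a then 1 else nrm (x - a).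
    pose m2 := if x == z then 1 else nrm (x - z).
    have m10 : 0 < m1 by rewrite /m1; case: eqVneq => // xa; rewrite nrm_gt0 subr_eq0.
    have m20 : 0 < m2 by rewrite /m2; case: eqVneq => // xa; rewrite nrm_gt0 subr_eq0.
    exists (Num.min (Num.min m1 m2) (p - nrm (x - a))).
      by rewrite !lt_min m10 m20 subr_gt0.
    move=> t tx; rewrite !lt_min => /andP[/andP[t1 t2] t3].
    have ta : t != a.
      apply: contraTneq t1 => ta; rewrite /m1; case: eqVneq => [xa|_].
        by move: tx; rewrite ta xa eqxx.
      by rewrite ta nrm_distC ltxx.
    have tz : t != z.
      apply: contraTneq t2 => tz; rewrite /m2; case: eqVneq => [xa|_].
        by move: tx; rewrite tz xa eqxx.
      by rewrite tz nrm_distC ltxx.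
    have [|d' Hd'] := dq t _ ta; first by have := nrm_trans x t a; lra.
    exact: cder_dquo tz Hd'.
  - move=> x xp; have xz : p / 2 <= nrm (x - z).
      have := nrm_trans z x a; lra.
    have xz0 : 0 < nrm (x - z) by apply: lt_le_trans xz; rewrite divr_gt0.
    have nxz : x != z by rewrite -subr_eq0 -nrm_gt0.
    rewrite /g /dquo (negbTE nxz) -/(q x) -/(q z) nrmM nrmV ler_pdivrMr //.
    have b1 : nrm (q x) <= 2 * M / p by apply: dquo_bound => //; rewrite xp.
    have b2 : nrm (q z) <= 2 * M / p by apply: dquo_bound => //; lra.
    have M0 : 0 <= 2 * M / p by apply: le_trans b1; exact: nrm_ge0.
    apply: le_trans (nrmB _ _) _.
    apply: (@le_trans _ _ (8 * M / p ^+ 2 * (p / 2))).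
      have -> : 8 * M / p ^+ 2 * (p / 2) = 2 * (2 * M / p) by field; rewrite gt_eqF.
      lra.
    apply: ler_wpM2l => //.
    have -> : 8 * M / p ^+ 2 = 4 / p * (2 * M / p) by field; rewrite gt_eqF.
    by rewrite mulr_ge0 // divr_ge0 // ltW.
(* No derivative of q at a is at hand, so for z = a the roles of y and z are exchanged. *)
move=> yp zp; have [za|za] := eqVneq z a; last exact: main.
have [ya|ya] := eqVneq y a; first by rewrite za ya !subrr nrm0 mulr0.
rewrite nrm_distC [nrm (y - z)]nrm_distC; exact: main.
Qed.

End DifferenceQuotient.

(** * Holomorphic and smooth functions *)

Section Regularity.
Variable R : realType.
Local Notation C := R[i].
Local Notation nrm := (@nrm R _).

(** Every g s - K s lies below every g t + K t, so the supremum of the former is the limit at 0. *)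
Lemma lipschitz_limit (g : R -> R) (r K : R) : 0 < r -> 0 <= K ->
  (forall s t, 0 < s < r -> 0 < t < r -> `|g s - g t| <= K * `|s - t|) ->
  exists L, forall s, 0 < s < r -> `|g s - L| <= K * s.
Proof.
move=> r0 K0 H.
have H' s t : 0 < s < r -> 0 < t < r -> g s - K * s <= g t + K * t.
  move=> sr tr; have := H _ _ sr tr; rewrite ler_norml => /andP[_].
  have : `|s - t| <= s + t by rewrite ler_norml; lra.
  move=> /(ler_wpM2l K0); rewrite mulrDr; lra.
pose A := [set g s - K * s | s in [set s | 0 < s < r]].
have r2 : 0 < r / 2 < r by lra.
exists (sup A) => s sr; rewrite ler_distl; apply/andP; split.
  by rewrite lerBlDr; apply: ge_sup; [exists (g (r / 2) - K * (r / 2)); exists (r / 2)|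
    move=> _ [t tr <-]; exact: H'].
rewrite -lerBlDr; apply: ub_le_sup; last by exists s.
by exists (g (r / 2) + K * (r / 2)) => _ [t tr <-]; exact: H'.
Qed.

Lemma lipschitz_limitC (G : C -> C) (r K : R) : 0 < r -> 0 <= K ->
  (forall s t : C, 0 < nrm s < r -> 0 < nrm t < r ->
     nrm (G s - G t) <= K * nrm (s - t)) ->
  exists L, forall s : C, 0 < nrm s < r -> nrm (G s - L) <= K * nrm s.
Proof.
move=> r0 K0 H.
have nR (s : R) : 0 < s -> nrm (s%:C : C) = s by move=> s0; rewrite nrmR gtr0_norm.
have HR (s t : R) : 0 < s < r -> 0 < t < r -> nrm (G s%:C - G t%:C) <= K * `|s - t|.
  move=> /andP[s0 sr] /andP[t0 tr]; rewrite -nrmR rmorphB; apply: H; rewrite nR //.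
    by rewrite s0.
  by rewrite t0.
have [|L1 HL1] := @lipschitz_limit (fun s => complex.Re (G s%:C)) r K r0 K0.
  move=> s t sr tr; apply: le_trans (HR _ _ sr tr).
  by apply: le_trans (Re_le_nrm _); rewrite !ReImE.
have [|L2 HL2] := @lipschitz_limit (fun s => complex.Im (G s%:C)) r K r0 K0.
  move=> s t sr tr; apply: le_trans (HR _ _ sr tr).
  by apply: le_trans (Im_le_nrm _); rewrite !ReImE.
exists (L1 +i* L2) => s sr; apply/ler_addgt0Pr => e e0.
(* The limit was found along the positive reals; G at s is compared with G at such a t, small enough
   for 3 K t <= e. *)
pose t := Num.min (r / 2) (e / (3 * (1 + K))).
have K1 : 0 < 1 + K by lra.
have t0 : 0 < t by rewrite lt_min !divr_gt0 // mulr_gt0.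
have tr : t < r by rewrite gt_min; apply/orP; left; lra.
have tt : 0 < t < r by rewrite t0.
have Kt : 3 * (K * t) <= e.
  have : t * (3 * (1 + K)) <= e by rewrite -ler_pdivlMr ?mulr_gt0 // ge_min lexx orbT.
  by nra.
have h1 := HL1 t tt; have h2 := HL2 t tt.
have h3 : nrm (G t%:C - (L1 +i* L2)) <= 2 * (K * t).
  by apply: le_trans (nrm_le_ReIm _) _; rewrite !ReImE /=; lra.
have h4 := H s t%:C sr; rewrite nR // in h4; have {}h4 := h4 tt.
have h5 := nrmB s t%:C; rewrite nR // in h5.
have h6 := ler_wpM2l K0 h5; rewrite mulrDr in h6.
have h7 := nrm_trans (G t%:C) (G s) (L1 +i* L2).
lra.
Qed.

Lemma nrm_trans_sym (V : normedModType C) (z x y : V) :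
  nrm (x - y) <= nrm (z - x) + nrm (z - y).
Proof. by rewrite [nrm (z - x)]nrm_distC; exact: nrm_trans. Qed.

Lemma three_thirds (a b c x1 x2 k e : R) : a <= b + c -> c <= x1 + x2 ->
  b <= k -> x2 <= k -> x1 < e / 3 -> 3 * k < e -> a < e.
Proof. lra. Qed.

Lemma two_halves (a b c b' c' k e : R) : a <= b + c -> b <= e / 2 ->
  c <= b' + c' -> b' <= k -> c' <= e / 2 -> a <= k + e.
Proof. lra. Qed.

Lemma sub4ACA (a b c d : C) : a - b - (c - d) = (a - c) - (b - d).
Proof. ring. Qed.

Lemma quotient_sub (x y t d : C) : t != 0 ->
  ((x - y) / t - d) * t = x - y - t *: d.
Proof. by move=> t0; rewrite /GRing.scale /=; field. Qed.

Lemma quotient_split (a b h d q x y : C) : h != 0 ->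
  a - b - h *: d = (y - b) - (x - a) + h * ((x - y) / h - q) + h * (q - d).
Proof. by move=> h0; rewrite /GRing.scale /=; field. Qed.

Section Vector.
Variables (V W : normedModType C).

(* Holomorphy in the sense of Osgood: the derivatives along complex lines are
   not required to be continuous. *)
Definition hol (A : set V) (F : V -> C) : Prop :=
  forall z, A z -> ctn F z /\ forall v, exists d, hder setT F z v d.

Definition dv (v : V) (F : V -> C) (z : V) : C := 'D_v F z.

Lemma dvE F z v d : hder setT F z v d -> dv v F z = d.
Proof. by move=> /cderP[]. Qed.

Lemma hol_dv A F z v : hol A F -> A z -> hder setT F z v (dv v F z).
Proof. by move=> HF /HF[_ /(_ v)[d Hd]]; rewrite (dvE Hd). Qed.

Lemma hder_line (S : set C) (F : V -> C) (z v : V) (l d : C) :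
  hder S F (z + l *: v) v d -> hder S (fun m : C => F (z + m *: v)) l 1 d.
Proof.
move=> H e /H[r r0 Hr]; exists r => // h Sh hr.
have := Hr h Sh hr; rewrite -(addrA z) -scalerDl.
by rewrite (_ : h *: (1 : C) = h) //; rewrite /GRing.scale /= mulr1.
Qed.

Lemma ctn_bounded (F : V -> C) z : ctn F z -> exists M r : R,
  [/\ 0 < r, 0 <= M & forall y, nrm (y - z) < r -> nrm (F y) <= M].
Proof.
move=> /(_ 1 ltr01)[r r0 Hr]; exists (1 + nrm (F z)), r; split => //.
  by rewrite addr_ge0 // nrm_ge0.
move=> y /Hr h; have := nrm_sub (F y) (F z); lra.
Qed.

(** The bounds on difference quotients along the complex lines z + l v, with constants common to all
    z near z0: [F] is bounded near z0, and nothing else enters the constants. *)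
Lemma dq_uniform A F z0 (v : V) : open A -> hol A F -> A z0 ->
  exists r s K : R, [/\ 0 < r /\ 0 < s, 0 <= K,
    forall z, nrm (z - z0) < r -> A z,
    forall z (l : C), nrm (z - z0) < r -> 0 < nrm l < s ->
      nrm ((F (z + l *: v) - F z) / l) <= K
    & forall z (l : C), nrm (z - z0) < r -> 0 < nrm l < s ->
      nrm ((F (z + l *: v) - F z) / l - dv v F z) <= K * nrm l].
Proof.
move=> /open_nrm oA HF Az0; have [rA rA0 HA] := oA _ Az0.
have [cF _] := HF _ Az0; have [M [rM [rM0 M0 HM]]] := ctn_bounded cF.
pose r := Num.min rA rM / 2.
have r0 : 0 < r by rewrite divr_gt0 // lt_min rA0.
pose s0 := r / (1 + nrm v).
have v1 : 0 < 1 + nrm v by rewrite ltr_pwDl ?nrm_ge0.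
have s00 : 0 < s0 by rewrite divr_gt0.
have near_z (z : V) (l : C) : nrm (z - z0) < r -> nrm (l - 0) < s0 -> A (z + l *: v) /\ nrm (F (z + l *: v)) <= M.
  rewrite subr0 => zr ls.
  have : nrm (z + l *: v - z0) < Num.min rA rM.
    rewrite addrAC; apply: le_lt_trans (nrmD _ _) _.
    have : nrm (l *: v) < r.
      rewrite nrmZ; move: ls; rewrite ltr_pdivlMr // => ls.
      by apply: le_lt_trans ls; rewrite ler_wpM2l ?nrm_ge0 // lerDr.
    rewrite /r in zr *; lra.
  by rewrite lt_min => /andP[/HA ? /HM ?].
have dphi (z : V) (l : C) : nrm (z - z0) < r -> nrm (l - 0) < s0 ->
    hder setT (fun m : C => F (z + m *: v)) l 1 (dv v F (z + l *: v)).
  by move=> zr ls; apply: hder_line; apply: (@hol_dv A) => //; case: (near_z z l zr ls).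
pose p := s0 / 2.
have p0 : 0 < p by rewrite divr_gt0.
have ps : p < s0 by rewrite /p; lra.
exists r, (p / 2), (Num.max (2 * M / p) (8 * M / p ^+ 2)); split => //.
- by split => //; rewrite divr_gt0.
- by rewrite le_max; apply/orP; left; apply: divr_ge0; [exact: mulr_ge0|exact: ltW].
- move=> z zr; apply: HA; apply: lt_trans zr _.
  apply: lt_le_trans (_ : Num.min rA rM <= _); last by rewrite ge_min lexx.
  by rewrite /r gtr_pMr ?invf_lt1 ?ltr1n // lt_min rA0.
- move=> z l zr /andP[l0 lp].
  have := @dquo_bound R _ _ 0 s0 M (fun l => dphi z l zr)
     (fun l ls => (near_z z l zr ls).2) p l p0 ps.
  have ln0 : l != 0 by rewrite -nrm_gt0.
  rewrite /dquo (negbTE ln0) scale0r addr0 subr0 => H.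
  by rewrite le_max H //; lra.
- move=> z l zr /andP[l0 lp].
  have := @dquo_lip R _ _ 0 s0 M (fun l => dphi z l zr)
     (fun l ls => (near_z z l zr ls).2) p l 0 p0 ps.
  have ln0 : l != 0 by rewrite -nrm_gt0.
  rewrite /dquo (negbTE ln0) eqxx scale0r addr0 subrr nrm0 !subr0 => H.
  rewrite maxr_pMl ?nrm_ge0 // le_max H ?orbT //; first lra.
  by rewrite divr_ge0 // ltW.
Qed.

Lemma ctn_shift (F : V -> C) (z w : V) : ctn F (z + w) ->
  ctn (fun y => F (y + w)) z.
Proof.
move=> cF e /cF[d d0 Hd]; exists d => // y yz; apply: Hd.
by rewrite opprD addrACA subrr addr0.
Qed.

(** The derivative is a locally uniform limit of the quotients (F (z + l v) - F z) / l, which are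
    continuous. *)
Lemma dv_ctn A F z0 v : open A -> hol A F -> A z0 -> ctn (dv v F) z0.
Proof.
move=> oA HF Az0; have [r [s [K [[r0 s0] K0 HA _ HK]]]] := dq_uniform v oA HF Az0.
move=> e e0.
have K1 : 0 < 3 * (1 + K) by rewrite mulr_gt0 // ltr_pwDl.
pose lr : R := Num.min (s / 2) (e / (3 * (1 + K))).
have lr0 : 0 < lr by rewrite lt_min !divr_gt0.
have lrs : lr < s by rewrite gt_min; apply/orP; left; lra.
have Kl : 3 * (K * lr) < e.
  have : lr * (3 * (1 + K)) <= e by rewrite -ler_pdivlMr // ge_min lexx orbT.
  by nra.
have nl : nrm (lr%:C : C) = lr by rewrite nrmR gtr0_norm.
(* shrink the increment so that the shifted point stays in the domain *)
have v1 : 0 < 1 + nrm v by rewrite ltr_pwDl ?nrm_ge0.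
pose l : R := Num.min lr (r / 2 / (1 + nrm v)).
have l0 : 0 < l by rewrite lt_min lr0 !divr_gt0.
have ll : l <= lr by rewrite ge_min lexx.
have nl' : nrm (l%:C : C) = l by rewrite nrmR gtr0_norm.
have lv : nrm (l%:C *: v) < r.
  rewrite nrmZ nl'; have : l * (1 + nrm v) <= r / 2.
    by rewrite -ler_pdivlMr // ge_min lexx orbT.
  have := nrm_ge0 v; nra.
have ls : 0 < nrm (l%:C : C) < s by rewrite nl' l0 (le_lt_trans ll).
have cQ : ctn (fun z => (F (z + l%:C *: v) - F z) / l%:C) z0.
  apply: ctn_mul; last exact: ctn_cst.
  apply: ctn_add; last by apply: ctn_opp; case: (HF _ Az0).
  apply: ctn_shift; apply: (HF _ _).1; apply: HA.
  by rewrite addrAC subrr add0r.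
have [|d d0 Hd] := cQ (e / 3); first by rewrite divr_gt0.
exists (Num.min r d); first by rewrite lt_min r0.
move=> y; rewrite lt_min => /andP[yr /Hd hq].
have h1 := HK y l%:C yr ls.
have := HK z0 l%:C; rewrite subrr nrm0 => /(_ r0 ls) h2.
rewrite nl' in h1 h2.
have h3 := nrm_trans ((F (y + l%:C *: v) - F y) / l%:C) (dv v F y) (dv v F z0).
have h4 := nrm_trans ((F (z0 + l%:C *: v) - F z0) / l%:C)
   ((F (y + l%:C *: v) - F y) / l%:C) (dv v F z0).
rewrite (nrm_distC (dv v F y) ((F (y + l%:C *: v) - F y) / l%:C)) in h3.
apply: three_thirds h3 h4 h1 h2 hq _; apply: le_lt_trans Kl.
by rewrite ler_pM2l // ler_wpM2l.
Qed.

Lemma hol_shift_quo A F v l : hol A F ->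
  hol [set z | A z /\ A (z + l *: v)] (fun z => (F (z + l *: v) - F z) / l).
Proof.
move=> HF z [Az Azl]; split.
  apply: ctn_mul; last exact: ctn_cst.
  by apply: ctn_add; [apply: ctn_shift; case: (HF _ Azl)|apply: ctn_opp; case: (HF _ Az)].
move=> w; have [_ /(_ w)[d Hd]] := HF _ Az; have [_ /(_ w)[d' Hd']] := HF _ Azl.
exists ((d' - d) * l^-1 + (F (z + l *: v) - F z) * 0).
apply: hder_mul; last exact: hder_cst.
apply: hder_add; last exact: hder_opp.
move=> e /Hd'[r r0 Hr]; exists r => // h _ hr.
by rewrite [z + h *: w + _]addrAC; apply: Hr.
Qed.

Lemma dv_quo A F v l w z : hol A F -> A z -> A (z + l *: v) ->
  dv w (fun z => (F (z + l *: v) - F z) / l) z =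
  (dv w F (z + l *: v) - dv w F z) / l.
Proof.
move=> HF Az Azl; apply: dvE.
have Hd := hol_dv w HF Az; have Hd' := hol_dv w HF Azl.
rewrite -[X in hder _ _ _ _ X]addr0 -[X in _ + X](mulr0 (F (z + l *: v) - F z)).
apply: hder_mul; last exact: hder_cst.
apply: hder_add; last exact: hder_opp.
move=> e /Hd'[r r0 Hr]; exists r => // h _ hr.
by rewrite [z + h *: w + _]addrAC; apply: Hr.
Qed.

Let Q (F : V -> C) (v : V) (l : C) (z : V) := (F (z + l *: v) - F z) / l.

(** The quotient along v is holomorphic and bounded uniformly in l, so its own difference quotients
    along w are Lipschitz with a constant independent of l. Letting l tend to 0 gives both the
    derivability of [dv v F] and the symmetry of mixed derivatives. *)
Lemma double_quotient A F z0 v w : open A -> hol A F -> A z0 ->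
  exists p s K : R, [/\ 0 < p /\ 0 < s, 0 <= K,
    forall m l : C, nrm m <= p -> nrm l < s ->
      A (z0 + m *: w) /\ A (z0 + m *: w + l *: v),
    forall m l : C, nrm m <= p -> 0 < nrm l < s ->
      nrm (Q F v l (z0 + m *: w) - dv v F (z0 + m *: w)) <= K * nrm l
    & forall l m n : C, 0 < nrm l < s -> nrm m <= p -> nrm n <= p ->
      nrm (dquo (fun k => Q F v l (z0 + k *: w))
                (fun k => dv w (Q F v l) (z0 + k *: w)) 0 m
         - dquo (fun k => Q F v l (z0 + k *: w))
                (fun k => dv w (Q F v l) (z0 + k *: w)) 0 n)
      <= K * nrm (m - n)].
Proof.
move=> oA HF Az0; have [r [s [K [[r0 s0] K0 HA HB HK]]]] := dq_uniform v oA HF Az0.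
have w1 : 0 < 1 + nrm w by rewrite ltr_pwDl ?nrm_ge0.
have v1 : 0 < 1 + nrm v by rewrite ltr_pwDl ?nrm_ge0.
pose p := r / 4 / (1 + nrm w).
have p0 : 0 < p by rewrite !divr_gt0.
pose s' := Num.min s (r / 4 / (1 + nrm v)).
have s'0 : 0 < s' by rewrite lt_min s0 !divr_gt0.
have lw (l : C) : nrm l < 2 * p -> nrm (l *: w) < r / 2.
  move=> lp; rewrite nrmZ; have : nrm l * (1 + nrm w) < 2 * p * (1 + nrm w).
    by rewrite ltr_pM2r.
  rewrite (_ : 2 * p * (1 + nrm w) = r / 2); last by rewrite /p; field; rewrite gt_eqF.
  apply: le_lt_trans; rewrite ler_wpM2l ?nrm_ge0 // lerDr //.
have lv (l : C) : nrm l < s' -> nrm (l *: v) < r / 2.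
  rewrite lt_min => /andP[_ lp]; rewrite nrmZ.
  have : nrm l * (1 + nrm v) < r / 4 by rewrite -ltr_pdivlMr.
  have := nrm_ge0 l; rewrite mulrDr mulr1; lra.
have AA (m l : C) : nrm m < 2 * p -> nrm l < s' ->
   nrm (z0 + m *: w - z0) < r /\ nrm (z0 + m *: w + l *: v - z0) < r.
  move=> mp ls; have h1 := lw _ mp; have h2 := lv _ ls.
  rewrite addrAC subrr add0r; split; first by have := nrm_ge0 (l *: v); lra.
  rewrite -(addrA z0) [z0 + _]addrC addrK.
  by apply: le_lt_trans (nrmD _ _) _; lra.
pose K2 := 8 * K / p ^+ 2.
have K20 : 0 <= K2.
  by apply: divr_ge0; [exact: mulr_ge0|exact: exprn_ge0 (ltW p0)].
have pp : p < 2 * p by lra.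
have ss (l : C) : 0 < nrm l < s' -> 0 < nrm l < s.
  by rewrite lt_min => /andP[-> /andP[->]].
exists (p / 2), s', (Num.max K K2); split.
- by split => //; rewrite divr_gt0.
- by rewrite le_max K0.
- move=> m l mp ls; have [|h1 h2] := AA m l _ ls; first by lra.
  by split; exact: HA.
- move=> m l mp ls; have [|h1 _] := AA m l _ (andP ls).2; first by lra.
  apply: le_trans (HK _ _ h1 (ss _ ls)) _.
  by rewrite ler_wpM2r ?nrm_ge0 // le_max lexx.
move=> l m n ls mp np; have l1 := (andP ls).2.
have d1 (k : C) : nrm (k - 0) < 2 * p ->
    hder setT (fun k : C => Q F v l (z0 + k *: w)) k 1 (dv w (Q F v l) (z0 + k *: w)).
  rewrite subr0 => kp; have [h1 h2] := AA k l kp l1.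
  have HQ := @hol_shift_quo A F v l HF.
  apply: (@hder_line setT (Q F v l) z0 w k); apply: (hol_dv w HQ).
  by split; exact: HA.
have d2 (k : C) : nrm (k - 0) < 2 * p -> nrm (Q F v l (z0 + k *: w)) <= K.
  by rewrite subr0 => kp; have [h1 h2] := AA k l kp l1; apply: HB => //; exact: ss.
have := @dquo_lip R _ _ 0 (2 * p) K d1 d2 p m n p0 pp.
rewrite !subr0 => /(_ mp np) H; apply: le_trans H _.
by rewrite ler_wpM2r ?nrm_ge0 // le_max lexx orbT.
Qed.

(** In the limit l = 0 the difference quotients of [dv v F] along w inherit the Lipschitz bound,
    hence converge. *)
Lemma dv_derivable A F z0 v w : open A -> hol A F -> A z0 ->
  exists d, hder setT (dv v F) z0 w d.
Proof.
move=> oA HF Az0.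
have [p [s [K [[p0 s0] K0 HA HK E]]]] := double_quotient v w oA HF Az0.
pose G (m : C) := (dv v F (z0 + m *: w) - dv v F z0) / m.
have K1 : 0 < 4 * (1 + K) by rewrite mulr_gt0 // ltr_pwDl.
have [|d Hd] := @lipschitz_limitC G p K p0 K0.
  move=> m n /andP[m0 mp] /andP[n0 np].
  have mm : 0 < nrm m <= p by rewrite m0 ltW.
  have nn : 0 < nrm n <= p by rewrite n0 ltW.
  apply/ler_addgt0Pr => e e0.
  (* the same increment [t] must serve both quotients *)
  pose t := Num.min (s / 2) (Num.min (e * nrm m / (4 * (1 + K))) (e * nrm n / (4 * (1 + K)))).
  have t0 : 0 < t by rewrite !lt_min !divr_gt0 // mulr_gt0.
  have ts : t < s by rewrite gt_min; apply/orP; left; lra.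
  have nt : nrm (t%:C : C) = t by rewrite nrmR gtr0_norm.
  have ns : 0 < nrm (t%:C : C) < s by rewrite nt t0.
  have cl (k : C) : 0 < nrm k <= p -> t <= e * nrm k / (4 * (1 + K)) ->
     nrm ((Q F v t%:C (z0 + k *: w) - Q F v t%:C z0) / k - G k) <= e / 2.
    move=> /andP[k0 kp] tk.
    have h2 := HK _ _ kp ns.
    have := HK 0 t%:C; rewrite nrm0 scale0r addr0 => /(_ (ltW p0) ns) h3.
    rewrite nt in h2 h3.
    rewrite /G -mulrBl nrmM nrmV ler_pdivrMr //.
    rewrite sub4ACA.
    apply: le_trans (nrmB _ _) _.
    move: tk; rewrite ler_pdivlMr // => tk; have t00 : 0 <= t by apply: ltW.
    apply: le_trans (lerD h2 h3) _; move: tk t00; move: (nrm k) => x; clear; lra.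
  have t1 : t <= e * nrm m / (4 * (1 + K)) by rewrite !ge_min lexx orbT.
  have t2 : t <= e * nrm n / (4 * (1 + K)) by rewrite !ge_min lexx !orbT.
  have c1 := cl m mm t1; have c2 := cl n nn t2.
  have hE := E t%:C m n ns (ltW mp) (ltW np).
  have nz (k : C) : 0 < nrm k -> (k == 0) = false by rewrite nrm_gt0 => /negbTE.
  rewrite /dquo !nz // scale0r addr0 !subr0 in hE.
  have h1 := nrm_trans_sym ((Q F v t%:C (z0 + m *: w) - Q F v t%:C z0) / m) (G m) (G n).
  have h2 := nrm_trans ((Q F v t%:C (z0 + n *: w) - Q F v t%:C z0) / n)
     ((Q F v t%:C (z0 + m *: w) - Q F v t%:C z0) / m) (G n).
  exact: two_halves h1 c1 h2 hE c2.
exists d => e e0.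
exists (Num.min p (e / (1 + K))).
  by rewrite lt_min p0 divr_gt0 // ltr_pwDl.
move=> h _; rewrite lt_min => /andP[h1 h2].
have [->|h0] := eqVneq h 0.
  by rewrite scale0r addr0 subrr scale0r subr0 nrm0 mulr0.
have nh : 0 < nrm h by rewrite nrm_gt0.
have := Hd h; rewrite nh h1 => /(_ isT) h3.
rewrite -quotient_sub // -/(G h) mulrC.
rewrite nrmM mulrC ler_wpM2r ?nrm_ge0 //; apply: le_trans h3 _.
have K2 : 0 < 1 + K by rewrite ltr_pwDl.
move: h2; rewrite ltr_pdivlMr //; have := nrm_ge0 h; lra.
Qed.

Lemma hol_deriv A F v : open A -> hol A F -> hol A (dv v F).
Proof.
move=> oA HF z Az; split; first exact: (dv_ctn v oA HF Az).
by move=> w; apply: dv_derivable oA HF Az.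
Qed.

(** For fixed l, the derivative along w of the quotient along v is the quotient along v of [dv w F];
    the bounds uniform in l allow l to tend to 0. *)
Lemma dv_comm A F z0 v w : open A -> hol A F -> A z0 ->
  dv w (dv v F) z0 = dv v (dv w F) z0.
Proof.
move=> oA HF Az0.
have [p [s [K [[p0 s0] K0 HA HK E]]]] := double_quotient v w oA HF Az0.
have Hd := hol_dv v (hol_deriv w oA HF) Az0.
apply: dvE; set d := dv v (dv w F) z0 in Hd *.
move=> e e0; have K1 : 0 < 1 + K by rewrite ltr_pwDl.
exists (Num.min p (e / (2 * (1 + K)))).
  by rewrite lt_min p0 divr_gt0 // mulr_gt0.
move=> h _; rewrite lt_min => /andP[hp he].
have [->|h0] := eqVneq h 0.
  by rewrite scale0r addr0 subrr scale0r subr0 nrm0 mulr0.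
have nh : 0 < nrm h by rewrite nrm_gt0.
have e4 : 0 < e / 4 by rewrite divr_gt0.
have [r r0 Hr] := Hd _ e4.
have K8 : 0 < 8 * (1 + K) by rewrite mulr_gt0.
(* The increment t along v may depend on h: it has to make K t small against e |h|. *)
pose t := Num.min (Num.min (s / 2) (r / 2)) (e * nrm h / (8 * (1 + K))).
have t0 : 0 < t by rewrite !lt_min !divr_gt0 // mulr_gt0.
have ts : t < s by rewrite !gt_min; apply/orP; left; apply/orP; left; lra.
have tr : t < r by rewrite !gt_min; apply/orP; left; apply/orP; right; lra.
have nt : nrm (t%:C : C) = t by rewrite nrmR gtr0_norm.
have ns : 0 < nrm (t%:C : C) < s by rewrite nt t0.
have tC0 : (t%:C : C) != 0 by rewrite -nrm_gt0 nt.
have p00 : nrm (0 : C) <= p by rewrite nrm0 ltW.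
have h1 := HK _ _ (ltW hp) ns.
have h2 := HK _ _ p00 ns; rewrite scale0r addr0 in h2.
have h3 := E _ _ _ ns (ltW hp) p00; rewrite /dquo (negbTE h0) eqxx scale0r addr0 !subr0 in h3.
have [_ Az0t] := HA 0 t%:C p00 (andP ns).2; rewrite scale0r addr0 in Az0t.
rewrite (dv_quo w HF Az0 Az0t) in h3.
have := Hr t%:C I; rewrite nt => /(_ tr) h4.
set q := (dv w F (z0 + t%:C *: v) - dv w F z0) / t%:C in h3.
have h5 : nrm (q - d) <= e / 4.
  rewrite -(ler_pM2r t0) -{1}nt -nrmM; apply: le_trans h4.
  rewrite le_eqVlt; apply/orP; left; apply/eqP; congr nrm.
  exact: quotient_sub.
rewrite nt in h1 h2.
rewrite (@quotient_split _ _ _ _ q (Q F v t%:C (z0 + h *: w)) (Q F v t%:C z0)) //.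
apply: le_trans (nrmD _ _) _.
apply: le_trans (lerD (nrmD _ _) (lexx _)) _.
apply: le_trans (lerD (lerD (nrmB _ _) (lexx _)) (lexx _)) _.
rewrite !nrmM.
have t8 : t * (8 * (1 + K)) <= e * nrm h by rewrite -ler_pdivlMr // ge_min lexx orbT.
have h6 := ler_wpM2l (ltW nh) h5.
have h7 := ler_wpM2l (ltW nh) h3.
have h8 : nrm h * (2 * (1 + K)) <= e by rewrite -ler_pdivlMr ?mulr_gt0 // ltW.
have h9 := ler_wpM2l (ltW nh) h8.
have tK : K * t <= e * nrm h / 8 by move: t8 (ltW t0); clear; lra.
apply: (@le_trans _ _ (e * nrm h / 8 + e * nrm h / 8 + nrm h * (K * nrm h) + nrm h * (e / 4))).
  apply: lerD => //; apply: lerD => //; apply: lerD; [exact: le_trans h2 tK|exact: le_trans h1 tK].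
move: h9 (mulr_ge0 (ltW nh) (ltW nh)); clear; lra.
Qed.

End Vector.
End Regularity.

Arguments Sreal {R}.

(** * Real smoothness and Wirtinger derivatives *)

Section SmoothFunctions.
Variable R : realType.
Local Notation C := R[i].
Local Notation nrm := (@nrm R _).

Section Generic.
Variable V : normedModType C.

Lemma rder_rderive (g : V -> C) z v d : hder Sreal g z v d -> rderive v g z = d.
Proof. by move=> /rderP[]. Qed.

(** [Ck] over any normed module, so that functions of a time in [C] and of coordinates in row
    vectors share one calculus. *)
Fixpoint CkV (k : nat) (A : set V) (g : V -> C) : Prop :=
  (forall z, A z -> ctn g z) /\
  match k with
  | 0%N => True
  | k'.+1 => forall v : V,
      (forall z, A z -> exists d, hder Sreal g z v d) /\ CkV k' A (rderive v g)
  end.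

Lemma CkV_ctn k A g z : CkV k A g -> A z -> ctn g z.
Proof. by case: k => [|k] [cg _] /cg. Qed.

Lemma CkV_der k A g z v : CkV k.+1 A g -> A z -> hder Sreal g z v (rderive v g z).
Proof.
by move=> [_ /(_ v)[H _]] /H[d Hd]; rewrite (rder_rderive Hd).
Qed.

Lemma CkV_rderive k A g v : CkV k.+1 A g -> CkV k A (rderive v g).
Proof. by move=> [_ /(_ v)[]]. Qed.

Lemma CkV_mono k (A B : set V) g : B `<=` A -> CkV k A g -> CkV k B g.
Proof.
elim: k g => [|k IH] g BA /= [cg H].
  by split=> // z /BA; exact: cg.
split=> [z /BA|v]; first exact: cg.
have [H1 H2] := H v; split=> [z /BA|]; first exact: H1.
exact: IH.
Qed.

Lemma open_near (A : set V) z : open A -> A z -> \forall y \near z, A y.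
Proof. by rewrite openE => /(_ z). Qed.

Lemma eq_near (A : set V) (f g : V -> C) z : open A -> A z ->
  (forall y, A y -> f y = g y) -> \forall y \near z, f y = g y.
Proof.
move=> oA Az fg; have [r r0 Hr] := (open_nrm A).1 oA z Az.
by apply/nbhs_nrm; exists r => // y /Hr /fg.
Qed.

Lemma CkV_ext k A f g : open A -> (forall y, A y -> f y = g y) ->
  CkV k A f -> CkV k A g.
Proof.
elim: k f g => [|k IH] f g oA fg /= [cf H].
  by split=> // z Az; apply: ctn_ext (cf z Az); exact: eq_near fg.
split=> [z Az|v]; first by apply: ctn_ext (cf z Az); exact: eq_near fg.
have [H1 H2] := H v.
have E z : A z -> rderive v f z = rderive v g z.
  move=> Az; have [d Hd] := H1 z Az.
  by rewrite (rder_rderive Hd) (rder_rderive (hder_ext (eq_near oA Az fg) Hd)).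
split=> [z Az|]; last exact: IH H2.
by have [d Hd] := H1 z Az; exists d; apply: hder_ext Hd; exact: eq_near fg.
Qed.

Lemma CkV_intro k A g (D : V -> V -> C) : open A ->
  (forall z, A z -> ctn g z) ->
  (forall v z, A z -> hder Sreal g z v (D v z)) ->
  (forall v, CkV k A (D v)) -> CkV k.+1 A g.
Proof.
move=> oA cg Hg HD; split=> // v; split=> [z Az|]; first by exists (D v z); exact: Hg.
by apply: CkV_ext (HD v) => // y Ay; rewrite (rder_rderive (Hg v y Ay)).
Qed.

Lemma CkV_pred k A g : CkV k.+1 A g -> CkV k A g.
Proof.
elim: k g => [|k IH] g [cg H]; first by split.
split=> // v; have [H1 H2] := H v; split=> //; exact: IH.
Qed.

Lemma CkV_le k m A g : (k <= m)%N -> CkV m A g -> CkV k A g.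
Proof.
move=> /subnK <-; elim: (m - k)%N => [//|j IH]; rewrite addSn => /CkV_pred.
exact: IH.
Qed.

Lemma CkV_local k A g : open A ->
  (forall z, A z -> exists B : set V, [/\ open B, B z & CkV k B g]) -> CkV k A g.
Proof.
elim: k g => [|k IH] g oA H /=.
  by split=> // z /H[B [_ Bz [cg _]]]; exact: cg.
split=> [z /H[B [_ Bz [cg _]]]|v]; first exact: cg.
split=> [z /H[B [_ Bz [_ /(_ v)[]]]]|]; first by move=> /(_ z Bz).
apply: IH => // z /H[B [oB Bz /(CkV_rderive v)]].
by exists B.
Qed.

Lemma CkV_cst k A (c : C) : open A -> CkV k A (fun=> c).
Proof.
move=> oA; elim: k c => [|k IH] c; first by split=> // z _; exact: ctn_cst.
apply: (@CkV_intro k A _ (fun _ _ => 0)) => // [z _|v z _]; first exact: ctn_cst.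
exact: hder_cst.
Qed.

Lemma CkV_add k A f g : open A -> CkV k A f -> CkV k A g ->
  CkV k A (fun y => f y + g y).
Proof.
move=> oA; elim: k f g => [|k IH] f g Hf Hg.
  by split=> // z Az; apply: ctn_add; apply: CkV_ctn Az; eassumption.
apply: (@CkV_intro k A _ (fun v z => rderive v f z + rderive v g z)) => //.
- by move=> z Az; apply: ctn_add; apply: CkV_ctn Az; eassumption.
- by move=> v z Az; apply: hder_add; apply: CkV_der Az; eassumption.
- by move=> v; apply: IH; exact: CkV_rderive.
Qed.

Lemma CkV_mul k A f g : open A -> CkV k A f -> CkV k A g ->
  CkV k A (fun y => f y * g y).
Proof.
move=> oA; elim: k f g => [|k IH] f g Hf Hg.
  by split=> // z Az; apply: ctn_mul; apply: CkV_ctn Az; eassumption.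
apply: (@CkV_intro k A _ (fun v z => rderive v f z * g z + f z * rderive v g z)) => //.
- by move=> z Az; apply: ctn_mul; apply: CkV_ctn Az; eassumption.
- by move=> v z Az; apply: hder_mul; apply: CkV_der Az; eassumption.
- move=> v; apply: CkV_add => //; apply: IH.
  + exact: CkV_rderive.
  + exact: CkV_pred.
  + exact: CkV_pred.
  + exact: CkV_rderive.
Qed.

Lemma CkV_scale k A (c : C) f : open A -> CkV k A f -> CkV k A (fun y => c * f y).
Proof. by move=> oA; apply: CkV_mul => //; exact: CkV_cst. Qed.

Lemma CkV_opp k A f : open A -> CkV k A f -> CkV k A (fun y => - f y).
Proof.
move=> oA Hf; apply: CkV_ext (CkV_scale (-1) oA Hf) => // y _.
by rewrite mulN1r.
Qed.

Lemma CkV_conj k A f : open A -> CkV k A f -> CkV k A (fun y => (conjc (f y))).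
Proof.
move=> oA; elim: k f => [|k IH] f Hf.
  by split=> // z Az; apply: ctn_conj; exact: (CkV_ctn Hf Az).
apply: (@CkV_intro k A _ (fun v z => (conjc (rderive v f z)))) => //.
- by move=> z Az; apply: ctn_conj; exact: (CkV_ctn Hf Az).
- by move=> v z Az; apply: rder_conj; exact: (CkV_der v Hf Az).
- by move=> v; apply: IH; exact: CkV_rderive.
Qed.

Lemma CkV_sum k A (I : Type) (r : seq I) (P : pred I) (F : I -> V -> C) : open A ->
  (forall i, P i -> CkV k A (F i)) -> CkV k A (fun y => \sum_(i <- r | P i) F i y).
Proof.
move=> oA H; elim: r => [|i r IH].
  by apply: CkV_ext (CkV_cst k 0 oA) => // y _; rewrite big_nil.
case Pi : (P i); last by apply: CkV_ext IH => // y _; rewrite big_cons Pi.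
by apply: CkV_ext (CkV_add oA (H i Pi) IH) => // y _; rewrite big_cons Pi.
Qed.

Lemma CkV_prod k A (I : Type) (r : seq I) (P : pred I) (F : I -> V -> C) : open A ->
  (forall i, P i -> CkV k A (F i)) -> CkV k A (fun y => \prod_(i <- r | P i) F i y).
Proof.
move=> oA H; elim: r => [|i r IH].
  by apply: CkV_ext (CkV_cst k 1 oA) => // y _; rewrite big_nil.
case Pi : (P i); last by apply: CkV_ext IH => // y _; rewrite big_cons Pi.
by apply: CkV_ext (CkV_mul oA (H i Pi) IH) => // y _; rewrite big_cons Pi.
Qed.

Lemma CkV_det k A m (F : 'I_m -> 'I_m -> V -> C) : open A ->
  (forall i j, CkV k A (F i j)) ->
  CkV k A (fun y => \det (\matrix_(i, j) F i j y)).
Proof.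
move=> oA H.
have E y : \sum_(s : 'S_m) (-1) ^+ s * \prod_i F i (s i) y = \det (\matrix_(i, j) F i j y).
  by apply: eq_bigr => s _; congr (_ * _); apply: eq_bigr => i _; rewrite mxE.
apply: (CkV_ext oA (fun y _ => E y)).
apply: CkV_sum => // s _; apply: CkV_scale => //.
by apply: CkV_prod => // i _; exact: H.
Qed.

Lemma CkV_hol k A F : open A -> hol A F -> CkV k A F.
Proof.
move=> oA; elim: k F => [|k IH] F HF.
  by split=> // z /HF[].
apply: (@CkV_intro k A _ (fun v z => dv v F z)) => //.
- by move=> z /HF[].
- by move=> v z Az; apply/cder_rder/(hol_dv v HF).
- by move=> v; apply: IH; exact: hol_deriv.
Qed.

(* [d] and [db] are the two Wirtinger derivatives of [g] along [v]. *)
Definition isW (g : V -> C) (z v : V) (d db : C) : Prop :=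
  hder Sreal g z v (d + db) /\ hder Sreal g z ('i%C *: v) ('i%C * d - 'i%C * db).

Lemma ii : 'i%C * 'i%C = -1 :> C.
Proof. by rewrite -expr2 sqr_i. Qed.

Lemma isW_wirtinger g z v d db : isW g z v d db -> wirtinger v g z = d.
Proof.
move=> [/rder_rderive H1 /rder_rderive H2]; rewrite /wirtinger H1 H2.
have -> : d + db - 'i%C * ('i%C * d - 'i%C * db) = d + db - ('i%C * 'i%C) * (d - db) by ring.
by rewrite ii; field.
Qed.

Lemma isW_bar g z v d db : isW g z v d db -> wirtinger_bar v g z = db.
Proof.
move=> [/rder_rderive H1 /rder_rderive H2]; rewrite /wirtinger_bar H1 H2.
have -> : d + db + 'i%C * ('i%C * d - 'i%C * db) = d + db + ('i%C * 'i%C) * (d - db) by ring.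
by rewrite ii; field.
Qed.

Lemma rder_isW g z v d1 d2 : hder Sreal g z v d1 -> hder Sreal g z ('i%C *: v) d2 ->
  isW g z v (wirtinger v g z) (wirtinger_bar v g z).
Proof.
move=> H1 H2; rewrite /isW /wirtinger /wirtinger_bar (rder_rderive H1) (rder_rderive H2).
split.
  by rewrite (_ : _ + _ = d1); [exact: H1|field].
rewrite (_ : _ - _ = - ('i%C * 'i%C) * d2); last by field.
by rewrite ii opprK mul1r.
Qed.

Lemma CkV_isW k A g z v : CkV k.+1 A g -> A z ->
  isW g z v (wirtinger v g z) (wirtinger_bar v g z).
Proof. by move=> Hg Az; apply: rder_isW; apply: CkV_der Az; exact: Hg. Qed.

Lemma CkV_wirtinger k A g v : open A -> CkV k.+1 A g -> CkV k A (wirtinger v g).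
Proof.
move=> oA Hg.
have H := CkV_scale (2%:R)^-1 oA (CkV_add oA (CkV_rderive v Hg)
  (CkV_scale (- 'i%C) oA (CkV_rderive ('i%C *: v) Hg))).
by apply: CkV_ext H => // y _; rewrite /wirtinger mulrC mulNr.
Qed.

Lemma CkV_wirtinger_bar k A g v : open A -> CkV k.+1 A g ->
  CkV k A (wirtinger_bar v g).
Proof.
move=> oA Hg.
have H := CkV_scale (2%:R)^-1 oA (CkV_add oA (CkV_rderive v Hg)
  (CkV_scale ('i%C) oA (CkV_rderive ('i%C *: v) Hg))).
by apply: CkV_ext H => // y _; rewrite /wirtinger_bar mulrC.
Qed.

Lemma isW_ext f g z v d db : (\forall y \near z, f y = g y) ->
  isW f z v d db -> isW g z v d db.
Proof. by move=> fg [H1 H2]; split; apply: hder_ext fg _. Qed.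

Lemma isW_cst (c : C) z v : isW (fun=> c) z v 0 0.
Proof. by rewrite /isW addr0 mulr0 subrr; split; exact: hder_cst. Qed.

Lemma isW_add f g z v d db d' db' : isW f z v d db -> isW g z v d' db' ->
  isW (fun y => f y + g y) z v (d + d') (db + db').
Proof.
move=> [H1 H2] [H3 H4]; split.
  by rewrite addrACA; apply: hder_add.
rewrite (_ : _ - _ = ('i%C * d - 'i%C * db) + ('i%C * d' - 'i%C * db')); last by ring.
exact: hder_add.
Qed.

Lemma isW_mul f g z v (d db d' db' : C) : isW f z v d db -> isW g z v d' db' ->
  isW (fun y => f y * g y) z v (d * g z + f z * d') (db * g z + f z * db').
Proof.
move=> [H1 H2] [H3 H4]; split.
  have -> : d * g z + f z * d' + (db * g z + f z * db') =
    (d + db) * g z + f z * (d' + db') by ring.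
  exact: hder_mul.
have -> : 'i%C * (d * g z + f z * d') - 'i%C * (db * g z + f z * db') =
  ('i%C * d - 'i%C * db) * g z + f z * ('i%C * d' - 'i%C * db') by ring.
exact: hder_mul.
Qed.

Lemma isW_hol f z v d : hder setT f z v d -> isW f z v d 0.
Proof.
move=> H; rewrite /isW addr0 mulr0 subr0; split; first exact: cder_rder.
exact/cder_rder/cder_dir.
Qed.

Lemma isW_sum (I : Type) (r : seq I) (P : pred I) (F : I -> V -> C) z v
    (D DB : I -> C) : (forall i, P i -> isW (F i) z v (D i) (DB i)) ->
  isW (fun y => \sum_(i <- r | P i) F i y) z v
    (\sum_(i <- r | P i) D i) (\sum_(i <- r | P i) DB i).
Proof.
move=> H; split; first by rewrite -big_split; apply: hder_sum => i /H[].
rewrite !mulr_sumr -sumrB; apply: hder_sum => i /H[] //.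
Qed.

(** The mean value theorem together with continuity of the derivative at z. The expansion is uniform
    in the base point y, so increments in several directions can be made one after the other. *)
Lemma strict_der A g z v : open A -> CkV 1 A g -> A z ->
  forall e : R, 0 < e -> exists2 r : R, 0 < r &
    forall (y : V) (t : R), nrm (y - z) < r -> `|t| < r ->
      nrm (g (y + t%:C *: v) - g y - t%:C * rderive v g z) <= e * `|t|.
Proof.
move=> oA Hg Az e e0; have e2 : 0 < e / 2 by rewrite divr_gt0.
have cD : ctn (rderive v g) z by apply: (@CkV_ctn 0 A) => //; exact: CkV_rderive.
have [q q0 Hq] := cD _ e2.
have [q' q'0 Hq'] := (open_nrm A).1 oA z Az.
have v1 : 0 < 1 + nrm v by rewrite ltr_pwDl ?nrm_ge0.
pose p := Num.min q q' / 2.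
have p0 : 0 < p by rewrite divr_gt0 // lt_min q0.
exists (Num.min p (p / (1 + nrm v))); first by rewrite lt_min p0 divr_gt0.
move=> y t; rewrite lt_min => /andP[yp _]; rewrite lt_min => /andP[_].
rewrite ltr_pdivlMr // => tp.
have near s : `|s| <= `|t| -> nrm (y + s%:C *: v - z) < Num.min q q'.
  move=> st; rewrite addrAC; apply: le_lt_trans (nrmD _ _) _.
  have : nrm (s%:C *: v) < p.
    rewrite nrmZ nrmR; apply: le_lt_trans tp; apply: ler_pM; rewrite ?nrm_ge0 //.
    by rewrite lerDr.
  rewrite /p in yp *; lra.
have Hd s : `|s| <= `|t| -> hder Sreal g (y + s%:C *: v) v (rderive v g (y + s%:C *: v))
    /\ nrm (rderive v g (y + s%:C *: v) - rderive v g z) < e / 2.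
  move=> /near; rewrite lt_min => /andP[/Hq h1 /Hq' h2]; split => //.
  exact: (CkV_der v Hg h2).
(* [pr] stands for the real or the imaginary part; the mean value theorem holds for each of them
   separately. *)
have part (pr : C -> R) : (forall a b, pr (a + b) = pr a + pr b) ->
    (forall (s : R) a, pr (s%:C * a) = s * pr a) -> (forall a, `|pr a| <= nrm a) ->
    `|pr (g (y + t%:C *: v) - g y - t%:C * rderive v g z)| <= e / 2 * `|t|.
  move=> prD prZ prn.
  have prN a : pr (- a) = - pr a.
    by apply/eqP; rewrite -addr_eq0 -prD addNr; apply/eqP; have := prZ 0 0; rewrite !mul0r.
  pose F s := pr (g (y + s%:C *: v)).
  have F' s : `|s| <= `|t| -> is_derive s (1 : R) F (pr (rderive v g (y + s%:C *: v))).
    move=> /Hd[H _]; have [d1 d2] : derivable F s 1 /\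
       derive1 F s = pr (rderive v g (y + s%:C *: v)).
      apply/real_derP => e' e'0; have [r r0 Hr] := H e' e'0; exists r => // h hr.
      have := Hr h%:C (SrealR h); rewrite nrmR => /(_ hr).
      apply: le_trans; apply: le_trans (prn _).
      by rewrite !prD !prN [_ *: rderive _ _ _]/GRing.scale /= prZ /F -(addrA y) -scalerDl -rmorphD.
    by apply: DeriveDef => //; rewrite -derive1E.
  have cF s : `|s| <= `|t| -> {for s, continuous F}.
    move=> st; apply: differentiable_continuous; apply/derivable1_diffP.
    by case: (F' s st).
  have [x xt Hx] : exists2 x, `|x| <= `|t| &
      F t - F 0 = pr (rderive v g (y + x%:C *: v)) * (t - 0).
    case: (lerP 0 t) => t0.
      have [||x] := @MVT_segment R F (fun s => pr (rderive v g (y + s%:C *: v))) 0 t t0.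
      - move=> x; rewrite in_itv /= => /andP[/ltW x0 /ltW xt]; apply: F'.
        by rewrite !ger0_norm.
      - apply: continuous_in_subspaceT => x; rewrite inE /= in_itv /= => /andP[x0 xt].
        by apply: cF; rewrite !ger0_norm.
      rewrite in_itv /= => /andP[x0 xt] ->; exists x => //; by rewrite !ger0_norm.
    have [||x] := @MVT_segment R F (fun s => pr (rderive v g (y + s%:C *: v))) t 0 (ltW t0).
    - move=> x; rewrite in_itv /= => /andP[/ltW tx /ltW x0]; apply: F'.
      by rewrite !ler0_norm ?lerN2 // ltW.
    - apply: continuous_in_subspaceT => x; rewrite inE /= in_itv /= => /andP[tx x0].
      by apply: cF; rewrite !ler0_norm ?lerN2 // ltW.
    rewrite in_itv /= => /andP[tx x0] h; exists x; first by rewrite !ler0_norm ?lerN2 // ltW.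
    by rewrite -[LHS]opprB h; ring.
  have -> : pr (g (y + t%:C *: v) - g y - t%:C * rderive v g z) =
     t * pr (rderive v g (y + x%:C *: v) - rderive v g z).
    rewrite prD prN prZ !prD !prN; move: Hx; rewrite /F scale0r addr0 subr0 => ->.
    ring.
  rewrite normrM mulrC ler_wpM2r //; apply: le_trans (prn _) _.
  by apply: ltW; case: (Hd x xt).
apply: le_trans (nrm_le_ReIm _) _.
have -> : e * `|t| = e / 2 * `|t| + e / 2 * `|t| by lra.
apply: lerD; apply: part.
- exact: ReD.
- by move=> s a; rewrite ReM /= mul0r subr0.
- exact: Re_le_nrm.
- exact: ImD.
- by move=> s a; rewrite ImM /= mul0r addr0.
- exact: Im_le_nrm.
Qed.

Lemma strict_der_sum A g z (I : Type) (r : seq I) (v : I -> V) :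
  open A -> CkV 1 A g -> A z ->
  forall e : R, 0 < e -> exists2 q : R, 0 < q &
    forall (y : V) (t : I -> R), nrm (y - z) < q -> (forall i, `|t i| < q) ->
      nrm (g (y + \sum_(i <- r) (t i)%:C *: v i) - g y
           - \sum_(i <- r) (t i)%:C * rderive (v i) g z)
        <= e * \sum_(i <- r) `|t i|.
Proof.
move=> oA Hg Az e e0; elim: r => [|i r [q q0 Hq]].
  exists 1 => // y t _ _; rewrite !big_nil addr0 subrr subr0 nrm0 mulr0 //.
have [p p0 Hp] := strict_der (v i) oA Hg Az e0.
have v1 : 0 < 1 + nrm (v i) by rewrite ltr_pwDl ?nrm_ge0.
pose m := Num.min (q / 2) (q / 2 / (1 + nrm (v i))).
have m0 : 0 < m by rewrite lt_min !divr_gt0.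
have mq : m <= q / 2 by rewrite ge_min lexx.
exists (Num.min p m); first by rewrite lt_min p0.
move=> y t; rewrite lt_min => /andP[yp ym] tm.
have ti j : `|t j| < p /\ `|t j| < m by apply/andP; rewrite -lt_min.
have h1 := Hp y (t i) yp (ti i).1.
have h2 : nrm (y + (t i)%:C *: v i - z) < q.
  rewrite addrAC; apply: le_lt_trans (nrmD _ _) _.
  have : nrm ((t i)%:C *: v i) < q / 2.
    rewrite nrmZ nrmR; have [_] := ti i; rewrite lt_min => /andP[_].
    rewrite ltr_pdivlMr //; apply: le_lt_trans; rewrite ler_wpM2l // lerDr //.
  lra.
have tq j : `|t j| < q by have [_] := ti j; lra.
have h3 := Hq _ t h2 tq.
rewrite !big_cons addrA mulrDr.
set a := g _ in h3 *; set b := g (y + _) in h1 h3.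
have -> : a - g y - ((t i)%:C * rderive (v i) g z + \sum_(j <- r) (t j)%:C * rderive (v j) g z)
  = (b - g y - (t i)%:C * rderive (v i) g z) + (a - b - \sum_(j <- r) (t j)%:C * rderive (v j) g z).
  ring.
exact: le_trans (nrmD _ _) (lerD h1 h3).
Qed.

End Generic.

Lemma Ck_CkV n k (A : set 'rV[C]_n) g : Ck k A g <-> CkV k A g.
Proof.
elim: k g => [|k IH] g /=.
  by split=> -[H _]; split=> // z /H; rewrite ctnP.
split=> -[H1 H2]; (split; first by move=> z /H1; rewrite ctnP).
  move=> v; have [H3 H4] := H2 v; split; last exact/IH.
  by move=> z /H3 d; exists (rderive v g z); apply/rderP.
move=> v; have [H3 H4] := H2 v; split; last exact/IH.
by move=> z /H3[d /rderP[]].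
Qed.

Lemma coord_nrm n (h : 'rV[C]_n) j : nrm (h 0 j) <= nrm h.
Proof.
apply/ler_addgt0Pr => e e0.
have : ball (0 : 'rV[C]_n) (nrm h + e)%:C h.
  by rewrite mx_norm_ball /ball_ /= sub0r normrN nrmE ltcR ltrDl.
case=> _ /(_ 0 j); rewrite mxE /ball /= sub0r normrN nrmE ltcR.
exact: ltW.
Qed.

End SmoothFunctions.

(** * Chain rules and differentials in several variables *)

Section ChainRule.
Variable R : realType.
Local Notation C := R[i].
Local Notation nrm := (@nrm R _).

Lemma conjcE (x : C) : conjc x = (complex.Re x)%:C - 'i%C * (complex.Im x)%:C.
Proof.
case: x => a b; apply: complexP; rewrite !ReImE /=.
  by rewrite mul0r mul1r subr0 oppr0 addr0.
by rewrite mul0r mul1r !add0r.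
Qed.

Lemma nrm_row_le n (h : 'rV[C]_n) : nrm h <= \sum_j nrm (h 0 j).
Proof.
have [->|h0] := eqVneq h 0.
  by rewrite nrm0 sumr_ge0 // => j _; exact: nrm_ge0.
have [[i j] hij] : exists ij : 'I_1 * 'I_n, `|h| = `|h ij.1 ij.2|.
  by apply: mx_norm_neq0; rewrite -[mx_norm h]/`|h| normr_eq0.
have -> : nrm h = nrm (h 0 j) by apply: (@complexI R); rewrite -!nrmE hij ord1.
by rewrite (bigD1 j) //= lerDl sumr_ge0 // => k _; exact: nrm_ge0.
Qed.

Lemma ctn_row (W : normedModType C) n (f : W -> 'rV[C]_n) z :
  (forall j, ctn (fun y => f y 0 j) z) -> ctn f z.
Proof.
move=> cf e e0.
have H : ctn (fun y => \sum_j (nrm (f y 0 j - f z 0 j))%:C : C) z.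
  apply: ctn_sum => j _; apply: (@ctn_nrm _ _ C).
  by apply: ctn_add (cf j) _; exact: ctn_cst.
have [d d0 Hd] := H e e0; exists d => // y /Hd.
rewrite [X in _ - X]big1 => [|j _]; last by rewrite subrr nrm0.
rewrite subr0 -rmorph_sum nrmR ger0_norm; last first.
  by rewrite sumr_ge0 // => j _; exact: nrm_ge0.
apply: le_lt_trans; apply: le_trans (nrm_row_le _) _.
by apply: ler_sum => j _; rewrite !mxE.
Qed.

Lemma ctn_coord (W : normedModType C) n (f : W -> 'rV[C]_n) z j :
  ctn f z -> ctn (fun y => f y 0 j) z.
Proof.
move=> cf e /cf[d d0 Hd]; exists d => // y /Hd; apply: le_lt_trans.
by have := coord_nrm (f y - f z) j; rewrite !mxE.
Qed.

Lemma hder_coord (S : set C) (W : normedModType C) n (f : W -> 'rV[C]_n) z v d j :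
  hder S f z v d -> hder S (fun y => f y 0 j) z v (d 0 j).
Proof.
move=> H e /H[r r0 Hr]; exists r => // h Sh hr; apply: le_trans (Hr h Sh hr).
by have := coord_nrm (f (z + h *: v) - f z - h *: d) j; rewrite !mxE.
Qed.

Lemma hder_row (S : set C) (W : normedModType C) n (f : W -> 'rV[C]_n) z v
    (d : 'I_n -> C) :
  (forall j, hder S (fun y => f y 0 j) z v (d j)) ->
  hder S f z v (\row_j d j).
Proof.
move=> H e e0.
have n1 : 0 < n.+1%:R :> R by [].
have en : 0 < e / n.+1%:R by rewrite divr_gt0.
have [r r0 Hr] : exists2 r : R, 0 < r & forall j (h : C), S h -> nrm h < r ->
    nrm (f (z + h *: v) 0 j - f z 0 j - h *: d j) <= e / n.+1%:R * nrm h.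
  have : forall j, exists r : R, 0 < r /\ forall (h : C), S h -> nrm h < r ->
    nrm (f (z + h *: v) 0 j - f z 0 j - h *: d j) <= e / n.+1%:R * nrm h.
    by move=> j; have [r r0 Hr] := H j _ en; exists r.
  move=> /choice[r Hr]; exists (\big[Num.min/1]_j r j).
    by apply: lt_bigmin => // j _; case: (Hr j).
  move=> j h Sh hr; apply: (Hr j).2 => //; apply: lt_le_trans hr _.
  exact: bigmin_le_cond.
exists r => // h Sh hr; apply: le_trans (nrm_row_le _) _.
apply: le_trans (_ : \sum_(j < n) e / n.+1%:R * nrm h <= _).
  by apply: ler_sum => j _; rewrite !mxE; exact: Hr.
rewrite sumr_const card_ord -[leLHS]mulr_natl mulrA ler_wpM2r ?nrm_ge0 //.
by rewrite mulrCA ler_piMr ?ltW // ltr_pdivrMr // mul1r ltr_nat.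
Qed.

Section Euclidean.
Variable n : nat.
Implicit Types (g : 'rV[C]_n -> C) (A : set 'rV[C]_n).
Local Notation "''e_' j" := (delta_mx 0 j : 'rV[C]_n) (at level 8, j at level 2).

(** The real differential of [g] at [z], split into its complex linear and antilinear parts. *)
Definition dW g (z h : 'rV[C]_n) : C :=
  \sum_j (h 0 j * wirtinger 'e_j g z + (conjc (h 0 j)) * wirtinger_bar 'e_j g z).

Lemma frechet A g z : open A -> CkV 1 A g -> A z ->
  forall e : R, 0 < e -> exists2 r : R, 0 < r & forall h, nrm h < r ->
    nrm (g (z + h) - g z - dW g z h) <= e * nrm h.
Proof.
move=> oA Hg Az e e0.
(* The real basis e_j, i e_j of C^n, with coordinates the real and imaginary parts of h. *)
pose v (i : bool * 'I_n) : 'rV[C]_n := if i.1 then 'i%C *: 'e_i.2 else 'e_i.2.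
have K0 : 0 < (2 * n).+1%:R :> R by [].
have eK : 0 < e / (2 * n).+1%:R by rewrite divr_gt0.
have [q q0 Hq] := strict_der_sum (index_enum (bool * 'I_n)%type) v oA Hg Az eK.
exists q => // h hq.
pose t (i : bool * 'I_n) : R := if i.1 then complex.Im (h 0 i.2) else complex.Re (h 0 i.2).
have tn i : `|t i| <= nrm h.
  rewrite /t; case: i => [[] j] /=; apply: le_trans (coord_nrm h j);
    [exact: Im_le_nrm|exact: Re_le_nrm].
have := Hq z t; rewrite subrr nrm0 => /(_ q0).
move=> /(_ (fun i => le_lt_trans (tn i) hq)) H.
have two (W : zmodType) (F : bool * 'I_n -> W) :
    \sum_i F i = \sum_j (F (false, j) + F (true, j)).
  transitivity (\sum_b \sum_j F (b, j)).
    by rewrite pair_bigA /=; apply: eq_bigr => -[].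
  by rewrite exchange_big /=; apply: eq_bigr => j _; rewrite big_bool addrC.
have Eh : \sum_i (t i)%:C *: v i = h.
  rewrite two [RHS]row_sum_delta; apply: eq_bigr => j _.
  rewrite /t /v /= scalerA -scalerDl; congr (_ *: _).
  by rewrite [RHS]complexE mulrC.
have Ed : \sum_i (t i)%:C * rderive (v i) g z = dW g z h.
  rewrite two; apply: eq_bigr => j _.
  have [/rder_rderive H1 /rder_rderive H2] := CkV_isW 'e_j Hg Az.
  rewrite /t /v /= H1 H2; set a := wirtinger _ _ _; set b := wirtinger_bar _ _ _.
  set x := h 0 j.
  have -> : x * a = ((complex.Re x)%:C + 'i%C * (complex.Im x)%:C) * a by rewrite -complexE.
  rewrite (conjcE x); ring.
rewrite Eh Ed in H; apply: le_trans H _.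
have Et : \sum_i `|t i| <= (2 * n)%:R * nrm h.
  apply: le_trans (_ : \sum_(i : bool * 'I_n) nrm h <= _); first exact: ler_sum.
  by rewrite sumr_const card_prod card_bool card_ord mulr_natl.
apply: le_trans (ler_wpM2l (ltW eK) Et) _.
rewrite mulrA ler_wpM2r ?nrm_ge0 // mulrAC ler_pdivrMr // ler_wpM2l ?ltW //.
by rewrite ltr_nat.
Qed.

(** Only the remainder of the expansion of [g] is estimated. The derivative of the linear part along
    [f] is left as a hypothesis, since for complex increments it exists only when the antilinear
    part drops out. *)
Lemma chain_gen (S : set C) (W : normedModType C) A g (f : W -> 'rV[C]_n) y v
    (d : 'I_n -> C) D :
  open A -> CkV 1 A g -> A (f y) ->
  (forall j, hder S (fun x => f x 0 j) y v (d j)) ->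
  hder S (fun x => dW g (f y) (f x)) y v D ->
  hder S (fun x => g (f x)) y v D.
Proof.
move=> oA Hg Afy Hf HD.
suff H0 : hder S (fun x => g (f x) + - dW g (f y) (f x)) y v 0.
  have := hder_add H0 HD; rewrite add0r; apply: hder_ext; near=> x.
  by rewrite subrK.
have dWB a b : dW g (f y) (a - b) = dW g (f y) a - dW g (f y) b.
  rewrite /dW -sumrB; apply: eq_bigr => j _; rewrite !mxE rmorphB /=; ring.
move=> e e0.
have [p p0 Hp] := hder_lip (hder_row Hf); set L := 1 + _ in Hp.
have L0 : 0 < L by rewrite ltr_pwDl ?nrm_ge0.
have [|r r0 Hr] := frechet oA Hg Afy (e := e / L); first by rewrite divr_gt0.
exists (Num.min p (r / L)); first by rewrite lt_min p0 divr_gt0.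
move=> h Sh; rewrite lt_min => /andP[hp]; rewrite ltr_pdivlMr // => hr.
have h1 := Hp h Sh hp.
have h2 : nrm (f (y + h *: v) - f y) < r.
  by apply: le_lt_trans h1 _; rewrite mulrC.
have key : f y + (f (y + h *: v) - f y) = f (y + h *: v) by rewrite addrC subrK.
have h3 := Hr _ h2; rewrite key dWB in h3.
rewrite scaler0 subr0 sub4ACA.
apply: le_trans h3 _; apply: le_trans (ler_wpM2l _ h1) _; first by rewrite divr_ge0 // ltW.
by rewrite mulrA divfK // gt_eqF.
Unshelve. all: by end_near. Qed.

Lemma chain_real (W : normedModType C) A g (f : W -> 'rV[C]_n) y v d :
  open A -> CkV 1 A g -> A (f y) ->
  (forall j, hder Sreal (fun x => f x 0 j) y v (d j)) ->
  hder Sreal (fun x => g (f x)) y v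
    (\sum_j (d j * wirtinger 'e_j g (f y) + (conjc (d j)) * wirtinger_bar 'e_j g (f y))).
Proof.
move=> oA Hg Afy Hf; apply: (chain_gen oA Hg Afy Hf).
apply: hder_sum => j _; apply: hder_add.
  rewrite -[X in hder _ _ _ _ X]addr0 -[X in _ + X](mulr0 (f y 0 j)).
  by apply: hder_mul (Hf j) _; exact: hder_cst.
rewrite -[X in hder _ _ _ _ X]addr0 -[X in _ + X](mulr0 ((conjc (f y 0 j)))).
by apply: hder_mul (rder_conj (Hf j)) _; exact: hder_cst.
Qed.

Lemma chain_hol (S : set C) (W : normedModType C) A g (f : W -> 'rV[C]_n) y v d :
  open A -> CkV 1 A g -> A (f y) -> (forall j, wirtinger_bar 'e_j g (f y) = 0) ->
  (forall j, hder S (fun x => f x 0 j) y v (d j)) ->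
  hder S (fun x => g (f x)) y v (\sum_j d j * wirtinger 'e_j g (f y)).
Proof.
move=> oA Hg Afy g0 Hf; apply: (chain_gen oA Hg Afy Hf).
apply: hder_sum => j _; rewrite -[X in hder _ _ _ _ X]addr0; apply: hder_add.
  rewrite -[X in hder _ _ _ _ X]addr0 -[X in _ + X](mulr0 (f y 0 j)).
  by apply: hder_mul (Hf j) _; exact: hder_cst.
rewrite g0; apply: hder_ext (hder_cst S (0 : C) y v).
by near=> x; rewrite mulr0.
Unshelve. all: by end_near. Qed.

Lemma isW_comp (W : normedModType C) A g (f : W -> 'rV[C]_n) y v d db :
  open A -> CkV 1 A g -> A (f y) ->
  (forall j, isW (fun x => f x 0 j) y v (d j) (db j)) ->
  isW (fun x => g (f x)) y v
    (\sum_j (d j * wirtinger 'e_j g (f y) + (conjc (db j)) * wirtinger_bar 'e_j g (f y)))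
    (\sum_j (db j * wirtinger 'e_j g (f y) + (conjc (d j)) * wirtinger_bar 'e_j g (f y))).
Proof.
move=> oA Hg Afy Hf; split.
  have := chain_real oA Hg Afy (fun j => (Hf j).1).
  rewrite -big_split /= (eq_bigr (fun j => (d j * wirtinger 'e_j g (f y) +
   (conjc (db j)) * wirtinger_bar 'e_j g (f y) + (db j * wirtinger 'e_j g (f y) +
   (conjc (d j)) * wirtinger_bar 'e_j g (f y))))) // => j _.
  rewrite rmorphD /=; ring.
have := chain_real oA Hg Afy (fun j => (Hf j).2).
rewrite !mulr_sumr -sumrB (eq_bigr (fun j => ('i%C * (d j * wirtinger 'e_j g (f y) +
   (conjc (db j)) * wirtinger_bar 'e_j g (f y)) - 'i%C * (db j * wirtinger 'e_j g (f y) +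
   (conjc (d j)) * wirtinger_bar 'e_j g (f y))))) // => j _.
rewrite rmorphB !rmorphM /=.
have -> : Complex 0 (-1) = - 'i%C :> C by apply: complexP; rewrite /= ?oppr0.
ring.
Qed.

(** Induction on k: the derivative of the composite is a polynomial in the derivatives of [f], their
    conjugates, and the Wirtinger derivatives of [g] composed with [f]. *)
Lemma CkV_comp (W : normedModType C) k (B : set W) A g (f : W -> 'rV[C]_n) :
  open B -> open A -> (forall y, B y -> A (f y)) -> CkV k A g ->
  (forall j, CkV k B (fun y => f y 0 j)) -> CkV k B (fun y => g (f y)).
Proof.
move=> oB oA BA; elim: k g => [|k IH] g Hg Hf.
  split=> // y By; apply: ctn_comp (CkV_ctn Hg (BA y By)).
  by apply: ctn_row => j; exact: CkV_ctn (Hf j) By.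
pose D v y := \sum_j (rderive v (fun x => f x 0 j) y * wirtinger 'e_j g (f y) +
   (conjc (rderive v (fun x => f x 0 j) y)) * wirtinger_bar 'e_j g (f y)).
apply: (@CkV_intro _ _ k B _ D) => //.
- move=> y By; apply: ctn_comp (CkV_ctn Hg (BA y By)).
  by apply: ctn_row => j; exact: CkV_ctn (Hf j) By.
- move=> v y By; apply: chain_real oA _ (BA y By) _; first exact: CkV_le Hg.
  by move=> j; exact: (CkV_der v (Hf j) By).
- move=> v; apply: CkV_sum => // j _; apply: CkV_add => //; apply: CkV_mul => //.
  + exact: CkV_rderive.
  + by apply: IH; [exact: CkV_wirtinger|move=> i; exact: CkV_pred].
  + by apply: CkV_conj => //; exact: CkV_rderive.
  + by apply: IH; [exact: CkV_wirtinger_bar|move=> i; exact: CkV_pred].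
Qed.

Lemma isW_dir A g z v : open A -> CkV 1 A g -> A z ->
  isW g z v (\sum_j v 0 j * wirtinger 'e_j g z)
            (\sum_j (conjc (v 0 j)) * wirtinger_bar 'e_j g z).
Proof.
move=> oA Hg Az.
have Hc j : isW (fun x : 'rV[C]_n => x 0 j) z v (v 0 j) 0.
  by apply: isW_hol; apply: hder_coord (hder_id _ _ _).
have := isW_comp (f := fun x => x) oA Hg Az Hc.
rewrite (eq_bigr (fun j => v 0 j * wirtinger 'e_j g z)) => [|j _]; last first.
  by rewrite rmorph0 mul0r addr0.
rewrite [X in isW _ _ _ _ X](eq_bigr (fun j => (conjc (v 0 j)) * wirtinger_bar 'e_j g z)) //.
by move=> j _; rewrite mul0r add0r.
Qed.

Lemma hol_coord j : hol setT (fun z : 'rV[C]_n => z 0 j).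
Proof.
move=> z _; split; first by apply: ctn_coord; exact: ctn_id.
by move=> v; exists (v 0 j); apply: hder_coord (hder_id _ _ _).
Qed.

Lemma hol_wirtinger A g z v : hol A g -> A z ->
  wirtinger v g z = dv v g z /\ wirtinger_bar v g z = 0.
Proof.
move=> Hg Az; have /isW_hol H := hol_dv v Hg Az.
by rewrite (isW_wirtinger H) (isW_bar H).
Qed.

Lemma hol_differentiable A g z : open A -> hol A g -> A z -> differentiable g z.
Proof.
move=> oA Hg Az; have H1 := CkV_hol 1 oA Hg.
pose L (h : 'rV[C]_n) : C := \sum_j h 0 j * wirtinger 'e_j g z.
have linL : linear L.
  move=> a x y; rewrite /L /GRing.scale /= mulr_sumr -big_split; apply: eq_bigr => j _.
  by rewrite /= !mxE; ring.
pose LL := GRing.isLinear.Build _ _ _ _ L linL.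
pose Lin : {linear 'rV[C]_n -> C} := HB.pack L LL.
have cL : continuous Lin.
  move=> y; apply/ctnP; apply: ctn_sum => j _; apply: ctn_mul; last exact: ctn_cst.
  by apply: ctn_coord; exact: ctn_id.
have U := @diff_unique _ _ _ g Lin z cL.
(* The premise of [diff_unique], the first order expansion of g at z, is read off its type. *)
have E : ltac:(match type of U with ?P -> _ => exact P end).
  apply/eqaddoP => e e0.
  have er : e = (complex.Re e)%:C.
    by move: e0; case: (e) => a b; rewrite ltcE /= => /andP[/eqP -> _].
  have e1 : 0 < complex.Re e by rewrite -ltcR -er.
  have [r r0 Hr] := frechet oA H1 Az e1.
  apply/(nbhs_nrm (0 : 'rV[C]_n)); exists r => // h; rewrite subr0 => /Hr.
  rewrite -lecR rmorphM /= -!nrmE -er; apply: le_trans.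
  rewrite le_eqVlt; apply/orP; left; apply/eqP; congr `|_|.
  rewrite -[LHS]/(g (h + z) - (g z + L h)) [h + z]addrC opprD addrA; congr (_ - _).
  apply: eq_bigr => j _; have [_ ->] := hol_wirtinger 'e_j Hg Az.
  by rewrite mulr0 addr0.
by apply/diff_locallyP; rewrite (U E).
Qed.

End Euclidean.

Lemma differentiable_hol (V : normedModType C) (A : set V) (g : V -> C) :
  (forall z, A z -> differentiable g z) -> hol A g.
Proof.
move=> dg z Az; split; first by apply/ctnP/differentiable_continuous/dg.
by move=> v; exists ('D_v g z); apply/cderP; split => //; apply/diff_derivable/dg.
Qed.

Lemma holomorphic_on_coord m n (A : set 'rV[C]_m) (f : 'rV[C]_m -> 'rV[C]_n) j :
  holomorphic_on A f -> hol A (fun z => f z 0 j).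
Proof.
move=> Hf z Az; have df := Hf z Az; split.
  by apply: ctn_coord; apply/ctnP/differentiable_continuous.
move=> v; exists (('D_v f z) 0 j); apply: hder_coord; apply/cderP.
by split => //; exact: diff_derivable.
Qed.

Lemma jacobianE m n (f : 'rV[C]_m -> 'rV[C]_n) p i j : differentiable f p ->
  'J f p i j = dv (delta_mx 0 i) (fun z => f z 0 j) p.
Proof.
move=> df; have /deriveEjacobian E := df.
have := E (delta_mx 0 i); rewrite -rowE => /(congr1 (fun M : 'rV[C]_n => M 0 j)).
rewrite !mxE => <-; apply/esym/dvE/hder_coord/cderP; split => //.
exact: diff_derivable.
Qed.

End ChainRule.

(** * Smooth bump functions *)

Section FlatFunction.
Variable R : realType.
Local Notation C := R[i].
Local Notation nrm := (@nrm R _).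

(* Derivatives of [flat m] are linear combinations of [flat k]'s. *)
Definition flat (m : nat) (x : R) : R :=
  if 0 < x then x^-1 ^+ m * expR (- x^-1) else 0.

Definition rdiff (u : R -> R) (x d : R) : Prop := forall e : R, 0 < e ->
  exists2 r : R, 0 < r &
    forall h, `|h| < r -> `|u (x + h) - u x - h * d| <= e * `|h|.

Lemma flat_ge0 m x : 0 <= flat m x.
Proof.
rewrite /flat; case: ifP => // x0; apply: mulr_ge0; last exact: expR_ge0.
by rewrite exprn_ge0 // invr_ge0 ltW.
Qed.

(** From y^(m+1) / (m+1)! <= exp y at y = 1/x. Applied to m + 1, this bound gives the derivative 0
    at the origin. *)
Lemma flat_le m x : 0 < x -> flat m x <= m.+1`!%:R * x.
Proof.
move=> x0; rewrite /flat x0.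
have y0 : 0 < x^-1 by rewrite invr_gt0.
have H : x^-1 ^+ m.+1 / m.+1`!%:R <= expR x^-1.
  by apply: le_trans (expR_ge1Dxn m (ltW y0)); rewrite lerDr.
rewrite expRN ler_pdivrMr ?expR_gt0 //.
have -> : x^-1 ^+ m = x * x^-1 ^+ m.+1 by rewrite exprS mulrA divff ?gt_eqF // mul1r.
have -> : m.+1`!%:R * x * expR x^-1 = x * (m.+1`!%:R * expR x^-1) by ring.
apply: ler_wpM2l; first exact: ltW.
by move: H; rewrite ler_pdivrMr ?ltr0n ?fact_gt0 // mulrC.
Qed.

Lemma flat_der m x : rdiff (flat m) x (flat m.+2 x - m%:R * flat m.+1 x).
Proof.
case: (ltrgtP x 0) => [x0|x0|->].
- move=> e e0; exists (- x); first by rewrite oppr_gt0.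
  move=> h hx; have xh : x + h < 0.
    by move: (ler_norm h) => ?; lra.
  rewrite /flat !ltNge (ltW x0) (ltW xh) /= mulr0 !subrr mulr0 subrr normr0.
  by rewrite mulr_ge0 // ltW.
- apply/real_derP.
  have xn0 : x != 0 by rewrite gt_eqF.
  pose G y : R := y^-1 ^+ m * expR (- y^-1).
  have E : \forall y \near x, G y = flat m y.
    apply/nbhs_normP; exists x => //= y; rewrite /ball_ /= => yx.
    have y0 : 0 < y by move: (ler_norm (x - y)) => ?; lra.
    by rewrite /flat y0.
  have D : is_derive x (1 : R) G (flat m.+2 x - m%:R * flat m.+1 x).
    have D1 := @is_deriveV R id x 1 1 xn0 (is_derive_id x (1 : R)).
    have D2 := @is_deriveX _ _ _ m x 1 _ D1.
    have D4 := @is_derive1_comp _ expR _ x _ _ (is_derive_expR _) (is_deriveN D1).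
    have D5 := is_deriveM D2 D4.
    have EG : ((fun y : R => y^-1) ^+ m) * (expR \o (- (fun y : R => y^-1))) = G.
      apply/funext => y; rewrite /G -[LHS]/((((fun y : R => y^-1) ^+ m) y) * expR (- y^-1)).
      congr (_ * _); elim: (m) => [|k IH]; first by rewrite !expr0.
      by rewrite !exprS -IH.
    rewrite -EG; apply: (is_derive_eq D5).
    have -> : ((fun y : R => y^-1) ^+ m) x = x^-1 ^+ m.
      elim: (m) => [|k IH]; first by rewrite !expr0.
      by rewrite !exprS -IH.
    rewrite /GRing.scale /= /flat x0 !mulr1.
    rewrite -[expR (_ x)]/(expR (- x^-1)) -exprVn.
    by case: (m) => [|k] /=; rewrite ?mul0r ?mulr0 ?exprS; ring.
  have D' := near_eq_is_derive E D.
  by split; [case: D'|rewrite derive1E; apply: derive_val].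
- move=> e e0; have K0 : 0 < m.+2`!%:R :> R by rewrite ltr0n fact_gt0.
  exists (e / m.+2`!%:R); first by rewrite divr_gt0.
  move=> h; rewrite ltr_pdivlMr // => hr.
  have f0 k : flat k 0 = 0 by rewrite /flat ltxx.
  rewrite !f0 mulr0 subrr mulr0 !subr0 add0r.
  case: (ltrP 0 h) => h0; last first.
    by rewrite /flat ltNge h0 /= normr0 mulr_ge0 // ltW.
  rewrite ger0_norm ?flat_ge0 // ger0_norm ?(ltW h0) //.
  have -> : flat m h = h * flat m.+1 h.
    by rewrite /flat h0 exprS; field; rewrite gt_eqF.
  rewrite mulrC ler_wpM2r ?(ltW h0) //; apply: le_trans (flat_le _ h0) _.
  by rewrite ger0_norm ?(ltW h0) // in hr; rewrite mulrC ltW.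
Qed.

Lemma rdiff_comp (V : normedModType C) (u : R -> R) (rho : V -> R) z v d d' :
  rdiff u (rho z) d -> hder Sreal (fun y => (rho y)%:C : C) z v d' ->
  hder Sreal (fun y => (u (rho y))%:C : C) z v (d' * d%:C).
Proof.
move=> Hu Hr.
apply: (@hder_comp_gen _ Sreal V Sreal C (fun y => (rho y)%:C)
   (fun w => (u (complex.Re w))%:C) z v d' d%:C).
- by move=> h _; rewrite -rmorphB.
- move=> e /Hu[r r0 H]; exists r => // h /Sreal_E ->; rewrite nrmR => hr.
  have -> : (rho z)%:C + (complex.Re h)%:C%:A = (rho z + complex.Re h)%:C :> C.
    by rewrite rmorphD /GRing.scale /= mulr1.
  rewrite -[_ *: d%:C]/(_ * _) -rmorphM /= -!rmorphB nrmR.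
  exact: H.
- exact: Hr.
Qed.

Lemma rdiff_ctn (V : normedModType C) (u : R -> R) (rho : V -> R) z d :
  rdiff u (rho z) d -> ctn (fun y => (rho y)%:C : C) z ->
  ctn (fun y => (u (rho y))%:C : C) z.
Proof.
move=> Hu Hr e e0; have [r r0 H] := Hu 1 ltr01.
have n1 : 0 < 1 + `|d| by rewrite ltr_pwDl.
have [|p p0 Hp] := Hr (Num.min r (e / (1 + `|d|))).
  by rewrite lt_min r0 divr_gt0.
exists p => // y /Hp; rewrite -rmorphB nrmR lt_min ltr_pdivlMr // => /andP[h1 h2].
have := H _ h1; rewrite [rho z + _]addrC subrK mul1r => h3.
rewrite -rmorphB nrmR; apply: le_lt_trans h2.
have -> : u (rho y) - u (rho z) = (u (rho y) - u (rho z) - (rho y - rho z) * d) + (rho y - rho z) * d.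
  by rewrite subrK.
apply: le_trans (ler_normD _ _) _; rewrite normrM mulrDr mulr1.
by rewrite lerD2r.
Qed.

Lemma CkV_flat (V : normedModType C) (A : set V) (rho : V -> R) k m : open A ->
  (forall j, CkV j A (fun y => (rho y)%:C : C)) ->
  CkV k A (fun y => (flat m (rho y))%:C : C).
Proof.
move=> oA Hr; elim: k m => [|k IH] m.
  by split=> // z Az; apply: rdiff_ctn (flat_der m _) (CkV_ctn (Hr 0%N) Az).
apply: (@CkV_intro _ V k A _ (fun v z => rderive v (fun y => (rho y)%:C) z *
    (flat m.+2 (rho z) - m%:R * flat m.+1 (rho z))%:C)) => //.
- by move=> z Az; apply: rdiff_ctn (flat_der m _) (CkV_ctn (Hr 0%N) Az).
- move=> v z Az; apply: rdiff_comp; first exact: flat_der.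
  exact: (CkV_der v (Hr 1%N) Az).
- move=> v; apply: CkV_mul => //; first exact: CkV_rderive.
  have H := CkV_add oA (IH m.+2) (CkV_scale (- m%:R%:C) oA (IH m.+1)).
  by apply: CkV_ext H => // y _; rewrite rmorphB rmorphM mulNr.
Qed.

Lemma sum_small_squares n (r : R) :
  \sum_(j < n) (r / (2 * n.+1%:R)) ^+ 2 <= r ^+ 2 / 2.
Proof.
rewrite sumr_const card_ord -[n.+1%:R]natr1; have n0 := ler0n R n.
set m := n%:R in n0 *; have m0 : 2 * (m + 1) != 0 by rewrite mulf_neq0 // lt0r_neq0 ?ltr_wpDl.
rewrite -[X in X <= _]mulr_natl -/m expr_div_n mulrCA ler_wpM2l ?sqr_ge0 //.
rewrite ler_pdivrMr ?exprn_gt0 ?mulr_gt0 ?ltr_wpDl //; nra.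
Qed.

(** Two flat functions nested. The inner one vanishes while the squared distance rho is at most r^2
    / 2, so the outer one is constant there; for rho >= r^2 the factor [k0] makes the argument of
    the outer one nonpositive. *)
Lemma bump n (p : 'rV[C]_n) (r : R) : 0 < r -> exists chi : 'rV[C]_n -> C,
  [/\ forall k, CkV k setT chi,
      exists2 s : R, 0 < s & forall z : 'rV[C]_n, nrm (z - p) < s -> chi z = 1
    & forall (z : 'rV[C]_n) j, r < nrm (z 0 j - p 0 j) -> chi z = 0].
Proof.
move=> r0; pose rho (z : 'rV[C]_n) : R := \sum_j nrm (z 0 j - p 0 j) ^+ 2.
have oT : open [set: 'rV[C]_n] by exact: openT.
have Hrho j : CkV j setT (fun y => (rho y)%:C : C).
  have H i : CkV j setT (fun z : 'rV[C]_n => z 0 i - p 0 i).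
    apply: CkV_add => //; last exact: CkV_cst.
    by apply: CkV_hol => //; exact: hol_coord.
  have H2 := CkV_sum (index_enum 'I_n) (P := xpredT) oT
     (fun i _ => CkV_mul oT (H i) (CkV_conj oT (H i))).
  apply: CkV_ext H2 => // y _; rewrite /rho rmorph_sum; apply: eq_bigr => i _.
  by rewrite -sqr_normc nrmE rmorphXn.
pose dl := r ^+ 2 / 2.
have dl0 : 0 < dl by rewrite divr_gt0 // exprn_gt0.
have fp x : 0 < x -> 0 < flat 0 x.
  by move=> x0; rewrite /flat x0 mulr_gt0 ?exprn_gt0 ?invr_gt0 ?expR_gt0.
pose k0 := (flat 0 dl)^-1.
have k00 : 0 < k0 by rewrite invr_gt0 fp.
pose rho1 z := rho z - dl.
pose rho2 z := 1 - k0 * flat 0 (rho1 z).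
have H1 j : CkV j setT (fun y => (rho1 y)%:C : C).
  have := CkV_add oT (Hrho j) (CkV_cst j (- dl%:C) oT).
  by apply: CkV_ext => // y _; rewrite /rho1 rmorphB.
have H2 j : CkV j setT (fun y => (rho2 y)%:C : C).
  have := CkV_add oT (CkV_cst j 1 oT) (CkV_scale (- k0%:C) oT (CkV_flat j 0 oT H1)).
  by apply: CkV_ext => // y _; rewrite /rho2 rmorphB rmorph1 rmorphM mulNr.
exists (fun z => (flat 0 1)^-1%:C * (flat 0 (rho2 z))%:C); split.
- by move=> k; apply: CkV_scale => //; exact: CkV_flat.
- exists (r / (2 * n.+1%:R)); first by rewrite divr_gt0 // mulr_gt0.
  move=> z zp.
  have rz : rho z <= dl.
    apply: le_trans (_ : \sum_(j < n) (r / (2 * n.+1%:R)) ^+ 2 <= _).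
      apply: ler_sum => j _; rewrite ler_pXn2r ?nnegrE ?nrm_ge0 //.
        apply: le_trans (ltW zp); have := coord_nrm (z - p) j.
        by rewrite !mxE.
      by rewrite divr_ge0 ?mulr_ge0 // ltW.
    exact: sum_small_squares.
  have -> : rho2 z = 1.
    rewrite /rho2 /rho1 {1}/flat ltNge subr_le0 rz /= mulr0 subr0 //.
  by rewrite -rmorphM mulVf ?gt_eqF // fp.
- move=> z j zj; rewrite [X in _ * X%:C](_ : _ = 0) ?mulr0 //.
  have rz : r ^+ 2 <= rho z.
    rewrite /rho (bigD1 j) //=; apply: le_trans (_ : nrm (z 0 j - p 0 j) ^+ 2 <= _).
      by rewrite ler_pXn2r ?nnegrE ?nrm_ge0 ?(ltW r0) ?(ltW zj).
    by rewrite lerDl sumr_ge0 // => i _; rewrite exprn_ge0 ?nrm_ge0.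
  have d1 : dl <= rho1 z by rewrite /rho1 /dl; move: rz; lra.
  have f1 : flat 0 dl <= flat 0 (rho1 z).
    rewrite /flat dl0 (lt_le_trans dl0 d1) !expr0 !mul1r ler_expR lerN2.
    by rewrite lef_pV2 ?posrE // (lt_le_trans dl0 d1).
  rewrite /flat ltNge /rho2 (_ : 1 - _ <= 0) //.
  by rewrite subr_le0 -(@mulVf _ (flat 0 dl)) ?gt_eqF ?fp // ler_wpM2l // ltW.
Qed.

End FlatFunction.

(** * Calculus on the manifold *)

Section ManifoldCalculus.
Variables (R : realType) (n : nat) (X : complexManifold R n).
Local Notation C := R[i].
Local Notation nrm := (@nrm R _).
Local Notation hchart := (holo_chart X).
Local Notation "''e_' i" := (delta_mx 0 i : 'rV[C]_n) (at level 8, i at level 2).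
Implicit Types (c : hchart) (x : X) (z : 'rV[C]_n) (O : set X).

Definition cim c (O : set X) : set 'rV[C]_n := coords c @` (O `&` dom c).

Lemma cimE c O z : cim c O z <-> img c z /\ O (param c z).
Proof.
split.
  by move=> [x [Ox dx] <-]; rewrite (coordsK dx); split => //; exists x.
move=> [[x dx <-]]; rewrite (coordsK dx) => Ox; by exists x.
Qed.

Lemma imgP c z : img c z -> dom c (param c z) /\ coords c (param c z) = z.
Proof. by move=> [x dx <-]; rewrite (coordsK dx). Qed.

Lemma cim_coords c O x : dom c x -> O x -> cim c O (coords c x).
Proof. by move=> dx Ox; exists x. Qed.

Lemma cim_mono c O O' : O `<=` O' -> cim c O `<=` cim c O'.
Proof. by move=> h z /cimE[h1 /h h2]; apply/cimE. Qed.

Lemma cim_open c O : open O -> open (cim c O).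
Proof.
move=> oO; rewrite openE => z /cimE[iz Oz].
have [dz ez] := imgP iz.
have H1 : \forall y \near z, img c y by apply: open_near iz; exact: img_open.
have H2 : \forall y \near z, O (param c y).
  have := @param_continuous _ _ _ c _ dz; rewrite ez => /(_ O); apply.
  by move: oO; rewrite openE; exact.
by near=> y; apply/cimE; split; near: y.
Unshelve. all: by end_near. Qed.

Arguments cim_open c {O} _.

Lemma cimT c : cim c setT = img c.
Proof. by rewrite /cim setTI. Qed.

Lemma cim_dom c : cim c (dom c) = img c.
Proof. by rewrite /cim setIid. Qed.

Lemma tr_hol c c' j :
  hol (cim c (dom c')) (fun z => coords c' (param c z) 0 j).
Proof.
have [+ _] := atlas_compatible (chart_of_atlas c) (chart_of_atlas c').
by rewrite setIC => /(holomorphic_on_coord j).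
Qed.

Arguments tr_hol : clear implicits.

Lemma tr_hder c c' x v j : dom c x -> dom c' x ->
  hder setT (fun z => coords c' (param c z) 0 j) (coords c x) v
    ((v *m jac c c' x) 0 j).
Proof.
move=> dx dx'; have oA := cim_open c (@dom_open _ _ _ c').
have Az := cim_coords dx dx'.
have Hv := hol_dv v (tr_hol c c' j) Az.
suff <- : dv v (fun z => coords c' (param c z) 0 j) (coords c x) = (v *m jac c c' x) 0 j by [].
rewrite -(hol_wirtinger v (tr_hol c c' j) Az).1.
rewrite (isW_wirtinger (isW_dir v oA (CkV_hol 1 oA (tr_hol c c' j)) Az)) mxE.
apply: eq_bigr => i _; congr (_ * _); rewrite /jac jacobianE //.
  by rewrite (hol_wirtinger _ (tr_hol c c' j) Az).1.
have [+ _] := atlas_compatible (chart_of_atlas c) (chart_of_atlas c').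
by apply; exists x.
Qed.

Lemma row_e m (A : 'M[C]_(n, m)) i j : ((delta_mx 0 i : 'rV[C]_n) *m A) 0 j = A i j.
Proof. by rewrite -rowE mxE. Qed.

Lemma jac_dv c c' x i j : dom c x -> dom c' x ->
  jac c c' x i j = dv 'e_i (fun z => coords c' (param c z) 0 j) (coords c x).
Proof.
by move=> dx dx'; rewrite (dvE (tr_hder 'e_i j dx dx')) row_e.
Qed.

#[global] Opaque jac.

Lemma hol_ext (V : normedModType C) (A : set V) (f g : V -> C) : open A ->
  (forall y, A y -> f y = g y) -> hol A f -> hol A g.
Proof.
move=> oA fg Hf z Az; have [cf df] := Hf z Az; have E := eq_near oA Az fg; split.
  exact: ctn_ext cf.
by move=> v; have [d Hd] := df v; exists d; exact: hder_ext Hd.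
Qed.

Lemma jac_hol c c' i j : hol (cim c (dom c')) (fun z => jac c c' (param c z) i j).
Proof.
have oA := cim_open c (@dom_open _ _ _ c').
apply: hol_ext (hol_deriv 'e_i oA (tr_hol c c' j)) => // z /cimE[iz dz].
by have [dz1 ez] := imgP iz; have -> := jac_dv i j dz1 dz; rewrite ez.
Qed.

Lemma jac_cocycle c c' c'' x : dom c x -> dom c' x -> dom c'' x ->
  jac c c'' x = jac c c' x *m jac c' c'' x.
Proof.
move=> d1 d2 d3; apply/matrixP => i j.
have oA := cim_open c' (@dom_open _ _ _ c'').
have Az : cim c' (dom c'') (coords c' (param c (coords c x))).
  by rewrite (coordsK d1); exact: cim_coords.
have [_ bar] : True /\ forall k, wirtinger_bar 'e_k (fun z => coords c'' (param c' z) 0 j)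
    (coords c' (param c (coords c x))) = 0.
  by split => // k; apply: (hol_wirtinger _ (tr_hol c' c'' j) Az).2.
have H := chain_hol oA (CkV_hol 1 oA (tr_hol c' c'' j)) Az bar
  (fun k => tr_hder 'e_i k d1 d2).
have oB : open (cim c (dom c')) by apply: cim_open; exact: dom_open.
have H' : hder setT (fun z => coords c'' (param c z) 0 j) (coords c x) 'e_i
   (\sum_k (jac c c' x) i k * jac c' c'' x k j).
  have E : \forall y \near coords c x,
     coords c'' (param c' (coords c' (param c y))) 0 j = coords c'' (param c y) 0 j.
    apply: (@eq_near _ _ (cim c (dom c'))) => //; first exact: cim_coords.
    by move=> y /cimE[_ dy]; rewrite coordsK.
  have := hder_ext E H; congr (hder _ _ _ _ _); apply: eq_bigr => k _.
  rewrite row_e; congr (_ * _).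
  rewrite (hol_wirtinger _ (tr_hol c' c'' j) Az).1 (coordsK d1).
  by rewrite jac_dv.
by rewrite (jac_dv i j d1 d3) (dvE H') [RHS]mxE.
Qed.

Lemma jac_id c x : dom c x -> jac c c x = 1%:M.
Proof.
move=> dx; apply/matrixP => i j; rewrite jac_dv //.
have E : \forall y \near coords c x, (y : 'rV[C]_n) 0 j = coords c (param c y) 0 j.
  apply: (@eq_near _ _ (img c)); [exact: img_open|by exists x|].
  by move=> y /imgP[_ ->].
rewrite (dvE (hder_ext E (hder_coord j (@hder_id _ _ _ (coords c x) 'e_i)))).
by rewrite !mxE eqxx /= eq_sym.
Qed.

Lemma jacK c c' x : dom c x -> dom c' x -> jac c c' x *m jac c' c x = 1%:M.
Proof. by move=> d1 d2; rewrite -jac_cocycle // jac_id. Qed.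

Lemma mulmx1_det_neq0 m (A B : 'M[C]_m) : A *m B = 1%:M -> \det A != 0.
Proof.
move=> h; apply/negP => /eqP d; have := det_mulmx A B.
by rewrite h d mul0r det1 => /eqP; rewrite oner_eq0.
Qed.

Lemma det_jac_neq0 c c' x : dom c x -> dom c' x -> \det (jac c c' x) != 0.
Proof. by move=> d1 d2; apply: mulmx1_det_neq0 (jacK d1 d2). Qed.

Lemma scale_mul_rcomp (a : C) (v : 'rV[C]_n) (A B D : 'M[C]_n) : D = A *m B ->
  a *: (v *m D) = a *: (v *m A) *m B.
Proof. by move=> ->; rewrite -scalemxAl mulmxA. Qed.

Definition smf (O : set X) (g : X -> C) : Prop :=
  forall c k, CkV k (cim c O) (fun z => g (param c z)).

(** Any other chart is reached by composing with a transition map, which is holomorphic and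
    therefore smooth. *)
Lemma smf_chart c O g : open O -> O `<=` dom c ->
  (forall k, CkV k (cim c O) (fun z => g (param c z))) -> smf O g.
Proof.
move=> oO Od H c' k; have o1 := cim_open c oO; have o2 := cim_open c' oO.
have Hf j : CkV k (cim c' O) (fun z => coords c (param c' z) 0 j).
  apply: CkV_hol => // z Az; apply: (tr_hol c' c j); exact: cim_mono Az.
have Hm y : cim c' O y -> cim c O (coords c (param c' y)).
  by move=> /cimE[_ Oy]; apply: cim_coords => //; exact: Od.
apply: CkV_ext (CkV_comp o2 o1 Hm (H k) Hf) => //.
by move=> y /cimE[_ /Od dy]; rewrite coordsK.
Qed.

Lemma smf_mono O O' g : O `<=` O' -> smf O' g -> smf O g.
Proof. by move=> h H c k; apply: CkV_mono (H c k); exact: cim_mono. Qed.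

Lemma smf_local O g : open O ->
  (forall x, O x -> exists O', [/\ open O', O' x & smf O' g]) -> smf O g.
Proof.
move=> oO H c k; apply: CkV_local; first exact: cim_open.
move=> z /cimE[iz Oz]; have [Q [oQ xQ HQ]] := H _ Oz.
exists (cim c Q); split => //; first exact: cim_open.
by apply/cimE.
Qed.

Lemma smf_ext O f g : open O -> (forall x, O x -> f x = g x) -> smf O f -> smf O g.
Proof.
move=> oO fg H c k; apply: CkV_ext (H c k); first exact: cim_open.
by move=> z /cimE[_ /fg].
Qed.

Lemma smf_cst O (a : C) : open O -> smf O (fun=> a).
Proof. by move=> oO c k; apply: CkV_cst; exact: cim_open. Qed.

Lemma smf_add O f g : open O -> smf O f -> smf O g -> smf O (fun x => f x + g x).
Proof.
move=> oO Hf Hg c k; apply: (CkV_add (f := fun z => f (param c z)) (g := fun z => g (param c z))).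
  exact: cim_open.
all: by [].
Qed.

Lemma smf_mul O f g : open O -> smf O f -> smf O g -> smf O (fun x => f x * g x).
Proof.
move=> oO Hf Hg c k; apply: (CkV_mul (f := fun z => f (param c z)) (g := fun z => g (param c z))).
  exact: cim_open.
all: by [].
Qed.

Lemma smf_sum O (I : Type) (r : seq I) (F : I -> X -> C) : open O ->
  (forall i, smf O (F i)) -> smf O (fun x => \sum_(i <- r) F i x).
Proof.
move=> oO H c k; apply: (CkV_sum r (P := xpredT) (F := fun i z => F i (param c z))).
  exact: cim_open.
by move=> i _; apply: H.
Qed.

Lemma smf_smooth g : smf setT g <-> smooth_fun g.
Proof.
split=> H c k.
  by apply/Ck_CkV; have := H c k; rewrite cimT.
by rewrite cimT; apply/Ck_CkV; exact: H.
Qed.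

Lemma smf_jac c c' i j : smf (dom c `&` dom c') (fun x => jac c c' x i j).
Proof.
apply: (@smf_chart c); [by apply: openI; exact: dom_open|by move=> x []|].
move=> k; have oA : open (cim c (dom c `&` dom c')).
  by apply: cim_open; apply: openI; exact: dom_open.
by apply: CkV_hol => // z Az; apply: jac_hol; apply: cim_mono Az => x [].
Qed.

Lemma smf_vfield (V : vfield X) c j : smooth_vfield V ->
  smf (dom c) (fun x => V c x 0 j).
Proof.
move=> [_ _ H]; apply: (@smf_chart c) => //; first exact: dom_open.
by move=> k; apply/Ck_CkV; rewrite cim_dom; exact: H.
Qed.

Lemma smooth_vfieldP (V : vfield X) :
  (forall c x, ~ dom c x -> V c x = 0) ->
  (forall c c' x, dom c x -> dom c' x -> V c' x = V c x *m jac c c' x) ->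
  (forall c j, smf (dom c) (fun x => V c x 0 j)) -> smooth_vfield V.
Proof.
move=> H1 H2 H3; split => // c j k; apply/Ck_CkV.
by have := H3 c j c k; rewrite cim_dom.
Qed.

Lemma near_open O x : open O -> O x -> \forall y \near x, O y.
Proof. by rewrite openE => /(_ x). Qed.

Lemma box_compact z (r : R) : compact [set y : 'rV[C]_n | forall j, nrm (y 0 j - z 0 j) <= r].
Proof.
apply: (@rV_compact _ _ (fun j : 'I_n => [set w : C | nrm (w - z 0 j) <= r])) => j.
exact: disc_compact.
Qed.

(** The image K of a closed polydisc is compact, hence closed as the manifold is Hausdorff. Its
    complement [N] and [W] cover the manifold, so the bump function extends smoothly by 0. *)
Lemma cutoff c W p : open W -> W `<=` dom c -> W p ->
  exists (chi : X -> C) (N : set X),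
  [/\ smf setT chi, \forall y \near p, chi y = 1, open N,
      forall x, N x \/ W x & forall y, N y -> chi y = 0].
Proof.
move=> oW Wd Wp; have oA := cim_open c oW.
have dp := Wd _ Wp; have Ap := cim_coords dp Wp.
have [q q0 Hq] := (open_nrm _).1 oA _ Ap.
(* The norm of a row is at most the sum of its n coordinate norms; n r < q puts the closed polydisc
   inside the chart image. *)
pose r := q / n.+1%:R; have r0 : 0 < r by rewrite divr_gt0.
pose K' := [set z : 'rV[C]_n | forall j, nrm (z 0 j - coords c p 0 j) <= r].
have K'A : K' `<=` cim c W.
  move=> z Kz; apply: Hq; apply: le_lt_trans (nrm_row_le _) _.
  apply: (@le_lt_trans _ _ (\sum_(j < n) r)).
    by apply: ler_sum => j _; rewrite !mxE; exact: Kz.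
  rewrite sumr_const card_ord -mulr_natr /r mulrAC ltr_pdivrMr // ltr_pM2l //.
  by rewrite ltr_nat.
have cK : compact (param c @` K').
  apply: continuous_compact; last exact: box_compact.
  apply: continuous_in_subspaceT => z; rewrite inE => /K'A /cimE[iz _].
  by have [dz <-] := imgP iz; exact: param_continuous.
have clK := compact_closed (@carrier_hausdorff _ _ X) cK.
have [chi0 [S1 [s s0 S2] S3]] := bump (coords c p) r0.
pose chi x := if `[< W x >] then chi0 (coords c x) else 0.
have chiW x : W x -> chi x = chi0 (coords c x) by move=> Wx; rewrite /chi asboolT.
have chiN y : (~` (param c @` K')) y -> chi y = 0.
  rewrite /chi; case: asboolP => // Wy Ny; have dy := Wd _ Wy.
  have [j Hj] : exists j, ~ (nrm (coords c y 0 j - coords c p 0 j) <= r).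
    apply: contrapT => h; apply: Ny; exists (coords c y); last exact: coordsK.
    by move=> j; apply: contrapT => h'; apply: h; exists j.
  by apply: (S3 _ j); rewrite ltNge; apply/negP.
exists chi, (~` (param c @` K')); split => //.
- apply: smf_local; first exact: openT.
  move=> x _; case: (pselect (W x)) => Wx.
    exists W; split => //; apply: (@smf_chart c) => // k.
    apply: (@CkV_ext _ _ _ _ chi0) => //; last exact: CkV_mono (S1 k).
    by move=> z /cimE[iz Wz]; rewrite chiW // (imgP iz).2.
  exists (~` (param c @` K')); split; [exact: closed_openC| |].
    by move=> [z /K'A /cimE[_ Wz] zx]; apply: Wx; rewrite -zx.
  apply: (@smf_ext _ (fun=> 0)); [exact: closed_openC| |].
    by move=> y /chiN ->.
  by apply: smf_cst; exact: closed_openC.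
- have H1 : \forall y \near p, W y by exact: near_open.
  have H2 : \forall y \near p, nrm (coords c y - coords c p) < s.
    have H := @coords_continuous _ _ _ c _ dp.
    have N : \forall z \near coords c p, nrm (z - coords c p) < s.
      by apply/nbhs_nrm; exists s.
    by have := H _ N.
  near=> y; rewrite chiW; first by apply: S2; near: y.
  by near: y.
- exact: closed_openC.
- move=> x; case: (pselect (W x)) => Wx; [by right|left].
  by move=> [z /K'A /cimE[_ Wz] zx]; apply: Wx; rewrite -zx.
Unshelve. all: by end_near. Qed.

Lemma ext_fun c p (a : X -> C) : dom c p -> smf (dom c) a ->
  exists2 b, smooth_fun b & \forall y \near p, b y = a y.
Proof.
move=> dp Ha; have oW : open (dom c) by exact: dom_open.
have [chi [N [S S1 oN NW S0]]] := cutoff oW (fun x h => h) dp.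
exists (fun x => chi x * a x); last by near=> y; rewrite (near S1 y) // mul1r.
apply/smf_smooth/smf_local; first exact: openT.
move=> x _; case: (NW x) => h.
  exists N; split => //; apply: (@smf_ext _ (fun=> 0)) => //; last exact: smf_cst.
  by move=> y /S0 ->; rewrite mul0r.
by exists (dom c); split => //; apply: smf_mul => //; exact: smf_mono S.
Unshelve. all: by end_near. Qed.

(** A connection accepts only global fields; a cutoff extends a local one without changing its germ
    at p. *)
Lemma ext_field c p (v : X -> 'rV[C]_n) : dom c p ->
  (forall j, smf (dom c) (fun x => v x 0 j)) ->
  exists2 V, smooth_vfield V & \forall y \near p, V c y = v y.
Proof.
move=> dp Hv; have oW : open (dom c) by exact: dom_open.
have [chi [N [S S1 oN NW S0]]] := cutoff oW (fun x h => h) dp.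
pose V : vfield X := fun c' x =>
  if `[< dom c' x >] then chi x *: (v x *m jac c c' x) else 0.
have VE c' x : dom c' x -> V c' x = chi x *: (v x *m jac c c' x).
  by move=> h; rewrite /V asboolT.
exists V; last first.
  have H : \forall y \near p, dom c y by exact: near_open.
  near=> y; have dy : dom c y by near: y.
  by rewrite VE // jac_id // mulmx1 (near S1 y) // scale1r.
apply: smooth_vfieldP.
- by move=> c' x h; rewrite /V asboolF.
- move=> c1 c2 x d1 d2; rewrite !VE //; case: (NW x) => [/S0 ->|dx].
    by move: (jac c c1 x) (jac c c2 x) (jac c1 c2 x) => A B D; rewrite !scale0r mul0mx.
  exact/scale_mul_rcomp/jac_cocycle.
- move=> c' j; have oD : open (dom c') by exact: dom_open.
  apply: smf_local => // x dx; case: (NW x) => [Nx|dx'].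
    have oI := openI oN oD; exists (N `&` dom c'); split => //.
    apply: (@smf_ext _ (fun=> 0)) => //; last exact: smf_cst.
    by move=> y [/S0 h h']; rewrite VE // h scale0r mxE.
  have oI := openI oW oD; exists (dom c `&` dom c'); split => //.
  apply: (@smf_ext _ (fun x => chi x * \sum_k v x 0 k * jac c c' x k j)) => //.
    by move=> y [h h']; rewrite VE // !mxE.
  apply: smf_mul => //; first exact: smf_mono S.
  apply: smf_sum => // k; apply: smf_mul => //; last exact: smf_jac.
  by apply: smf_mono (Hv k) => y [].
Unshelve. all: by end_near. Qed.

End ManifoldCalculus.

Arguments cim_open {R n X} c {O} _.
Arguments tr_hol {R n X} c c' j.

(** * Connections and projective equivalence *)

Section Connections.
Variables (R : realType) (n : nat) (X : complexManifold R n).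
Local Notation C := R[i].
Local Notation nrm := (@nrm R _).
Local Notation hchart := (holo_chart X).
Local Notation "''e_' i" := (delta_mx 0 i : 'rV[C]_n) (at level 8, i at level 2).
Implicit Types (c : hchart) (x : X) (z : 'rV[C]_n) (O : set X) (U V : vfield X).

Lemma near_param c x (P : X -> Prop) : dom c x -> (\forall y \near x, P y) ->
  \forall z \near coords c x, P (param c z).
Proof.
move=> dx H; have := @param_continuous _ _ _ c _ dx.
by move=> H0; apply: H0; rewrite (coordsK dx).
Qed.

Lemma near_dom c x : dom c x -> \forall y \near x, dom c y.
Proof. by move=> dx; apply: near_open => //; exact: dom_open. Qed.

Lemma smf_isW c O a x v : open O -> smf O a -> O x -> dom c x ->
  isW (fun z => a (param c z)) (coords c x) v
    (wirtinger v (a \o param c) (coords c x))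
    (wirtinger_bar v (a \o param c) (coords c x)).
Proof.
move=> oO Ha Ox dx.
by apply: (CkV_isW (k := 0) v (Ha c 1%N)); exact: cim_coords.
Qed.

Lemma vderive_near O U a b c x : open O -> O x -> dom c x -> smf O a ->
  (\forall y \near x, a y = b y) -> vderive U a c x = vderive U b c x.
Proof.
move=> oO Ox dx Ha E; apply: eq_bigr => i _; congr (_ * _); apply/esym.
apply: isW_wirtinger; apply: isW_ext (smf_isW 'e_i oO Ha Ox dx).
exact: (near_param dx (P := fun y => a y = b y)).
Qed.

Lemma vderiveE O U a c x : open O -> O x -> dom c x -> smf O a ->
  vderive U a c x = wirtinger (U c x) (a \o param c) (coords c x).
Proof.
move=> oO Ox dx Ha; apply/esym; apply: isW_wirtinger.
apply: (isW_dir (g := a \o param c) (U c x) (cim_open c oO) (Ha c 1%N)).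
exact: cim_coords.
Qed.

Lemma vderive_chart O U a c c' x : open O -> O x -> dom c x -> dom c' x ->
  smf O a -> U c' x = U c x *m jac c c' x -> vderive U a c' x = vderive U a c x.
Proof.
move=> oO Ox dx dx' Ha EU; rewrite (vderiveE _ oO Ox dx Ha).
have Ax : cim c' O (coords c' (param c (coords c x))).
  by rewrite (coordsK dx); exact: cim_coords.
have H := isW_comp (g := a \o param c') (cim_open c' oO) (Ha c' 1%N) Ax
  (fun j => isW_hol (tr_hder (U c x) j dx dx')).
apply/esym; apply: isW_wirtinger.
have E : \forall z \near coords c x,
    (a \o param c') (coords c' (param c z)) = (a \o param c) z.
  apply: (near_param dx (P := fun y => (a \o param c') (coords c' y) = a y)).
  by near=> y; rewrite /= coordsK //; near: y; exact: near_dom.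
have {H} := isW_ext E H; congr (isW _ _ _ _ _).
rewrite /vderive EU (coordsK dx); apply: eq_bigr => j _.
by rewrite conjc0 mul0r addr0.
Unshelve. all: by end_near. Qed.

Lemma smooth_vadd U V : smooth_vfield U -> smooth_vfield V -> smooth_vfield (vadd U V).
Proof.
move=> HU HV; apply: smooth_vfieldP.
- by move=> c x h; case: HU => h1 _ _; case: HV => h2 _ _; rewrite /vadd h1 // h2 // addr0.
- move=> c c' x h h'; case: HU => _ h1 _; case: HV => _ h2 _.
  by rewrite /vadd mulmxDl -h1 // -h2.
- move=> c j; apply: (@smf_ext _ _ _ _ (fun x => U c x 0 j + V c x 0 j)).
  + exact: dom_open.
  + by move=> x _; rewrite mxE.
  + by apply: smf_add; [exact: dom_open|exact: smf_vfield|exact: smf_vfield].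
Qed.

Lemma smooth_vscale a U : smooth_fun a -> smooth_vfield U -> smooth_vfield (vscale a U).
Proof.
move=> /smf_smooth Ha HU; apply: smooth_vfieldP.
- by move=> c x h; case: HU => h1 _ _; rewrite /vscale h1 // scaler0.
- move=> c c' x h h'; case: HU => _ h1 _.
  by rewrite /vscale -scalemxAl -h1.
- move=> c j; apply: (@smf_ext _ _ _ _ (fun x => a x * U c x 0 j)).
  + exact: dom_open.
  + by move=> x _; rewrite mxE.
  + by apply: smf_mul; [exact: dom_open|exact: smf_mono Ha|exact: smf_vfield].
Qed.

Definition vsum (r : seq 'I_n) (F : 'I_n -> vfield X) : vfield X :=
  fun c x => \sum_(i <- r) F i c x.

Lemma vsum_cons i r F : vsum (i :: r) F = vadd (F i) (vsum r F).
Proof. by apply/funext => c; apply/funext => x; rewrite /vsum big_cons. Qed.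

Lemma smooth_cst (k : C) : smooth_fun (fun _ : X => k).
Proof. by apply/smf_smooth/smf_cst; exact: openT. Qed.

Lemma vsum_nil F U : vsum [::] F = vscale (cst 0) U.
Proof.
by apply/funext => c; apply/funext => x; rewrite /vsum big_nil /vscale /= scale0r.
Qed.

Lemma smooth_vsum r F U : smooth_vfield U -> (forall i, smooth_vfield (F i)) ->
  smooth_vfield (vsum r F).
Proof.
move=> HU HF; elim: r => [|i r IH]; last by rewrite vsum_cons; exact: smooth_vadd.
by rewrite (vsum_nil F U); apply: smooth_vscale => //; exact: smooth_cst.
Qed.

Lemma coord_field c x (v : 'rV[C]_n) : dom c x ->
  exists2 V, smooth_vfield V & \forall y \near x, V c y = v.
Proof.
move=> dx; apply: (ext_field (v := fun=> v)) => // j.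
by apply: smf_cst; exact: dom_open.
Qed.

Lemma coord_frame c x : dom c x -> exists E : 'I_n -> vfield X,
  forall i, smooth_vfield (E i) /\ \forall y \near x, E i c y = 'e_i.
Proof.
move=> dx; have H (i : 'I_n) : exists V, smooth_vfield V /\ \forall y \near x, V c y = 'e_i.
  by have [V h1 h2] := coord_field 'e_i dx; exists V.
by have [E HE] := boolp.choice H; exists E.
Qed.

Lemma coord_funs c x V : dom c x -> smooth_vfield V ->
  exists b : 'I_n -> X -> C,
  forall i, smooth_fun (b i) /\ \forall y \near x, b i y = V c y 0 i.
Proof.
move=> dx HV; have H (i : 'I_n) : exists f, smooth_fun f /\ \forall y \near x, f y = V c y 0 i.
  by have [b h1 h2] := ext_fun dx (smf_vfield c i HV); exists b.
by have [b Hb] := boolp.choice H; exists b.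
Qed.

Lemma mul_rowE (v : 'rV[C]_n) (A : 'M[C]_n) k : (v *m A) 0 k = \sum_l v 0 l * A l k.
Proof. by rewrite mxE. Qed.

Lemma near_all (T : topologicalType) (I : finType) (x : T) (P : I -> T -> Prop) :
  (forall i, \forall y \near x, P i y) -> \forall y \near x, forall i, P i y.
Proof.
move=> H; have : \forall y \near x, forall i, i \in enum I -> P i y.
  elim: (enum I) => [|i r IH]; first by near=> y.
  have Hi := H i; near=> y => j; rewrite inE => /orP[/eqP ->|jr]; first by near: y.
  by move: j jr; near: y.
by apply: filterS => y Hy i; apply: Hy; rewrite mem_enum.
Unshelve. all: by end_near. Qed.

Lemma decomp c x V E b : dom c x ->
  (forall i, smooth_vfield (E i) /\ \forall y \near x, E i c y = 'e_i) ->
  (forall i, smooth_fun (b i) /\ \forall y \near x, b i y = V c y 0 i) ->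
  \forall y \near x, V c y = vsum (index_enum 'I_n) (fun i => vscale (b i) (E i)) c y.
Proof.
move=> dx HE Hb.
have H1 := near_all (fun i => (HE i).2); have H2 := near_all (fun i => (Hb i).2).
near=> y; rewrite /vsum [LHS]row_sum_delta; apply: eq_bigr => i _.
rewrite /vscale; have -> : E i c y = 'e_i by move: i; near: y.
by have -> : b i y = V c y 0 i by move: i; near: y.
Unshelve. all: by end_near. Qed.

Section OneConnection.
Variables (D : vfield X -> vfield X -> vfield X) (HD : is_connection D).

(** With [chi] supported where the two fields agree, chi U and chi U' are the same field, so a
    connection cannot separate them; linearity or the Leibniz rule then removes [chi] at x. *)
Lemma locality_cut c x U U' : dom c x -> smooth_vfield U -> smooth_vfield U' ->
  (\forall y \near x, U c y = U' c y) ->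
  exists chi : X -> C, [/\ smooth_fun chi, \forall y \near x, chi y = 1
    & vscale chi U = vscale chi U'].
Proof.
move=> dx [U0 UJ _] [U'0 U'J _] E.
have : nbhs x [set y | U c y = U' c y /\ dom c y].
  by near=> y; split; near: y => //; exact: near_dom.
rewrite nbhsE => -[W [oW Wx] WE].
have [chi [N [S S1 _ NW S0]]] := cutoff oW (fun y Wy => (WE y Wy).2) Wx.
exists chi; split => //; first exact/smf_smooth.
apply/funext => c'; apply/funext => y; rewrite /vscale.
case: (NW y) => [/S0 ->|/WE[e dy]]; first by rewrite !scale0r.
case: (pselect (dom c' y)) => dy'; last by rewrite U0 // U'0.
by rewrite (UJ c c') // (U'J c c') // e.
Unshelve. all: by end_near. Qed.

Lemma conn_local_l c x U U' V : dom c x -> smooth_vfield U -> smooth_vfield U' ->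
  smooth_vfield V -> (\forall y \near x, U c y = U' c y) ->
  D U V c x = D U' V c x.
Proof.
move=> dx HU HU' HV E; have [chi [S S1 Ee]] := locality_cut dx HU HU' E.
have := congr1 (fun F => F c x) (congr1 (fun F => D F V) Ee).
rewrite (conn_scalel HD) // (conn_scalel HD) // /vscale.
by rewrite (nbhs_singleton S1) !scale1r.
Qed.

Lemma conn_local_r c x U V V' : dom c x -> smooth_vfield U -> smooth_vfield V ->
  smooth_vfield V' -> (\forall y \near x, V c y = V' c y) ->
  D U V c x = D U V' c x.
Proof.
move=> dx HU HV HV' E; have [chi [S S1 Ee]] := locality_cut dx HV HV' E.
have := congr1 (fun F => F c x) (congr1 (fun F => D U F) Ee).
rewrite (conn_leibniz HD S HU HV dx) (conn_leibniz HD S HU HV' dx).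
rewrite (nbhs_singleton S1) !scale1r.
have -> : vderive U chi c x = 0.
  rewrite -(@vderive_near setT U (fun=> 1) chi c x) //; [|exact: openT|exact: smf_cst openT|].
    rewrite /vderive big1 // => i _.
    by rewrite (isW_wirtinger (isW_cst _ _ _)) mulr0.
  by apply: filterS S1.
by rewrite !scale0r !add0r.
Qed.

(** Locality makes the value independent of the fields extending d_i and d_j, hence of the choice
    made by [xget]. *)
Lemma christoffelE c x i j k U V : dom c x -> smooth_vfield U -> smooth_vfield V ->
  (\forall y \near x, U c y = 'e_i) -> (\forall y \near x, V c y = 'e_j) ->
  christoffel D c i j k x = D U V c x 0 k.
Proof.
move=> dx HU HV EU EV; rewrite /christoffel; case: xgetP => [y _ /=|]; last first.
  by move=> /(_ (D U V c x 0 k)) /=; case; exists U, V.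
move=> [U' [V' [HU' HV' EU' EV' ->]]].
rewrite (conn_local_l (U' := U) dx HU') //.
  rewrite (conn_local_r (V' := V) dx HU HV') //.
  by near=> y'; rewrite (near EV' y') // (near EV y').
by near=> y'; rewrite (near EU' y') // (near EU y').
Unshelve. all: by end_near. Qed.

Lemma conn_sum_r r F U V0 : smooth_vfield U -> smooth_vfield V0 ->
  (forall i, smooth_vfield (F i)) ->
  D U (vsum r F) = vsum r (fun i => D U (F i)).
Proof.
move=> HU HV HF; elim: r => [|i r IH].
  rewrite (vsum_nil F V0) (conn_scaler HD) //.
  by rewrite -(vsum_nil (fun i => D U (F i)) (D U V0)).
by rewrite !vsum_cons (conn_addr HD) ?IH //; exact: smooth_vsum HV HF.
Qed.

Lemma conn_sum_l r F U V0 : smooth_vfield U -> smooth_vfield V0 ->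
  (forall i, smooth_vfield (F i)) ->
  D (vsum r F) U = vsum r (fun i => D (F i) U).
Proof.
move=> HU HV HF; elim: r => [|i r IH].
  rewrite (vsum_nil F V0) (conn_scalel HD) //; last exact: smooth_cst.
  by rewrite -(vsum_nil (fun i => D (F i) U) (D V0 U)).
by rewrite !vsum_cons (conn_addl HD) ?IH //; exact: smooth_vsum HV HF.
Qed.

(** Near x both fields are combinations of extended coordinate fields: the Leibniz rule produces the
    derivative term, linearity over functions in [U] the quadratic one. *)
Lemma conn_localE c x U V k : dom c x -> smooth_vfield U -> smooth_vfield V ->
  D U V c x 0 k = vderive U (fun y => V c y 0 k) c x
    + \sum_i \sum_j christoffel D c i j k x * U c x 0 i * V c x 0 j.
Proof.
move=> dx HU HV; have [E HE] := coord_frame dx.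
have [a Ha] := coord_funs dx HU; have [b Hb] := coord_funs dx HV.
have SE i := (HE i).1.
have SaE i := smooth_vscale (Ha i).1 (SE i).
have SbE i := smooth_vscale (Hb i).1 (SE i).
rewrite (conn_local_r (V' := vsum (index_enum 'I_n) (fun i => vscale (b i) (E i)))) //;
  [|exact: smooth_vsum HU SbE|exact: decomp].
rewrite (conn_sum_r _ HU HU) // /vsum summxE.
have EE i : E i c x = 'e_i by have := nbhs_singleton (HE i).2.
have bE i : b i x = V c x 0 i by have := nbhs_singleton (Hb i).2.
have aE i : a i x = U c x 0 i by have := nbhs_singleton (Ha i).2.
have L j : D U (vscale (b j) (E j)) c x 0 k =
    vderive U (b j) c x * (k == j)%:R
    + \sum_i christoffel D c i j k x * U c x 0 i * V c x 0 j.
  rewrite (conn_leibniz HD) //; last exact: (Hb j).1.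
  rewrite !mxE EE mxE eqxx /=; congr (_ + _).
  rewrite (conn_local_l (U' := vsum (index_enum 'I_n) (fun i => vscale (a i) (E i)))) //;
    [|exact: smooth_vsum HU SaE|exact: decomp].
  rewrite (conn_sum_l _ (SE j) HU) // /vsum summxE mulr_sumr; apply: eq_bigr => i _.
  rewrite (conn_scalel HD) //; last exact: (Ha i).1.
  rewrite /vscale mxE -(@christoffelE c x i j k (E i) (E j)) //; last 2 first.
  - exact: (HE i).2.
  - exact: (HE j).2.
  by rewrite aE bE; ring.
rewrite (eq_bigr _ (fun j _ => L j)) big_split /= [X in _ + X]exchange_big /=.
congr (_ + _); rewrite (bigD1 k) //= eqxx mulr1 big1 ?addr0; last first.
  by move=> j jk; rewrite eq_sym (negbTE jk) mulr0.
apply: (@vderive_near setT) => //; [exact: openT|exact/smf_smooth/(Hb k).1|].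
exact: (Hb k).2.
Qed.

Lemma smf_christoffel c i j k : smf (dom c) (christoffel D c i j k).
Proof.
apply: smf_local; first exact: dom_open.
move=> x dx; have [E HE] := coord_frame dx.
have : nbhs x [set y | (E i c y = 'e_i /\ E j c y = 'e_j) /\ dom c y].
  have Hi := (HE i).2; have Hj := (HE j).2.
  by near=> y; split; [split|]; near: y => //; exact: near_dom.
rewrite nbhsE => -[W [oW Wx] WE]; exists W; split => //.
apply: (@smf_ext _ _ _ _ (fun y => D (E i) (E j) c y 0 k)) => //.
  move=> y Wy; rewrite (@christoffelE c y i j k (E i) (E j)) //.
  - exact: (WE y Wy).2.
  - exact: (HE i).1.
  - exact: (HE j).1.
  - by apply: filterS (near_open oW Wy) => u /WE[[]].
  - by apply: filterS (near_open oW Wy) => u /WE[[]].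
apply: (@smf_mono _ _ _ _ (dom c)); first by move=> y /WE[].
by apply: smf_vfield; apply: (conn_smooth HD); [exact: (HE i).1|exact: (HE j).1].
Unshelve. all: by end_near. Qed.

(** The transformation law of Gamma contracted with u and v. It comes from computing D U V in both
    charts for fields with constant components u, v in c near x: in c' the derivative of V falls on
    the Jacobian. *)
Lemma christoffel_transform c c' x (u v : 'rV[C]_n) k : dom c x -> dom c' x ->
  \sum_l (\sum_i \sum_j christoffel D c i j l x * u 0 i * v 0 j) * jac c c' x l k =
  \sum_i \sum_j christoffel D c' i j k x * (u *m jac c c' x) 0 i * (v *m jac c c' x) 0 j
  + \sum_l v 0 l * wirtinger u (fun z => jac c c' (param c z) l k) (coords c x).
Proof.
move=> dx dx'; have [U HU EU] := coord_field u dx; have [V HV EV] := coord_field v dx.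
have oc : open (dom c) by exact: dom_open.
have oc' : open (dom c') by exact: dom_open.
have [_ DJ _] := conn_smooth HD HU HV.
have [_ UJ _] := HU; have [_ VJ _] := HV.
have := congr1 (fun M : 'rV_n => M 0 k) (DJ c c' x dx dx'); rewrite (conn_localE _ dx') // mxE.
rewrite (UJ c c') // (VJ c c') //.
have Ux : U c x = u by have := nbhs_singleton EU.
have Vx : V c x = v by have := nbhs_singleton EV.
rewrite Ux Vx => H; apply/esym; rewrite addrC.
transitivity (\sum_j D U V c x 0 j * jac c c' x j k); last first.
  apply: eq_bigr => l _; congr (_ * _); rewrite (conn_localE _ dx) // Ux Vx.
  rewrite -[RHS]add0r; congr (_ + _).
  rewrite (@vderive_near (dom c) U _ (fun=> v 0 l)) //; last 2 first.
  - exact: smf_vfield.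
  - by apply: filterS EV => y ->.
  by rewrite /vderive big1 // => i _; rewrite (isW_wirtinger (isW_cst _ _ _)) mulr0.
rewrite -H; congr (_ + _).
rewrite (vderive_chart oc' dx' dx dx') //; [|exact: smf_vfield|exact: UJ].
rewrite (vderiveE _ oc' dx' dx) ?Ux; last exact: smf_vfield.
apply/esym; apply: isW_wirtinger.
have oA := openI oc oc'.
have HJ l := isW_mul (isW_cst (v 0 l) (coords c x) u)
  (@smf_isW c (dom c `&` dom c') (fun y => jac c c' y l k) x u oA (smf_jac c c' l k) (conj dx dx') dx).
have HS := isW_sum (index_enum 'I_n) (P := xpredT) (fun l _ => HJ l).
have E : \forall z \near coords c x,
   \sum_l v 0 l * jac c c' (param c z) l k = V c' (param c z) 0 k.
  apply: (near_param dx (P := fun y => \sum_l v 0 l * jac c c' y l k = V c' y 0 k)).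
  have N1 := near_dom dx; have N2 := near_dom dx'.
  apply: (filterS _ (filterI N1 (filterI N2 EV))) => y [dy [dy' Vy]].
  rewrite (VJ c c' y dy dy') Vy mul_rowE.
  reflexivity.
have := isW_ext E HS; congr (isW _ _ _ _ _).
by apply: eq_bigr => l _; rewrite mul0r add0r.
Qed.

End OneConnection.
End Connections.

(** * Torsion, symmetrization and projective equivalence *)

Section Torsion.
Variables (R : realType) (n : nat) (X : complexManifold R n).
Local Notation C := R[i].
Local Notation hchart := (holo_chart X).
Local Notation "''e_' i" := (delta_mx 0 i : 'rV[C]_n) (at level 8, i at level 2).
Implicit Types (c : hchart) (x : X) (z : 'rV[C]_n) (O : set X) (U V : vfield X).

Lemma vderive_notdom U a c x : smooth_vfield U -> ~ dom c x -> vderive U a c x = 0.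
Proof.
move=> [h _ _] dx; rewrite /vderive h // big1 // => i _.
by rewrite mxE mul0r.
Qed.

Lemma smf_vderive U a c : smooth_vfield U -> smf (dom c) a ->
  smf (dom c) (vderive U a c).
Proof.
move=> HU Ha; have oW : open (dom c) by exact: dom_open.
apply: (@smf_chart _ _ _ c) => // k; have oA := cim_open c oW.
have H : CkV k (cim c (dom c)) (fun z => \sum_i U c (param c z) 0 i *
    wirtinger 'e_i (a \o param c) z).
  apply: CkV_sum => // i _; apply: CkV_mul => //; first exact: (smf_vfield c i HU).
  by apply: CkV_wirtinger => //; exact: (Ha c k.+1).
apply: (CkV_ext oA _ H) => z /cimE[iz _]; rewrite /vderive (imgP iz).2.
reflexivity.
Qed.

(** Second derivatives of the transition map commute. This cancels the derivatives of the Jacobian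
    in the bracket, which is therefore a vector field. *)
Lemma jac_sym c c' x i l j : dom c x -> dom c' x ->
  wirtinger 'e_i ((fun y => jac c c' y l j) \o param c) (coords c x) =
  wirtinger 'e_l ((fun y => jac c c' y i j) \o param c) (coords c x).
Proof.
move=> dx dx'; have oA := cim_open c (@dom_open _ _ _ c').
have Az := cim_coords dx dx'.
have key (a b : 'I_n) : wirtinger 'e_a ((fun y => jac c c' y b j) \o param c) (coords c x)
    = dv 'e_a (dv 'e_b (fun z => coords c' (param c z) 0 j)) (coords c x).
  have Hd := hol_deriv 'e_b oA (tr_hol c c' j).
  rewrite -(hol_wirtinger 'e_a Hd Az).1; apply: isW_wirtinger.
  have HW := CkV_isW (k := 0) 'e_a (CkV_hol 1 oA Hd) Az.
  apply: isW_ext HW; apply: (@eq_near _ _ (cim c (dom c'))) => // z /cimE[iz dz].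
  have [dz1 ez] := imgP iz; rewrite /comp.
  by have -> := jac_dv b j dz1 dz; rewrite ez.
by rewrite !key; exact: (dv_comm _ _ oA (tr_hol c c' j) Az).
Qed.

Lemma vderive_mul_sum O U c x (a b : 'I_n -> X -> C) : open O -> O x -> dom c x ->
  (forall l, smf O (a l)) -> (forall l, smf O (b l)) ->
  vderive U (fun y => \sum_l a l y * b l y) c x =
  \sum_l (vderive U (a l) c x * b l x + a l x * vderive U (b l) c x).
Proof.
move=> oO Ox dx Ha Hb.
have HW := isW_sum (index_enum 'I_n) (P := xpredT) (fun l _ =>
  isW_mul (smf_isW (U c x) oO (Ha l) Ox dx) (smf_isW (U c x) oO (Hb l) Ox dx)).
rewrite (vderiveE U oO Ox dx); last first.
  by apply: smf_sum => // l; apply: smf_mul.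
rewrite (isW_wirtinger HW); apply: eq_bigr => l _.
by rewrite !(vderiveE U oO Ox dx) // (coordsK dx).
Qed.

Lemma vbracket_field_smooth U V : smooth_vfield U -> smooth_vfield V ->
  smooth_vfield (vbracket U V).
Proof.
move=> HU HV; apply: smooth_vfieldP.
- move=> c x dx; apply/rowP => j; rewrite !mxE.
  by rewrite !vderive_notdom // subr0.
- move=> c c' x dx dx'; apply/rowP => j; rewrite mxE mul_rowE.
  have oc : open (dom c) by exact: dom_open.
  have oc' : open (dom c') by exact: dom_open.
  have oI := openI oc oc'.
  have key U' V' : smooth_vfield U' -> smooth_vfield V' ->
      vderive U' (fun y => V' c' y 0 j) c' x =
      \sum_l vderive U' (fun y => V' c y 0 l) c x * jac c c' x l j
      + \sum_l \sum_i V' c x 0 l * (U' c x 0 i *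
         wirtinger 'e_i ((fun y => jac c c' y l j) \o param c) (coords c x)).
    move=> HU' HV'; have [_ UJ _] := HU'; have [_ VJ _] := HV'.
    rewrite (vderive_chart oc' dx' dx dx') //; [|exact: smf_vfield|exact: UJ].
    have SV l : smf (dom c `&` dom c') (fun y => V' c y 0 l).
      by apply: smf_mono (smf_vfield c l HV') => y [].
    have SJ l := @smf_jac _ _ _ c c' l j.
    rewrite (@vderive_near _ _ _ (dom c `&` dom c') _ _
      (fun y => \sum_l V' c y 0 l * jac c c' y l j)) //; last 2 first.
    - by apply: smf_mono (smf_vfield c' j HV') => y [].
    - apply: filterS (near_open oI (conj dx dx')) => y [dy dy'].
      rewrite (VJ c c' y dy dy') mul_rowE.
      reflexivity.
    rewrite (vderive_mul_sum _ oI (conj dx dx') dx SV SJ) big_split /=.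
    by congr (_ + _); apply: eq_bigr => l _; rewrite mulr_sumr.
  rewrite !key //.
  have E : \sum_l \sum_i V c x 0 l * (U c x 0 i *
         wirtinger 'e_i ((fun y => jac c c' y l j) \o param c) (coords c x)) =
     \sum_l \sum_i U c x 0 l * (V c x 0 i *
         wirtinger 'e_i ((fun y => jac c c' y l j) \o param c) (coords c x)).
    rewrite exchange_big; apply: eq_bigr => i _; apply: eq_bigr => l _.
    by rewrite (jac_sym _ _ _ dx dx') mulrCA.
  rewrite E; set S := (X in _ + X - _).
  rewrite opprD addrACA subrr addr0 -sumrB; apply: eq_bigr => l _.
  by rewrite [vbracket _ _ _ _ _ _]mxE mulrBl.
- move=> c j; have oc : open (dom c) by exact: dom_open.
  have H := smf_add oc (smf_vderive HU (smf_vfield c j HV))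
    (smf_mul oc (smf_cst (-1) oc) (smf_vderive HV (smf_vfield c j HU))).
  apply: smf_ext H => // x dx; by rewrite mxE mulN1r.
Qed.

Lemma bilin_sum_addl (G : 'I_n -> 'I_n -> C) (u u' v : 'rV[C]_n) :
  \sum_i \sum_j G i j * (u + u') 0 i * v 0 j =
  \sum_i \sum_j G i j * u 0 i * v 0 j + \sum_i \sum_j G i j * u' 0 i * v 0 j.
Proof.
rewrite -big_split; apply: eq_bigr => i _; rewrite -big_split; apply: eq_bigr => j _.
by rewrite !mxE /=; ring.
Qed.

Lemma bilin_sum_addr (G : 'I_n -> 'I_n -> C) (u v v' : 'rV[C]_n) :
  \sum_i \sum_j G i j * u 0 i * (v + v') 0 j =
  \sum_i \sum_j G i j * u 0 i * v 0 j + \sum_i \sum_j G i j * u 0 i * v' 0 j.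
Proof.
rewrite -big_split; apply: eq_bigr => i _; rewrite -big_split; apply: eq_bigr => j _.
by rewrite !mxE /=; ring.
Qed.

Lemma bilin_sum_scalel (G : 'I_n -> 'I_n -> C) (a : C) (u v : 'rV[C]_n) :
  \sum_i \sum_j G i j * (a *: u) 0 i * v 0 j = a * \sum_i \sum_j G i j * u 0 i * v 0 j.
Proof.
rewrite mulr_sumr; apply: eq_bigr => i _; rewrite mulr_sumr; apply: eq_bigr => j _.
by rewrite !mxE; ring.
Qed.

Lemma bilin_sum_scaler (G : 'I_n -> 'I_n -> C) (a : C) (u v : 'rV[C]_n) :
  \sum_i \sum_j G i j * u 0 i * (a *: v) 0 j = a * \sum_i \sum_j G i j * u 0 i * v 0 j.
Proof.
rewrite mulr_sumr; apply: eq_bigr => i _; rewrite mulr_sumr; apply: eq_bigr => j _.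
by rewrite !mxE; ring.
Qed.

Lemma bilin_antisym (G : 'I_n -> 'I_n -> C) (u v : 'rV[C]_n) :
  \sum_i \sum_j G i j * u 0 i * v 0 j - \sum_i \sum_j G i j * v 0 i * u 0 j
  = \sum_i \sum_j (G i j - G j i) * u 0 i * v 0 j.
Proof.
rewrite [X in _ - X]exchange_big /= -sumrB; apply: eq_bigr => i _.
rewrite -sumrB; apply: eq_bigr => j _; by ring.
Qed.

Lemma scale_sub_half (a : C) (d t : 'rV[C]_n) :
  a *: d - 2^-1 *: (a *: t) = a *: (d - 2^-1 *: t).
Proof. by rewrite scalerBr !scalerA mulrC. Qed.

Section OneConnection.
Variables (D : vfield X -> vfield X -> vfield X) (HD : is_connection D).

Lemma torsionE c x U V k : dom c x -> smooth_vfield U -> smooth_vfield V ->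
  torsion D U V c x 0 k = \sum_i \sum_j
    (christoffel D c i j k x - christoffel D c j i k x) * U c x 0 i * V c x 0 j.
Proof.
move=> dx HU HV; rewrite /torsion !mxE !(conn_localE HD _ dx) //.
rewrite -(bilin_antisym (fun i j => christoffel D c i j k x)).
set A := vderive _ _ _ _; set B := vderive _ _ _ _.
set S := \sum_i _; set S' := \sum_i _; by ring.
Qed.

Lemma conn_notdom c x U V : ~ dom c x -> smooth_vfield U -> smooth_vfield V ->
  D U V c x = 0.
Proof. by move=> dx HU HV; have [h _ _] := conn_smooth HD HU HV; exact: h. Qed.

Lemma torsion_notdom c x U V : ~ dom c x -> smooth_vfield U -> smooth_vfield V ->
  torsion D U V c x = 0.
Proof.
move=> dx HU HV; rewrite /torsion !conn_notdom //.
by have [-> // _ _] := vbracket_field_smooth HU HV; rewrite !subr0.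
Qed.

Definition symconn U V : vfield X := fun c x => D U V c x - 2^-1 *: torsion D U V c x.

Lemma smooth_torsion U V : smooth_vfield U -> smooth_vfield V ->
  smooth_vfield (torsion D U V).
Proof.
move=> HU HV.
have H := smooth_vadd (conn_smooth HD HU HV) (smooth_vscale (@smooth_cst _ _ X (-1))
  (smooth_vadd (conn_smooth HD HV HU) (vbracket_field_smooth HU HV))).
congr smooth_vfield : H; apply/funext => c; apply/funext => x.
by rewrite /vadd /vscale /torsion scaleN1r opprD addrA.
Qed.

Lemma symconn_smooth U V : smooth_vfield U -> smooth_vfield V ->
  smooth_vfield (symconn U V).
Proof.
move=> HU HV.
have H := smooth_vadd (conn_smooth HD HU HV) (smooth_vscale (@smooth_cst _ _ X (- 2^-1))
  (smooth_torsion HU HV)).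
congr smooth_vfield : H; apply/funext => c; apply/funext => x.
by rewrite /vadd /vscale /symconn scaleNr.
Qed.

Lemma torsion_addl U U' V : smooth_vfield U -> smooth_vfield U' -> smooth_vfield V ->
  torsion D (vadd U U') V = vadd (torsion D U V) (torsion D U' V).
Proof.
move=> HU HU' HV; have HS := smooth_vadd HU HU'.
apply/funext => c; apply/funext => x; rewrite [RHS]/vadd.
case: (pselect (dom c x)) => dx; last by rewrite !torsion_notdom // addr0.
apply/rowP => k; rewrite [RHS]mxE; apply: (etrans (torsionE k dx HS HV)).
apply: (etrans (bilin_sum_addl (fun i j => christoffel D c i j k x - christoffel D c j i k x) (U c x) (U' c x) (V c x))).
by congr (_ + _); apply/esym/torsionE.
Qed.

Lemma torsion_addr U V V' : smooth_vfield U -> smooth_vfield V -> smooth_vfield V' ->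
  torsion D U (vadd V V') = vadd (torsion D U V) (torsion D U V').
Proof.
move=> HU HV HV'; have HS := smooth_vadd HV HV'.
apply/funext => c; apply/funext => x; rewrite [RHS]/vadd.
case: (pselect (dom c x)) => dx; last by rewrite !torsion_notdom // addr0.
apply/rowP => k; rewrite [RHS]mxE; apply: (etrans (torsionE k dx HU HS)).
apply: (etrans (bilin_sum_addr (fun i j => christoffel D c i j k x - christoffel D c j i k x) (U c x) (V c x) (V' c x))).
by congr (_ + _); apply/esym/torsionE.
Qed.

Lemma torsion_scalel a U V : smooth_fun a -> smooth_vfield U -> smooth_vfield V ->
  torsion D (vscale a U) V = vscale a (torsion D U V).
Proof.
move=> Ha HU HV; have HS := smooth_vscale Ha HU.
apply/funext => c; apply/funext => x; rewrite [RHS]/vscale.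
case: (pselect (dom c x)) => dx; last by rewrite !torsion_notdom // scaler0.
apply/rowP => k; rewrite [RHS]mxE; apply: (etrans (torsionE k dx HS HV)).
apply: (etrans (bilin_sum_scalel (fun i j => christoffel D c i j k x - christoffel D c j i k x) (a x) (U c x) (V c x))).
by congr (_ * _); apply/esym/torsionE.
Qed.

Lemma torsion_scaler a U V : smooth_fun a -> smooth_vfield U -> smooth_vfield V ->
  torsion D U (vscale a V) = vscale a (torsion D U V).
Proof.
move=> Ha HU HV; have HS := smooth_vscale Ha HV.
apply/funext => c; apply/funext => x; rewrite [RHS]/vscale.
case: (pselect (dom c x)) => dx; last by rewrite !torsion_notdom // scaler0.
apply/rowP => k; rewrite [RHS]mxE; apply: (etrans (torsionE k dx HU HS)).
apply: (etrans (bilin_sum_scaler (fun i j => christoffel D c i j k x - christoffel D c j i k x) (a x) (U c x) (V c x))).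
by congr (_ * _); apply/esym/torsionE.
Qed.

Lemma symconn_connection : is_connection symconn.
Proof.
split.
- exact: symconn_smooth.
- move=> U U' V HU HU' HV; rewrite /symconn torsion_addl // (conn_addl HD) //.
  apply/funext => c; apply/funext => x; rewrite /vadd scalerDr opprD.
  by rewrite addrACA.
- move=> a U V Ha HU HV; rewrite /symconn torsion_scalel // (conn_scalel HD) //.
  apply/funext => c; apply/funext => x; exact: scale_sub_half.
- move=> U V V' HU HV HV'; rewrite /symconn torsion_addr // (conn_addr HD) //.
  apply/funext => c; apply/funext => x; rewrite /vadd scalerDr opprD.
  by rewrite addrACA.
- move=> k U V HU HV; rewrite /symconn torsion_scaler ?(conn_scaler HD) //.
    apply/funext => c; apply/funext => x; exact: scale_sub_half.
  exact: smooth_cst.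
- move=> a U V Ha HU HV c x dx; rewrite /symconn torsion_scaler // (conn_leibniz HD) //.
  by rewrite -addrA; congr (_ + _); exact: scale_sub_half.
Qed.

Lemma christoffel_symconn c i j k x : dom c x ->
  christoffel symconn c i j k x =
  (christoffel D c i j k x + christoffel D c j i k x) / 2.
Proof.
move=> dx; have [E HE] := coord_frame dx.
have H m := (HE m).1; have N m := (HE m).2.
rewrite (christoffelE symconn_connection k dx (H i) (H j) (N i) (N j)) /symconn.
rewrite [LHS]mxE [X in _ + X]mxE [X in _ - X]mxE torsionE //.
rewrite -(christoffelE HD k dx (H i) (H j) (N i) (N j)).
rewrite (bigD1 i) //= (bigD1 j) //= (nbhs_singleton (N i)) (nbhs_singleton (N j)).
rewrite !mxE !eqxx /= big1 ?big1 //.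
- by rewrite !addr0 !mulr1; field.
- by move=> m /negbTE mj; rewrite big1 // => l _; rewrite !mxE mj mulr0 mul0r.
- by move=> m /negbTE mj; rewrite !mxE mj mulr0.
Qed.

End OneConnection.

Lemma symconn_torsion_free (D : vfield X -> vfield X -> vfield X) :
  is_connection D -> torsion_free (symconn D).
Proof.
move=> HD U V HU HV c x dx; apply/rowP => k; rewrite [RHS]mxE.
rewrite (torsionE (symconn_connection HD) k dx HU HV) big1 // => i _; rewrite big1 // => j _.
by rewrite !(christoffel_symconn HD) // [X in _ - X / 2]addrC subrr !mul0r.
Qed.

Lemma proj_equiv_refl (D : vfield X -> vfield X -> vfield X) : projectively_equivalent D D.
Proof.
move=> p; exists setT, (fun _ _ => 0); split => //; first exact: openT.
  split; first by move=> c c' x _ _ _; rewrite mulmx0.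
  move=> c j k; apply/Ck_CkV.
  have oA : open (coords c @` (setT `&` dom c)) by apply: cim_open; exact: openT.
  by apply: (CkV_ext (f := fun=> 0) oA); [move=> z _; rewrite mxE|exact: CkV_cst].
by move=> U V _ _ c x _ _; rewrite /form_apply !mulmx0 !mxE !scale0r !addr0.
Qed.

Lemma proj_cancel (g ai aj dj di t1 t2 N : C) : N != 0 ->
  g + ai * dj + aj * di - N^-1 * (di * (t1 + N * aj) + dj * (t2 + N * ai)) =
  g - N^-1 * (di * t1 + dj * t2).
Proof. by move=> N0; field. Qed.

(** The form alpha adds alpha_i delta^k_j + alpha_j delta^k_i to Gamma, hence (n + 1) alpha_j to the
    trace, which is exactly what the trace correction removes. *)
Lemma proj_christoffel_equiv (D D' : vfield X -> vfield X -> vfield X) c i j k x : is_connection D -> is_connection D' ->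
  projectively_equivalent D D' -> dom c x ->
  proj_christoffel D' c i j k x = proj_christoffel D c i j k x.
Proof.
move=> HD HD' Heq dx; have [Q [al [oO Ox _ H]]] := Heq x.
have [E HE] := coord_frame dx.
have HS m := (HE m).1; have N m := (HE m).2.
pose a i := al c x i 0.
have fa m : form_apply al (E m) c x = a m.
  by rewrite /form_apply (nbhs_singleton (N m)) row_e.
have G i1 j1 k1 : christoffel D' c i1 j1 k1 x =
    christoffel D c i1 j1 k1 x + a i1 * (k1 == j1)%:R + a j1 * (k1 == i1)%:R.
  rewrite (christoffelE HD' k1 dx (HS i1) (HS j1) (N i1) (N j1)).
  rewrite (christoffelE HD k1 dx (HS i1) (HS j1) (N i1) (N j1)).
  rewrite (H _ _ (HS i1) (HS j1) c x Ox dx) !fa.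
  rewrite (nbhs_singleton (N i1)) (nbhs_singleton (N j1)).
  by rewrite !mxE eqxx.
have T j1 : \sum_b christoffel D' c b j1 b x =
    \sum_b christoffel D c b j1 b x + n.+1%:R * a j1.
  under eq_bigr do rewrite G.
  rewrite !big_split /= -addrA; congr (_ + _).
  rewrite (bigD1 j1) //= eqxx mulr1 big1 ?addr0; last first.
    by move=> b /negbTE ->; rewrite mulr0.
  under eq_bigr do rewrite eqxx mulr1.
  by rewrite sumr_const card_ord -[X in _ + X]mulr_natl -[n.+1%:R]natr1 mulrDl mul1r addrC.
rewrite /proj_christoffel G !T.
have n0 : n.+1%:R != 0 :> C by rewrite pnatr_eq0.
exact: proj_cancel.
Qed.

End Torsion.

(** * Wronskians of curves *)

Section HolomorphicAlgebra.
Variables (R : realType) (V : normedModType R[i]).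
Local Notation C := R[i].

Lemma hol_cst (A : set V) (a : C) : hol A (fun=> a).
Proof. by move=> z _; split; [exact: ctn_cst|move=> v; exists 0; exact: hder_cst]. Qed.

Lemma hol_add (A : set V) (f g : V -> C) : hol A f -> hol A g -> hol A (fun z => f z + g z).
Proof.
move=> Hf Hg z Az; have [cf df] := Hf z Az; have [cg dg] := Hg z Az.
split; first exact: ctn_add.
move=> v; have [d1 h1] := df v; have [d2 h2] := dg v; exists (d1 + d2).
exact: hder_add.
Qed.

Lemma hol_mul (A : set V) (f g : V -> C) : hol A f -> hol A g -> hol A (fun z => f z * g z).
Proof.
move=> Hf Hg z Az; have [cf df] := Hf z Az; have [cg dg] := Hg z Az.
split; first exact: ctn_mul.
move=> v; have [d1 h1] := df v; have [d2 h2] := dg v; eexists; exact: hder_mul h1 h2.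
Qed.

Lemma hol_inv (A : set V) (f : V -> C) : (forall z, A z -> f z != 0) -> hol A f ->
  hol A (fun z => (f z)^-1).
Proof.
move=> f0 Hf z Az; have [cf df] := Hf z Az; split; first by apply: ctn_inv; first exact: f0.
move=> v; have [d1 h1] := df v; eexists; apply: hder_inv h1; exact: f0.
Qed.

Lemma hol_sum (A : set V) (I : Type) (r : seq I) (P : pred I) (F : I -> V -> C) :
  (forall i, P i -> hol A (F i)) -> hol A (fun y => \sum_(i <- r | P i) F i y).
Proof.
move=> H z Az; split.
  by apply: ctn_sum => i Pi; have [] := H i Pi z Az.
move=> v; exists (\sum_(i <- r | P i) dv v (F i) z); apply: hder_sum => i Pi.
exact: hol_dv (H i Pi) Az.
Qed.

Lemma hol_prod (A : set V) (I : Type) (r : seq I) (F : I -> V -> C) :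
  (forall i, hol A (F i)) -> hol A (fun y => \prod_(i <- r) F i y).
Proof.
move=> H; elim: r => [|i r IH].
  by under [X in hol _ X]funext do rewrite big_nil; exact: hol_cst.
under [X in hol _ X]funext do rewrite big_cons.
exact: hol_mul.
Qed.

Lemma hol_det (A : set V) m (F : 'I_m -> 'I_m -> V -> C) :
  (forall i j, hol A (F i j)) -> hol A (fun y => \det (\matrix_(i, j) F i j y)).
Proof.
move=> H; have E y : \det (\matrix_(i, j) F i j y) =
    \sum_(s : 'S_m) (-1) ^+ s * \prod_i F i (s i) y.
  by apply: eq_bigr => s _; congr (_ * _); apply: eq_bigr => i _; rewrite mxE.
under [X in hol _ X]funext do rewrite E.
apply: hol_sum => s _; apply: hol_mul; first exact: hol_cst.
by apply: hol_prod => i.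
Qed.

Lemma hol_comp n (A : set 'rV[C]_n) g (B : set V) (f : V -> 'rV[C]_n) : open A ->
  CkV 1 A g -> (forall z j, A z -> wirtinger_bar (delta_mx 0 j) g z = 0) ->
  (forall y, B y -> A (f y)) -> (forall j, hol B (fun y => f y 0 j)) ->
  hol B (fun y => g (f y)).
Proof.
move=> oA Hg bar BA Hf z Bz; split.
  apply: ctn_comp; last exact: CkV_ctn Hg (BA z Bz).
  by apply: ctn_row => j; have [] := Hf j z Bz.
move=> v; eexists; apply: (chain_hol oA Hg (BA z Bz)).
  by move=> j; exact: bar (BA z Bz).
by move=> j; exact: hol_dv (Hf j) Bz.
Qed.

End HolomorphicAlgebra.

(** * Jets of a curve under changes of chart *)

Section CurveJets.
Variables (R : realType) (n : nat) (X : complexManifold R n).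
Local Notation C := R[i].
Local Notation hchart := (holo_chart X).
Local Notation "''e_' i" := (delta_mx 0 i : 'rV[C]_n) (at level 8, i at level 2).
Implicit Types (c : hchart) (x : X) (t : C).
Variables (A : set C) (f : C -> X).
Hypotheses (oA : open A) (Hf : holomorphic_curve A f).

Definition ctime c : set C := [set t | A t /\ dom c (f t)].
Definition vel c t : 'rV[C]_n := derive1 (coords c \o f) t.

Lemma ctime_open c : open (ctime c).
Proof.
rewrite openE => t [At dt]; have [cf _] := Hf At.
have H1 := open_near oA At; have H2 := near_dom dt.
have H3 : \forall s \near t, dom c (f s) by exact: cf.
exact: filterI H1 H3.
Qed.

Arguments ctime_open c : clear implicits.

Lemma curve_hder c t : ctime c t -> hder setT (coords c \o f) t 1 (vel c t).
Proof.
move=> [At dt]; have [_ /(_ c dt) df] := Hf At.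
apply/cderP; split; first exact: df.
by rewrite /vel derive1E.
Qed.

Lemma curve_hol c j : hol (ctime c) (fun t => coords c (f t) 0 j).
Proof.
move=> t Ct; have H := curve_hder Ct; split.
  by apply: (ctn_coord (f := coords c \o f)); exact: cder_ctn H.
move=> v; exists (v *: vel c t 0 j); have := cder_dir v (hder_coord j H).
by rewrite (_ : v *: 1 = v) //; rewrite /GRing.scale /= mulr1.
Qed.

Lemma velE c j t : ctime c t ->
  vel c t 0 j = dv (1 : C) (fun s : C => coords c (f s) 0 j) t.
Proof. by move=> Ct; rewrite (dvE (hder_coord j (curve_hder Ct))). Qed.

Lemma vel_hol c j : hol (ctime c) (fun t => vel c t 0 j).
Proof.
have oT := ctime_open c.
by apply: hol_ext (hol_deriv (1 : C) oT (@curve_hol c j)) => // t Ct; rewrite velE.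
Qed.

Lemma smf_curve c g k : smf (dom c) g -> CkV k (ctime c) (fun t => g (f t)).
Proof.
move=> Hg; have oT := ctime_open c; have oI := cim_open c (@dom_open _ _ _ c).
have Hm t : ctime c t -> cim c (dom c) (coords c (f t)).
  by move=> [_ dt]; exact: cim_coords.
have H := CkV_comp oT oI Hm (Hg c k) (fun j => CkV_hol k oT (curve_hol (c := c) j)).
by apply: CkV_ext H => // t [_ dt]; rewrite coordsK.
Qed.

Lemma vel_covariant c c' t : ctime c t -> ctime c' t ->
  vel c' t = vel c t *m jac c c' (f t).
Proof.
move=> Ct Ct'; have [At dt] := Ct; have [_ dt'] := Ct'.
apply/rowP => k; rewrite mul_rowE.
have oI := cim_open c (@dom_open _ _ _ c').
have Ic : cim c (dom c') (coords c (f t)) by exact: cim_coords.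
have HC := chain_hol oI (CkV_hol 1 oI (tr_hol c c' k)) Ic
  (fun j => (hol_wirtinger _ (tr_hol c c' k) Ic).2)
  (fun j => hder_coord j (curve_hder Ct)).
have E : \forall s \near t, coords c' (param c (coords c (f s))) 0 k = coords c' (f s) 0 k.
  apply: (@eq_near _ _ (ctime c)) Ct _ => [|s [_ ds]]; first exact: ctime_open.
  by rewrite coordsK.
apply: (etrans (velE k Ct')); apply: (etrans (dvE (hder_ext E HC))).
apply: eq_bigr => j _.
congr (_ * _); rewrite (hol_wirtinger _ (tr_hol c c' k) Ic).1.
by rewrite (jac_dv _ _ dt dt').
Qed.

Lemma isW_along c (g : X -> C) (O : set X) t : open O -> O (f t) -> smf O g ->
  ctime c t ->
  isW (fun s => g (f s)) t 1
    (wirtinger (vel c t) (g \o param c) (coords c (f t)))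
    (wirtinger_bar (vel c t) (g \o param c) (coords c (f t))).
Proof.
move=> oO Ot Hg Ct; have [At dt] := Ct; have oI := cim_open c oO.
have Ic : cim c O (coords c (f t)) by exact: cim_coords.
have H := isW_comp (g := g \o param c) oI (Hg c 1%N) Ic
   (fun j => isW_hol (hder_coord j (curve_hder Ct))).
have E : \forall s \near t, (g \o param c) (coords c (f s)) = g (f s).
  apply: (@eq_near _ _ (ctime c)) Ct _ => [|s [_ ds]]; first exact: ctime_open.
  by rewrite /comp coordsK.
have HD' := isW_dir (vel c t) oI (Hg c 1%N) Ic.
rewrite (isW_wirtinger HD') (isW_bar HD').
have := isW_ext E H; congr (isW _ _ _ _ _).
  by apply: eq_bigr => j _; rewrite conjc0 mul0r addr0.
by apply: eq_bigr => j _; rewrite mul0r add0r.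
Qed.

Section OneConnection.
Variables (D : vfield X -> vfield X -> vfield X) (HD : is_connection D).
Local Notation jet := (curve_jet D f).

Lemma curve_jetS c r t k : jet c r.+1 t 0 k =
  wirtinger 1 (fun s => jet c r s 0 k) t +
  \sum_i \sum_j christoffel D c i j k (f t) * vel c t 0 i * jet c r t 0 j.
Proof. by rewrite [LHS]mxE. Qed.

Lemma curve_jet_smooth c r j k : CkV k (ctime c) (fun t => jet c r t 0 j).
Proof.
have oT := ctime_open c.
elim: r j k => [|r IH] j k; first by apply: CkV_hol => //; exact: vel_hol.
have H : CkV k (ctime c) (fun t => wirtinger 1 (fun s => jet c r s 0 j) t +
  \sum_i \sum_l christoffel D c i l j (f t) * vel c t 0 i * jet c r t 0 l).
  apply: CkV_add => //; first by apply: CkV_wirtinger.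
  apply: CkV_sum => // i _; apply: CkV_sum => // l _; apply: CkV_mul => //.
  apply: CkV_mul => //; last by apply: CkV_hol => //; exact: vel_hol.
  by apply: smf_curve; exact: smf_christoffel.
by apply: CkV_ext H => // t _; rewrite curve_jetS.
Qed.

(** Differentiating the Jacobian along f gives precisely the inhomogeneous term of
    [christoffel_transform]. *)
Lemma curve_jet_covariant c c' r t : ctime c t -> ctime c' t ->
  jet c' r t = jet c r t *m jac c c' (f t).
Proof.
elim: r t => [|r IH] t Ct Ct'; first exact: vel_covariant.
have [At dt] := Ct; have [_ dt'] := Ct'.
have oI : open (dom c `&` dom c') by apply: openI; exact: dom_open.
apply/rowP => k; rewrite mul_rowE curve_jetS (vel_covariant Ct Ct') (IH t Ct Ct').
have oT := ctime_open c; have oT' := ctime_open c'.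
have HW l := isW_mul (CkV_isW (k := 0) (1 : C) (curve_jet_smooth c r l 1) Ct)
  (@isW_along c (fun y => jac c c' y l k) (dom c `&` dom c') t oI (conj dt dt')
    (smf_jac c c' l k) Ct).
have HS := isW_sum (index_enum 'I_n) (P := xpredT) (fun l _ => HW l).
have E : \forall s \near t, \sum_l jet c r s 0 l * jac c c' (f s) l k = jet c' r s 0 k.
  apply: (@eq_near _ _ (ctime c `&` ctime c')) => //; first exact: openI.
  move=> s [Cs Cs']; rewrite (IH s Cs Cs') mul_rowE.
  reflexivity.
rewrite (isW_wirtinger (isW_ext E HS)) big_split /= -addrA [X in _ + X]addrC.
rewrite -(christoffel_transform HD (vel c t) (jet c r t) k dt dt') -big_split.
apply: eq_bigr => l _; rewrite [in RHS]curve_jetS mulrDl.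
reflexivity.
Qed.

Lemma wronskian_covariant c c' t : ctime c t -> ctime c' t ->
  wronskian D f c' t = wronskian D f c t * \det (jac c c' (f t)).
Proof.
move=> Ct Ct'; rewrite /wronskian -det_mulmx; congr (\det _).
apply/matrixP => r k; rewrite !mxE (curve_jet_covariant _ Ct Ct') mul_rowE.
by apply: eq_bigr => l _; rewrite [X in _ = X * _]mxE.
Qed.

End OneConnection.
End CurveJets.

(** * Jets built from the projective Christoffel symbols *)

Section ProjectiveJets.
Variables (R : realType) (n : nat) (X : complexManifold R n).
Local Notation C := R[i].
Local Notation hchart := (holo_chart X).
Local Notation "''e_' i" := (delta_mx 0 i : 'rV[C]_n) (at level 8, i at level 2).
Implicit Types (c : hchart) (x : X) (t : C).
Variables (A : set C) (f : C -> X).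
Hypotheses (oA : open A) (Hf : holomorphic_curve A f).
Variables (D : vfield X -> vfield X -> vfield X) (HD : is_connection D).
Local Notation jet := (curve_jet D f).
Local Notation vel := (vel f).
Local Notation ctime := (ctime A f).

(** The recursion of [curve_jet] with Pi for Gamma. It is used inside a fixed chart, as Pi does not
    transform like a connection. *)
Fixpoint proj_jet c (r : nat) t : 'rV[C]_n :=
  match r with
  | 0%N => vel c t
  | r'.+1 => \row_k (wirtinger (1 : C) (fun s : C => proj_jet c r' s 0 k) t
      + \sum_i \sum_j proj_christoffel D c i j k (f t)
           * vel c t 0 i * proj_jet c r' t 0 j)
  end.

Definition trace_form c j x : C :=
  (n.+1%:R)^-1 * \sum_a christoffel D c a j a x.

Lemma christoffel_proj c i j k x : christoffel D c i j k x =
  proj_christoffel D c i j k x + (k == i)%:R * trace_form c j x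
  + (k == j)%:R * trace_form c i x.
Proof. by rewrite /proj_christoffel /trace_form; ring. Qed.

Lemma sum_delta_l k (v : 'rV[C]_n) : \sum_i (k == i)%:R * v 0 i = v 0 k.
Proof.
rewrite (bigD1 k) //= eqxx mul1r big1 ?addr0 // => i ik.
by rewrite eq_sym (negbTE ik) mul0r.
Qed.

Lemma christoffel_sum c k x (v g : 'rV[C]_n) :
  \sum_i \sum_j christoffel D c i j k x * v 0 i * g 0 j =
  \sum_i \sum_j proj_christoffel D c i j k x * v 0 i * g 0 j
  + v 0 k * (\sum_j trace_form c j x * g 0 j)
  + (\sum_j trace_form c j x * v 0 j) * g 0 k.
Proof.
rewrite -(sum_delta_l k v) -[g 0 k in RHS](sum_delta_l k g).
rewrite !big_distrlr /= -!big_split; apply: eq_bigr => i _.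
rewrite -!big_split; apply: eq_bigr => j _ /=.
by rewrite christoffel_proj; ring.
Qed.

Lemma smf_proj_christoffel c i j k : smf (dom c) (proj_christoffel D c i j k).
Proof.
have oc : open (dom c) by exact: dom_open.
have S i1 j1 k1 := smf_christoffel HD c i1 j1 k1.
have T j1 : smf (dom c) (fun x => \sum_a christoffel D c a j1 a x).
  by apply: smf_sum => // a; exact: S.
have H := smf_add oc (S i j k) (smf_mul oc (smf_cst (- (n.+1%:R)^-1) oc)
  (smf_add oc (smf_mul oc (smf_cst (k == i)%:R oc) (T j))
              (smf_mul oc (smf_cst (k == j)%:R oc) (T i)))).
by apply: smf_ext H => // x _; rewrite mulNr.
Qed.

Lemma smf_trace_form c j : smf (dom c) (trace_form c j).
Proof.
have oc : open (dom c) by exact: dom_open.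
apply: smf_mul => //; first exact: smf_cst.
by apply: smf_sum => // a; exact: smf_christoffel.
Qed.

(* Replacing Gamma by Pi removes from F_(r.+1) a multiple of f' and a multiple of
   F_r, so the two families of jets differ by a unitriangular change of frame. *)
Lemma jets_triangular c r : exists l : nat -> C -> C,
  [/\ forall s k, CkV k (ctime c) (l s), forall s t, (r < s)%N -> l s t = 0,
      forall t, l r t = 1
    & forall N t, ctime c t -> (r < N)%N ->
        jet c r t = \sum_(s < N) l s t *: proj_jet c s t].
Proof.
have oT := @ctime_open _ _ _ _ _ oA Hf c.
have smooth_pjet : forall s k q, CkV q (ctime c) (fun t => proj_jet c s t 0 k).
  elim=> [|s IHs] k q; first by apply: CkV_hol => //; exact: vel_hol.
  have H : CkV q (ctime c) (fun t => wirtinger (1 : C) (fun u : C => proj_jet c s u 0 k) t +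
    \sum_i \sum_l proj_christoffel D c i l k (f t) * vel c t 0 i * proj_jet c s t 0 l).
    apply: CkV_add => //; first by apply: CkV_wirtinger.
    apply: CkV_sum => // i _; apply: CkV_sum => // l _; apply: CkV_mul => //.
    apply: CkV_mul => //; last by apply: CkV_hol => //; exact: vel_hol.
    by apply: (smf_curve oA Hf); exact: smf_proj_christoffel.
  by apply: (CkV_ext oT _ H) => t _; rewrite [RHS]mxE.
elim: r => [|r [l [lS l0 l1 lE]]].
  exists (fun s _ => (s == 0%N)%:R); split => //.
  - by move=> s k; exact: CkV_cst.
  - by move=> [].
  - move=> [//|N] t Ct _; rewrite big_ord_recl big1 ?addr0 /= ?scale1r //.
    by move=> s _; rewrite scale0r.
pose b c t (g : 'rV[C]_n) := \sum_j trace_form c j (f t) * g 0 j.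
(* Coefficients one step later, with alpha the trace form: the derivative of the old ones, the
   multiple by alpha(f'), the shift from differentiating each projective jet, and alpha of the
   current jet in place 0, where the projective jet is f'. *)
pose l' s t := wirtinger (1 : C) (l s) t + b c t (vel c t) * l s t
   + (if s is s'.+1 then l s' t else b c t (jet c r t)).
have bS q (g : C -> 'rV[C]_n) : (forall j, CkV q (ctime c) (fun t => g t 0 j)) ->
    CkV q (ctime c) (fun t => b c t (g t)).
  move=> Hg; apply: CkV_sum => // j _; apply: CkV_mul => //.
  by apply: (smf_curve oA Hf); exact: smf_trace_form.
have l0' s t : (r < s)%N -> wirtinger (1 : C) (l s) t = 0.
  move=> rs; have -> : l s = fun=> 0 by apply/funext => u; exact: l0.
  by rewrite (isW_wirtinger (isW_cst _ _ _)).
exists l'; split.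
- move=> s q; apply: CkV_add => //.
    apply: CkV_add => //; first by apply: CkV_wirtinger.
    apply: CkV_mul => //; apply: bS => j; apply: CkV_hol => //; exact: vel_hol.
  case: s => [|s]; last exact: lS.
  by apply: bS => j; exact: curve_jet_smooth.
- move=> [//|s] t rs; rewrite /l' l0' 1?ltnW // l0 1?ltnW // mulr0 !add0r.
  exact: l0.
- by move=> t; rewrite /l' l0' // l0 // mulr0 !add0r l1.
- move=> [//|N] t Ct; rewrite ltnS => rN.
  apply/rowP => k; rewrite curve_jetS christoffel_sum.
  have HW := isW_sum (index_enum 'I_N) (P := xpredT) (fun (s : 'I_N) _ =>
    isW_mul (CkV_isW (k := 0) (1 : C) (lS s 1%N) Ct)
            (CkV_isW (k := 0) (1 : C) (smooth_pjet s k 1%N) Ct)).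
  have E1 : \forall u \near t,
      \sum_(s < N) l s u * proj_jet c s u 0 k = jet c r u 0 k.
    apply: (@eq_near _ _ (ctime c)) => // u Cu.
    by rewrite (lE N u Cu rN) summxE; apply: eq_bigr => s _; rewrite mxE.
  rewrite (isW_wirtinger (isW_ext E1 HW)) summxE.
  have EF : \sum_i \sum_j proj_christoffel D c i j k (f t) * vel c t 0 i * jet c r t 0 j =
      \sum_(s < N) l s t * \sum_i \sum_j
         proj_christoffel D c i j k (f t) * vel c t 0 i * proj_jet c s t 0 j.
    under [RHS]eq_bigr do rewrite mulr_sumr.
    rewrite [RHS]exchange_big; apply: eq_bigr => i _ /=.
    under [RHS]eq_bigr do rewrite mulr_sumr.
    rewrite [RHS]exchange_big; apply: eq_bigr => j _ /=.
    rewrite (lE N t Ct rN) summxE mulr_sumr; apply: eq_bigr => s _.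
    by rewrite mxE; ring.
  have EK : jet c r t 0 k = \sum_(s < N) l s t * proj_jet c s t 0 k.
    by rewrite (nbhs_singleton E1).
  rewrite EF; under [RHS]eq_bigr => s _ do rewrite mxE /l' mulrDl [X in X + _]mulrDl.
  rewrite !big_split /= big_ord_recr /= l0' // mul0r addr0.
  rewrite [X in _ = _ + X + _]big_ord_recr /= l0 // mulr0 mul0r addr0.
  rewrite [X in _ = _ + X]big_ord_recl /=.
  under [X in _ = _ + (_ + X)]eq_bigr => s _ do rewrite mxE mulrDr.
  rewrite big_split /= EK -/(b c t (jet c r t)) -/(b c t (vel c t)).
  under [X in _ = _ + X + _]eq_bigr => s _ do rewrite -mulrA.
  rewrite -[X in _ = _ + X + _]mulr_sumr.
  set S1 := \sum_(s < N) _; set S2 := \sum_(s < N) _; set S3 := \sum_(s < N) _.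
  set S4 := \sum_(s < N) _; by ring.
Qed.

Hypothesis HPi : forall c i j k l z, img c z ->
  wirtinger_bar 'e_l (proj_christoffel D c i j k \o param c) z = 0.

Lemma proj_jet_hol c r k : hol (ctime c) (fun t => proj_jet c r t 0 k).
Proof.
have oT := @ctime_open _ _ _ _ _ oA Hf c.
elim: r k => [|r IH] k; first exact: vel_hol.
have H : hol (ctime c) (fun t => dv (1 : C) (fun u : C => proj_jet c r u 0 k) t +
    \sum_i \sum_l proj_christoffel D c i l k (f t) * vel c t 0 i * proj_jet c r t 0 l).
  apply: hol_add; first exact: hol_deriv.
  apply: hol_sum => i _; apply: hol_sum => l _; apply: hol_mul => //.
  apply: hol_mul; last exact: vel_hol.
  have oI := cim_open c (@dom_open _ _ _ c).
  have Hm t : ctime c t -> cim c (dom c) (coords c (f t)).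
    by move=> [_ dt]; exact: cim_coords.
  have Hc := hol_comp oI (@smf_proj_christoffel c i l k c 1%N) (fun z j Az =>
    @HPi c i l k j z (proj1 (proj1 (cimE _ _ _) Az))) Hm (fun j => curve_hol Hf (c := c) j).
  by apply: (hol_ext oT _ Hc) => t [_ dt]; rewrite coordsK.
apply: (hol_ext oT _ H) => t Ct; rewrite [RHS]mxE; congr (_ + _).
exact: (esym (isW_wirtinger (isW_hol (hol_dv (1 : C) (IH k) Ct)))).
Qed.

Lemma wronskian_hol c : hol (ctime c) (wronskian D f c).
Proof.
have oT := @ctime_open _ _ _ _ _ oA Hf c.
have := boolp.choice (fun r => jets_triangular c r) => -[L HL].
have H : hol (ctime c) (fun t => \det (\matrix_(r < n, k < n) proj_jet c r t 0 k)).
  by apply: hol_det => r k; exact: proj_jet_hol.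
apply: (hol_ext oT _ H) => t Ct; rewrite /wronskian.
pose M := \matrix_(r < n, s < n) L r s t.
have -> : \matrix_(r < n, k < n) curve_jet D f c r t 0 k =
    M *m (\matrix_(r < n, k < n) proj_jet c r t 0 k).
  apply/matrixP => r k; have [_ _ _ lE] := HL r.
  rewrite !mxE (lE n t Ct (ltn_ord r)) summxE; apply: eq_bigr => s _.
  by rewrite !mxE.
rewrite det_mulmx det_trig.
  rewrite big1 ?mul1r // => i _; rewrite mxE; have [_ _ l1 _] := HL i; exact: l1.
apply/is_trig_mxP => i j ij; rewrite mxE; have [_ l0 _ _] := HL i; exact: l0.
Qed.

(** Near each time a chart around f(t) presents w as a holomorphic Wronskian divided by a
    holomorphic coefficient without zeros. *)
Lemma frame_quotient_hol (O : set X) (e : hchart -> X -> C) (w : C -> C) :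
  holo_frame O e -> (forall t, A t -> O (f t)) ->
  (forall t c, A t -> dom c (f t) -> wronskian D f c t = w t * e c (f t)) ->
  hol A w.
Proof.
move=> [oO _ eh e0] fO Hw t At.
have [c0 ac dt] := atlas_cover (f t); pose c := HoloChart ac.
have Ct : ctime c t by [].
have oT := @ctime_open _ _ _ _ _ oA Hf c.
have oI := cim_open c oO.
have He : hol (cim c O) (e c \o param c) by apply: differentiable_hol; exact: eh.
have Hm s : ctime c s -> cim c O (coords c (f s)).
  by move=> [As ds]; apply: cim_coords => //; exact: fO.
have Hc : hol (ctime c) (fun s => e c (f s)).
  have H := hol_comp oI (CkV_hol 1 oI He) (fun z j Az => (hol_wirtinger _ He Az).2)
    Hm (fun j => curve_hol Hf (c := c) j).
  by apply: (hol_ext oT _ H) => s [_ ds]; rewrite /= coordsK.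
have Hn s : ctime c s -> e c (f s) != 0.
  by move=> [As ds]; apply: e0 => //; exact: fO.
have H := hol_mul (wronskian_hol (c := c)) (hol_inv Hn Hc).
have E s : ctime c s -> wronskian D f c s * (e c (f s))^-1 = w s.
  by move=> Cs; have [As ds] := Cs; rewrite (Hw s c As ds) mulfK // Hn.
exact: (hol_ext oT E H) Ct.
Qed.

End ProjectiveJets.

(** * Subharmonicity of the logarithm of the modulus *)

Section LogModulus.
Variable R : realType.
Local Notation C := R[i].
Local Notation nrm := (@nrm R _).
Local Notation mu := (@lebesgue_measure R).

Lemma cis_surj (s : C) : nrm s = 1 -> exists t : R, - pi <= t <= pi /\ s = cis t.
Proof.
move=> s1; have h := nrm_sqr s; rewrite s1 expr1n in h.
have b : -1 <= complex.Re s <= 1.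
  by rewrite -ler_norml -s1; exact: Re_le_nrm.
pose t := acos (complex.Re s).
have ct : cos t = complex.Re s by rewrite acosK // in_itv.
have st : sin t = `|complex.Im s|.
  rewrite sin_acos // (_ : 1 - _ = complex.Im s ^+ 2) ?sqrtr_sqr //.
  by rewrite h addrC addKr.
have t0 : 0 <= t by exact: acos_ge0.
have tp : t <= pi by exact: acos_lepi.
have [i0|i0] := lerP 0 (complex.Im s).
  exists t; split; first by rewrite tp (le_trans _ t0) // oppr_le0 pi_ge0.
  by apply: complexP; rewrite /= ?ct ?st // ger0_norm.
exists (- t); split; first by rewrite lerN2 tp (le_trans _ (pi_ge0 R)) // oppr_le0.
by apply: complexP; rewrite /= ?cosN ?sinN ?ct ?st // ltr0_norm // opprK.
Qed.

Lemma uniform_continuity (u : R -> R) (a b e : R) : continuous u -> 0 < e ->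
  exists2 d : R, 0 < d &
    forall x y, a <= x <= b -> `|y - x| < d -> `|u y - u x| <= e.
Proof.
move=> cu e0; have /compact_near_coveringP K := @segment_compact R a b.
pose P (d x : R) := forall y, `|y - x| < d -> `|u y - u x| <= e.
have : \forall d \near 0^'+, forall x, `[a, b]%classic x -> P d x.
  apply: (K R (0^'+)%R P _) => x _.
  have [d d0 Hd] := (continuousRR u x).1 (cu x) (e / 2) (divr_gt0 e0 (ltr0n _ 2)).
  have d2 : 0 < d / 2 by rewrite divr_gt0.
  exists ([set x' : R | `|x' - x| < d / 2], [set i : R | i < d / 2]).
    split; last by exact: nbhs_right_lt.
    by apply/nbhs_normP; exists (d / 2) => //= y; rewrite /ball_ /= distrC.
  move=> [x' i] /= [hx hi] y hy.
  have h1 : `|x' - x| < d by apply: lt_trans hx _; lra.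
  have h2 : `|y - x| < d.
    have -> : y - x = (y - x') + (x' - x) by ring.
    by apply: le_lt_trans (ler_normD _ _) _; lra.
  have -> : u y - u x' = (u y - u x) - (u x' - u x) by ring.
  apply: le_trans (ler_normB _ _) _; have := Hd _ h1; have := Hd _ h2; lra.
move=> H; have : \forall d \near (0:R)^'+, 0 < d /\ forall x, `[a, b]%classic x -> P d x.
  by near=> d; split; near: d => //; exact: nbhs_right_gt.
move=> /filter_ex[d [d0 Hd]]; exists d => // x y xab; apply: Hd.
by rewrite /= in_itv.
Unshelve. all: by end_near. Qed.

Lemma Int_period (u : R -> R) (t : R) : continuous u -> (forall x, u (x + 2 * pi) = u x) ->
  Int u t (t + 2 * pi) = Int u 0 (2 * pi).
Proof.
move=> cu per; have [K [dK KE]] := Int_ex cu.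
rewrite !KE; have -> : K (2 * pi) = K (0 + 2 * pi) by rewrite add0r.
apply: (@is_derive_0_is_cst _ (fun t => K (t + 2 * pi) - K t)) => x.
have D1 : is_derive x (1 : R) (fun t => K (t + 2 * pi)) (u (x + 2 * pi)).
  have Ds : is_derive x (1 : R) (fun t : R => t + 2 * pi) 1.
    have D0 := is_deriveD (is_derive_id x (1 : R)) (is_derive_cst (2 * pi : R) x (1 : R)).
    by rewrite addr0 in D0.
  have Dc := @is_derive1_comp _ K (fun t => t + 2 * pi) x _ _ (dK (x + 2 * pi)) Ds.
  by rewrite /GRing.scale /= mulr1 in Dc.
have := is_deriveB D1 (dK x); by rewrite per subrr.
Qed.

Lemma Int_telescope (u : R -> R) (t h : R) (N : nat) :
  \sum_(k < N) Int u (t + k%:R * h) (t + k.+1%:R * h) = Int u t (t + N%:R * h).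
Proof.
elim: N => [|N IH]; first by rewrite big_ord0 mul0r addr0 /Int subrr.
by rewrite big_ord_recr /= IH Int_cat.
Qed.

(** One N serves every starting point t, by uniform continuity on [-pi, 3 pi], which contains all
    nodes t + k h. *)
Lemma riemann_sum (u : R -> R) (e : R) : continuous u ->
  (forall x, u (x + 2 * pi) = u x) -> 0 < e -> exists2 N : nat, (0 < N)%N &
  forall t, - pi <= t <= pi ->
    \sum_(k < N) u (t + k%:R * (2 * pi / N%:R)) * (2 * pi / N%:R) <=
    Int u 0 (2 * pi) + 2 * pi * e.
Proof.
move=> cu per e0; have p0 := @pi_gt0 R.
have [d d0 Hd] := @uniform_continuity u (- pi) (3 * pi) e cu e0.
pose N := (Num.truncn (2 * pi / d)).+1.
have Nd : 2 * pi / N%:R < d.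
  rewrite ltr_pdivrMr ?ltr0n // [X in _ < X]mulrC -ltr_pdivrMr //.
  by apply: truncnS_gt.
exists N => // t /andP[t1 t2]; set h := 2 * pi / N%:R in Nd *.
have h0 : 0 < h by rewrite divr_gt0 ?mulr_gt0 // ltr0n.
have hN : N%:R * h = 2 * pi by rewrite /h mulrC divfK // pnatr_eq0.
have -> : 2 * pi * e = \sum_(k < N) e * h.
  by rewrite sumr_const card_ord -[RHS]mulr_natl mulrCA hN mulrC.
rewrite -(Int_period t cu per) -hN -Int_telescope -big_split /=.
apply: ler_sum => k _; set a := t + k%:R * h.
have -> : t + k.+1%:R * h = a + h by rewrite -natr1 mulrDl mul1r addrA.
have ah : a <= a + h by rewrite lerDl ltW.
rewrite -lerBlDr -mulrBl.
have -> : (u a - e) * h = Int (fun=> u a - e) a (a + h) by rewrite Int_cst addrAC subrr add0r.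
apply: Int_le => //; first by move=> x; exact: cvg_cst.
move=> x /andP[ax xa].
have kh : k%:R * h <= 2 * pi.
  by rewrite -hN ler_pM2r // ler_nat ltnW.
have kh0 : 0 <= k%:R * h by rewrite mulr_ge0 // ltW.
have := Hd a x; rewrite ler_norml => H.
have /H : - pi <= a <= 3 * pi by rewrite /a; apply/andP; split; lra.
have hx : `|x - a| < d by rewrite ger0_norm; lra.
by move=> /(_ hx) /andP[]; lra.
Qed.

Lemma continuous_ln_max (g : R -> R) (e : R) : 0 < e -> continuous g ->
  continuous (fun t => ln (Num.max (g t) e)).
Proof.
move=> e0 cg t; have m0 : 0 < Num.max (g t) e by rewrite lt_max e0 orbT.
apply: (continuous_comp (f := fun t => Num.max (g t) e)); last exact: continuous_ln.
apply: (continuous_comp (f := fun t => (g t)) (g := fun x : R => Num.max x e)); first exact: cg.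
by move=> x; apply: continuous_max; [exact: cvg_id|exact: cvg_cst].
Qed.

Lemma quarter_half (p x : R) : p != 0 -> 2 * p * (x / (4 * p)) = x / 2.
Proof. by move=> p_neq0; field. Qed.

(* Apply the maximum principle to the product of the w(z + s zeta^k), zeta a
   primitive N-th root of unity: its value at s = 0 is w(z)^N, and the logarithm
   of its modulus on |s| = r is a Riemann sum of the integral. Truncating at e
   keeps the integrand continuous at the zeros of w. *)
Lemma jensen_truncated (w : C -> C) (z : C) (r e : R) : 0 < r -> 0 < e ->
  (forall y, nrm (y - z) <= r -> ctn w y) ->
  (forall y, nrm (y - z) <= r -> exists d, hder setT w y 1 d) -> w z != 0 ->
  2 * pi * ln (nrm (w z)) <=
  Int (fun t => ln (Num.max (nrm (w (z + r%:C * cis t))) e)) 0 (2 * pi).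
Proof.
move=> r0 e0 cw dw wz; have p0 := @pi_gt0 R.
pose g t := nrm (w (z + r%:C * cis t)).
set u := fun t => ln _.
have nc t : nrm (z + r%:C * cis t - z) <= r.
  by rewrite addrAC subrr add0r nrmM nrmR nrm_cis mulr1 gtr0_norm.
have cg : continuous g.
  have H := ctnR_circle (f := w) (fun t => cw _ (nc t)).
  move=> t; apply/continuousRR => q q0; have [d d0 Hd] := H t q q0; exists d => // y /Hd h.
  apply: le_lt_trans h; rewrite ler_norml [X in _ && X]nrm_sub andbT lerNl opprB.
  by rewrite nrm_distC nrm_sub.
have cu : continuous u by exact: continuous_ln_max.
have per x : u (x + 2 * pi) = u x by rewrite /u cisD cis2pi mulr1.
rewrite -subr_ge0 leNgt; apply/negP => neg.
(* Multiplied by 2 pi this is half of the supposed gap, so the error of the Riemann sum leaves a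
   contradiction. *)
pose dl := (2 * pi * ln (nrm (w z)) - Int u 0 (2 * pi)) / (4 * pi).
have dl0 : 0 < dl by rewrite divr_gt0 ?mulr_gt0 //; lra.
have [N N0 HN] := riemann_sum cu per dl0.
pose h : R := 2 * pi / N%:R; have h0 : 0 < h by rewrite divr_gt0 ?mulr_gt0 ?ltr0n.
pose H (s : C) := \prod_(k < N) w (z + s * cis (k%:R * h)).
have nk (s : C) t : nrm (z + s * cis t - z) = nrm s.
  by rewrite addrAC subrr add0r nrmM nrm_cis mulr1.
have cH s : nrm (s - 0) <= r -> ctn H s.
  rewrite subr0 => sr; apply: ctn_prod => k _.
  have c1 : ctn (fun s : C => z + s * cis (k%:R * h)) s.
    apply: ctn_add; first exact: ctn_cst.
    by apply: ctn_mul; [exact: ctn_id|exact: ctn_cst].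
  have c2 : ctn w (z + s * cis (k%:R * h)) by apply: cw; rewrite nk.
  exact: (ctn_comp c1 c2).
have dH s : nrm (s - 0) < r -> exists d, hder setT H s 1 d.
  rewrite subr0 => sr; rewrite /H; elim: (index_enum _) => [|k q [d Hd]].
    exists 0; apply: (hder_ext (f := fun _ : C => 1 : C)); last exact: hder_cst.
    by apply: (@eq_near _ _ setT) => // [|y _]; [exact: openT|rewrite big_nil].
  have [d1 Hd1] : exists d, hder setT w (z + s * cis (k%:R * h)) 1 d.
    by apply: dw; rewrite nk ltW.
  have Hl : hder setT (fun s : C => z + s * cis (k%:R * h)) s 1 (0 + (1 * cis (k%:R * h) + s * 0)).
    apply: hder_add; first exact: hder_cst.
    by apply: hder_mul; [exact: hder_id|exact: hder_cst].
  have Hc := hder_comp (f := fun s : C => z + s * cis (k%:R * h)) Hd1 Hl.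
  have Hm := hder_mul Hc Hd; eexists; apply: (hder_ext _ Hm).
  by apply: (@eq_near _ _ setT) => // [|y _]; [exact: openT|rewrite big_cons].
pose M := expR ((Int u 0 (2 * pi) + 2 * pi * dl) / h).
have HM s : nrm (s - 0) = r -> nrm (H s) <= M.
  rewrite subr0 => sr.
  have [t [tpi st]] : exists t : R, - pi <= t <= pi /\ r%:C^-1 * s = cis t.
    by apply: cis_surj; rewrite nrmM nrmV nrmR sr gtr0_norm // mulVf // gt_eqF.
  have {}st : s = r%:C * cis t.
    by rewrite -st mulrA mulfV ?mul1r // eq_complex /= eqxx andbT gt_eqF.
  have -> : nrm (H s) = \prod_(k < N) g (t + k%:R * h).
    rewrite /H (big_morph _ (@nrmM R) (@nrm1 R)); apply: eq_bigr => k _.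
    by rewrite /g cisD mulrA -st.
  apply: le_trans (_ : expR (\sum_(k < N) u (t + k%:R * h)) <= _); last first.
    by rewrite ler_expR ler_pdivlMr // mulr_suml; exact: HN.
  rewrite expR_sum; apply: ler_prod => k _; rewrite nrm_ge0 /= /u lnK ?le_max ?lexx //.
  by rewrite posrE lt_max e0 orbT.
have Hmm := max_mod r0 cH _ HM.
have {}Hmm : nrm (H 0) <= M.
  apply: Hmm; last by rewrite subrr nrm0 ltW.
  move=> s sr; exists (r - nrm (s - 0)); first by rewrite subr_gt0.
  move=> s' _ ss; apply: dH; have := nrm_trans s s' 0; lra.
have n0 : 0 < nrm (w z) by rewrite nrm_gt0.
have E0 : nrm (H 0) = nrm (w z) ^+ N.
  rewrite /H (eq_bigr (fun=> w z)) ?prodr_const ?card_ord ?nrmX // => k _.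
  by rewrite mul0r addr0.
have L : ln (nrm (w z)) *+ N <= (Int u 0 (2 * pi) + 2 * pi * dl) / h.
  rewrite -lnXn // -[leRHS]expRK ler_ln ?posrE ?expR_gt0 ?exprn_gt0 //.
  by rewrite -E0.
have hN : h * N%:R = 2 * pi by rewrite /h divfK // pnatr_eq0 -lt0n.
move: L; rewrite ler_pdivlMr // -[X in X * h]mulr_natl mulrAC [X in X * _]mulrC hN.
have -> : 2 * pi * dl = (2 * pi * ln (nrm (w z)) - Int u 0 (2 * pi)) / 2.
  by apply: quarter_half; rewrite gt_eqF.
lra.
Qed.

(** Monotone convergence for M - ln (max g e_k), which is nonnegative and increases as e_k = 1 / (k
    + 1) decreases; its limit M - [lne] g is +oo at the zeros of g, where the truncation was
    needed. *)
Lemma lne_integral_ge (g : R -> R) (L : R) : continuous g -> (forall t, 0 <= g t) ->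
  (forall e : R, 0 < e -> 2 * pi * L <= Int (fun t => ln (Num.max (g t) e)) 0 (2 * pi)) ->
  (L%:E <= ((2 * pi)^-1)%:E * \int[mu]_(t in `[0%R, (2 * pi)%R]) lne (g t)%:E)%E.
Proof.
move=> cg g0 H; have p0 : 0 < 2 * pi :> R by rewrite mulr_gt0 // pi_gt0.
have [B HB] : exists B : R, forall t : R, t \in `[0, 2 * pi]%R -> g t <= B.
  have [c _ Hc] := EVT_max (ltW p0) (continuous_subspaceT cg).
  by exists (g c).
(* The 1 dominates the truncations e_k <= 1 and keeps the argument of the logarithm positive. *)
pose M := ln (Num.max B 1).
pose e_ (k : nat) : R := k.+1%:R^-1.
have e0 k : 0 < e_ k by rewrite invr_gt0.
have m0 k t : 0 < Num.max (g t) (e_ k) by rewrite lt_max e0 orbT.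
pose v k t : R := M - ln (Num.max (g t) (e_ k)).
have cu k : continuous (fun t => ln (Num.max (g t) (e_ k))) by exact: continuous_ln_max.
have cv k : continuous (v k).
  by move=> t; apply: cvgB; [exact: cvg_cst|exact: cu].
pose D : set R := `[0%R, (2 * pi)%R]%classic.
have mD : measurable D by exact: measurable_itv.
have v0 k t : D t -> 0 <= v k t.
  move=> Dt; rewrite subr_ge0 ler_ln ?posrE ?lt_max ?ltr01 ?orbT ?e0 ?orbT //.
  rewrite ge_max !le_max HB //= ?inE //; apply/orP; right.
  by rewrite invf_le1 // ler1n.
have nd t : {homo v ^~ t : k m / (k <= m)%N >-> k <= m}.
  move=> k m km; rewrite lerB // ler_ln ?posrE //.
  rewrite ge_max le_max lexx /= le_max; apply/orP; right.
  by rewrite lef_pV2 ?posrE // ler_nat ltnS.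
pose f t : \bar R := (M%:E - lne (g t)%:E)%E.
have vf t : (v k t)%:E @[k --> \oo] --> f t.
  rewrite /f; have [gt0|] := ltrP 0 (g t).
    rewrite lne_EFin //; apply: cvg_near_cst.
    near=> k; rewrite /v EFinB; congr (_ - (ln _)%:E)%E; apply/max_idPl.
    rewrite invf_ple ?posrE //.
    by apply: le_trans (_ : k%:R <= _); [near: k; exact: nbhs_infty_ger|rewrite ler_nat].
  move=> gt0; have {}gt0 : g t = 0 by apply/eqP; rewrite eq_le gt0 g0.
  rewrite gt0 le0_lneNy // /= addey //; apply/cvgeryP/cvgryPge => A.
  near=> k; rewrite /v gt0 (max_idPr _) ?(ltW (e0 k)) // lnV ?posrE // opprK.
  rewrite -lerBlDl -[leLHS]expRK ler_ln ?posrE ?expR_gt0 //.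
  by apply: le_trans (_ : k%:R <= _); [near: k; exact: nbhs_infty_ger|rewrite ler_nat].
have mv k := measurable_int mu (continuous_integrable_seg 0 (2 * pi) (cv k)).
have If k : (\int[mu]_(t in D) (v k t)%:E <= (2 * pi * (M - L))%:E)%E.
  rewrite /D Int_Leb // lee_fin /v.
  have := H _ (e0 k).
  have -> : Int (fun t => M - ln (Num.max (g t) (e_ k))) 0 (2 * pi) =
     Int (fun=> M) 0 (2 * pi) + -1 * Int (fun t => ln (Num.max (g t) (e_ k))) 0 (2 * pi).
    rewrite -IntZ // -IntD //; first by congr Int; apply/funext => t; rewrite mulN1r.
      by move=> t; exact: cvg_cst.
    by move=> t; apply: cvgM; [exact: cvg_cst|exact: cu].
  by rewrite Int_cst; lra.
have mf := emeasurable_fun_cvg (fun k => EFin \o v k) f mv (fun t (_ : D t) => vf t).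
have fE t : limn (fun k => (v k t)%:E) = f t by exact: cvg_lim (vf t).
have f0 t : D t -> (0 <= f t)%E.
  move=> Dt; rewrite -fE; apply: lime_ge; first by apply/cvg_ex; exists (f t).
  by near=> k; rewrite lee_fin v0.
have Cf := @cvg_monotone_convergence _ _ _ mu D mD (fun k t => (v k t)%:E) mv
  (fun k t Dt => v0 k t Dt) (fun t Dt k m km => nd t k m km).
have IfE : (\int[mu]_(t in D) f t <= (2 * pi * (M - L))%:E)%E.
  under eq_integral do rewrite -fE.
  rewrite -(cvg_lim _ Cf) //; apply: lime_le; first by apply/cvg_ex; eexists; exact: Cf.
  by near=> k; exact: If.
have fi : mu.-integrable D f.
  apply/integrableP; split => //; apply: le_lt_trans (ltry (2 * pi * (M - L))).
  by under eq_integral => t /set_mem Dt do rewrite gee0_abs ?f0 //.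
have ci : mu.-integrable D (EFin \o cst M).
  by apply: continuous_integrable_seg => t; exact: cvg_cst.
have -> : (\int[mu]_(t in D) lne (g t)%:E = \int[mu]_(t in D) ((EFin \o cst M) t - f t))%E.
  apply: eq_integral => t _; rewrite /f /=; case: ifP => _ //=.
  by rewrite -EFinD; congr (_%:E); ring.
have I0 : (0 <= \int[mu]_(t in D) f t)%E by apply: integral_ge0 => t /f0.
rewrite integralB //; move: IfE I0; case: (integral mu D f) => [i| |] //.
rewrite !lee_fin => Ii i0; have -> : (\int[mu]_(t in D) (EFin \o cst M) t = (M * (2 * pi))%:E)%E.
  have cM : continuous (fun _ : R => M) by move=> t; exact: cvg_cst.
  by have := Int_Leb p0 cM; rewrite Int_cst subr0.
rewrite -EFinB -EFinM lee_fin ler_pdivlMl //; move: Ii; rewrite mulrBr; lra.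
Unshelve. all: by end_near. Qed.

Lemma log_modulus_subharmonic (A : set C) (w : C -> C) : open A -> hol A w ->
  subharmonic_on A (fun t => lne (nrm (w t))%:E).
Proof.
move=> oA Hw; split.
- move=> z _; case: (ltrP 0 (nrm (w z))) => h; first by rewrite lne_EFin // ltry.
  by rewrite le0_lneNy ?lee_fin // ltNyr.
- move=> z a Az; have [cw _] := Hw z Az => Hlt.
  have wa : nrm (w z) < expR a.
    case: (ltrP 0 (nrm (w z))) => h; last by apply: le_lt_trans h (expR_gt0 _).
    by move: Hlt; rewrite lne_EFin // lte_fin -[a in _ < a -> _]expRK ltr_ln ?posrE ?expR_gt0.
  have [d d0 Hd] := cw (expR a - nrm (w z)) (ltac:(by rewrite subr_gt0)).
  apply/nbhs_nrm; exists d => // y /Hd h.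
  have h2 : nrm (w y) < expR a by have := nrm_sub (w y) (w z); lra.
  case: (ltrP 0 (nrm (w y))) => h3; last by rewrite le0_lneNy ?lee_fin // ltNyr.
  by rewrite lne_EFin // lte_fin -[a]expRK ltr_ln ?posrE ?expR_gt0.
- move=> z r r0 sub.
  have sub' y : nrm (y - z) <= r -> A y.
    by move=> h; apply: sub; rewrite /= nrmE lecR.
  have [w0|w0] := eqVneq (w z) 0.
    by rewrite w0 nrm0 le0_lneNy // leNye.
  rewrite lne_EFin ?nrm_gt0 //.
  have cw y : nrm (y - z) <= r -> ctn w y by move=> /sub' /Hw[].
  have dw y : nrm (y - z) <= r -> exists d, hder setT w y 1 d.
    by move=> /sub' /Hw[_ /(_ 1)].
  apply: (@lne_integral_ge (fun t => nrm (w (z + r%:C * cis t)))).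
  + have nc t : nrm (z + r%:C * cis t - z) <= r.
      by rewrite addrAC subrr add0r nrmM nrmR nrm_cis mulr1 gtr0_norm.
    have H := ctnR_circle (f := w) (fun t => cw _ (nc t)).
    move=> t; apply/continuousRR => q q0; have [d d0 Hd] := H t q q0; exists d => // y /Hd h.
    apply: le_lt_trans h; rewrite ler_norml [X in _ && X]nrm_sub andbT lerNl opprB.
    by rewrite nrm_distC nrm_sub.
  + by move=> t; exact: nrm_ge0.
  + by move=> e e0; exact: jensen_truncated.
Qed.

End LogModulus.

(** * Second order consequences of subharmonicity *)

Section SmoothAlgebra.
Variables (R : realType) (V : normedModType R[i]).
Local Notation C := R[i].
Local Notation nrm := (@nrm R _).
Implicit Types (A : set V) (f g : V -> C) (z v : V).

Lemma conjc_mul_i (a b : C) :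
  conjc ('i%C * a - 'i%C * b) = 'i%C * conjc b - 'i%C * conjc a.
Proof. by case: a b => [x y] [x' y']; apply: complexP; rewrite /=; ring. Qed.

Lemma isW_conj f z v (d db : C) : isW f z v d db ->
  isW (fun y => conjc (f y)) z v (conjc db) (conjc d).
Proof.
move=> [h1 h2]; split.
  have := rder_conj h1; congr (hder _ _ _ _ _).
  by rewrite rmorphD addrC.
have := rder_conj h2; congr (hder _ _ _ _ _).
exact: conjc_mul_i.
Qed.

Lemma isW_inv f z v (d db : C) : f z != 0 -> isW f z v d db ->
  isW (fun y => (f y)^-1) z v (- (d / f z ^+ 2)) (- (db / f z ^+ 2)).
Proof.
move=> f0 [h1 h2]; split.
  have := hder_inv f0 h1; congr (hder _ _ _ _ _).
  by rewrite mulrDl opprD.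
have := hder_inv f0 h2; congr (hder _ _ _ _ _).
by move: (f z ^+ 2)^-1 => b; ring.
Qed.

Lemma CkV_inv k A f : open A -> (forall z, A z -> f z != 0) ->
  (forall j, CkV j A f) -> CkV k A (fun z => (f z)^-1).
Proof.
move=> oA f0 Hf; have c z : A z -> ctn (fun z => (f z)^-1) z.
  by move=> Az; apply: ctn_inv; [exact: f0|exact: CkV_ctn (Hf 0%N) Az].
elim: k => [|k IH]; first by split.
apply: (@CkV_intro _ _ k A _ (fun v z => - (rderive v f z * ((f z)^-1 * (f z)^-1)))) => //.
- move=> v z Az; have := hder_inv (f0 z Az) (CkV_der v (Hf 1%N) Az).
  by rewrite expr2 invfM.
- move=> v; apply: CkV_opp => //; apply: CkV_mul => //; first exact: CkV_rderive (Hf k.+1).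
  exact: CkV_mul.
Qed.

Lemma rdiff_ln (x : R) : 0 < x -> rdiff (@ln R) x x^-1.
Proof.
move=> x0; apply/real_derP; have D := is_derive1_ln x0.
by split; [case: D|rewrite derive1E; apply: derive_val].
Qed.

Lemma CkV_ln k A (rho : V -> R) : open A -> (forall z, A z -> 0 < rho z) ->
  (forall j, CkV j A (fun z => (rho z)%:C : C)) ->
  CkV k A (fun z => (ln (rho z))%:C : C).
Proof.
move=> oA r0 Hr; have c z : A z -> ctn (fun z => (ln (rho z))%:C : C) z.
  by move=> Az; apply: rdiff_ctn (rdiff_ln (r0 z Az)) (CkV_ctn (Hr 0%N) Az).
case: k => [|k]; first by split.
apply: (@CkV_intro _ _ k A _ (fun v z => rderive v (fun y => (rho y)%:C : C) z * ((rho z)%:C)^-1)) => //.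
- move=> v z Az; have := rdiff_comp (rdiff_ln (r0 z Az)) (CkV_der v (Hr 1%N) Az).
  by rewrite fmorphV.
- move=> v; apply: CkV_mul => //; first exact: CkV_rderive (Hr k.+1).
  by apply: CkV_inv => // z Az; rewrite eq_complex /= eqxx andbT gt_eqF // r0.
Qed.

Lemma hder_shift (S : set C) g z u v d : hder S g (z + u) v d ->
  hder S (fun y => g (y + u)) z v d.
Proof.
move=> H e /H[r r0 Hr]; exists r => // h Sh /(Hr h Sh).
by rewrite (addrAC z).
Qed.

Lemma mean_value_ineq (q q' : R -> R) (K h : R) : 0 <= h ->
  (forall s, 0 <= s <= h -> rdiff q s (q' s)) ->
  (forall s, 0 <= s <= h -> `|q' s| <= K) -> `|q h - q 0| <= K * h.
Proof.
move=> h0 Hq HK.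
have D s : 0 <= s <= h -> is_derive s (1 : R) q (q' s).
  move=> /Hq /real_derP[d1 d2]; apply: DeriveDef => //; by rewrite -derive1E.
have [||x] := @MVT_segment R q q' 0 h h0.
- by move=> x; rewrite in_itv /= => /andP[/ltW x0 /ltW xh]; apply: D; rewrite x0.
- apply: continuous_in_subspaceT => x; rewrite inE /= in_itv /= => xh.
  by apply: differentiable_continuous; apply/derivable1_diffP; case: (D x xh).
rewrite in_itv /= => xh ->; rewrite subr0 normrM (ger0_norm h0).
by rewrite ler_wpM2r // HK.
Qed.

Lemma line_ineq g z v (d : R -> C) (c : C) (K h : R) : 0 <= h ->
  (forall s, 0 <= s <= h -> hder Sreal g (z + s%:C *: v) v (d s)) ->
  (forall s, 0 <= s <= h -> nrm (d s - c) <= K) ->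
  nrm (g (z + h%:C *: v) - g z - h%:C * c) <= 2 * K * h.
Proof.
move=> h0 Hd HK.
have part (pr : C -> R) : (forall a b, pr (a + b) = pr a + pr b) ->
    (forall (s : R) a, pr (s%:C * a) = s * pr a) -> (forall a, `|pr a| <= nrm a) ->
    `|pr (g (z + h%:C *: v) - g z - h%:C * c)| <= K * h.
  move=> prD prZ prn.
  have prN a : pr (- a) = - pr a.
    by apply/eqP; rewrite -addr_eq0 -prD addNr; apply/eqP; have := prZ 0 0; rewrite !mul0r.
  pose q s := pr (g (z + s%:C *: v)) - s * pr c.
  have -> : pr (g (z + h%:C *: v) - g z - h%:C * c) = q h - q 0.
    by rewrite /q !prD !prN prZ scale0r addr0; ring.
  apply: (@mean_value_ineq q (fun s => pr (d s - c))) => // s sh; last first.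
    by apply: le_trans (prn _) (HK s sh).
  move=> e e0; have [r r0 Hr] := Hd s sh e e0; exists r => // t tr.
  have := Hr t%:C (SrealR t); rewrite nrmR => /(_ tr).
  apply: le_trans; apply: le_trans (prn _).
  rewrite /q !prD !prN [_ *: d s]/GRing.scale /= prZ -(addrA z) -scalerDl -rmorphD.
  by rewrite le_eqVlt; apply/orP; left; apply/eqP; congr `|_|; ring.
apply: le_trans (nrm_le_ReIm _) _.
have -> : 2 * K * h = K * h + K * h by ring.
apply: lerD; apply: part.
- exact: ReD.
- by move=> s a; rewrite ReM /= mul0r subr0.
- exact: Re_le_nrm.
- exact: ImD.
- by move=> s a; rewrite ImM /= mul0r addr0.
- exact: Im_le_nrm.
Qed.

Lemma quarter_absurd (h N : R) : 0 < h * h -> 0 < N ->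
  ~ (h * h * N <= N / 4 * h * h + N / 4 * h * h).
Proof. by move=> hh N0; have := mulr_gt0 hh N0; lra. Qed.

(** The second difference of g over the parallelogram spanned by h v and h w equals h^2 times either
    mixed derivative, up to o(h^2). *)
Lemma rderive_comm A g z v w : open A -> CkV 2 A g -> A z ->
  rderive v (rderive w g) z = rderive w (rderive v g) z.
Proof.
move=> oA Hg Az.
have half v' w' (e : R) : 0 < e -> exists2 r : R, 0 < r & forall h : R, 0 < h -> h < r ->
   nrm (g (z + h%:C *: v' + h%:C *: w') - g (z + h%:C *: v') - (g (z + h%:C *: w') - g z)
     - h%:C * (h%:C * rderive w' (rderive v' g) z)) <= e * h * h.
  move=> e0; have e2 : 0 < e / 2 by rewrite divr_gt0.
  have [r1 r10 H1] := strict_der w' oA (CkV_rderive v' Hg) Az e2.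
  have [r2 r20 H2] := (open_nrm A).1 oA z Az.
  pose p := Num.min r1 r2; have p0 : 0 < p by rewrite lt_min r10.
  have n1 : 0 < 1 + (nrm v' + nrm w') by rewrite ltr_pwDl ?addr_ge0 ?nrm_ge0.
  exists (Num.min p (p / (1 + (nrm v' + nrm w')))); first by rewrite lt_min p0 divr_gt0.
  move=> h h0; rewrite lt_min ltr_pdivlMr // => /andP[hp hn].
  have small s : 0 <= s <= h -> nrm (s%:C *: v') + nrm (h%:C *: w') < p.
    move=> /andP[s0 sh]; apply: le_lt_trans hn.
    rewrite !nrmZ !nrmR !ger0_norm ?(ltW h0) // !mulrDr mulr1.
    have := ler_wpM2r (nrm_ge0 v') sh; lra.
  have in1 s : 0 <= s <= h -> nrm (z + s%:C *: v' - z) < p.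
    move=> /small; rewrite addrAC subrr add0r; apply: le_lt_trans.
    by rewrite lerDl nrm_ge0.
  have in2 s : 0 <= s <= h -> nrm (z + s%:C *: v' + h%:C *: w' - z) < p.
    move=> /small; rewrite -(addrA z) addrAC subrr add0r; apply: le_lt_trans.
    exact: nrmD.
  pose G y := g (y + h%:C *: w') - g y.
  have -> : e * h * h = 2 * (e / 2 * h) * h by field.
  apply: (@line_ineq G z v' (fun s => rderive v' g (z + s%:C *: v' + h%:C *: w')
     - rderive v' g (z + s%:C *: v'))) => //; first exact: ltW.
    move=> s sh; apply: hder_add.
      apply: hder_shift; apply: (CkV_der v' (CkV_pred Hg)); apply: H2.
      by apply: lt_le_trans (in2 s sh) _; rewrite ge_min lexx orbT.
    apply: hder_opp; apply: (CkV_der v' (CkV_pred Hg)); apply: H2.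
    by apply: lt_le_trans (in1 s sh) _; rewrite ge_min lexx orbT.
  move=> s sh; rewrite -[h in leRHS](ger0_norm (ltW h0)); apply: H1.
    by apply: lt_le_trans (in1 s sh) _; rewrite ge_min lexx.
  by rewrite ger0_norm ?ltW //; apply: lt_le_trans hp _; rewrite ge_min lexx.
set D1 := rderive v _ z; set D2 := rderive w _ z.
apply/eqP; rewrite -subr_eq0 -nrm_eq0; apply/eqP.
apply: contrapT => /eqP ne.
have N0 : 0 < nrm (D1 - D2) by rewrite lt_def ne nrm_ge0.
have e0 : 0 < nrm (D1 - D2) / 4 by rewrite divr_gt0.
have [r1 r10 H1] := half w v _ e0; have [r2 r20 H2] := half v w _ e0.
pose h := Num.min r1 r2 / 2.
have m0 : 0 < Num.min r1 r2 by rewrite lt_min r10.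
have h0 : 0 < h by rewrite divr_gt0.
have hm : h < Num.min r1 r2 by rewrite /h; lra.
move: hm; rewrite lt_min => /andP[hm1 hm2].
have {}H1 := H1 h h0 hm1.
have {}H2 := H2 h h0 hm2.
rewrite -/D1 in H1; rewrite -/D2 in H2.
have E : h%:C * (h%:C * (D1 - D2)) =
   (g (z + h%:C *: v + h%:C *: w) - g (z + h%:C *: v) - (g (z + h%:C *: w) - g z)
     - h%:C * (h%:C * D2)) -
   (g (z + h%:C *: w + h%:C *: v) - g (z + h%:C *: w) - (g (z + h%:C *: v) - g z)
     - h%:C * (h%:C * D1)).
  rewrite (addrAC z (h%:C *: w)); by ring.
have := le_trans (nrmB _ _) (lerD H2 H1); rewrite -E !nrmM nrmR (gtr0_norm h0).
have hh : 0 < h * h by rewrite mulr_gt0.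
by rewrite mulrA; exact: quarter_absurd.
Qed.

End SmoothAlgebra.

(** * Taylor expansion, circle means and the Laplacian *)

Section SecondOrder.
Variable R : realType.
Local Notation C := R[i].
Local Notation nrm := (@nrm R _).
Local Notation dz := (wirtinger (1 : C)).
Local Notation dzb := (wirtinger_bar (1 : C)).

Lemma mixed_wirtinger (c a b d i : C) :
  (c * (a + - i * b) + i * (c * (b + - i * d))) / 2%:R =
  (c * (a + i * b) - i * (c * (b + i * d))) / 2%:R.
Proof. by congr (_ / _); ring. Qed.

Lemma wirtinger_comm (V : normedModType C) (A : set V) g z v : open A -> CkV 2 A g -> A z ->
  wirtinger_bar v (wirtinger v g) z = wirtinger v (wirtinger_bar v g) z.
Proof.
move=> oA Hg Az; pose iv := 'i%C *: v.
have D u u' : hder Sreal (rderive u g) z u' (rderive u' (rderive u g) z).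
  exact: (CkV_der u' (CkV_rderive u Hg) Az).
pose c1 : C := 2%:R^-1.
have E1 u : rderive u (wirtinger v g) z =
    c1 * (rderive u (rderive v g) z + - 'i%C * rderive u (rderive iv g) z).
  have H := hder_scale c1 (hder_add (D v u) (hder_scale (- 'i%C) (D iv u))).
  apply: rder_rderive; have := H; congr (hder _ _ _ _ _); apply/funext => y.
  by rewrite /wirtinger /GRing.scale /= mulNr mulrC.
have E2 u : rderive u (wirtinger_bar v g) z =
    c1 * (rderive u (rderive v g) z + 'i%C * rderive u (rderive iv g) z).
  have H := hder_scale c1 (hder_add (D v u) (hder_scale 'i%C (D iv u))).
  apply: rder_rderive; have := H; congr (hder _ _ _ _ _); apply/funext => y.
  by rewrite /wirtinger_bar /GRing.scale /= mulrC.
rewrite /wirtinger_bar /wirtinger -/(wirtinger v g) -/(wirtinger_bar v g) !E1 !E2.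
by rewrite -/iv (rderive_comm iv v oA Hg Az); exact: mixed_wirtinger.
Qed.

Lemma complexRI (h : C) : h = (complex.Re h)%:C * 1 + (complex.Im h)%:C * 'i%C.
Proof. by case: h => x y; apply: complexP; rewrite /=; ring. Qed.

Lemma conj_double (z w : C) : z * w + conjc z * conjc w = (2 * complex.Re (z * w))%:C.
Proof. by case: z w => [x y] [x' y']; apply: complexP; rewrite /=; ring. Qed.

Lemma real_to_wirtinger (a b x y : C) : x * a + y * b =
  (x * 1 + y * 'i%C) * ((a - 'i%C * b) / 2%:R) + (x - 'i%C * y) * ((a + 'i%C * b) / 2%:R).
Proof.
transitivity (x * a - ('i%C * 'i%C) * y * b); last by field.
by rewrite ii; ring.
Qed.

Lemma frechetC A g (z : C) : open A -> CkV 1 A g -> A z ->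
  forall e : R, 0 < e -> exists2 r : R, 0 < r & forall h : C, nrm h < r ->
    nrm (g (z + h) - g z - (h * dz g z + conjc h * dzb g z)) <= e * nrm h.
Proof.
move=> oA Hg Az e e0; have e2 : 0 < e / 2 by rewrite divr_gt0.
have [q q0 Hq] := strict_der_sum [:: true; false] (fun b : bool => if b then 1 else 'i%C : C) oA Hg Az e2.
exists q => // h hq.
pose t (b : bool) := if b then complex.Re h else complex.Im h.
have tq b : `|t b| < q.
  by apply: le_lt_trans hq; case: b; [exact: Re_le_nrm|exact: Im_le_nrm].
have := Hq z t; rewrite subrr nrm0 => /(_ q0 tq).
rewrite !big_cons !big_nil !addr0 /= /GRing.scale /= -(complexRI h).
have -> : (complex.Re h)%:C * rderive 1 g z + (complex.Im h)%:C * rderive 'i%C g z =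
    h * dz g z + conjc h * dzb g z.
  rewrite /wirtinger /wirtinger_bar (_ : Complex 0 1 *: (1 : C) = 'i%C); last first.
    by rewrite /GRing.scale /= mulr1.
  rewrite conjcE {3}(complexRI h); exact: real_to_wirtinger.
move=> H; apply: le_trans H _; rewrite -mulrA ler_wpM2l ?(ltW e0) //.
have := Re_le_nrm h; have := Im_le_nrm h; lra.
Qed.

Lemma hder_dirC A g (z v : C) : open A -> CkV 1 A g -> A z ->
  hder Sreal g z v (v * dz g z + conjc v * dzb g z).
Proof.
move=> oA Hg Az e e0; have n1 : 0 < 1 + nrm v by rewrite ltr_pwDl ?nrm_ge0.
have [r r0 Hr] := frechetC oA Hg Az (divr_gt0 e0 n1).
exists (r / (1 + nrm v)); first by rewrite divr_gt0.
move=> h /Sreal_E hE; rewrite ltr_pdivlMr // => hr.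
have hv : nrm h * nrm v <= nrm h * (1 + nrm v) by rewrite ler_wpM2l ?nrm_ge0 // lerDr.
have := Hr (h *: v); rewrite nrmZ => /(_ (le_lt_trans hv hr)).
have -> : h *: v * dz g z + conjc (h *: v) * dzb g z = h *: (v * dz g z + conjc v * dzb g z).
  have ch : conjc h = h by rewrite hE; apply: complexP; rewrite /= ?oppr0.
  by rewrite /GRing.scale /= rmorphM /= ch; ring.
move=> H; apply: le_trans H _; rewrite mulrAC ler_pdivrMr // -mulrA.
by rewrite ler_wpM2l // ltW.
Qed.

Lemma rdiff_sub (u p : R -> R) s d d' : rdiff u s d -> rdiff p s d' ->
  rdiff (fun x => u x - p x) s (d - d').
Proof.
move=> Hu Hp e e0; have e2 : 0 < e / 2 by rewrite divr_gt0.
have [r r0 Hr] := Hu _ e2; have [q q0 Hq] := Hp _ e2.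
exists (Num.min r q); first by rewrite lt_min r0.
move=> h; rewrite lt_min => /andP[/Hr h1 /Hq h2].
have -> : u (s + h) - p (s + h) - (u s - p s) - h * (d - d') =
  (u (s + h) - u s - h * d) - (p (s + h) - p s - h * d') by ring.
apply: le_trans (ler_normB _ _) _; move: h1 h2; set x := `|h|; lra.
Qed.

Lemma rdiff_quadratic (a b s : R) :
  rdiff (fun x => x * a + x ^+ 2 * b) s (a + 2 * s * b).
Proof.
move=> e e0; have b1 : 0 < 1 + `|b| by rewrite ltr_pwDl.
exists (e / (1 + `|b|)); first by rewrite divr_gt0.
move=> h; rewrite ltr_pdivlMr // => he.
have -> : (s + h) * a + (s + h) ^+ 2 * b - (s * a + s ^+ 2 * b) - h * (a + 2 * s * b) = h * b * h by ring.
rewrite normrM ler_wpM2r // normrM; apply: le_trans (ltW he).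
by rewrite ler_wpM2l // lerDr.
Qed.

Lemma quadratic_remainder (z g g0 g1 g2 : C) (s : R) :
  2 * complex.Re (z * g) - (2 * complex.Re (z * g0) + 2 * s *
   (complex.Re (g1 * z ^+ 2)
    + complex.Re g2 * (complex.Re z ^+ 2 + complex.Im z ^+ 2))) =
  2 * complex.Re (z * (g - g0 - (s%:C * z * g1 + conjc (s%:C * z) * g2))).
Proof.
case: z g g0 g1 g2 => [x y] [a b] [a0 b0] [a1 b1] [a2 b2].
by rewrite !expr2 /=; ring.
Qed.

Lemma Re_double (g z p : C) :
  complex.Re (2%:R * g * z + p) = 2 * complex.Re (z * g) + complex.Re p.
Proof. by case: g z p => [x y] [x' y'] [a b]; rewrite /=; ring. Qed.

Lemma taylor_rearrange (u v a p g m e : R) :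
  u - (a + (p + g * m)) - v <= e * m -> u <= v + (a + p) + (g + e) * m.
Proof. by rewrite mulrDl; lra. Qed.

(** The terms in z and z^2 stay together as the real part of a holomorphic polynomial, which
    contributes nothing but its central value to a circle mean; the term in |z|^2 carries the
    Laplacian. *)
Lemma taylor2 A (rho : R[i] -> R) : open A -> A 0 -> CkV 2 A (fun z => (rho z)%:C : C) ->
  let G := dz (fun z => (rho z)%:C : C) in
  forall e : R, 0 < e -> exists2 r : R, 0 < r & forall z, nrm z < r ->
    rho z <= rho 0 + complex.Re (2%:R * G 0 * z + dz G 0 * z ^+ 2)
             + (complex.Re (dzb G 0) + e) * nrm z ^+ 2.
Proof.
move=> oA A0 Hr G e e0; pose phi : C -> C := fun z => (rho z)%:C.
have HG : CkV 1 A G by exact: CkV_wirtinger.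
have e2 : 0 < e / 2 by rewrite divr_gt0.
have [r1 r10 H1] := frechetC oA HG A0 e2.
have [r2 r20 H2] := (open_nrm A).1 oA 0 A0.
exists (Num.min r1 r2); first by rewrite lt_min r10.
move=> z; rewrite lt_min => /andP[z1 z2].
have nsz s : 0 <= s <= 1 -> nrm (s%:C * z) <= nrm z.
  move=> /andP[s0 s1]; rewrite nrmM nrmR ger0_norm // -[leRHS]mul1r.
  by rewrite ler_wpM2r ?nrm_ge0.
have inA s : 0 <= s <= 1 -> A (s%:C * z).
  by move=> /nsz h; apply: H2; rewrite subr0; apply: le_lt_trans h z2.
have barE y : A y -> dzb phi y = conjc (G y).
  move=> Ay; have HW := CkV_isW (1 : C) (CkV_pred Hr) Ay.
  have E : (fun y => conjc (phi y)) = phi.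
    by apply/funext => u; apply: complexP; rewrite /= ?oppr0.
  by have := isW_conj HW; rewrite -/phi E => /isW_bar.
pose a := 2 * complex.Re (z * G 0).
pose b := complex.Re (dz G 0 * z ^+ 2) + complex.Re (dzb G 0) * nrm z ^+ 2.
(* The function along the ray minus its quadratic model: a bound e |z|^2 for the derivative on
   [0, 1] bounds the remainder. *)
pose q (s : R) := rho (s%:C * z) - (s * a + s ^+ 2 * b).
pose q' (s : R) := 2 * complex.Re (z * G (s%:C * z)) - (a + 2 * s * b).
have Dq s : 0 <= s <= 1 -> rdiff q s (q' s).
  move=> s01; apply: rdiff_sub; last exact: rdiff_quadratic.
  have := hder_dirC z oA (CkV_pred Hr) (inA s s01); rewrite -/phi barE; last exact: inA.
  move=> H e' /H[r r0 {}H]; exists r => // h hr; have := H h%:C (SrealR h).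
  rewrite nrmR => /(_ hr); apply: le_trans.
  rewrite conj_double.
  rewrite /phi /GRing.scale /= -mulrDl -rmorphD -rmorphM -!rmorphB nrmR.
  exact: lexx.
have Bq s : 0 <= s <= 1 -> `|q' s| <= e * nrm z ^+ 2.
  move=> s01; have h := H1 (s%:C * z) (le_lt_trans (nsz s s01) z1).
  rewrite add0r in h.
  have -> : q' s = 2 * complex.Re (z * (G (s%:C * z) - G 0 -
      (s%:C * z * dz G 0 + conjc (s%:C * z) * dzb G 0))).
    by rewrite /q' /a /b nrm_sqr; exact: quadratic_remainder.
  rewrite normrM ger0_norm //.
  apply: le_trans (_ : 2 * (nrm z * (e / 2 * nrm (s%:C * z))) <= _).
    rewrite ler_wpM2l //; apply: le_trans (Re_le_nrm _) _; rewrite nrmM.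
    by rewrite ler_wpM2l ?nrm_ge0.
  have -> : 2 * (nrm z * (e / 2 * nrm (s%:C * z))) = e * (nrm z * nrm (s%:C * z)) by field.
  by rewrite expr2 ler_wpM2l ?(ltW e0) // ler_wpM2l ?nrm_ge0 // nsz.
have q1 : q 1 = rho z - (a + b).
  by rewrite /q rmorph1 expr1n !mul1r.
have q0 : q 0 = rho 0.
  by rewrite /q rmorph0 expr2 !mul0r addr0 subr0.
have := le_trans (ler_norm _) (mean_value_ineq ler01 Dq Bq).
rewrite q1 q0 mulr1 Re_double; exact: taylor_rearrange.
Qed.

Lemma circle_average (rho : C -> R) (f : C -> C) (r K : R) : 0 < r ->
  continuous (fun t => rho (r%:C * cis t)) ->
  hol setT f -> (forall z, nrm z = r -> rho z <= complex.Re (f z) + K) ->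
  Int (fun t => rho (r%:C * cis t)) 0 (2 * pi) <= 2 * pi * (complex.Re (f 0) + K).
Proof.
move=> r0 cr Hf Hb; have p0 := @pi_gt0 R.
have nr t : nrm (r%:C * cis t) = r by rewrite nrmM nrmR nrm_cis mulr1 gtr0_norm.
have cf : ctnR (fun t => f (0 + r%:C * cis t)).
  by apply: ctnR_circle => t; have [] := Hf (0 + r%:C * cis t) I.
have M := @mean_value R f 0 (r + 1) r r0 (ltac:(by rewrite ltrDl)) (fun z _ => (Hf z I).1)
  (fun z _ _ => (Hf z I).2 1).
have cRe := ctsRe cf.
have cK : continuous (fun _ : R => K) by move=> t; exact: cvg_cst.
apply: le_trans (_ : Int (fun t => complex.Re (f (0 + r%:C * cis t)) + K) 0 (2 * pi) <= _).
  apply: Int_le => //; first by rewrite mulr_ge0 // ltW.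
    by move=> t; apply: cvgD; [exact: cRe|exact: cK].
  by move=> t _; rewrite add0r; apply: Hb.
have -> : Int (fun t => complex.Re (f (0 + r%:C * cis t)) + K) 0 (2 * pi) =
    2 * pi * complex.Re (f 0) + K * (2 * pi).
  rewrite IntD // Int_cst subr0; congr (_ + _).
  by have := congr1 (@complex.Re R) M; rewrite ReM ReR ImR mul0r subr0 => <-.
by move: (2 * pi) (complex.Re _) => x y; rewrite mulrDr [K * _]mulrC.
Qed.

Lemma log_derivative (a b x y : C) : x != 0 -> y != 0 ->
  (a * y + x * b) * (x * y)^-1 = a / x + b / y.
Proof. by move=> x0 y0; field; rewrite x0 y0. Qed.

(** The fraction is dbar (dw / w), and twice its real part is dbar d log |w|^2. Were it negative,
    the Taylor bound would push the mean of log |w|^2 over a small circle below the value at the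
    centre. *)
Lemma laplacian_ge0 (A : set C) (w : C -> C) (r0 : R) : open A -> A 0 -> 0 < r0 ->
  (forall k, CkV k A w) -> w 0 != 0 ->
  subharmonic_on (disk 0 r0) (fun t => lne (nrm (w t))%:E) ->
  0 <= complex.Re ((dzb (dz w) 0 * w 0 - dz w 0 * dzb w 0) / w 0 ^+ 2).
Proof.
move=> oA A0 r00 Hw w0 [_ _ sub].
pose B := [set z | A z /\ w z != 0].
have oB : open B.
  apply/open_nrm => z [Az wz]; have [q q0 Hq] := (open_nrm A).1 oA z Az.
  have := ctn_neq0 (CkV_ctn (Hw 0%N) Az) wz => /nbhs_nrm[p p0 Hp].
  exists (Num.min p q); first by rewrite lt_min p0.
  by move=> y; rewrite lt_min => /andP[/Hp h1 /Hq h2].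
have B0 : B 0 by [].
have BA : B `<=` A by move=> z [].
have HwB k : CkV k B w := CkV_mono BA (Hw k).
pose rho z : R := nrm (w z) ^+ 2.
have rhoE z : (rho z)%:C = w z * conjc (w z) by rewrite -sqr_normc nrmE rmorphXn.
have Hrho k : CkV k B (fun z => (rho z)%:C : C).
  apply: (CkV_ext (f := fun z => w z * conjc (w z)) oB) => [z _|]; first by rewrite rhoE.
  by apply: CkV_mul => //; apply: CkV_conj.
have rho0 z : B z -> 0 < rho z by move=> [_ wz]; rewrite exprn_gt0 // nrm_gt0.
pose phi z := (ln (rho z))%:C : C.
have Hphi k : CkV k B phi by exact: CkV_ln.
have iW z : B z -> isW w z (1 : C) (dz w z) (dzb w z).
  by move=> Bz; exact: (CkV_isW (k := 0) (1 : C) (HwB 1%N) Bz).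
have EG z : B z -> dz w z * (w z)^-1 + conjc (dzb w z * (w z)^-1) = dz phi z.
  move=> Bz; have [_ wz] := Bz; apply/esym; apply: isW_wirtinger.
  have P := isW_mul (iW z Bz) (isW_conj (iW z Bz)).
  have [P1 P2] : isW (fun z => (rho z)%:C : C) z (1 : C)
      (dz w z * conjc (w z) + w z * conjc (dzb w z)) (dzb w z * conjc (w z) + w z * conjc (dz w z)).
    apply: isW_ext P; apply: (@eq_near _ _ B) => // y _; by rewrite rhoE.
  have L1 := rdiff_comp (rdiff_ln (rho0 z Bz)) P1.
  have L2 := rdiff_comp (rdiff_ln (rho0 z Bz)) P2.
  have cw : conjc (w z) != 0 by rewrite fmorph_eq0.
  have HI : isW phi z (1 : C) ((dz w z * conjc (w z) + w z * conjc (dzb w z)) * ((rho z)^-1)%:C)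
      ((dzb w z * conjc (w z) + w z * conjc (dz w z)) * ((rho z)^-1)%:C).
    by split; [have := L1|have := L2]; congr (hder _ _ _ _ _); ring.
  have := HI; congr (isW _ _ _ _ _).
  have -> : ((rho z)^-1)%:C = (w z * conjc (w z))^-1 :> C by rewrite -rhoE fmorphV.
  have -> : conjc (dzb w z / w z) = conjc (dzb w z) / conjc (w z) by rewrite rmorphM /= fmorphV.
  exact: log_derivative.
pose X := (dzb (dz w) 0 * w 0 - dz w 0 * dzb w 0) / w 0 ^+ 2.
have G2 : dzb (dz phi) 0 = X + conjc X.
  apply: isW_bar.
  have W1 := CkV_isW (k := 0) (1 : C) (CkV_wirtinger (1 : C) oB (HwB 2%N)) B0.
  have W2 := CkV_isW (k := 0) (1 : C) (CkV_wirtinger_bar (1 : C) oB (HwB 2%N)) B0.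
  have WI := isW_inv w0 (iW 0 B0).
  have W := isW_add (isW_mul W1 WI) (isW_conj (isW_mul W2 WI)).
  have := isW_ext (eq_near oB B0 EG) W; congr (isW _ _ _ _ _).
  congr (_ + conjc _); rewrite /X; first by field.
  by rewrite -(wirtinger_comm _ oB (HwB 2%N) B0); field.
rewrite -/X leNgt; apply/negP => X0.
(* The coefficient of |z|^2 is 2 Re X; an error of - Re X still leaves Re X < 0. *)
have [r1 r10 H1] := taylor2 oB B0 (Hphi 2%N) (ltac:(by rewrite oppr_gt0) : 0 < - complex.Re X).
have [r2 r20 H2] := (open_nrm B).1 oB 0 B0.
pose r := Num.min r0 (Num.min r1 r2) / 2.
have m0 : 0 < Num.min r0 (Num.min r1 r2) by rewrite !lt_min r00 r10.
have rp : 0 < r by rewrite divr_gt0.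
have : r < Num.min r0 (Num.min r1 r2) by rewrite /r; lra.
rewrite !lt_min => /and3P[rr0 rr1 rr2].
have nr t : nrm (r%:C * cis t) = r by rewrite nrmM nrmR nrm_cis mulr1 gtr0_norm.
have Bc t : B (r%:C * cis t) by apply: H2; rewrite subr0 nr.
have csub : [set y : C | `|y - 0| <= r%:C] `<=` disk 0 r0.
  by move=> y /=; rewrite /disk /= nrmE lecR ltcR => h; apply: le_lt_trans rr0.
have := sub 0 r rp csub.
have cphi : continuous (fun t => ln (rho (r%:C * cis t))).
  have Bc0 t : B (0 + r%:C * cis t) by rewrite add0r.
  have H := @ctnR_circle R phi 0 r (fun t => CkV_ctn (Hphi 0%N) (Bc0 t)).
  have := ctsRe H; rewrite /phi /=; under eq_fun do rewrite add0r; exact.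
pose f (z : C) : C := (ln (rho 0))%:C + (2%:R * dz phi 0 * z + dz (dz phi) 0 * (z * z)).
have holid : hol setT (fun z : C => z).
  by move=> z _; split; [exact: ctn_id|move=> v; exists v; exact: hder_id].
have Hf : hol setT f.
  apply: hol_add; first exact: hol_cst.
  apply: hol_add; first by apply: hol_mul => //; exact: hol_cst.
  by apply: hol_mul; [exact: hol_cst|exact: hol_mul].
pose K := (complex.Re (X + conjc X) + - complex.Re X) * r ^+ 2.
have Hb z : nrm z = r -> ln (rho z) <= complex.Re (f z) + K.
  move=> nz; have := H1 z (ltac:(by rewrite nz)); rewrite -/phi G2 nz.
  by rewrite /f [in X in _ -> X]ReD ReR expr2.
have := circle_average (rho := fun z => ln (rho z)) rp cphi Hf Hb.
set I0 := Int _ 0 (2 * pi) => HI.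
have lnE z : B z -> lne (nrm (w z))%:E = (2^-1 * ln (rho z))%:E.
  move=> [_ wz]; rewrite lne_EFin ?nrm_gt0 // /rho lnXn ?nrm_gt0 //.
  by congr (_%:E); rewrite mulr2n -mulr2n -[X in _ * X]mulr_natl mulKf // pnatr_eq0.
rewrite lnE //.
have -> : (\int[lebesgue_measure]_(th in `[0%R, (2 * pi)%R])
     lne (nrm (w (0 + r%:C * (cos th +i* sin th))))%:E = (2^-1 * I0)%:E)%E.
  transitivity (\int[lebesgue_measure]_(t in `[0%R, (2 * pi)%R])
     (2^-1 * ln (rho (r%:C * cis t)))%:E)%E.
    by apply: eq_integral => t _; rewrite add0r -/(cis t) lnE.
  have p2 : 0 < 2 * pi :> R by rewrite mulr_gt0 // pi_gt0.
  have c2 : continuous (fun t => 2^-1 * ln (rho (r%:C * cis t))).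
    by move=> t; apply: cvgM; [exact: cvg_cst|exact: cphi].
  by rewrite (Int_Leb p2 c2) IntZ.
rewrite -EFinM lee_fin => Hs.
have fe : complex.Re (f 0) = ln (rho 0) by rewrite /f !mulr0 !addr0.
have KE : K = complex.Re X * r ^+ 2.
  by rewrite /K; case: (X) => a b /=; ring.
have Kn : K < 0 by rewrite KE pmulr_llt0 // exprn_gt0.
move: HI Hs; rewrite fe mulrCA ler_pM2l ?invr_gt0 //.
have p2 : 0 < 2 * pi :> R by rewrite mulr_gt0 // pi_gt0.
rewrite ler_pdivlMl // => h1 h2; have := le_trans h2 h1.
by rewrite ler_pM2l // lerDl leNgt Kn.
Qed.

End SecondOrder.

(** * Jets of curves and their perturbation *)

#[global] Opaque rderive wirtinger wirtinger_bar.

Section FiniteJets.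
Variable R : realType.
Local Notation C := R[i].
Local Notation nrm := (@nrm R _).
Local Notation dz := (wirtinger (1 : C)).
Local Notation dzb := (wirtinger_bar (1 : C)).
Implicit Types phi psi : C -> C.

(* [jeq m xi phi psi]: the derivatives d^p phi and dbar d^p phi at 0 agree with
   those of psi for p < m; for p = m, d^m phi exceeds d^m psi by xi and the
   dbar d^m agree. *)
Fixpoint jeq (m : nat) (xi : C) phi psi : Prop :=
  match m with
  | 0%N => phi 0 = psi 0 + xi /\ dzb phi 0 = dzb psi 0
  | m'.+1 => [/\ phi 0 = psi 0, dzb phi 0 = dzb psi 0 & jeq m' xi (dz phi) (dz psi)]
  end.

(** Agreement of the derivatives d^p and dbar d^p at 0 for p < m, without any shift. *)
Definition jeq0 (m : nat) phi psi : Prop :=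
  if m is m'.+1 then jeq m' 0 phi psi else True.

Lemma jeq0S m phi psi : jeq0 m.+1 phi psi <->
  [/\ phi 0 = psi 0, dzb phi 0 = dzb psi 0 & jeq0 m (dz phi) (dz psi)].
Proof.
case: m => [|m] /=; last by split.
by rewrite addr0; split => [[]|[]].
Qed.

Lemma jeq_jeq0 m xi phi psi : jeq m xi phi psi -> jeq0 m phi psi.
Proof.
elim: m phi psi => [//|m IH] phi psi [h1 h2 h3]; apply/jeq0S; split => //.
exact: IH.
Qed.

Lemma jeq0_le m k phi psi : (k <= m)%N -> jeq0 m phi psi -> jeq0 k phi psi.
Proof.
elim: k m phi psi => [//|k IH] [//|m] phi psi km /jeq0S[h1 h2 h3].
by apply/jeq0S; split => //; exact: IH h3.
Qed.

Lemma jeq0_refl m phi : jeq0 m phi phi.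
Proof. by elim: m phi => [//|m IH] phi; apply/jeq0S. Qed.

Variable A : set C.
Hypotheses (oA : open A) (A0 : A 0).

Definition Sm phi : Prop := forall k, CkV k A phi.

Lemma Sm_isW phi z : Sm phi -> A z -> isW phi z 1 (dz phi z) (dzb phi z).
Proof. by move=> H Az; exact: (CkV_isW (k := 0) (1 : C) (H 1%N) Az). Qed.

Lemma Sm_dz phi : Sm phi -> Sm (dz phi).
Proof. by move=> H k; apply: CkV_wirtinger. Qed.

Lemma Sm_add phi psi : Sm phi -> Sm psi -> Sm (fun t => phi t + psi t).
Proof. by move=> H H' k; exact: CkV_add. Qed.

Lemma Sm_mul phi psi : Sm phi -> Sm psi -> Sm (fun t => phi t * psi t).
Proof. by move=> H H' k; exact: CkV_mul. Qed.

Lemma Sm_sum (I : Type) (r : seq I) (F : I -> C -> C) : (forall i, Sm (F i)) ->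
  Sm (fun t => \sum_(i <- r) F i t).
Proof. by move=> H k; apply: CkV_sum => // i _; exact: H. Qed.

Lemma Sm_hol phi : hol A phi -> Sm phi.
Proof. by move=> H k; exact: CkV_hol. Qed.

Lemma dz_ext phi phi' z : (forall z, A z -> phi z = phi' z) -> Sm phi -> A z ->
  dz phi z = dz phi' z /\ dzb phi z = dzb phi' z.
Proof.
move=> E H Az; have W := isW_ext (eq_near oA Az E) (Sm_isW H Az).
by rewrite (isW_wirtinger W) (isW_bar W).
Qed.

Lemma jeq_ext m xi phi phi' psi psi' : Sm phi -> Sm psi ->
  (forall z, A z -> phi z = phi' z) -> (forall z, A z -> psi z = psi' z) ->
  jeq m xi phi psi -> jeq m xi phi' psi'.
Proof.
elim: m phi phi' psi psi' => [|m IH] phi phi' psi psi' Sp Ss Ep Es /=.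
  have [_ e1] := dz_ext Ep Sp A0; have [_ e2] := dz_ext Es Ss A0.
  by rewrite -(Ep 0 A0) -(Es 0 A0) -e1 -e2.
move=> [h1 h2 h3]; have [_ e1] := dz_ext Ep Sp A0; have [_ e2] := dz_ext Es Ss A0.
rewrite -(Ep 0 A0) -(Es 0 A0) -e1 -e2; split; [exact: h1|exact: h2|].
apply: IH h3; [exact: Sm_dz|exact: Sm_dz| |].
  by move=> z Az; exact: (dz_ext Ep Sp Az).1.
by move=> z Az; exact: (dz_ext Es Ss Az).1.
Qed.

Lemma jeq0_ext m phi phi' psi psi' : Sm phi -> Sm psi ->
  (forall z, A z -> phi z = phi' z) -> (forall z, A z -> psi z = psi' z) ->
  jeq0 m phi psi -> jeq0 m phi' psi'.
Proof. by case: m => [//|m]; exact: jeq_ext. Qed.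

Lemma dz_add phi psi z : Sm phi -> Sm psi -> A z ->
  dz (fun t => phi t + psi t) z = dz phi z + dz psi z /\
  dzb (fun t => phi t + psi t) z = dzb phi z + dzb psi z.
Proof.
move=> H H' Az; have W := isW_add (Sm_isW H Az) (Sm_isW H' Az).
by rewrite (isW_wirtinger W) (isW_bar W).
Qed.

Lemma dz_mul phi psi z : Sm phi -> Sm psi -> A z ->
  dz (fun t => phi t * psi t) z = dz phi z * psi z + phi z * dz psi z /\
  dzb (fun t => phi t * psi t) z = dzb phi z * psi z + phi z * dzb psi z.
Proof.
move=> H H' Az; have W := isW_mul (Sm_isW H Az) (Sm_isW H' Az).
by rewrite (isW_wirtinger W) (isW_bar W).
Qed.

Lemma jeq_add m a b phi psi phi' psi' : Sm phi -> Sm psi -> Sm phi' -> Sm psi' ->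
  jeq m a phi psi -> jeq m b phi' psi' ->
  jeq m (a + b) (fun t => phi t + phi' t) (fun t => psi t + psi' t).
Proof.
elim: m phi psi phi' psi' => [|m IH] phi psi phi' psi' S1 S2 S3 S4 /=.
  have [_ e1] := dz_add S1 S3 A0; have [_ e2] := dz_add S2 S4 A0; rewrite e1 e2.
  move=> [a1 a2] [b1 b2]; split; first by rewrite a1 b1 addrACA.
  by rewrite a2 b2.
have [_ e1] := dz_add S1 S3 A0; have [_ e2] := dz_add S2 S4 A0; rewrite e1 e2.
move=> [a1 a2 h] [b1 b2 h']; split; [by rewrite a1 b1|by rewrite a2 b2|].
have := IH _ _ _ _ (Sm_dz S1) (Sm_dz S2) (Sm_dz S3) (Sm_dz S4) h h'.
apply: jeq_ext.
- by apply: Sm_add; exact: Sm_dz.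
- by apply: Sm_add; exact: Sm_dz.
- by move=> z Az; rewrite (dz_add S1 S3 Az).1.
- by move=> z Az; rewrite (dz_add S2 S4 Az).1.
Qed.

Lemma jeq0_add m phi psi phi' psi' : Sm phi -> Sm psi -> Sm phi' -> Sm psi' ->
  jeq0 m phi psi -> jeq0 m phi' psi' ->
  jeq0 m (fun t => phi t + phi' t) (fun t => psi t + psi' t).
Proof.
case: m => [//|m] S1 S2 S3 S4 h h'; rewrite /jeq0.
have := jeq_add S1 S2 S3 S4 h h'; by rewrite addr0.
Qed.

Lemma jeq0_mul m phi psi phi' psi' : Sm phi -> Sm psi -> Sm phi' -> Sm psi' ->
  jeq0 m phi psi -> jeq0 m phi' psi' ->
  jeq0 m (fun t => phi t * phi' t) (fun t => psi t * psi' t).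
Proof.
elim: m phi psi phi' psi' => [//|m IH] phi psi phi' psi' S1 S2 S3 S4 H H'.
have K := jeq0_le (leqnSn m) H; have K' := jeq0_le (leqnSn m) H'.
move: H H' => /jeq0S[h1 h2 h3] /jeq0S[h1' h2' h3']; apply/jeq0S.
have [_ e1] := dz_mul S1 S3 A0; have [_ e2] := dz_mul S2 S4 A0.
rewrite e1 e2; split; [by rewrite h1 h1'|by rewrite h1 h2 h1' h2'|].
have := jeq0_add (Sm_mul (Sm_dz S1) S3) (Sm_mul (Sm_dz S2) S4)
  (Sm_mul S1 (Sm_dz S3)) (Sm_mul S2 (Sm_dz S4))
  (IH _ _ _ _ (Sm_dz S1) (Sm_dz S2) S3 S4 h3 K')
  (IH _ _ _ _ S1 S2 (Sm_dz S3) (Sm_dz S4) K h3').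
apply: jeq0_ext.
- by apply: Sm_add; apply: Sm_mul => //; exact: Sm_dz.
- by apply: Sm_add; apply: Sm_mul => //; exact: Sm_dz.
- by move=> z Az; rewrite (dz_mul S1 S3 Az).1.
- by move=> z Az; rewrite (dz_mul S2 S4 Az).1.
Qed.

Lemma Sm_cst (a : C) : Sm (fun=> a).
Proof. by move=> k; exact: CkV_cst. Qed.

Lemma jeq0_sum m (I : Type) (r : seq I) (F G : I -> C -> C) :
  (forall i, Sm (F i)) -> (forall i, Sm (G i)) -> (forall i, jeq0 m (F i) (G i)) ->
  jeq0 m (fun t => \sum_(i <- r) F i t) (fun t => \sum_(i <- r) G i t).
Proof.
move=> SF SG H; elim: r => [|i r IH].
  apply: (jeq0_ext (phi := fun=> 0) (psi := fun=> 0)); try exact: Sm_cst.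
  - by move=> z _; rewrite big_nil.
  - by move=> z _; rewrite big_nil.
  - exact: jeq0_refl.
have := jeq0_add (SF i) (SG i) (Sm_sum r SF) (Sm_sum r SG) (H i) IH.
apply: jeq0_ext.
- by apply: Sm_add => //; exact: Sm_sum.
- by apply: Sm_add => //; exact: Sm_sum.
- by move=> z _; rewrite big_cons.
- by move=> z _; rewrite big_cons.
Qed.

Lemma Sm_prod (I : Type) (r : seq I) (F : I -> C -> C) : (forall i, Sm (F i)) ->
  Sm (fun t => \prod_(i <- r) F i t).
Proof. by move=> H k; apply: CkV_prod => // i _; exact: H. Qed.

Lemma jeq0_prod m (I : Type) (r : seq I) (F G : I -> C -> C) :
  (forall i, Sm (F i)) -> (forall i, Sm (G i)) -> (forall i, jeq0 m (F i) (G i)) ->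
  jeq0 m (fun t => \prod_(i <- r) F i t) (fun t => \prod_(i <- r) G i t).
Proof.
move=> SF SG H; elim: r => [|i r IH].
  apply: (jeq0_ext (phi := fun=> 1) (psi := fun=> 1)); try exact: Sm_cst.
  - by move=> z _; rewrite big_nil.
  - by move=> z _; rewrite big_nil.
  - exact: jeq0_refl.
have := jeq0_mul (SF i) (SG i) (Sm_prod r SF) (Sm_prod r SG) (H i) IH.
apply: jeq0_ext.
- by apply: Sm_mul => //; exact: Sm_prod.
- by apply: Sm_mul => //; exact: Sm_prod.
- by move=> z _; rewrite big_cons.
- by move=> z _; rewrite big_cons.
Qed.

Lemma jeq0_det m d (F G : 'I_d -> 'I_d -> C -> C) :
  (forall i j, Sm (F i j)) -> (forall i j, Sm (G i j)) ->
  (forall i j, jeq0 m (F i j) (G i j)) ->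
  jeq0 m (fun t => \det (\matrix_(i, j) F i j t)) (fun t => \det (\matrix_(i, j) G i j t)).
Proof.
move=> SF SG H; pose E (F : 'I_d -> 'I_d -> C -> C) t :=
  \sum_(s : 'S_d) (-1) ^+ s * \prod_i F i (s i) t.
have EE F' t : E F' t = \det (\matrix_(i, j) F' i j t).
  by apply: eq_bigr => s _; congr (_ * _); apply: eq_bigr => i _; rewrite mxE.
have SE F' : (forall i j, Sm (F' i j)) -> forall s : 'S_d,
    Sm (fun t => (-1) ^+ s * \prod_i F' i (s i) t).
  by move=> SF' s; apply: Sm_mul; [exact: Sm_cst|apply: Sm_prod => i].
apply: (jeq0_ext (phi := E F) (psi := E G)).
- by apply: Sm_sum; exact: SE.
- by apply: Sm_sum; exact: SE.
- by move=> z _; rewrite EE.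
- by move=> z _; rewrite EE.
apply: jeq0_sum; [exact: SE|exact: SE|] => s.
apply: jeq0_mul; [exact: Sm_cst|exact: Sm_cst| | |exact: jeq0_refl|].
- by apply: Sm_prod => i.
- by apply: Sm_prod => i.
- by apply: jeq0_prod.
Qed.

(** Equality of the first derivatives is a hypothesis of its own: already dbar of g(f(t)) involves
    the conjugate of f', which [jeq0 1] does not control. *)
Lemma jeq0_comp n m (B : set 'rV[C]_n) g (f f' : C -> 'rV[C]_n) : open B ->
  (forall k, CkV k B g) -> (forall t, A t -> B (f t)) -> (forall t, A t -> B (f' t)) ->
  (forall j, hol A (fun t => f t 0 j)) -> (forall j, hol A (fun t => f' t 0 j)) ->
  f 0 = f' 0 -> (forall j, dz (fun t => f t 0 j) 0 = dz (fun t => f' t 0 j) 0) ->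
  (forall j, jeq0 m (fun t => f t 0 j) (fun t => f' t 0 j)) ->
  jeq0 m (fun t => g (f t)) (fun t => g (f' t)).
Proof.
move=> oB Hg fB fB' Hf Hf' E0 E1; elim: m g Hg => [//|m IH] g Hg H.
have W (h : C -> 'rV[C]_n) t : (forall t, A t -> B (h t)) ->
    (forall j, hol A (fun t => h t 0 j)) -> A t ->
    isW (fun t => g (h t)) t 1
      (\sum_j dz (fun t => h t 0 j) t * wirtinger (delta_mx 0 j) g (h t))
      (\sum_j conjc (dz (fun t => h t 0 j) t) * wirtinger_bar (delta_mx 0 j) g (h t)).
  move=> hB Hh At.
  have D j : isW (fun t => h t 0 j) t (1 : C) (dz (fun t => h t 0 j) t) 0.
    have W0 := isW_hol (hol_dv (1 : C) (Hh j) At).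
    by rewrite (isW_wirtinger W0).
  have := isW_comp oB (Hg 1%N) (hB t At) D; congr (isW _ _ _ _ _).
    by apply: eq_bigr => j _; rewrite conjc0 mul0r addr0.
  by apply: eq_bigr => j _; rewrite mul0r add0r.
have SmC (g' : 'rV[C]_n -> C) (h : C -> 'rV[C]_n) : (forall k, CkV k B g') ->
    (forall t, A t -> B (h t)) -> (forall j, hol A (fun t => h t 0 j)) ->
    Sm (fun t => g' (h t)).
  by move=> Hg' hB Hh k; apply: (CkV_comp oA oB hB (Hg' k)) => j; exact: CkV_hol.
apply/jeq0S; split; first by rewrite E0.
  rewrite (isW_bar (W f 0 fB Hf A0)) (isW_bar (W f' 0 fB' Hf' A0)).
  by apply: eq_bigr => j _; rewrite E1 E0.
have Sw j k : CkV k B (wirtinger (delta_mx 0 j) g) by apply: CkV_wirtinger.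
have Sd (h : C -> 'rV[C]_n) j : (forall j, hol A (fun t => h t 0 j)) ->
   Sm (dz (fun t => h t 0 j)) by move=> Hh; exact/Sm_dz/Sm_hol.
apply: (jeq0_ext (phi := fun t => \sum_j dz (fun t => f t 0 j) t * wirtinger (delta_mx 0 j) g (f t))
   (psi := fun t => \sum_j dz (fun t => f' t 0 j) t * wirtinger (delta_mx 0 j) g (f' t))).
- by apply: Sm_sum => j; apply: Sm_mul; [exact: Sd|exact: SmC].
- by apply: Sm_sum => j; apply: Sm_mul; [exact: Sd|exact: SmC].
- by move=> z Az; rewrite (isW_wirtinger (W f z fB Hf Az)).
- by move=> z Az; rewrite (isW_wirtinger (W f' z fB' Hf' Az)).
apply: jeq0_sum => j; try (apply: Sm_mul; [exact: Sd|exact: SmC]).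
have IHj : jeq0 m (fun t => wirtinger (delta_mx 0 j) g (f t)) (fun t => wirtinger (delta_mx 0 j) g (f' t)).
  by apply: IH => // i; apply: jeq0_le (leqnSn m) (H i).
have Hd : jeq0 m (dz (fun t => f t 0 j)) (dz (fun t => f' t 0 j)).
  by have /jeq0S[] := H j.
exact: (jeq0_mul (Sd f j Hf) (Sd f' j Hf') (SmC _ f (Sw j) fB Hf) (SmC _ f' (Sw j) fB' Hf') Hd IHj).
Qed.

Definition mono (m : nat) (t : C) : C := t ^+ m / (m`!)%:R.

Lemma mono_der m t : hder setT (mono m.+1) t 1 (mono m t).
Proof.
have P : hder setT (fun t : C => t ^+ m.+1) t 1 (m.+1%:R * t ^+ m).
  elim: m => [|m IH].
    have := @hder_id R setT _ t 1; congr (hder _ _ _ _ _).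
    by rewrite expr0 mulr1.
  have := hder_mul (@hder_id R setT _ t 1) IH; congr (hder _ _ _ _ _).
  by rewrite mul1r mulrCA -exprS -[m.+2%:R]natr1 mulrDl mul1r addrC.
have := hder_scale (((m.+1)`!)%:R^-1) P; congr (hder _ _ _ _ _).
  by apply/funext => y; rewrite /mono mulrC.
rewrite /mono factS natrM /GRing.scale /= invfM mulrC.
have n0 : (m.+1%:R : C) != 0 by rewrite pnatr_eq0.
have f0 : ((m`!)%:R : C) != 0 by rewrite pnatr_eq0 -lt0n fact_gt0.
by move: (m.+1%:R) (m`!%:R) n0 f0 => a b a0 b0; field; rewrite a0 b0.
Qed.

Lemma mono_hol m : hol setT (mono m).
Proof.
move=> t _; case: m => [|m].
  have E : mono 0 = fun=> 1 by apply/funext => y; rewrite /mono expr0 divr1.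
  by rewrite E; split; [exact: ctn_cst|move=> v; exists 0; exact: hder_cst].
split; first exact: cder_ctn (mono_der m t).
move=> v; eexists; have := cder_dir v (mono_der m t).
by rewrite (_ : v *: 1 = v) //; [exact|rewrite /GRing.scale /= mulr1].
Qed.

Lemma jeq_mono m xi phi : Sm phi -> jeq m xi (fun t => phi t + xi * mono m t) phi.
Proof.
have W k psi z : Sm psi -> A z -> isW (fun t => psi t + xi * mono k.+1 t) z 1
    (dz psi z + xi * mono k z) (dzb psi z).
  move=> Sp Az.
  have := isW_add (Sm_isW Sp Az) (isW_mul (isW_cst xi z 1) (isW_hol (mono_der k z))).
  by congr (isW _ _ _ _ _); rewrite ?mul0r ?mulr0 ?addr0 ?add0r.
have SM k psi : Sm psi -> Sm (fun t => psi t + xi * mono k t).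
  move=> Sp; apply: Sm_add => //; apply: Sm_mul; first exact: Sm_cst.
  by apply: Sm_hol => t _; exact: mono_hol.
elim: m phi => [|m IH] phi Sp.
  have E : (fun t => phi t + xi * mono 0 t) = fun t => phi t + xi.
    by apply/funext => t; rewrite /mono expr0 divr1 mulr1.
  rewrite E /=; split => //.
  by rewrite (isW_bar (isW_add (Sm_isW Sp A0) (isW_cst xi (0 : C) (1 : C)))) addr0.
split; first by rewrite /mono expr0n /= mul0r mulr0 addr0.
  by rewrite (isW_bar (W m phi 0 Sp A0)).
apply: jeq_ext (IH _ (Sm_dz Sp)) => //.
- exact/SM/Sm_dz.
- exact: Sm_dz.
- by move=> z Az; rewrite (isW_wirtinger (W m phi z Sp Az)).
Qed.

End FiniteJets.

(** * Curves in a chart with prescribed jets *)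

Section ChartCurves.
Variables (R : realType) (n : nat) (X : complexManifold R n).
Local Notation C := R[i].
Local Notation nrm := (@nrm R _).
Local Notation hchart := (holo_chart X).
Local Notation "''e_' i" := (delta_mx 0 i : 'rV[C]_n) (at level 8, i at level 2).
Local Notation dz := (wirtinger (1 : C)).
Local Notation dzb := (wirtinger_bar (1 : C)).
Variables (D : vfield X -> vfield X -> vfield X) (HD : is_connection D).
Variable c : hchart.
Implicit Types gam : C -> 'rV[C]_n.

(** The curves to be built are polynomials in coordinates, so no domain has to be carried along;
    they stay in the chart image for small t ([small_disk]). *)
Definition entire gam : Prop := forall j, hol setT (fun t => gam t 0 j).
Definition cjet gam r t : 'rV[C]_n := curve_jet D (param c \o gam) c r t.

Lemma hol_sub (V : normedModType C) (A B : set V) (g : V -> C) : A `<=` B -> hol B g -> hol A g.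
Proof. by move=> AB H z /AB /H. Qed.

Section OneCurve.
Variables (A : set C) (gam : C -> 'rV[C]_n).
Hypotheses (oA : open A) (Hg : entire gam) (gA : forall t, A t -> img c (gam t)).

Lemma chart_curve_holomorphic : holomorphic_curve A (param c \o gam).
Proof.
move=> t At; have [dt et] := imgP (gA At).
have cg : ctn gam t by apply: ctn_row => j; exact: (Hg j I).1.
split.
  apply: continuous_comp; first exact/ctnP.
  by rewrite -et; exact: param_continuous.
move=> c' dt'; have oI := cim_open c (@dom_open _ _ _ c').
have Ic : cim c (dom c') (gam t) by apply/cimE; split => //; exact: gA.
suff H : hder setT (coords c' \o (param c \o gam)) t (1 : C)
    (\row_k \sum_j dv (1 : C) (fun s => gam s 0 j) t * wirtinger 'e_j (fun z => coords c' (param c z) 0 k) (gam t)).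
  by case/cderP: H.
apply: hder_row => k.
apply: (chain_hol oI (CkV_hol 1 oI (tr_hol c c' k)) Ic).
  by move=> j; exact: (hol_wirtinger _ (tr_hol c c' k) Ic).2.
by move=> j; exact: hol_dv (Hg j) I.
Qed.

Lemma ctime_chart t : A t -> ctime A (param c \o gam) c t.
Proof. by move=> At; split => //; have [] := imgP (gA At). Qed.

Lemma cjet_smooth r k : Sm A (fun t => cjet gam r t 0 k).
Proof.
move=> q; have H := @curve_jet_smooth _ _ _ _ _ oA chart_curve_holomorphic _ HD c r k q.
by apply: CkV_mono H => t; exact: ctime_chart.
Qed.

Lemma cjet0 t k : A t -> cjet gam 0 t 0 k = dz (fun s => gam s 0 k) t.
Proof.
move=> At; have Ct := ctime_chart At.
have W : isW (fun s => gam s 0 k) t (1 : C) (cjet gam 0 t 0 k) 0.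
  apply: isW_hol; apply: (hder_ext _ (hder_coord k (curve_hder chart_curve_holomorphic Ct))).
  by apply: (@eq_near _ _ A) => // s As; rewrite /= (imgP (gA As)).2.
by rewrite (isW_wirtinger W).
Qed.

Lemma cjetS r t k : cjet gam r.+1 t 0 k = dz (fun s => cjet gam r s 0 k) t +
  \sum_i \sum_j (christoffel D c i j k \o param c) (gam t) * cjet gam 0 t 0 i * cjet gam r t 0 j.
Proof. exact: curve_jetS. Qed.

End OneCurve.

Lemma Sm_gamma (A : set C) gam j : open A -> entire gam -> Sm A (fun t => gam t 0 j).
Proof. by move=> oA H; apply: Sm_hol => //; apply: hol_sub (H j). Qed.

Lemma christoffel_param_smooth i j k q : CkV q (img c) (christoffel D c i j k \o param c).
Proof. by have := smf_christoffel HD c i j k c q; rewrite cim_dom. Qed.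

Definition bump_curve gam (M : nat) (xi : 'rV[C]_n) : C -> 'rV[C]_n :=
  fun t => gam t + mono M t *: xi.

Lemma bump_curve_entire gam M xi : entire gam -> entire (bump_curve gam M xi).
Proof.
move=> H j; have := hol_add (H j) (hol_mul (mono_hol M) (hol_cst (xi 0 j))).
by apply: hol_ext; [exact: openT|move=> t _; rewrite !mxE].
Qed.

(* Adding [xi t^M/M!] to a curve first affects F_r in its derivative of order M - r, where it adds xi. *)
Lemma cjet_perturb (A : set C) gam N xi : open A -> A 0 -> entire gam ->
  (forall t, A t -> img c (gam t)) -> (forall t, A t -> img c (bump_curve gam N.+2 xi t)) ->
  forall q k, (q <= N.+1)%N -> jeq (N.+1 - q) (xi 0 k)
    (fun t => cjet (bump_curve gam N.+2 xi) q t 0 k) (fun t => cjet gam q t 0 k).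
Proof.
move=> oA A0 Hg gA gA'; set gam' := bump_curve _ _ _ in gA' *.
have Hg' : entire gam' by exact: bump_curve_entire.
have gamE t j : gam t 0 j + xi 0 j * mono N.+2 t = gam' t 0 j.
  by rewrite !mxE mulrC.
have G j : jeq N.+2 (xi 0 j) (fun t => gam' t 0 j) (fun t => gam t 0 j).
  apply: (jeq_ext oA A0) (jeq_mono oA A0 N.+2 (xi 0 j) (Sm_gamma j oA Hg)) => //.
  + have := Sm_gamma j oA Hg'; congr (Sm A _); apply/funext => t; by rewrite gamE.
  + exact: Sm_gamma.
have SC q k := cjet_smooth oA Hg gA q k.
have SC' q k := cjet_smooth oA Hg' gA' q k.
have V k : jeq N.+1 (xi 0 k) (fun t => cjet gam' 0 t 0 k) (fun t => cjet gam 0 t 0 k).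
  have [_ _ H] := G k.
  apply: (@jeq_ext _ A oA A0 N.+1 (xi 0 k) (dz (fun t => gam' t 0 k)) _ (dz (fun t => gam t 0 k)) _ _ _ _ _ H).
  + exact/(Sm_dz oA)/Sm_gamma.
  + exact/(Sm_dz oA)/Sm_gamma.
  + by move=> z Az; rewrite (cjet0 oA Hg' gA').
  + by move=> z Az; rewrite (cjet0 oA Hg gA).
have oI : open (img c) by exact: img_open.
have E0 : gam' 0 = gam 0 by apply/rowP => j; have [-> _ _] := G j.
have HA (g : C -> 'rV[C]_n) : entire g -> forall j, hol A (fun t => g t 0 j).
  by move=> Hh j; apply: hol_sub (Hh j).
have Gm i j k m : (m <= N.+2)%N -> jeq0 m
    (fun t => (christoffel D c i j k \o param c) (gam' t))
    (fun t => (christoffel D c i j k \o param c) (gam t)).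
  move=> mN; apply: (jeq0_comp oA A0 oI) => //.
  + by move=> q; exact: christoffel_param_smooth.
  + exact: HA.
  + exact: HA.
  (* The exponent N + 2 is at least 2, so the first derivatives at 0 agree, as [jeq0_comp]
     requires. *)
  + by move=> l; have [_ _] := G l; case: (N) => [|N'] [] h _ ; rewrite h.
  + by move=> l; apply: jeq0_le mN (jeq_jeq0 (G l)).
have SG (g : C -> 'rV[C]_n) i j k : entire g -> (forall t, A t -> img c (g t)) ->
    Sm A (fun t => (christoffel D c i j k \o param c) (g t)).
  move=> Hh hA q; apply: (CkV_comp oA oI hA (christoffel_param_smooth i j k q)).
  by move=> l; apply: CkV_hol => //; exact: HA.
elim=> [|q IH] k qN; first by rewrite subn0; exact: V.
have qN' : (q <= N.+1)%N by exact: ltnW.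
have := IH k qN'; have -> : (N.+1 - q = (N.+1 - q.+1).+1)%N by rewrite subSn // -subSS.
set m := (N.+1 - q.+1)%N => -[_ _ Hd].
have mS : (m.+1 = N.+1 - q)%N by rewrite /m subSS subSn.
pose T (g : C -> 'rV[C]_n) i j t : C := (christoffel D c i j k \o param c) (g t) * cjet g 0 t 0 i * cjet g q t 0 j.
have ST (g : C -> 'rV[C]_n) i j : entire g -> (forall t, A t -> img c (g t)) -> Sm A (T g i j).
  move=> Hh hA; apply: Sm_mul => //; last exact: cjet_smooth.
  by apply: Sm_mul => //; [exact: SG|exact: cjet_smooth].
(* The terms with Gamma agree one order further than is visible here, so the shift by xi comes from
   the derivative of the previous jet alone. *)
have JT i j : jeq0 m.+1 (T gam' i j) (T gam i j).
  apply: (jeq0_mul oA A0).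
  + by apply: Sm_mul => //; exact: SG.
  + by apply: Sm_mul => //; exact: SG.
  + exact: SC'.
  + exact: SC.
  + apply: (jeq0_mul oA A0); [exact: SG|exact: SG|exact: SC'|exact: SC| |].
      by apply: Gm; rewrite mS (leq_trans (leq_subr _ _)).
    by apply: jeq0_le (jeq_jeq0 (V i)); rewrite mS leq_subr.
  + by rewrite mS; exact: jeq_jeq0 (IH j qN').
have SS (g : C -> 'rV[C]_n) : entire g -> (forall t, A t -> img c (g t)) ->
    Sm A (fun t => \sum_i \sum_j T g i j t).
  by move=> Hh hA; apply: Sm_sum => // i; apply: Sm_sum => // j; exact: ST.
have JS : jeq0 m.+1 (fun t => \sum_i \sum_j T gam' i j t) (fun t => \sum_i \sum_j T gam i j t).
  apply: (jeq0_sum oA A0) => i.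
  - by apply: Sm_sum => // j; exact: ST.
  - by apply: Sm_sum => // j; exact: ST.
  - by apply: (jeq0_sum oA A0) => j; [exact: ST|exact: ST|exact: JT].
have := jeq_add oA A0 (Sm_dz oA (SC' q k)) (Sm_dz oA (SC q k)) (SS gam' Hg' gA') (SS gam Hg gA) Hd JS.
rewrite addr0; apply: (jeq_ext oA A0).
- by apply: Sm_add => //; [exact: Sm_dz|exact: SS].
- by apply: Sm_add => //; [exact: Sm_dz|exact: SS].
- by move=> z _; rewrite cjetS.
- by move=> z _; rewrite cjetS.
Qed.

Lemma small_disk gam : entire gam -> img c (gam 0) ->
  exists2 r : R, 0 < r & forall t, nrm t < r -> img c (gam t).
Proof.
move=> Hg g0; have cg : ctn gam 0 by apply: ctn_row => j; exact: (Hg j 0 I).1.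
have [e e0 He] := (open_nrm _).1 (@img_open _ _ _ c) _ g0.
have [r r0 Hr] := cg e e0; exists r => // t tr; apply: He; apply: Hr.
by rewrite subr0.
Qed.

Lemma ball_open (r : R) : open [set t : C | nrm t < r].
Proof.
apply/open_nrm => t tr; exists (r - nrm t); first by rewrite subr_gt0.
by move=> y; rewrite /=; have := nrm_sub y t; lra.
Qed.

Arguments ball_open r : clear implicits.

(** Adding xi t^(N+2) / (N+2)! moves the jet of index N + 1 at 0 by xi and leaves the earlier ones
    fixed, so the jets can be corrected one after the other. *)
Lemma jets_prescribed (p : 'rV[C]_n) (b : nat -> 'rV[C]_n) N : img c p ->
  exists gam, [/\ entire gam, gam 0 = p & forall q, (q <= N)%N -> cjet gam q 0 = b q].
Proof.
move=> ip; elim: N => [|N [gam [Hg g0 Hb]]].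
  pose gam t := p + t *: b 0%N.
  have Hg : entire gam.
    have hid : hol setT (fun t : C => t).
      by move=> z _; split; [exact: ctn_id|move=> v; exists v; exact: hder_id].
    move=> j; have := hol_add (hol_cst (p 0 j)) (hol_mul hid (hol_cst (b 0%N 0 j))).
    by apply: hol_ext; [exact: openT|move=> t _; rewrite !mxE].
  exists gam; split => //; first by rewrite /gam scale0r addr0.
  have gi : img c (gam 0) by rewrite /gam scale0r addr0.
  have [r r0 Hr] := small_disk Hg gi.
  move=> [|//] _; apply/rowP => k.
  rewrite (cjet0 (ball_open r) Hg Hr) /= ?nrm0 //; apply: isW_wirtinger.
  have := isW_add (isW_cst (p 0 k) (0 : C) (1 : C)) (isW_mul (isW_hol (@hder_id R setT _ (0 : C) 1)) (isW_cst (b 0%N 0 k) (0 : C) (1 : C))).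
  congr (isW _ _ _ _ _); first by apply/funext => t; rewrite !mxE.
  by rewrite mul1r mul0r !addr0 add0r.
pose xi := b N.+1 - cjet gam N.+1 0.
have Hg' := bump_curve_entire N.+2 xi Hg.
have m0 : bump_curve gam N.+2 xi 0 = gam 0 by rewrite /bump_curve /mono expr0n mul0r scale0r addr0.
exists (bump_curve gam N.+2 xi); split => //; first by rewrite m0.
have [r r0 Hr] : exists2 r : R, 0 < r & forall t, nrm t < r -> img c (gam t).
  by apply: small_disk; rewrite ?g0.
have [r' r'0 Hr'] : exists2 r : R, 0 < r & forall t, nrm t < r -> img c (bump_curve gam N.+2 xi t).
  by apply: small_disk; rewrite ?m0 ?g0.
pose A := [set t : C | nrm t < Num.min r r'].
have A0 : A 0 by rewrite /A /= nrm0 lt_min r0.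
have gA t : A t -> img c (gam t) by rewrite /A /= lt_min => /andP[/Hr].
have gA' t : A t -> img c (bump_curve gam N.+2 xi t) by rewrite /A /= lt_min => /andP[_ /Hr'].
have P := cjet_perturb (ball_open _) A0 Hg gA gA'.
move=> q; rewrite leq_eqVlt => /orP[/eqP ->|].
  apply/rowP => k.
  have E : cjet (bump_curve gam N.+2 xi) N.+1 0 0 k = cjet gam N.+1 0 0 k + xi 0 k.
    by have := P N.+1 k (leqnn _); rewrite subnn; case.
  by rewrite E [xi 0 k]mxE [X in _ + (_ + X)]mxE addrC subrK.
rewrite ltnS => qN; rewrite -(Hb q qN); apply/rowP => k.
by have := P q k (leqW qN); rewrite subSn //; case.
Qed.

End ChartCurves.

(** * Curvature positivity and the projective class *)

Section CurvaturePositivity.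
Variables (R : realType) (n : nat) (X : complexManifold R n).
Local Notation C := R[i].
Local Notation nrm := (@nrm R _).
Local Notation hchart := (holo_chart X).
Local Notation "''e_' i" := (delta_mx 0 i : 'rV[C]_n) (at level 8, i at level 2).
Local Notation dz := (wirtinger (1 : C)).
Local Notation dzb := (wirtinger_bar (1 : C)).
Variables (D : vfield X -> vfield X -> vfield X) (HD : is_connection D).
Hypothesis Hpos : wronskian_curvature_positive D.
Variable c : hchart.
Local Notation cjet := (cjet D c).
Implicit Types gam : C -> 'rV[C]_n.

Lemma diskE (r : R) (t : C) : disk 0 r t <-> nrm t < r.
Proof. by rewrite /disk /= subr0 nrmE ltcR. Qed.

(** The frame d_1 /\ ... /\ d_n of the chart c itself, seen from the other charts; relative to it
    the Wronskian is [wr]. *)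
Lemma jac_frame : holo_frame (dom c) (fun c' x => \det (jac c c' x)).
Proof.
split.
- exact: dom_open.
- by move=> c1 c2 x dx d1 d2; rewrite -det_mulmx -jac_cocycle.
- move=> c' z Az; have oI := cim_open c' (@dom_open _ _ _ c).
  have oJ := cim_open c (@dom_open _ _ _ c').
  apply: (hol_differentiable oI _ Az).
  have Hm y : cim c' (dom c) y -> cim c (dom c') (coords c (param c' y)).
    by move=> /cimE[iy dy]; apply: cim_coords => //; have [] := imgP iy.
  have H i j : hol (cim c' (dom c)) (fun z => jac c c' (param c' z) i j).
    have Hc := hol_comp oJ (CkV_hol 1 oJ (@jac_hol _ _ _ c c' i j))
      (fun z j' Az => (hol_wirtinger _ (@jac_hol _ _ _ c c' i j) Az).2) Hm (fun k => tr_hol c' c k).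
    by apply: (hol_ext oI _ Hc) => y /cimE[_ dy]; rewrite coordsK.
  apply: (hol_ext oI _ (hol_det H)) => y _; congr (\det _).
  by apply/matrixP => i j; rewrite mxE.
- by move=> c' x dx dx'; exact: det_jac_neq0.
Qed.

Definition wr gam t : C := wronskian D (param c \o gam) c t.

Lemma wr_subharmonic gam (r : R) : entire gam -> 0 < r ->
  (forall t, nrm t < r -> img c (gam t)) -> wr gam 0 != 0 ->
  subharmonic_on (disk 0 r) (fun t => lne (nrm (wr gam t))%:E).
Proof.
move=> Hg r0 gA w0.
have oA : open (disk (0 : C) r).
  by have := @ball_open R r; congr open; apply/seteqP; split => t /diskE.
have gA' t : disk 0 r t -> img c (gam t) by move=> /diskE; exact: gA.
have Hf := chart_curve_holomorphic Hg gA'.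
have d0 : disk (0 : C) r 0 by apply/diskE; rewrite nrm0.
apply: (Hpos r0 Hf r0 _ jac_frame) => //.
- by move=> x [t /gA' /imgP[dt _] <-].
- move=> t c' dt dt'; have Ct := ctime_chart gA' dt.
  by apply: (wronskian_covariant oA Hf HD Ct); split.
- by exists 0, c; split => //; have [] := imgP (gA' 0 d0).
Qed.

Lemma det_last_row (M M' : 'M[C]_n) (il : 'I_n) :
  (forall r k, r != il -> M' r k = M r k) ->
  \det M' = \sum_k M' il k * cofactor M il k.
Proof.
move=> H; rewrite (expand_det_row M' il); apply: eq_bigr => k _; congr (_ * _).
rewrite /cofactor; congr (_ * \det _); apply/matrixP => a b.
by rewrite !mxE H // eq_sym neq_lift.
Qed.

Lemma jeq_common m xi (phi phi' psi : C -> C) : jeq m xi phi psi -> jeq m xi phi' psi ->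
  jeq0 m.+1 phi phi'.
Proof.
elim: m phi phi' psi => [|m IH] phi phi' psi.
  by move=> [a1 a2] [b1 b2]; split; [rewrite a1 b1 addr0|rewrite a2 b2].
move=> [a1 a2 h] [b1 b2 h']; split; [by rewrite a1 b1|by rewrite a2 b2|].
exact: (IH _ _ _ h h').
Qed.

Lemma laplacian_congr (d d' a a' b b' w : C) : d = d' -> a = a' -> b = b' ->
  0 <= complex.Re ((d * w - a * b) / w ^+ 2) ->
  0 <= complex.Re ((d' * w - a' * b') / w ^+ 2).
Proof. by move=> -> -> ->. Qed.

Lemma linear_part_zero (k0 k1 : C) :
  (forall a : C, 0 <= complex.Re (k0 + a * k1)) -> k1 = 0.
Proof.
move=> H; apply/eqP; apply/negPn/negP => k10.
have := H (- (complex.Re k0 + 1)%:C / k1); rewrite divfK // ReD ReN ReR; lra.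
Qed.

Lemma wr_smooth_of gam (A : set C) : entire gam -> open A ->
  (forall t, A t -> img c (gam t)) -> Sm A (wr gam).
Proof.
by move=> Hg oA gA q; apply: CkV_det => // a b; exact: (cjet_smooth HD oA Hg gA).
Qed.

Lemma ltn_predL' : (1 < n)%N -> (n.-1 < n)%N.
Proof. by move=> hn; rewrite ltn_predL ltnW. Qed.

Section Perturbation.
Variables (hn : (1 < n)%N) (gam : C -> 'rV[C]_n).
Hypotheses (Hg : entire gam) (g0 : img c (gam 0)) (w0 : wr gam 0 != 0).
(** Rows count from 0: [il] is the row of F_n and [i1] that of F_2. They coincide when n = 2. *)
Let il : 'I_n := Ordinal (ltn_predL' hn).
Let i1 : 'I_n := Ordinal hn.
Let Mat t : 'M[C]_n := \matrix_(r < n, k < n) cjet gam r t 0 k.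
(** Cofactors of the last row; they depend on F_1, ..., F_(n-1) only. *)
Let Cf k t : C := cofactor (Mat t) il k.

Lemma wr_det t : wr gam t = \det (Mat t). Proof. by []. Qed.

Lemma last_row_neq q : q != il -> (q.+2 <= n)%N.
Proof.
move=> ql; rewrite ltn_neqAle ltn_ord andbT; apply: contra ql => /eqP h.
by apply/eqP/val_inj; exact: (congr1 predn h).
Qed.

Lemma cofactor_smooth (A : set C) k : open A -> (forall t, A t -> img c (gam t)) ->
  Sm A (Cf k).
Proof.
move=> oA gA q.
have H : CkV q A (fun t => (-1) ^+ (il + k) * \det (\matrix_(a, b) cjet gam (lift il a) t 0 (lift k b))).
  apply: CkV_scale => //; apply: CkV_det => // a b; exact: (cjet_smooth HD oA Hg gA).
apply: (CkV_ext oA _ H) => t _; rewrite /Cf /cofactor; congr (_ * \det _).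
by apply/matrixP => a b; rewrite !mxE.
Qed.

Lemma perturbed_laplacian (xi : 'rV[C]_n) :
  0 <= complex.Re (((dzb (dz (wr gam)) 0 + \sum_k xi 0 k * dzb (Cf k) 0) * wr gam 0
     - (dz (wr gam) 0 + \sum_k xi 0 k * Cf k 0) * dzb (wr gam) 0) / wr gam 0 ^+ 2).
Proof.
(* This exponent is n + 1, written in the form of [cjet_perturb]. *)
pose gam' := bump_curve gam n.-1.+2 xi.
have Hg' : entire gam' by exact: bump_curve_entire.
have E0 : gam' 0 = gam 0.
  by rewrite /gam' /bump_curve /mono expr0n mul0r scale0r addr0.
have [r r0 Hr] := small_disk Hg g0.
have [r' r'0 Hr'] : exists2 r : R, 0 < r & forall t, nrm t < r -> img c (gam' t).
  by apply: small_disk; rewrite ?E0.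
pose s := Num.min r r'; have s0 : 0 < s by rewrite lt_min r0.
pose A := [set t : C | nrm t < s].
have A0 : A 0 by rewrite /A /= nrm0.
have oA : open A by exact: ball_open.
have gA t : A t -> img c (gam t) by rewrite /A /= lt_min => /andP[/Hr].
have gA' t : A t -> img c (gam' t) by rewrite /A /= lt_min => /andP[_ /Hr'].
have P := cjet_perturb HD oA A0 Hg gA gA'.
have SC q k := cjet_smooth HD oA Hg gA q k.
have SC' q k := cjet_smooth HD oA Hg' gA' q k.
have n0 : (0 < n)%N by exact: ltnW.
pose m t := \sum_k xi 0 k * Cf k t.
have Sm1 : Sm A (mono 1) by apply: Sm_hol => //; apply: hol_sub (@mono_hol R 1).
have SmCf k : Sm A (Cf k) by exact: cofactor_smooth.
have Smm : Sm A m.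
  by apply: Sm_sum => // k; apply: Sm_mul => //; exact: Sm_cst.
(* The unperturbed matrix with t xi added to its last row. Its determinant is [psi] = w + t m, which
   is to have the same 2-jet as the perturbed Wronskian. *)
pose G (q k : 'I_n) t := cjet gam q t 0 k + (if q == il then xi 0 k else 0) * mono 1 t.
have SG q k : Sm A (G q k).
  by apply: Sm_add => //; apply: Sm_mul => //; exact: Sm_cst.
pose psi t := wr gam t + mono 1 t * m t.
have psiE t : \det (\matrix_(q, k) G q k t) = psi t.
  rewrite (@det_last_row (Mat t) _ il); last first.
    by move=> q k /negbTE ql; rewrite !mxE /G ql mul0r addr0.
  rewrite /psi wr_det [X in X + _](@det_last_row (Mat t) _ il) //.
  rewrite /m mulr_sumr -big_split; apply: eq_bigr => k _ /=.
  rewrite [X in X * _]mxE /G eqxx [X in _ = X * _ + _]mxE /Cf; ring.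
have J : jeq0 2 (wr gam') psi.
  have H2 : jeq0 2 (fun t => \det (\matrix_(q < n, k < n) cjet gam' q t 0 k))
      (fun t => \det (\matrix_(q, k) G q k t)).
    apply: (@jeq0_det _ A oA A0 2 n (fun q k t => cjet gam' q t 0 k) G);
      [by move=> q k; exact: SC'|exact: SG|move=> q k].
    (* Row q changes from the derivative of order n - q on: order 1 for the last row, and order at
       least 2, which [jeq0 2] does not see, for the others. *)
    have qn : (q <= n.-1.+1)%N by rewrite prednK // ltnW.
    have Pq := P q k qn.
    have Q : (q == il) || (q != il) by exact: orbN.
    case/orP: Q => ql.
      have e : (n.-1.+1 - q = 1)%N by rewrite (eqP ql) /= prednK // -subn1 subKn.
      have JG := jeq_mono oA A0 1 (xi 0 k) (SC q k).
      have -> : G q k = fun t => cjet gam q t 0 k + xi 0 k * mono 1 t.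
        by apply/funext => t; rewrite /G ql.
      rewrite e in Pq; exact: jeq_common Pq JG.
    have -> : G q k = fun t => cjet gam q t 0 k.
      by apply/funext => t; rewrite /G (negbTE ql) mul0r addr0.
    have le2 : (2 <= n.-1.+1 - q)%N.
      by rewrite prednK // leq_subRL ?addn2 ?last_row_neq // ltnW.
    exact: jeq0_le le2 (jeq_jeq0 Pq).
  by have -> : psi = fun t => \det (\matrix_(q, k) G q k t) by apply/funext => t; rewrite psiE.
have SW := wr_smooth_of Hg oA gA.
have D1 z : A z -> isW psi z 1 (dz (wr gam) z + (m z + mono 1 z * dz m z))
     (dzb (wr gam) z + mono 1 z * dzb m z).
  move=> Az; have := isW_add (Sm_isW SW Az) (isW_mul (isW_hol (mono_der 0 z)) (Sm_isW Smm Az)).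
  congr (isW _ _ _ _ _); first by rewrite {1}/mono expr0 divr1 mul1r.
  by rewrite mul0r add0r.
have m10 : mono 1 (0 : C) = 0 by rewrite /mono expr0n mul0r.
have D2 : isW (dz psi) 0 1 (dz (dz psi) 0) (dzb (dz (wr gam)) 0 + dzb m 0).
  have E z : A z -> dz (wr gam) z + (m z + mono 1 z * dz m z) = dz psi z.
    by move=> Az; rewrite (isW_wirtinger (D1 z Az)).
  have H := isW_add (Sm_isW (Sm_dz oA SW) A0) (isW_add (Sm_isW Smm A0)
     (isW_mul (isW_hol (mono_der 0 (0 : C))) (Sm_isW (Sm_dz oA Smm) A0))).
  have H' := isW_ext (eq_near oA A0 E) H; rewrite (isW_wirtinger H').
  have := H'; congr (isW _ _ _ _ _).
  by rewrite m10 !mul0r !addr0.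
have mb : dzb m 0 = \sum_k xi 0 k * dzb (Cf k) 0.
  apply: isW_bar; have := isW_sum (index_enum 'I_n) (P := xpredT) (fun k _ =>
    isW_mul (isW_cst (xi 0 k) (0 : C) (1 : C)) (Sm_isW (SmCf k) A0)).
  congr (isW _ _ _ _ _); by apply: eq_bigr => k _; rewrite mul0r add0r.
move/jeq0S: J => [J1 J2 /jeq0S[J3 J4 _]].
have w0' : wr gam' 0 = wr gam 0 by rewrite J1 /psi m10 mul0r addr0.
have L := laplacian_ge0 oA A0 s0 (fun k => wr_smooth_of Hg' oA gA' k).
have {L} := L _ (wr_subharmonic Hg' s0 gA' _); rewrite w0' => /(_ w0 w0).
have e2 : dzb (wr gam') 0 = dzb (wr gam) 0.
  by rewrite J2 (isW_bar (D1 0 A0)) m10 mul0r addr0.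
have e3 : dz (wr gam') 0 = dz (wr gam) 0 + m 0.
  by rewrite J3 (isW_wirtinger (D1 0 A0)) m10 mul0r addr0.
have e4 : dzb (dz (wr gam')) 0 = dzb (dz (wr gam)) 0 + \sum_k xi 0 k * dzb (Cf k) 0.
  by apply: (etrans J4); apply: (etrans (isW_bar D2)); congr (_ + _).
exact: laplacian_congr e4 e3 e2.
Qed.

Lemma cofactor_relation (xi : 'rV[C]_n) :
  (\sum_k xi 0 k * dzb (Cf k) 0) * wr gam 0 = (\sum_k xi 0 k * Cf k 0) * dzb (wr gam) 0.
Proof.
set mu := \sum_k xi 0 k * dzb (Cf k) 0; set m := \sum_k xi 0 k * Cf k 0.
pose W := wr gam 0; pose b := dzb (wr gam) 0.
have K : (mu * W - m * b) / W ^+ 2 = 0.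
  apply: (@linear_part_zero ((dzb (dz (wr gam)) 0 * W - dz (wr gam) 0 * b) / W ^+ 2)) => a.
  have E1 : \sum_k (a *: xi) 0 k * dzb (Cf k) 0 = a * mu.
    by rewrite mulr_sumr; apply: eq_bigr => k _; rewrite mxE mulrA.
  have E2 : \sum_k (a *: xi) 0 k * Cf k 0 = a * m.
    by rewrite mulr_sumr; apply: eq_bigr => k _; rewrite mxE mulrA.
  have := perturbed_laplacian (a *: xi); rewrite E1 E2 -/W -/b.
  move: (dzb (dz (wr gam)) 0) (dz (wr gam) 0) => d e.
  by congr (0 <= complex.Re _); rewrite mulrA -mulrDl; congr (_ / _); ring.
apply/eqP; rewrite -subr_eq0 -/W -/b; have := K => /eqP.
by rewrite mulf_eq0 invr_eq0 expf_eq0 /= (negbTE w0) orbF.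
Qed.

(** With F_2 in the last row the determinant is [dl] times the Wronskian, by repetition of a row
    when n > 2. Apply dbar at 0 and compare with [cofactor_relation] for xi = F_2(0): the terms
    where dbar falls on the cofactors cancel. *)
Lemma second_jet_relation :
  \sum_k dzb (fun t => cjet gam 1 t 0 k) 0 * Cf k 0 = 0.
Proof.
have [r r0 gA] := small_disk Hg g0.
pose A := [set t : C | nrm t < r].
have A0 : A 0 by rewrite /A /= nrm0.
have oA : open A by exact: ball_open.
have SmCf k : Sm A (Cf k) by exact: cofactor_smooth.
pose dl : C := (i1 == il)%:R.
have ME t : \sum_k cjet gam 1 t 0 k * Cf k t = dl * wr gam t.
  pose M' : 'M[C]_n := \matrix_(q, k) (if q == il then Mat t i1 k else Mat t q k).
  have E1 : \det M' = \sum_k cjet gam 1 t 0 k * Cf k t.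
    rewrite (@det_last_row (Mat t) _ il); last by move=> q k /negbTE ql; rewrite mxE ql.
    by apply: eq_bigr => k _; congr (_ * _); rewrite mxE eqxx mxE.
  rewrite -E1 /dl; have Q : (i1 == il) || (i1 != il) by exact: orbN.
  case/orP: Q => e.
    rewrite e mul1r wr_det; congr (\det _); apply/matrixP => q k.
    by rewrite mxE; case: ifP => // /eqP ->; rewrite (eqP e).
  rewrite (negbTE e) mul0r; apply: (determinant_alternate e) => k.
  have -> : M' i1 k = Mat t i1 k by rewrite mxE (negbTE e).
  by rewrite [RHS]mxE eqxx.
have SF k : Sm A (fun t => cjet gam 1 t 0 k) by exact: (cjet_smooth HD oA Hg gA).
have W := isW_sum (index_enum 'I_n) (P := xpredT) (fun k _ =>
  isW_mul (Sm_isW (SF k) A0) (Sm_isW (SmCf k) A0)).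
have W' := isW_mul (isW_cst dl (0 : C) (1 : C)) (Sm_isW (wr_smooth_of Hg oA gA) A0).
have Eb := isW_bar (isW_ext (eq_near oA A0 (fun t _ => ME t)) W).
rewrite (isW_bar W') mul0r add0r big_split /= in Eb.
have CR := cofactor_relation (cjet gam 1 0).
rewrite (ME 0) mulrAC in CR.
have {}CR := mulIf w0 CR.
by apply: (addIr (dl * dzb (wr gam) 0)); rewrite add0r [RHS]Eb -CR.
Qed.

(** In F_2 both f' and its derivative are holomorphic in t; dbar acts on Gamma(f(t)) alone and
    brings out the conjugates of the components of f'. *)
Lemma dzb_second_jet k : dzb (fun t => cjet gam 1 t 0 k) 0 =
  \sum_i \sum_j (\sum_l conjc (cjet gam 0 0 0 l) *
      wirtinger_bar 'e_l (christoffel D c i j k \o param c) (gam 0))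
    * cjet gam 0 0 0 i * cjet gam 0 0 0 j.
Proof.
have [r r0 gA] := small_disk Hg g0.
pose A := [set t : C | nrm t < r].
have A0 : A 0 by rewrite /A /= nrm0.
have oA : open A by exact: ball_open.
have H0 j : hol A (fun t => cjet gam 0 t 0 j).
  have := vel_hol oA (chart_curve_holomorphic Hg gA) (c := c) j.
  by apply: hol_sub => t; exact: (ctime_chart gA).
have W0 j := isW_hol (hol_dv (1 : C) (H0 j) A0).
have Wd : isW (dz (fun t => cjet gam 0 t 0 k)) 0 (1 : C)
    (dv (1 : C) (dv (1 : C) (fun t => cjet gam 0 t 0 k)) 0) 0.
  have := isW_hol (hol_dv (1 : C) (hol_deriv (1 : C) oA (H0 k)) A0).
  apply: isW_ext; apply: (@eq_near _ _ A) => // t At.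
  exact: esym (isW_wirtinger (isW_hol (hol_dv (1 : C) (H0 k) At))).
have oI : open (img c) by exact: img_open.
have Wg i j := isW_comp oI (christoffel_param_smooth HD c i j k 1) g0
  (fun l => isW_hol (hol_dv (1 : C) (Hg l) (I : setT (0 : C)))).
have W := isW_add Wd (isW_sum (index_enum 'I_n) (P := xpredT) (fun i _ =>
  isW_sum (index_enum 'I_n) (P := xpredT) (fun j _ =>
    isW_mul (isW_mul (Wg i j) (W0 i)) (W0 j)))).
apply: isW_bar; have := W; congr (isW _ _ _ _ _).
  by apply/funext => t; rewrite cjetS.
rewrite add0r; apply: eq_bigr => i _; apply: eq_bigr => j _.
rewrite !mulr0 !addr0; congr (_ * _ * _); apply: eq_bigr => l _.
rewrite mul0r add0r; congr (conjc _ * _).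
have E := @cjet0 R n X D c A gam oA Hg gA 0 l A0.
apply: etrans (esym E); exact: esym (isW_wirtinger (isW_hol (hol_dv (1 : C) (Hg l) (I : setT (0 : C))))).
Qed.

End Perturbation.

(** If B were invertible, some curve would have the rows of B as its jets at 0 and a nonzero
    Wronskian. The last row of B equals dbar F_2 for this curve, as it depends only on p and F_1 =
    v, so [second_jet_relation] reads det B = 0. *)
Lemma prescribed_det (hn : (1 < n)%N) (p v : 'rV[C]_n) (B : 'M[C]_n) (i0 il : 'I_n) :
  img c p -> val i0 = 0%N -> val il = n.-1 -> row i0 B = v ->
  row il B = \row_k (\sum_i \sum_j (\sum_l conjc (v 0 l) *
      wirtinger_bar 'e_l (christoffel D c i j k \o param c) p) * v 0 i * v 0 j) ->
  \det B = 0.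
Proof.
move=> ip e0 el Bv Bl; apply/eqP; apply/negPn/negP => dB.
pose b (q : nat) : 'rV[C]_n := if insub q is Some i then row i B else 0.
have bE (q : 'I_n) : b q = row q B by rewrite /b valK.
have [gam [Hg gp Hb]] := jets_prescribed HD b n.-1 ip.
have JE (q : 'I_n) : cjet gam q 0 = row q B.
  by rewrite Hb ?bE // -ltnS prednK // ltnW.
have ME : (\matrix_(r < n, k < n) cjet gam r 0 0 k) = B.
  by apply/matrixP => q k; rewrite mxE JE mxE.
have w0 : wr gam 0 != 0 by rewrite /wr /wronskian -ME in dB *.
have g0 : img c (gam 0) by rewrite gp.
have := second_jet_relation hn Hg g0 w0; rewrite ME.
set il' := Ordinal _; have -> : il' = il by apply: val_inj; rewrite /= el.
have J0 : cjet gam 0 0 = v by rewrite -Bv -JE e0.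
move=> S; move/eqP: dB; apply; rewrite (@det_last_row B B il) // -[RHS]S.
apply: eq_bigr => k _; congr (_ * _).
rewrite (dzb_second_jet Hg g0 k) gp.
have := congr1 (fun u : 'rV_n => u 0 k) Bl; rewrite [LHS]mxE [X in _ = X -> _]mxE => ->.
by rewrite -J0.
Qed.

End CurvaturePositivity.

(** * Quadratic maps parallel to their argument *)

Section QuadraticAlgebra.
Variables (F : numFieldType) (n : nat).
Local Notation "''e_' i" := (delta_mx 0 i : 'rV[F]_n) (at level 8, i at level 2).

(** Complete v and b by the basis vectors other than e_k and e_m. A kernel vector of this matrix is
    supported on the places k and m and is orthogonal there to v and b, so their 2 x 2 minor
    vanishes. *)
Lemma wedge_zero (v b : 'rV[F]_n) (i0 il : 'I_n) : i0 != il ->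
  (forall B : 'M[F]_n, row i0 B = v -> row il B = b -> \det B = 0) ->
  forall k m, v 0 k * b 0 m = v 0 m * b 0 k.
Proof.
move=> il0 H k m; have [->//|km] := eqVneq k m.
(* A permutation taking [i0] to k and [il] to m; it distributes the other basis vectors over the
   other rows. *)
pose s := (tperm i0 k * tperm (tperm i0 k il) m)%g.
have x0 : tperm i0 k il != k by rewrite -{2}(tpermL i0 k) (inj_eq perm_inj) eq_sym.
have s0 : s i0 = k by rewrite permM tpermL tpermD // eq_sym.
have sl : s il = m by rewrite permM tpermL.
pose B : 'M[F]_n := \matrix_r if r == i0 then v else if r == il then b else 'e_(s r).
have dB : \det B^T = 0.
  rewrite det_tr; apply: H; apply/rowP => j; rewrite !mxE ?eqxx //.
  by rewrite eq_sym (negbTE il0).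
move/eqP/det0P: dB => [u u0 uB].
have E r : \sum_j u 0 j * B r j = 0.
  have := congr1 (fun w : 'rV_n => w 0 r) uB; rewrite mxE [RHS]mxE => uBr.
  by rewrite -[RHS]uBr; apply: eq_bigr => j _; rewrite [B^T _ _]mxE.
have uz j : j != k -> j != m -> u 0 j = 0.
  move=> jk jm; pose r := (s^-1)%g j; have sr : s r = j by rewrite permKV.
  have r0 : (r == i0) = false.
    by apply/negbTE; apply: contra jk => /eqP e; rewrite -s0 -e sr.
  have rl : (r == il) = false.
    by apply/negbTE; apply: contra jm => /eqP e; rewrite -sl -e sr.
  have Br a : B r a = (a == j)%:R by rewrite mxE r0 rl mxE eqxx sr.
  have := E r; rewrite (bigD1 j) //= Br eqxx mulr1 big1 ?addr0 // => a aj.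
  by rewrite Br (negbTE aj) mulr0.
have T (w : 'rV[F]_n) r : (forall j, B r j = w 0 j) -> u 0 k * w 0 k + u 0 m * w 0 m = 0.
  move=> Bw; rewrite -(E r) (bigD1 k) //= (bigD1 m) /=; last by rewrite eq_sym.
  by rewrite big1 ?addr0 ?Bw // => j /andP[jk jm]; rewrite uz ?mul0r.
have Tv : u 0 k * v 0 k + u 0 m * v 0 m = 0.
  by apply: (T v i0) => j; rewrite mxE eqxx.
have Tb : u 0 k * b 0 k + u 0 m * b 0 m = 0.
  by apply: (T b il) => j; rewrite mxE eqxx eq_sym (negbTE il0).
apply/eqP; rewrite -subr_eq0; apply/negPn/negP => d0; case/negP: u0.
have ek : u 0 k = 0.
  have : u 0 k * (v 0 k * b 0 m - v 0 m * b 0 k) = 0.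
    transitivity (b 0 m * (u 0 k * v 0 k + u 0 m * v 0 m)
        - v 0 m * (u 0 k * b 0 k + u 0 m * b 0 m)); first by ring.
    by rewrite Tv Tb !mulr0 subrr.
  by move/eqP; rewrite mulf_eq0 (negbTE d0) orbF => /eqP.
have em : u 0 m = 0.
  have : u 0 m * (v 0 k * b 0 m - v 0 m * b 0 k) = 0.
    by rewrite ek !mul0r !add0r in Tv Tb; rewrite mulrBr mulrCA Tb mulrA Tv mulr0 mul0r subr0.
  by move/eqP; rewrite mulf_eq0 (negbTE d0) orbF => /eqP.
apply/eqP/rowP => j; rewrite mxE; have [->//|jk] := eqVneq j k.
by have [->//|jm] := eqVneq j m; exact: uz.
Qed.

Variable G : 'I_n -> 'I_n -> 'I_n -> F.
Let Q k (v : 'rV[F]_n) := \sum_i \sum_j G i j k * v 0 i * v 0 j.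
Hypothesis HQ : forall (v : 'rV[F]_n) k m, v 0 k * Q m v = v 0 m * Q k v.

Lemma quad2 k (i j : 'I_n) (s : F) : i != j ->
  Q k ('e_i + s *: 'e_j) = G i i k + s * (G i j k + G j i k) + s ^+ 2 * G j j k.
Proof.
move=> ij.
pose w : 'rV[F]_n := 'e_i + s *: 'e_j.
have E (f : 'I_n -> F) : \sum_a f a * w 0 a = f i + s * f j.
  rewrite (bigD1 i) //= (bigD1 j) /=; last by rewrite eq_sym.
  rewrite big1 ?addr0 => [|a /andP[ai aj]].
    by rewrite !mxE !eqxx (negbTE ij) [j == i]eq_sym (negbTE ij) /=; ring.
  by rewrite !mxE !eqxx (negbTE ai) (negbTE aj) /=; ring.
rewrite -/w; have -> : Q k w = \sum_a (\sum_b G a b k * w 0 b) * w 0 a.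
  by apply: eq_bigr => a _; rewrite mulr_suml; apply: eq_bigr => b _; rewrite mulrAC.
by rewrite E !E; ring.
Qed.

Lemma quad1 k (i : 'I_n) : Q k 'e_i = G i i k.
Proof.
rewrite /Q (bigD1 i) //= [X in _ + X]big1 ?addr0 => [|a ai]; last first.
  by apply: big1 => b _; rewrite !mxE eqxx (negbTE ai) mulr0 mul0r.
rewrite (bigD1 i) //= big1 ?addr0 => [|a ai]; first by rewrite !mxE !eqxx !mulr1.
by rewrite !mxE !eqxx (negbTE ai) mulr0.
Qed.

Lemma quad_diag (i k : 'I_n) : k != i -> G i i k = 0.
Proof.
move=> ki; have := HQ 'e_i k i; rewrite !quad1 !mxE !eqxx (negbTE ki) mul0r mul1r.
by [].
Qed.

(** Test vectors e_i + s e_j. The coordinates i and j give an identity in s whose odd and even parts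
    are separated by s = 1 and s = -1; a third coordinate k gives zero already at s = 1. *)
Lemma quad_sym (i j k : 'I_n) :
  G i j k + G j i k = (k == j)%:R * G i i i + (k == i)%:R * G j j j.
Proof.
have [<-|ij] := eqVneq i j.
  have [->|ki] := eqVneq k i; first by rewrite !mul1r.
  by rewrite quad_diag // !mul0r.
have D (s : F) a b := HQ ('e_i + s *: 'e_j) a b.
have ei (s : F) : ('e_i + s *: 'e_j : 'rV[F]_n) 0 i = 1.
  by rewrite !mxE !eqxx (negbTE ij) mulr0 addr0.
have ej (s : F) : ('e_i + s *: 'e_j : 'rV[F]_n) 0 j = s.
  by rewrite !mxE !eqxx eq_sym (negbTE ij) add0r mulr1.
have E (s : F) : s * (G i j j + G j i j) + s ^+ 2 * G j j j = s * (G i i i + s * (G i j i + G j i i)).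
  have := D s i j; rewrite ei ej !quad2 // mul1r (quad_diag (i := i) (k := j)); last by rewrite eq_sym.
  by rewrite (quad_diag (i := j) (k := i)) // mulr0 addr0 add0r.
have E1 := E 1; have E2 := E (- 1).
have [->|kj] := eqVneq k j.
  rewrite [j == i]eq_sym (negbTE ij) mul0r addr0 mul1r.
  apply: (@mulfI _ 2%:R); rewrite ?pnatr_eq0 //; apply: subr0_eq.
  transitivity (1 * (G i j j + G j i j) + 1 ^+ 2 * G j j j
      - 1 * (G i i i + 1 * (G i j i + G j i i))
      - (- 1 * (G i j j + G j i j) + (- 1) ^+ 2 * G j j j
      - - 1 * (G i i i + - 1 * (G i j i + G j i i)))); first by ring.
  by rewrite E1 E2 !subrr.
have [->|ki] := eqVneq k i.
  rewrite mul0r add0r mul1r.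
  apply: (@mulfI _ 2%:R); rewrite ?pnatr_eq0 //; apply: subr0_eq.
  transitivity (- (1 * (G i j j + G j i j) + 1 ^+ 2 * G j j j
      - 1 * (G i i i + 1 * (G i j i + G j i i))
      + (- 1 * (G i j j + G j i j) + (- 1) ^+ 2 * G j j j
      - - 1 * (G i i i + - 1 * (G i j i + G j i i))))); first by ring.
  by rewrite E1 E2 !subrr addr0 oppr0.
rewrite !mul0r addr0; have := D 1 k i.
rewrite ei !quad2 // (quad_diag ki) (quad_diag kj) add0r mulr0 addr0 !mul1r => <-.
by rewrite !mxE !eqxx (negbTE ki) (negbTE kj) mulr0 addr0 mul0r.
Qed.

(** By [quad_sym], S is half of delta^k_j g_i + delta^k_i g_j with g_i = G i i i, and its trace is
    (n + 1) / 2 times g. *)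
Lemma quad_trace_free (i j k : 'I_n) :
  let S i j k := 2^-1 * (G i j k + G j i k) in
  S i j k - (n.+1%:R)^-1 * ((k == i)%:R * \sum_a S a j a + (k == j)%:R * \sum_a S a i a) = 0.
Proof.
move=> S.
have T b : \sum_a S a b a = 2^-1 * (n.+1%:R * G b b b).
  rewrite -mulr_sumr; congr (_ * _).
  under eq_bigr do rewrite quad_sym eqxx mul1r.
  rewrite big_split /= sumr_const card_ord -[_ *+ n]mulr_natl -natr1 [RHS]mulrDl mul1r addrC.
  apply: (congr1 (+%R (n%:R * G b b b))); rewrite (bigD1 b) //= eqxx mul1r big1 ?addr0 // => a ab.
  by rewrite (negbTE ab) mul0r.
rewrite !T /S quad_sym; have : n.+1%:R != 0 :> F by rewrite pnatr_eq0.
by move: (n.+1%:R) => x x0; field.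
Qed.

End QuadraticAlgebra.

Lemma isW_scale (R : realType) (V : normedModType R[i]) (a : R[i]) (f : V -> R[i]) z v
    (d db : R[i]) : isW f z v d db -> isW (fun y => a * f y) z v (a * d) (a * db).
Proof.
move=> H; have := isW_mul (isW_cst a z v) H.
by congr (isW _ _ _ _ _); rewrite mul0r add0r.
Qed.

Section Separation.
Variables (R : realType) (n : nat).
Local Notation C := R[i].
Local Notation "''e_' i" := (delta_mx 0 i : 'rV[C]_n) (at level 8, i at level 2).

(* The Wirtinger derivatives d/dzbar_l see only the factors conj(v_l). *)
Lemma conj_coord_separation (H : 'I_n -> 'rV[C]_n -> C) :
  (forall l, hol setT (H l)) -> (forall v : 'rV[C]_n, \sum_l conjc (v 0 l) * H l v = 0) ->
  forall l v, H l v = 0.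
Proof.
move=> hH S l v.
have W a : isW (H a) v 'e_l (dv 'e_l (H a) v) 0.
  exact: isW_hol (hol_dv 'e_l (hH a) (I : setT v)).
have K a : isW (fun y : 'rV[C]_n => y 0 a) v 'e_l ('e_l 0 a : C) 0.
  exact: isW_hol (hder_coord a (hder_id _ _ _)).
have T := isW_sum (index_enum 'I_n) (P := xpredT) (fun a _ => isW_mul (isW_conj (K a)) (W a)).
have Z := isW_cst (0 : C) v 'e_l.
have E : \forall y \near (v : 'rV[C]_n), 0 = \sum_a conjc ((y : 'rV[C]_n) 0 a) * H a y.
  exact: (eq_near openT (I : setT v) (fun y _ => esym (S y))).
have := isW_bar (isW_ext E Z); rewrite (isW_bar T) (bigD1 l) //= big1 => [|a al].
  by rewrite !mxE !eqxx /= oppr0 mulr0 !addr0 mul1r.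
by rewrite !mxE (negbTE al) mulr0 addr0 /= oppr0 mul0r.
Qed.

End Separation.

(** * The holomorphic projective class and the equivalence *)

Section ProjectiveClass.
Variables (R : realType) (n : nat) (X : complexManifold R n).
Local Notation C := R[i].
Local Notation hchart := (holo_chart X).
Local Notation "''e_' i" := (delta_mx 0 i : 'rV[C]_n) (at level 8, i at level 2).
Variables (D : vfield X -> vfield X -> vfield X) (HD : is_connection D).
Hypothesis hn : (1 < n)%N.

Lemma christoffel_bar_relation c z : wronskian_curvature_positive D -> img c z ->
  forall l (v : 'rV[C]_n) k m,
  let Q k := \sum_i \sum_j wirtinger_bar 'e_l (christoffel D c i j k \o param c) z * v 0 i * v 0 j in
  v 0 k * Q m = v 0 m * Q k.
Proof.
move=> Hpos iz l v k m.
pose G a i j k0 := wirtinger_bar 'e_a (christoffel D c i j k0 \o param c) z.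
pose Q a k0 (u : 'rV[C]_n) := \sum_i \sum_j G a i j k0 * u 0 i * u 0 j.
have hX j := @hol_coord R n j.
have hQ a k0 : hol setT (Q a k0).
  apply: hol_sum => i _; apply: hol_sum => j _; apply: hol_mul => //.
  by apply: hol_mul => //; exact: hol_cst.
suff: v 0 k * Q l m v = v 0 m * Q l k v by exact.
apply: subr0_eq.
apply: (@conj_coord_separation R n (fun a u => u 0 k * Q a m u - u 0 m * Q a k u)).
  move=> a; have := hol_add (hol_mul (hX k) (hQ a m)) (hol_mul (hol_cst (-1 : C)) (hol_mul (hX m) (hQ a k))).
  by congr hol; apply/funext => u; rewrite mulN1r.
move=> u; pose i0 : 'I_n := Ordinal (ltnW hn).
pose il : 'I_n := Ordinal (ltn_predL' hn).
have i0l : i0 != il by rewrite -val_eqE /= eq_sym -lt0n -ltnS prednK // ltnW.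
pose b : 'rV[C]_n := \row_k0 (\sum_i \sum_j (\sum_a conjc (u 0 a) * G a i j k0) * u 0 i * u 0 j).
have bE k0 : b 0 k0 = \sum_a conjc (u 0 a) * Q a k0 u.
  transitivity (\sum_a \sum_i \sum_j conjc (u 0 a) * (G a i j k0 * u 0 i * u 0 j)).
    rewrite mxE [RHS]exchange_big; apply: eq_bigr => i _.
    rewrite [RHS]exchange_big; apply: eq_bigr => j _; rewrite !mulr_suml.
    by apply: eq_bigr => a _; rewrite !mulrA.
  by apply: eq_bigr => a _; rewrite mulr_sumr; apply: eq_bigr => i _; rewrite mulr_sumr.
have E : u 0 k * b 0 m = u 0 m * b 0 k.
  exact: (wedge_zero i0l (fun B => @prescribed_det R n X D HD Hpos c hn z u B i0 il iz erefl erefl)).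
rewrite !bE in E.
transitivity (u 0 k * (\sum_a conjc (u 0 a) * Q a m u) - u 0 m * (\sum_a conjc (u 0 a) * Q a k u)).
  by rewrite !mulr_sumr -sumrB; apply: eq_bigr => a _; ring.
by rewrite E subrr.
Qed.

(** The projective symbols of the symmetrization are linear in Gamma with constant coefficients, so
    dbar_l passes to Gamma and [quad_trace_free] applies to its derivatives. *)
Lemma proj_christoffel_bar c i j k l z : wronskian_curvature_positive D -> img c z ->
  wirtinger_bar 'e_l (proj_christoffel (symconn D) c i j k \o param c) z = 0.
Proof.
move=> Hpos iz.
pose g i j k := christoffel D c i j k \o param c.
pose G i j k := wirtinger_bar 'e_l (g i j k) z.
have W a b d := CkV_isW 'e_l (christoffel_param_smooth HD c a b d 1) iz.
have WS a b d := isW_scale 2^-1 (isW_add (W a b d) (W b a d)).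
have WT b := isW_sum (index_enum 'I_n) (P := xpredT) (fun a _ => WS a b a).
have WP := isW_add (WS i j k) (isW_scale (- n.+1%:R^-1)
  (isW_add (isW_scale (k == i)%:R (WT j)) (isW_scale (k == j)%:R (WT i)))).
have E y : img c y -> 2^-1 * (g i j k y + g j i k y) +
    - n.+1%:R^-1 * ((k == i)%:R * (\sum_a 2^-1 * (g a j a y + g j a a y)) +
      (k == j)%:R * (\sum_a 2^-1 * (g a i a y + g i a a y)))
    = (proj_christoffel (symconn D) c i j k \o param c) y.
  move=> /imgP[dy _]; rewrite /= /proj_christoffel (christoffel_symconn HD) //.
  rewrite mulNr [2^-1 * _]mulrC; congr (_ - _ * (_ * _ + _ * _)); apply: eq_bigr => a _;
    by rewrite (christoffel_symconn HD a _ a dy) mulrC.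
rewrite (isW_bar (isW_ext (eq_near (@img_open _ _ _ c) iz E) WP)).
have := @quad_trace_free _ n G (fun v a b => christoffel_bar_relation Hpos iz l v a b) i j k.
by rewrite mulNr; apply: etrans.
Qed.

(** All members of the class have the same projective symbols, so holomorphy needs to be known for
    the symmetrization alone. *)
Lemma symconn_projective : wronskian_curvature_positive D ->
  exists P : set (vfield X -> vfield X -> vfield X), holomorphic_projective_connection P.
Proof.
move=> Hpos; have HS := symconn_connection HD; have TS := symconn_torsion_free HD.
exists [set D' | [/\ is_connection D', torsion_free D' & projectively_equivalent (symconn D) D']].
split; first by exists (symconn D).
move=> D' [HD' _ Heq] c i j k l z iz.
have E y : img c y -> (proj_christoffel (symconn D) c i j k \o param c) y =
    (proj_christoffel D' c i j k \o param c) y.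
  by move=> /imgP[dy _]; rewrite /= (proj_christoffel_equiv i j k HS HD' Heq dy).
have S : CkV 1 (img c) (proj_christoffel (symconn D) c i j k \o param c).
  by have := smf_proj_christoffel HS c i j k c 1%N; rewrite cim_dom.
rewrite (isW_bar (isW_ext (eq_near (@img_open _ _ _ c) iz E) (CkV_isW 'e_l S iz))).
exact: proj_christoffel_bar.
Qed.

Lemma holomorphic_wcp : (forall c i j k l z, img c z ->
    wirtinger_bar 'e_l (proj_christoffel D c i j k \o param c) z = 0) ->
  wronskian_curvature_positive D.
Proof.
move=> HPi f t0 r0 r00 Hf t1 r1 r10 sub O e He fO w Hw _.
have oA : open (disk t1 r1).
  rewrite /disk; apply/open_nrm => t At.
  exists (r1 - nrm (t - t1)); first by rewrite subr_gt0; move: At; rewrite /= nrmE ltcR.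
  move=> y yt; rewrite /= nrmE ltcR; have -> : y - t1 = (y - t) + (t - t1) by rewrite addrA subrK.
  by apply: le_lt_trans (nrmD _ _) _; rewrite -ltrBrDr.
have Hf1 : holomorphic_curve (disk t1 r1) f by move=> t /sub; exact: Hf.
have Hfw := frame_quotient_hol oA Hf1 HD HPi He (fun t At => fO _ (ex_intro2 _ _ t At erefl)) Hw.
exact: log_modulus_subharmonic oA Hfw.
Qed.

End ProjectiveClass.

Theorem theorem1p3 (R : realType) (n : nat) (X : complexManifold R n)
    (hn : (2 <= n)%N) :
  ((exists D : vfield X -> vfield X -> vfield X,
      is_connection D /\ wronskian_curvature_positive D)
   <->
   (exists D : vfield X -> vfield X -> vfield X,
      [/\ is_connection D, torsion_free D & wronskian_curvature_positive D]))
  /\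
  ((exists D : vfield X -> vfield X -> vfield X,
      [/\ is_connection D, torsion_free D & wronskian_curvature_positive D])
   <->
   (exists P : set (vfield X -> vfield X -> vfield X),
      holomorphic_projective_connection P)).
Proof.
have ac (D : vfield X -> vfield X -> vfield X) : is_connection D -> wronskian_curvature_positive D ->
    exists P : set (vfield X -> vfield X -> vfield X), holomorphic_projective_connection P.
  by move=> HD; exact: symconn_projective HD hn.
have cb : (exists P : set (vfield X -> vfield X -> vfield X),
      holomorphic_projective_connection P) ->
    exists D : vfield X -> vfield X -> vfield X,
      [/\ is_connection D, torsion_free D & wronskian_curvature_positive D].
  move=> [P [[D [HD TD PE]] HP]]; exists D; split => //.
  apply: holomorphic_wcp => //; apply: HP; rewrite PE; split => //.
  exact: proj_equiv_refl.
split; split => //.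
- by move=> [D [HD Hpos]]; exact: cb (ac D HD Hpos).
- by move=> [D [HD _ Hpos]]; exists D.
- by move=> [D [HD _ Hpos]]; exact: ac HD Hpos.
Qed.
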